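(* Let $(M,g)$ be a smooth two-dimensional Riemannian manifold. Suppose there is a quadratic integral $I$ of the geodesic flow of $g$ such that (1) its zero directions are real; (2) the geodesic net defined by these directions has a closed simple smooth envelope; (3) the foliation of the bisector net (of this geodesic net) that goes along the envelope has a closed simple smooth leaf $\mathfrak B$ that is convex with respect to the geodesics. Then the billiard with the wall $\mathfrak B$ is locally integrable, namely: (1) there is an integral of motion for the billiard trajectories forming a sufficiently small angle with the billiard wall $\mathfrak B$, and (2) a neighbourhood of the billiard wall (in the billiard table) is foliated by caustics of the billiard.
   Context: The geodesic flow of $g$ is the Hamiltonian system on $T^*M$ with Hamiltonian $H(\cdot)=\tfrac12|\cdot|_g^2$. A quadratic integral is a first integral of the form $I=a_0(u,v)p^2+a_1(u,v)pq+a_2(u,v)q^2$, where $(p,q)$ are the momenta conjugate to local coordinates $(u,v)$. Identifying $T^*M$ with $TM$ via $g$, $I$ becomes a quadratic form in velocities; its zero directions (real roots) at a point are the tangent directions on which it vanishes. Where there are two distinct real zero directions, the integral curves of the zero directions, i.e. of the implicit ODE $\tilde a_0du^2+\tilde a_1du\,dv+\tilde a_2dv^2=0$, are geodesics, and they form the geodesic net defined by $I$ (a net being a pair of transverse foliations). The condition that zero directions are real refers to the region filled by this net; on an envelope of the net (a curve to which the geodesics of the net are tangent) the two directions coincide. The bisector net of a geodesic net is formed by the integral curves of the two mutually orthogonal direction fields bisecting the angles at which the geodesics of the net intersect. The foliation of the bisector net that goes along the envelope is the one of its two foliations whose leaves extend to include the envelope itself as a leaf. The curve $\mathfrak B$ is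 convex with respect to the geodesics if each geodesic tangent to $\mathfrak B$ lies locally on one side of $\mathfrak B$; the billiard table lies on the other side. The billiard with wall $\mathfrak B$ is the dynamical system in which a point moves along geodesics inside the table and, on hitting $\mathfrak B$, is reflected so that the angle of incidence equals the angle of reflection. An integral of motion is a non-constant function of the oriented geodesic segments (of the trajectories under consideration) that is invariant under reflection, hence constant along each billiard trajectory. A caustic is a curve such that if one geodesic segment of a billiard trajectory (extended if necessary) is tangent to it, then so are all the segments of the trajectory. *)

(* Defs.v *)
From HB Require Import structures.
From mathcomp Require Import all_boot all_order all_algebra.
From mathcomp Require Import all_classical all_reals all_analysis.
Set Implicit Arguments.
Unset Strict Implicit.
Unset Printing Implicit Defensive.
Import Order.TTheory GRing.Theory Num.Theory.
Import numFieldNormedType.Exports.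
Local Open Scope classical_set_scope.
Local Open Scope ring_scope.

Section Smoothness.
Context {R : realType}.

Definition basis_vec n (i : 'I_n) : 'rV[R]_n := delta_mx 0 i.

Definition iter_partial n (s : seq 'I_n) (f : 'rV[R]_n -> R) : 'rV[R]_n -> R :=
  foldr (fun i h => fun x => 'D_(basis_vec i) h x) f s.

(* C^oo on U: all iterated partial derivatives exist and are continuous at the
   points of U.  Only used for open U. *)
Definition smooth_on n (U : set 'rV[R]_n) (f : 'rV[R]_n -> R) : Prop :=
  forall (s : seq 'I_n) x, U x ->
    {for x, continuous (iter_partial s f)} /\
    forall i, derivable (iter_partial s f) x (basis_vec i).

Definition smooth_map_on n m (U : set 'rV[R]_n) (f : 'rV[R]_n -> 'rV[R]_m) :=
  forall i, smooth_on U (fun x => f x 0 i).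

Definition smooth_path_on n (a b : R) (x : R -> 'rV[R]_n) : Prop :=
  forall k t, a < t < b -> derivable (derive1n k x) t 1.

End Smoothness.

(* [coord c] and [point c] are total functions; only their values on [dom c],
   respectively on the image of [dom c], are meaningful. *)
Record surface (R : realType) (M : topologicalType) := Surface {
  chart : Type;
  dom : chart -> set M;
  coord : chart -> M -> 'rV[R]_2;
  point : chart -> 'rV[R]_2 -> M;
  surface_hausdorff : hausdorff_space M;
  surface_second_countable : @second_countable M;
  dom_cover : forall x, exists c, dom c x;
  dom_open : forall c, open (dom c);
  img_open : forall c, open (coord c @` dom c);
  coordK : forall c x, dom c x -> point c (coord c x) = x;
  coord_continuous : forall c x, dom c x -> {for x, continuous (coord c)};
  point_continuous : forall c y, (coord c @` dom c) y ->
    {for y, continuous (point c)};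
  transition_smooth : forall c c',
    smooth_map_on (coord c @` (dom c `&` dom c')) (coord c' \o point c) }.

Section Geometry.
Context {R : realType} {M : topologicalType} (S : surface R M).
Implicit Types (c : chart S) (y v p : 'rV[R]_2) (g : R -> M) (a b t : R).

Definition img c : set 'rV[R]_2 := coord c @` dom c.

(* Components of tangent (row) vectors change by [v' = v *m transition c c' x],
   those of covectors by [p = p' *m (transition c c' x)^T]. *)
Definition transition c c' (x : M) : 'M[R]_2 :=
  jacobian (coord c' \o point c) (coord c x).

Definition in_both c c' (x : M) : Prop := dom c x /\ dom c' x.

Definition smooth_fun_on (O : set M) (f : M -> R) : Prop :=
  forall c, smooth_on (coord c @` (O `&` dom c)) (f \o point c).

Record metric := Metric {
  gram : chart S -> 'rV[R]_2 -> 'M[R]_2;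
  gram_smooth : forall c i j, smooth_on (img c) (fun y => gram c y i j);
  gram_sym : forall c y, img c y -> (gram c y)^T = gram c y;
  gram_pos : forall c y v, img c y -> v != 0 ->
    0 < (v *m gram c y *m v^T) 0 0;
  gram_change : forall c c' x, in_both c c' x ->
    gram c (coord c x) =
    transition c c' x *m gram c' (coord c' x) *m (transition c c' x)^T }.

Definition smooth_curve g a b : Prop :=
  forall t c, a < t < b -> dom c (g t) -> exists2 e : R, 0 < e &
    (forall s, t - e < s < t + e -> dom c (g s)) /\
    smooth_path_on (t - e) (t + e) (coord c \o g).

(* Components in the chart c of the velocity of g. *)
Definition vel c g t : 'rV[R]_2 := derive1 (coord c \o g) t.

Definition regular_curve g a b : Prop :=
  smooth_curve g a b /\
  forall t c, a < t < b -> dom c (g t) -> vel c g t != 0.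

Definition collinear v (w : 'rV[R]_2) : Prop := exists2 k : R, k != 0 & v = k *: w.

(* Closed simple smooth curves are regular 1-periodic parametrizations,
   injective modulo the period. *)
Definition simple_closed_curve g : Prop :=
  (forall a b, regular_curve g a b) /\
  (forall s t, g s = g t <-> exists k : int, t = s + k%:~R).

(* A direction field is given by its vectors (zero included) in each chart. *)
Definition directions := chart S -> 'rV[R]_2 -> 'rV[R]_2 -> Prop.

Definition direction_field
    (regular : set 'rV[R]_2 -> ('rV[R]_2 -> 'rV[R]_2) -> Prop)
    (A : set M) (D : directions) : Prop :=
  (forall c c' x v, A x -> in_both c c' x ->
     D c (coord c x) v <-> D c' (coord c' x) (v *m transition c c' x)) /\
  (forall c x, A x -> dom c x ->
     exists (O : set 'rV[R]_2) (X : 'rV[R]_2 -> 'rV[R]_2),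
     let V := O `&` coord c @` (A `&` dom c) in
     [/\ open O, O (coord c x), regular V X &
         forall y, V y -> X y != 0 /\
           forall v, D c y v <-> exists k : R, v = k *: X y]).

Definition continuous_field (A : set M) (D : directions) : Prop :=
  direction_field (fun V X => {within V, continuous X}) A D.

(* Only used for open A. *)
Definition smooth_field (A : set M) (D : directions) : Prop :=
  direction_field (fun V X => smooth_map_on V X) A D.

Definition integral_curve (D : directions) (A : set M) g a b : Prop :=
  regular_curve g a b /\
  forall t, a < t < b -> A (g t) /\
    forall c, dom c (g t) -> D c (coord c (g t)) (vel c g t).

Definition leaf (D : directions) (A : set M) (x : M) : set M :=
  [set z | exists g a b s t,
    [/\ integral_curve D A g a b, a < s < b, a < t < b, g s = x & g t = z]].

(* A closed simple integral curve is automatically an entire leaf. *)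
Definition closed_leaf (D : directions) (A : set M) g : Prop :=
  simple_closed_curve g /\ forall a b, integral_curve D A g a b.

Section Metric.
Variable G : metric.

Definition inner c y v (w : 'rV[R]_2) : R := (v *m gram G c y *m w^T) 0 0.

Definition speed c y v : R := Num.sqrt (inner c y v v).

(* Angle in [0, pi/2] between the lines spanned by v and w. *)
Definition line_angle c y v (w : 'rV[R]_2) : R :=
  acos (`|inner c y v w| / (speed c y v * speed c y w)).

Definition hamiltonian c y p : R := 2^-1 * (p *m invmx (gram G c y) *m p^T) 0 0.

Definition hamilton_solution c (x p : R -> 'rV[R]_2) a b : Prop :=
  forall t, a < t < b ->
    [/\ img c (x t), derivable x t 1, derivable p t 1 &
      forall k : 'I_2,
        (derive1 x t) 0 k = 'D_(basis_vec k) (hamiltonian c (x t)) (p t) /\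
        (derive1 p t) 0 k =
          - 'D_(basis_vec k) (fun y => hamiltonian c y (p t)) (x t)].

(* Non-constant projections to the surface of orbits of the geodesic flow. *)
Definition geodesic g a b : Prop :=
  forall t c, a < t < b -> dom c (g t) ->
    vel c g t != 0 /\
    exists (e : R) (p : R -> 'rV[R]_2),
      [/\ 0 < e, (forall s, t - e < s < t + e -> dom c (g s)) &
          hamilton_solution c (coord c \o g) p (t - e) (t + e)].

Definition quad_form (a0 a1 a2 : chart S -> 'rV[R]_2 -> R) c y p : R :=
  a0 c y * p 0 0 ^+ 2 + a1 c y * (p 0 0 * p 0 1) + a2 c y * p 0 1 ^+ 2.

Record quadratic_integral := QuadraticIntegral {
  coef0 : chart S -> 'rV[R]_2 -> R;
  coef1 : chart S -> 'rV[R]_2 -> R;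
  coef2 : chart S -> 'rV[R]_2 -> R;
  coef0_smooth : forall c, smooth_on (img c) (coef0 c);
  coef1_smooth : forall c, smooth_on (img c) (coef1 c);
  coef2_smooth : forall c, smooth_on (img c) (coef2 c);
  (* the local expressions define one function on the cotangent bundle *)
  coef_change : forall c c' x p, in_both c c' x ->
    quad_form coef0 coef1 coef2 c (coord c x) (p *m (transition c c' x)^T) =
    quad_form coef0 coef1 coef2 c' (coord c' x) p;
  coef_first_integral : forall c (x p : R -> 'rV[R]_2) a b,
    hamilton_solution c x p a b ->
    forall s t, a < s < b -> a < t < b ->
      quad_form coef0 coef1 coef2 c (x s) (p s) =
      quad_form coef0 coef1 coef2 c (x t) (p t) }.

Section Net.
Variable I : quadratic_integral.

(* I as a quadratic form in velocities: the momentum of v is v *m gram. *)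
Definition vform c y v : R :=
  quad_form (coef0 I) (coef1 I) (coef2 I) c y (v *m gram G c y).

Definition two_real_zero_directions (x : M) : Prop :=
  forall c, dom c x -> exists v1 v2 : 'rV[R]_2,
    row_free (col_mx v1 v2) /\
    forall v, vform c (coord c x) v = 0 <->
      exists k : R, v = k *: v1 \/ v = k *: v2.

(* e is an envelope of the net of geodesics of zero direction filling Om. *)
Definition envelope (Om : set M) (e : R -> M) : Prop :=
  forall s,
    (forall c v, dom c (e s) ->
       vform c (coord c (e s)) v = 0 <-> exists k : R, v = k *: vel c e s) /\
    (exists (g : R -> M) (r : R),
       [/\ 0 < r, geodesic g (- r) r, g 0 = e s,
           (forall c, dom c (e s) -> collinear (vel c g 0) (vel c e s)) &
           forall t, 0 < `|t| < r -> Om (g t) /\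
             forall c, dom c (g t) -> vform c (coord c (g t)) (vel c g t) = 0]).

(* n1 + n2, for unit vectors n1 and n2 on the two zero lines, bisects one pair
   of opposite angles; changing the sign of n2 gives the other bisector. *)
Definition bisecting c y v : Prop :=
  exists (n1 n2 : 'rV[R]_2) (k : R),
    [/\ row_free (col_mx n1 n2),
        inner c y n1 n1 = 1 /\ inner c y n2 n2 = 1,
        vform c y n1 = 0 /\ vform c y n2 = 0 & v = k *: (n1 + n2)].

Definition bisector_foliation (Om : set M) (D : directions) : Prop :=
  continuous_field Om D /\
  forall x c v, Om x -> dom c x -> D c (coord c x) v ->
    bisecting c (coord c x) v.

(* The leaves of D extend to include the envelope e as a leaf. *)
Definition goes_along (Om : set M) (D : directions) (e : R -> M) : Prop :=
  continuous_field (Om `|` range e) D /\ closed_leaf D (Om `|` range e) e.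

End Net.

Section Billiard.
(* T is the table (wall included), w a closed curve parametrizing the wall. *)
Variables (T : set M) (w : R -> M).

(* Near each point of the wall, T is the closure of one of the two sides of the
   wall.  Nothing is required of T away from the wall. *)
Definition one_sided_table : Prop :=
  forall s, exists (O : set M) (f : M -> R),
    [/\ open O, O (w s), smooth_fun_on O f,
        (forall x c, O x -> dom c x -> exists i : 'I_2,
           'D_(basis_vec i) (f \o point c) (coord c x) != 0) &
        (forall x, O x ->
           (range w x <-> f x = 0) /\ (T x <-> 0 <= f x))].

(* A geodesic tangent to the wall lies, locally and except for the point of
   tangency, strictly on the side of the wall opposite to the table. *)
Definition wall_convex : Prop :=
  forall (g : R -> M) a b t s, geodesic g a b -> a < t < b -> g t = w s ->
    (forall c, dom c (w s) -> collinear (vel c g t) (vel c w s)) ->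
    exists2 e : R, 0 < e & forall t', 0 < `|t' - t| < e -> ~ T (g t').

(* The oriented geodesic segment traced by [track] on [0, len]. *)
Record segment := Segment { track : R -> M; len : R }.

Definition is_segment (sg : segment) : Prop :=
  [/\ 0 < len sg,
      (exists2 e : R, 0 < e & geodesic (track sg) (- e) (len sg + e)),
      (forall t c, 0 <= t <= len sg -> dom c (track sg t) ->
         speed c (coord c (track sg t)) (vel c (track sg) t) = 1),
      range w (track sg 0) /\ range w (track sg (len sg)) &
      (forall t, 0 < t < len sg ->
         T (track sg t) /\ ~ range w (track sg t))].

(* sg' leaves the wall in the direction of sg reflected in the tangent line. *)
Definition reflected (sg sg' : segment) : Prop :=
  track sg' 0 = track sg (len sg) /\
  forall s c, w s = track sg' 0 -> dom c (w s) ->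
    let y := coord c (w s) in
    let tau := vel c w s in
    let v := vel c (track sg) (len sg) in
    vel c (track sg') 0 = (2 * inner c y v tau / inner c y tau tau) *: tau - v.

(* Consecutive segments sg 0, ..., sg n. *)
Definition trajectory (n : nat) (sg : nat -> segment) : Prop :=
  (forall i, (i <= n)%N -> is_segment (sg i)) /\
  (forall i, (i < n)%N -> reflected (sg i) (sg i.+1)).

Definition small_angle (delta : R) (sg : segment) : Prop :=
  forall s c, w s = track sg 0 -> dom c (w s) ->
    line_angle c (coord c (w s)) (vel c (track sg) 0) (vel c w s) < delta.

Definition tangent_vector (K : set M) (x : M) c v : Prop :=
  exists (k : R -> M) (e : R),
    [/\ 0 < e, regular_curve k (- e) e, k 0 = x,
        (forall t, - e < t < e -> K (k t)) & collinear v (vel c k 0)].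

(* The segment, extended as a geodesic if necessary, is tangent to K. *)
Definition segment_tangent (sg : segment) (K : set M) : Prop :=
  exists (g : R -> M) a b t,
    [/\ a < 0 < len sg /\ len sg < b, geodesic g a b,
        (forall s, 0 <= s <= len sg -> g s = track sg s),
        a < t < b &
        K (g t) /\
        forall c, dom c (g t) -> tangent_vector K (g t) c (vel c g t)].

Definition caustic (K : set M) : Prop :=
  forall n sg, trajectory n sg ->
  forall i j, (i <= n)%N -> (j <= n)%N ->
    segment_tangent (sg i) K -> segment_tangent (sg j) K.

(* A smooth function on the tangent bundle without its zero section, read in
   charts.  It is evaluated on an oriented segment through its initial (unit)
   velocity, which determines the segment. *)
Definition tangent_function (F : chart S -> 'rV[R]_2 -> 'rV[R]_2 -> R) : Prop :=
  (forall c, smooth_on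
     [set z : 'rV[R]_(2 + 2) | img c (lsubmx z) /\ rsubmx z != 0]
     (fun z => F c (lsubmx z) (rsubmx z))) /\
  (forall c c' x v, in_both c c' x ->
     F c (coord c x) v = F c' (coord c' x) (v *m transition c c' x)).

Definition induced (F : chart S -> 'rV[R]_2 -> 'rV[R]_2 -> R)
    (J : segment -> R) : Prop :=
  forall sg, is_segment sg -> forall c, dom c (track sg 0) ->
    J sg = F c (coord c (track sg 0)) (vel c (track sg) 0).

(* The trajectories considered are those with a segment leaving the wall at an
   angle smaller than delta. *)
Definition motion_integral (delta : R) (J : segment -> R) : Prop :=
  [/\ (exists2 F, tangent_function F & induced F J),
      (exists sg sg', [/\ is_segment sg, is_segment sg', small_angle delta sg,
         small_angle delta sg' & J sg <> J sg']) &
      (forall n sg, trajectory n sg ->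
         (exists2 k, (k <= n)%N & small_angle delta (sg k)) ->
         forall i, (i < n)%N -> J (sg i) = J (sg i.+1))].

(* D is a smooth foliation of a neighbourhood W of the wall having the wall as
   a leaf; its leaves in the table are caustics. *)
Definition foliated_by_caustics : Prop :=
  exists (W : set M) (D : directions),
    [/\ open W, range w `<=` W, smooth_field W D, closed_leaf D W w &
        forall x, (W `&` T) x -> caustic (leaf D (W `&` T) x)].

End Billiard.
End Metric.
End Geometry.

(* Main.v *)
Require Import Defs.
From HB Require Import structures.
From mathcomp Require Import all_boot all_order all_algebra.
From mathcomp Require Import all_classical all_reals all_analysis.
From mathcomp Require Import ring lra.
Require Import Defs.
Import Order.TTheory GRing.Theory Num.Theory.
Import numFieldNormedType.Exports.
Local Open Scope classical_set_scope.
Local Open Scope ring_scope.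

(** Let g be the metric, I the integral and H the energy on phase space, and b the
integral read as a quadratic form in velocities.  Where b has two distinct real zero
directions it is indefinite; hence it has two eigenvalues with respect to g, of opposite
signs, and the bisectors of the zero directions are the two eigenlines (bisector_eigen).
The foliation D of the bisector net thus comes with a smooth eigenvalue lam, and v
belongs to D exactly when b (v, v) = lam * g (v, v), because b - lam * g is a degenerate
form (D_vform).

The eigenvalue is a first integral of the foliation.  If v is in D at x and l = lam x,
the function I - 2 * l * H is conserved by the geodesic flow.  At the covector of v its
derivative along the fibre vanishes, and its derivative along the surface is d lam times
g (v, v) (eigen_critical_p, derive_penz_x).  Conservation along the geodesic of v gives
d lam (v) = 0 (eiglam_along).  If moreover d lam vanishes at x, the covector is a
critical point of the conserved function; since the flow carries critical points to
critical points, the whole geodesic is then tangent to D (critical_geodesic).  At a point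
of the wall this is impossible: that geodesic would satisfy a linear differential
inequality keeping it in the wall, while convexity makes it leave the table
(wall_noncritical).  So near the wall the leaves of D are the level curves of lam, the
wall is the level lam0, and the table is one side of it (wall_local).

The integral of the billiard is the value of b on the unit velocity of a segment.  It is
constant along geodesics, and reflection preserves it because the tangent to the wall is
an eigenline of b (seg_integral_reflected).  At the angle phi to the wall its value is
lam0 plus a nonzero multiple of the square of sin phi, so that it is not constant as soon
as there are segments of all small angles.  Convexity provides them: the geodesic tangent
to the wall is outside the table after a short time, hence so is a slightly tilted one,
which first enters the table (tilted_segments).

The leaves of D near the wall are caustics because a segment is tangent to the leaf of
level l exactly when its integral is l.  At a point of tangency the velocity is in D,
where b equals lam (tangent_value).  Conversely lam equals lam0 at both ends of the
segment.  Either the segment stays near the wall and lam has a critical point on it,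
where the velocity is in D and lam is equal to the integral; or it goes away and lam
takes the value l on the way (segment_touches).  In both cases the segment touches a leaf
of level l, and it remains to see that near the wall a level has only one leaf.  Flow
boxes give this locally (flow_box).  Additivity along the wall extends it to a strip
(strip_along_all), and compactness cuts out of the strip a neighbourhood that curves can
leave only at levels far from lam0 (wall_neighbourhood).

The geodesic flow and the leaves come from the Picard theorem with Lipschitz dependence
on the initial point (local_flow, solution_dist); a bound by a factor 2 for short times
is enough throughout. *)

Set Implicit Arguments.
Unset Strict Implicit.
Unset Printing Implicit Defensive.

(** * Differential calculus of real functions on row vectors *)

Section Neighbourhoods.
Context {R : realType} {V W : normedModType R}.

Lemma near_normP (x : V) (P : set V) :
  nbhs x P <-> exists2 r : R, 0 < r & forall y, `|y - x| < r -> P y.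
Proof.
split=> [/nbhs_ballP[r r0 rP]|[r r0 rP]].
  by exists r => // y yx; apply: rP; rewrite -ball_normE /ball_ /= distrC.
by apply/nbhs_ballP; exists r => // y; rewrite -ball_normE /ball_ /= distrC => /rP.
Qed.

Lemma continuous_normP (x : V) (f : V -> W) : {for x, continuous f} <->
  forall e : R, 0 < e -> exists2 r : R, 0 < r &
    forall y, `|y - x| < r -> `|f y - f x| < e.
Proof.
split=> [/cvgrPdistC_lt cf e /cf /near_normP //|cf].
by apply/cvgrPdistC_lt => e /cf /near_normP.
Qed.

Lemma near_norm_forall (I : finType) (x : V) (P : I -> set V) :
  (forall i, exists2 r : R, 0 < r & forall y, `|y - x| < r -> P i y) ->
  exists2 r : R, 0 < r & forall y, `|y - x| < r -> forall i, P i y.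
Proof.
move=> h; apply/(near_normP x (fun y => forall i, P i y)).
by apply: filter_forall => i; apply/near_normP.
Qed.

Lemma near_normI (x : V) (P Q : set V) :
  (exists2 r : R, 0 < r & forall y, `|y - x| < r -> P y) ->
  (exists2 r : R, 0 < r & forall y, `|y - x| < r -> Q y) ->
  exists2 r : R, 0 < r & forall y, `|y - x| < r -> P y /\ Q y.
Proof.
move=> /near_normP hP /near_normP hQ.
by apply/(near_normP x (fun y => P y /\ Q y)); apply: filterI.
Qed.

Lemma open_normP (x : V) (U : set V) : open U -> U x ->
  exists2 r : R, 0 < r & forall y, `|y - x| < r -> U y.
Proof. by move=> oU Ux; apply/near_normP; apply: open_nbhs_nbhs. Qed.

Lemma open_norm (U : set V) : (forall x, U x ->
  exists2 r : R, 0 < r & forall y, `|y - x| < r -> U y) -> open U.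
Proof. by rewrite openE => h x /h /near_normP. Qed.

End Neighbourhoods.

Lemma scale_row {R : realType} n (k : R) (v : 'rV[R]_n) i : (k *: v) 0 i = k * v 0 i.
Proof. by rewrite mxE. Qed.

Lemma row_entry {R : realType} n (F : 'I_n -> R) i : (\row_j F j) 0 i = F i.
Proof. by rewrite mxE. Qed.

Lemma add_row {R : realType} n (u v : 'rV[R]_n) i : (u + v) 0 i = u 0 i + v 0 i.
Proof. by rewrite mxE. Qed.

Lemma opp_row {R : realType} n (v : 'rV[R]_n) i : (- v) 0 i = - v 0 i.
Proof. by rewrite mxE. Qed.

Section RowVectors.
Context {R : realType} {n : nat}.
Implicit Types (x y v : 'rV[R]_n) (f : 'rV[R]_n -> R).

Lemma norm_coord x i : `|x 0 i| <= `|x|.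
Proof.
rewrite [leRHS]/Num.Def.normr/= mx_normrE.
exact: (le_bigmax _ (fun ij : 'I_1 * 'I_n => `|x ij.1 ij.2|) (0, i)).
Qed.

Lemma norm_row_le x e : 0 <= e -> (forall i, `|x 0 i| <= e) -> `|x| <= e.
Proof.
move=> e0 h; rewrite [leLHS]/Num.Def.normr/= mx_normrE.
by rewrite (bigmax_le _ e0)// => -[i j] _ /=; rewrite ord1.
Qed.

Lemma basis_vecE i j : (basis_vec i : 'rV[R]_n) 0 j = (j == i)%:R.
Proof. by rewrite mxE eqxx. Qed.

Lemma norm_basis_vec i : `|basis_vec i : 'rV[R]_n| <= 1.
Proof.
by apply: norm_row_le => // j; rewrite basis_vecE; case: eqP => _;
  rewrite ?normr0 ?normr1.
Qed.

Lemma row_basis x : x = \sum_i x 0 i *: basis_vec i.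
Proof. exact: row_sum_delta. Qed.

Lemma derivable_line f x v s : derivable f (x + s *: v) v ->
  is_derive s 1 (fun t => f (x + t *: v)) ('D_v f (x + s *: v)).
Proof.
have E : (fun h : R => h^-1 *: (f (x + (h *: 1 + s) *: v) - f (x + s *: v))) =
         (fun h : R => h^-1 *: (f (h *: v + (x + s *: v)) - f (x + s *: v))).
  apply/funext => h; congr (_ *: (f _ - _)).
  by rewrite [h *: 1]mulr1 scalerDl addrCA.
by move=> d; apply: DeriveDef; [rewrite /derivable /= E|rewrite /derive /= E].
Qed.

Lemma mvt_line f x v :
  (forall s : R, 0 <= s <= 1 -> derivable f (x + s *: v) v) ->
  exists2 s : R, 0 <= s <= 1 & f (x + v) - f x = 'D_v f (x + s *: v).
Proof.
move=> df.
have d1 (s : R) : s \in `[0, 1]%R ->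
    is_derive s 1 (fun t => f (x + t *: v)) ('D_v f (x + s *: v)).
  by rewrite in_itv/= => /df /derivable_line.
pose g (t : R) : R := f (x + t *: v); pose dg (s : R) : R := 'D_v f (x + s *: v).
have gc : {within `[(0:R), 1], continuous g}.
  by apply: derivable_within_continuous => s /d1[].
have g1 (s : R) : s \in `](0:R), 1[%R -> is_derive s 1 g (dg s).
  by move=> sI; apply: d1; apply: subset_itv_oo_cc sI.
have [s sI] := @MVT_segment R g dg 0 1 ler01 g1 gc.
rewrite /g scale0r addr0 scale1r subr0 mulr1 => ->; exists s => //.
Qed.

Lemma is_derive_scalev f x v (h a : R) :
  is_derive x v f a -> is_derive x (h *: v) f (h * a).
Proof.
move=> [df <-].
have := @derivable_line f x v 0; rewrite scale0r addr0 => /(_ df) dl.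
suff D : is_derive (0 : R) 1 (fun t => f (x + t *: (h *: v))) (h * 'D_v f x).
  have E : (fun k : R => k^-1 *: (f (x + (k *: 1 + 0) *: (h *: v)) -
         f (x + 0 *: (h *: v)))) =
         (fun k : R => k^-1 *: (f (k *: (h *: v) + x) - f x)).
    by apply/funext => k; rewrite addr0 [k *: 1]mulr1 scale0r addr0 [x + _]addrC.
  apply: DeriveDef.
    by have := @ex_derive _ _ _ _ _ _ _ D; rewrite /derivable /= E.
  by have := @derive_val _ _ _ _ _ _ _ D; rewrite /derive /= E.
pose g (t : R) : R := f (x + t *: v); pose k (t : R) : R := h * t.
have -> : (fun t => f (x + t *: (h *: v))) = g \o k.
  by apply/funext => t /=; rewrite /g /k scalerA mulrC.
have dk : is_derive (0 : R) 1 k h.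
  have -> : k = h \*o id by [].
  by apply: is_derive_eq; rewrite [LHS]mulr1.
have dg : is_derive (k 0) 1 g ('D_v f x) by rewrite /k mulr0.
by have := @is_derive1_comp R g k 0 _ _ dg dk; rewrite mulrC.
Qed.

Lemma mvt_basis f x i (h : R) :
  (forall s : R, `|s| <= `|h| -> derivable f (x + s *: basis_vec i) (basis_vec i)) ->
  exists2 s : R, `|s| <= `|h| & f (x + h *: basis_vec i) - f x =
     h * 'D_(basis_vec i) f (x + s *: basis_vec i).
Proof.
move=> df.
have le1 (s : R) : 0 <= s <= 1 -> `|s * h| <= `|h|.
  by move=> /andP[s0 s1]; rewrite normrM ger0_norm// ler_piMl.
have d1 (s : R) : 0 <= s <= 1 -> is_derive (x + s *: (h *: basis_vec i))
    (h *: basis_vec i) f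
    (h * 'D_(basis_vec i) f (x + (s * h) *: basis_vec i)).
  move=> /le1 /df sh; rewrite scalerA.
  by apply: is_derive_scalev; apply: derivableP.
have [s s01 E] := @mvt_line f x (h *: basis_vec i)
  (fun s s01 => @ex_derive _ _ _ _ _ _ _ (d1 s s01)).
exists (s * h); first exact: le1.
by rewrite E (@derive_val _ _ _ _ _ _ _ (d1 s s01)).
Qed.

End RowVectors.

Section Differentiability.
Context {R : realType}.

Lemma linear_rV_continuous n (W : normedModType R)
  (g : {linear 'rV[R]_n -> W}) : continuous g.
Proof.
have -> : (g : 'rV[R]_n -> W) = (fun x => \sum_i x 0 i *: g (basis_vec i)).
  apply/funext => x; rewrite {1}(row_basis x) linear_sum.
  by apply: eq_bigr => i _; rewrite linearZ.
apply: continuous_big => [|i _ x]; first exact: add_continuous.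
apply: cvgZr_tmp; first exact: (@nbhs_filter _ x).
exact: (@matrix_normedtype.coord_continuous _ _ _ _ _ x).
Qed.

Lemma littleo_differentiable (V W : normedModType R) (f : V -> W)
    (df : {linear V -> W}) x : continuous df ->
  (forall e, 0 < e -> \forall h \near (0 : V),
      `|f (h + x) - f x - df h| <= e * `|h|) ->
  differentiable f x /\ 'd f x = df :> (V -> W).
Proof.
move=> dfc H.
have dxf : f \o shift x = cst (f x) + df +o_ 0 id.
  apply/eqaddoP => e e0; near=> h.
  rewrite /= (_ : _ h = f (h + x) - f x - df h); last first.
    by rewrite !fctE /= opprD addrA.
  by near: h; exact: H.
split; last exact: diff_unique.
apply/diffP => /=.
apply: (@getPex _ (fun (df : {linear V -> W}) => continuous df /\
  forall y, f y = f (lim (nbhs x)) + df (y - lim (nbhs x))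
                  +o_(y \near x) (y - lim (nbhs x)))).
exists df; split=> //.
suff E : f = (fun y => f (lim (nbhs x)) + df (y - lim (nbhs x)))
    +o_ (nbhs x) (fun y => y - lim (nbhs x)).
  by move=> y; exact: (congr1 (@^~ y) E).
rewrite lim_id//; apply/eqaddoP => e e0.
rewrite [\forall y \near _, _ <= _](near_shift 0) subr0; near=> h.
rewrite /= !fctE /= addrK opprD addrA.
by near: h; exact: H.
Unshelve. all: by end_near. Qed.

(** Telescoping over the coordinates turns an increment into increments along
basis vectors, to each of which the mean value theorem applies. *)
Lemma partials_differentiable n (U : set 'rV[R]_n) (f : 'rV[R]_n -> R) x :
  open U -> U x ->
  (forall y i, U y -> derivable f y (basis_vec i)) ->
  (forall i, {for x, continuous (fun y => 'D_(basis_vec i) f y)}) ->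
  differentiable f x.
Proof.
move=> oU Ux df cf.
pose g (h : 'rV[R]_n) : R := \sum_i h 0 i * 'D_(basis_vec i) f x.
have g_lin : linear g.
  move=> a u v; rewrite /g scaler_sumr -big_split; apply: eq_bigr => i _.
  by rewrite !mxE mulrDl /= -mulrA.
pose gL := HB.pack g (GRing.isLinear.Build _ _ _ _ _ g_lin) :
  {linear 'rV[R]_n -> R}.
have [] // := @littleo_differentiable _ _ f gL x; first exact: linear_rV_continuous.
move=> e e0; pose e' := e / n.+1%:R.
have e'0 : 0 < e' by rewrite divr_gt0.
have [r r0 rU] : exists2 r : R, 0 < r & forall y, `|y - x| < r -> U y /\
    forall i, `|'D_(basis_vec i) f y - 'D_(basis_vec i) f x| <= e'.
  apply: near_normI; first exact: open_normP.
  apply: near_norm_forall => i.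
  have [r r0 rP] := (continuous_normP _ _).1 (cf i) _ e'0.
  by exists r => // y /rP /ltW.
have tr (h : 'rV[R]_n) : `|h| < r -> `|f (h + x) - f x - g h| <= e * `|h|.
  move=> hr.
  pose t k : 'rV[R]_n := \row_j (if (j < k)%N then h 0 j else 0).
  have t0 : t 0%N = 0 by apply/rowP => j; rewrite !mxE.
  have tn : t n = h by apply/rowP => j; rewrite !mxE ltn_ord.
  have tS (k : 'I_n) : t k.+1 = t k + h 0 k *: basis_vec k.
    apply/rowP => j; rewrite !mxE eqxx /= ltnS leq_eqVlt -val_eqE /=.
    by case: (ssrnat.ltngtP j k) => [_|_|/ord_inj ->] /=; rewrite ?(mulr0, mulr1, addr0, add0r).
  have tlt (k : 'I_n) (s : R) : `|s| <= `|h 0 k| ->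
      `|t k + s *: basis_vec k| <= `|h|.
    move=> sk; apply: norm_row_le => // j; rewrite !mxE eqxx /= -val_eqE /=.
    case: (ssrnat.ltngtP j k) => [_|_|_] /=; rewrite ?(mulr0, mulr1, addr0, add0r).
    - exact: norm_coord.
    - by rewrite normr0.
    - exact: le_trans sk (norm_coord _ _).
  have -> : f (h + x) - f x = \sum_(k < n) (f (x + t k.+1) - f (x + t k)).
    rewrite -(big_mkord xpredT (fun k => f (x + t k.+1) - f (x + t k))).
    by rewrite (telescope_sumr (fun k => f (x + t k)))// tn t0 addr0 [x + h]addrC.
  rewrite /g -sumrB; apply: le_trans (ler_norm_sum _ _ _) _.
  have step (k : 'I_n) : `|f (x + t k.+1) - f (x + t k) -
      h 0 k * 'D_(basis_vec k) f x| <= e' * `|h|.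
    have inU (s : R) : `|s| <= `|h 0 k| ->
        `|x + t k + s *: basis_vec k - x| < r.
      move=> /tlt; rewrite -[x + t k + _]addrA [_ - x]addrC addKr => th.
      exact: le_lt_trans th hr.
    have [|s sh E] := @mvt_basis _ _ f (x + t k) k (h 0 k).
      by move=> s /inU /rU[+ _]; exact: df.
    rewrite tS addrA E -mulrBr normrM mulrC ler_pM//; last exact: norm_coord.
    by have [_] := rU _ (inU _ sh); exact.
  apply: le_trans (ler_sum _ (fun k _ => step k)) _.
  rewrite sumr_const card_ord -mulr_natr mulrAC ler_wpM2r// /e'.
  by rewrite mulrAC -mulrA ler_piMr ?(ltW e0)// ler_pdivrMr// mul1r ler_nat.
by apply/near_normP; exists r => // h; rewrite subr0 => /tr.
Qed.

End Differentiability.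

(** * The algebra of smooth functions *)

Section SmoothFunctions.
Context {R : realType} {n : nat}.
Implicit Types (U : set 'rV[R]_n) (f g : 'rV[R]_n -> R) (x y v : 'rV[R]_n).

Lemma near_open (W : normedModType R) (V : set W) (T : Type) (f g : W -> T) (x : W) :
  open V -> V x -> (forall z, V z -> f z = g z) -> {near x, f =1 g}.
Proof.
by move=> oV Vx fg; apply: (@filterS _ _ _ V) => //; apply: open_nbhs_nbhs.
Qed.

Lemma near_eq_continuous (V W : topologicalType) (f g : V -> W) (a : V) :
  {near a, f =1 g} -> {for a, continuous f} -> {for a, continuous g}.
Proof.
move=> fg; rewrite /prop_for /continuous_at -(nbhs_singleton fg).
by apply: cvg_trans; exact: near_eq_cvg.
Qed.

Lemma eq_on_derivable U f g x v : open U -> U x ->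
  (forall y, U y -> f y = g y) -> derivable f x v -> derivable g x v.
Proof. by move=> oU Ux fg; apply: near_eq_derivable; exact: near_open fg. Qed.

Lemma eq_on_derive U f g x v : open U -> U x ->
  (forall y, U y -> f y = g y) -> 'D_v f x = 'D_v g x.
Proof. by move=> oU Ux fg; apply: near_eq_derive; exact: near_open fg. Qed.

Lemma eq_on_continuous U f g x : open U -> U x ->
  (forall y, U y -> f y = g y) -> {for x, continuous f} ->
  {for x, continuous g}.
Proof. by move=> oU Ux fg; apply: near_eq_continuous; exact: near_open fg. Qed.

(** Smoothness by coinduction: a class of functions that is closed, up to
equality on U, under partial derivatives consists of smooth functions. *)
Lemma smooth_coind U (C : ('rV[R]_n -> R) -> Prop) : open U ->
  (forall f, C f -> forall x, U x -> {for x, continuous f}) ->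
  (forall f, C f -> forall i, (forall x, U x -> derivable f x (basis_vec i)) /\
     exists2 g, C g & forall x, U x -> 'D_(basis_vec i) f x = g x) ->
  forall f, C f -> smooth_on U f.
Proof.
move=> oU Ccont Cder f Cf.
have H s : exists2 g, C g & forall x, U x -> iter_partial s f x = g x.
  elim: s => [|i s [g Cg gE]]; first by exists f.
  have [_ [h Ch hE]] := Cder _ Cg i; exists h => // x Ux /=.
  by rewrite (@eq_on_derive U (iter_partial s f) g) // hE.
move=> s x Ux; have [g Cg gE] := H s.
have gE' y : U y -> g y = iter_partial s f y by move=> /gE.
split; first by apply: (eq_on_continuous oU Ux gE'); exact: Ccont.
by move=> i; apply: (eq_on_derivable oU Ux gE'); apply: (Cder _ Cg i).1.
Qed.

Lemma smooth_sub U V f : (forall x, V x -> U x) -> smooth_on U f ->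
  smooth_on V f.
Proof. by move=> VU sf s x /VU; exact: sf. Qed.

Lemma smooth_continuous U f x : smooth_on U f -> U x -> {for x, continuous f}.
Proof. by move=> /(_ [::] x) sf /sf[]. Qed.

Lemma smooth_derivable U f x i : smooth_on U f -> U x ->
  derivable f x (basis_vec i).
Proof. by move=> /(_ [::] x) sf /sf[_]; exact. Qed.

Lemma smooth_partial U f i : smooth_on U f ->
  smooth_on U (fun x => 'D_(basis_vec i) f x).
Proof.
move=> sf s x Ux; have := sf (rcons s i) x Ux.
by rewrite /iter_partial -cats1 foldr_cat.
Qed.

Lemma smooth_ext U f g : open U -> (forall x, U x -> f x = g x) ->
  smooth_on U f -> smooth_on U g.
Proof.
move=> oU fg sf.
apply: (@smooth_coind U (fun g => exists2 f, smooth_on U f &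
    forall x, U x -> f x = g x)) => //; last by exists f.
- move=> h [k sk kh] x Ux; apply: (eq_on_continuous oU Ux kh).
  exact: smooth_continuous sk Ux.
- move=> h [k sk kh] i; split=> [x Ux|].
    by apply: (eq_on_derivable oU Ux kh); exact: smooth_derivable sk Ux.
  exists (fun x => 'D_(basis_vec i) k x).
    by exists (fun x => 'D_(basis_vec i) k x); [exact: smooth_partial|].
  by move=> x Ux; rewrite (eq_on_derive _ oU Ux kh).
Qed.

(** Partial derivatives of such expressions are again such expressions, which is what
smooth_coind asks for. *)
Inductive smooth_alg U : ('rV[R]_n -> R) -> Prop :=
| SmoothBase f : smooth_on U f -> smooth_alg U f
| SmoothCst (c : R) : smooth_alg U (cst c)
| SmoothAdd f g : smooth_alg U f -> smooth_alg U g -> smooth_alg U (f + g)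
| SmoothMul f g : smooth_alg U f -> smooth_alg U g -> smooth_alg U (f * g)
| SmoothInv f : (forall x, U x -> f x != 0) -> smooth_alg U f ->
    smooth_alg U (fun x => (f x)^-1)
| SmoothSqrt f : (forall x, U x -> 0 < f x) -> smooth_alg U f ->
    smooth_alg U (fun x => Num.sqrt (f x)).

Lemma is_derive_sqrt_comp f x v d : 0 < f x -> is_derive x v f d ->
  is_derive x v (fun y => Num.sqrt (f y)) (d * (2 * Num.sqrt (f x))^-1).
Proof.
move=> fx0 [df <-].
pose g (t : R) : R := f (x + t *: v).
have dg : is_derive (0 : R) 1 g ('D_v f x).
  by have dl := @derivable_line R n f x v 0; rewrite scale0r addr0 in dl; apply: dl.
have gE : g 0 = f x by rewrite /g scale0r addr0.
have ds : is_derive (g 0) 1 (@Num.sqrt R) (2 * Num.sqrt (f x))^-1.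
  by rewrite gE; exact: is_derive1_sqrt.
have D := @is_derive1_comp R (@Num.sqrt R) g 0 _ _ ds dg.
have E : (fun k : R => k^-1 *: (Num.sqrt (g (k *: 1 + 0)) - Num.sqrt (g 0))) =
    (fun k : R => k^-1 *: (Num.sqrt (f (k *: v + x)) - Num.sqrt (f x))).
  apply/funext => k; rewrite addr0 [k *: 1]mulr1 gE /g.
  by rewrite [x + _]addrC.
apply: DeriveDef.
  by have := @ex_derive _ _ _ _ _ _ _ D; rewrite /derivable /= E.
by have := @derive_val _ _ _ _ _ _ _ D; rewrite /derive /= E mulrC.
Qed.

Lemma smooth_alg_smooth U f : open U -> smooth_alg U f -> smooth_on U f.
Proof.
move=> oU; apply: smooth_coind => // {}f.
  elim=> {f} [f sf|c|f g _ cf _ cg|f g _ cf _ cg|f f0 _ cf|f f0 _ cf] x Ux.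
  - exact: smooth_continuous sf Ux.
  - exact: cst_continuous.
  - by apply: continuousD; [exact: cf|exact: cg].
  - by apply: continuousM; [exact: cf|exact: cg].
  - by apply: continuousV; [exact: f0|exact: cf].
  - apply: (@continuous_comp _ _ _ f Num.sqrt); first exact: cf.
    exact: sqrt_continuous.
elim=> {f} [f sf|c|f g Cf cf Cg cg|f g Cf cf Cg cg|f f0 Cf cf|f f0 Cf cf] i.
- split=> [x|]; first exact: smooth_derivable.
  exists (fun x => 'D_(basis_vec i) f x) => //.
  by apply: SmoothBase; exact: smooth_partial.
- split=> [x _|]; first exact: derivable_cst.
  by exists (cst 0) => [|x _]; [exact: SmoothCst|rewrite derive_cst].
- have [df [f' Cf' fE]] := cf i; have [dg [g' Cg' gE]] := cg i.
  split=> [x Ux|]; first by apply: derivableD; [exact: df|exact: dg].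
  exists (f' + g') => [|x Ux]; first exact: SmoothAdd.
  by rewrite deriveD ?fE ?gE//; [exact: df|exact: dg].
- have [df [f' Cf' fE]] := cf i; have [dg [g' Cg' gE]] := cg i.
  split=> [x Ux|]; first by apply: derivableM; [exact: df|exact: dg].
  exists (f * g' + g * f') => [|x Ux].
    by apply: SmoothAdd; apply: SmoothMul.
  by rewrite deriveM ?fE ?gE//; [exact: df|exact: dg].
- have [df [f' Cf' fE]] := cf i.
  split=> [x Ux|]; first by apply: derivableV; [exact: f0|exact: df].
  exists ((cst (-1) * ((fun x => (f x)^-1) * (fun x => (f x)^-1))) * f')
    => [|x Ux].
    apply: SmoothMul => //; apply: SmoothMul; first exact: SmoothCst.
    by apply: SmoothMul; exact: SmoothInv.
  rewrite deriveV; [|exact: f0|exact: df].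
  rewrite fE// [RHS](_ : _ = -1 * ((f x)^-1 * (f x)^-1) * f' x)//.
  by rewrite mulN1r -expr2 exprVn.
- have [df [f' Cf' fE]] := cf i.
  have D x : U x -> is_derive x (basis_vec i) (fun y => Num.sqrt (f y))
      (f' x * (2 * Num.sqrt (f x))^-1).
    move=> Ux; apply: is_derive_sqrt_comp; first exact: f0.
    by apply: DeriveDef; [exact: df|exact: fE].
  split=> [x /D[]//|].
  exists (f' * (fun x => ((cst 2 * (fun x => Num.sqrt (f x))) x)^-1)) => [|x Ux].
    apply: SmoothMul => //; apply: SmoothInv.
      move=> x Ux; rewrite !fctE mulf_neq0// gt_eqF// sqrtr_gt0; exact: f0.
    by apply: SmoothMul; [exact: SmoothCst|exact: SmoothSqrt].
  by rewrite (@derive_val _ _ _ _ _ _ _ (D x Ux)).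
Qed.

Lemma smooth_cst U (c : R) : open U -> smooth_on U (cst c).
Proof. by move=> oU; apply: smooth_alg_smooth => //; exact: SmoothCst. Qed.

Lemma smoothD U f g : open U -> smooth_on U f -> smooth_on U g ->
  smooth_on U (fun x => f x + g x).
Proof.
move=> oU sf sg.
exact: (smooth_alg_smooth oU (SmoothAdd (SmoothBase sf) (SmoothBase sg))).
Qed.

Lemma smoothM U f g : open U -> smooth_on U f -> smooth_on U g ->
  smooth_on U (fun x => f x * g x).
Proof.
move=> oU sf sg.
exact: (smooth_alg_smooth oU (SmoothMul (SmoothBase sf) (SmoothBase sg))).
Qed.

Lemma smoothZ U (c : R) f : open U -> smooth_on U f ->
  smooth_on U (fun x => c * f x).
Proof. by move=> oU; apply: (smoothM oU); exact: smooth_cst. Qed.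

Lemma smoothN U f : open U -> smooth_on U f -> smooth_on U (fun x => - f x).
Proof.
move=> oU sf; have := @smoothZ U (-1) f oU sf.
by under [X in smooth_on _ X -> _]funext do rewrite mulN1r.
Qed.

Lemma smoothB U f g : open U -> smooth_on U f -> smooth_on U g ->
  smooth_on U (fun x => f x - g x).
Proof. by move=> oU sf sg; exact: (smoothD oU sf (smoothN oU sg)). Qed.

Lemma smooth_sqr U f : open U -> smooth_on U f -> smooth_on U (fun x => f x ^+ 2).
Proof.
move=> oU sf; under [X in smooth_on _ X]funext do rewrite expr2.
exact: smoothM.
Qed.

Lemma smoothV U f : open U -> (forall x, U x -> f x != 0) -> smooth_on U f ->
  smooth_on U (fun x => (f x)^-1).
Proof.
by move=> oU f0 sf; exact: (smooth_alg_smooth oU (SmoothInv f0 (SmoothBase sf))).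
Qed.

Lemma smooth_sqrt U f : open U -> (forall x, U x -> 0 < f x) ->
  smooth_on U f -> smooth_on U (fun x => Num.sqrt (f x)).
Proof.
by move=> oU f0 sf; exact: (smooth_alg_smooth oU (SmoothSqrt f0 (SmoothBase sf))).
Qed.

Lemma smooth_sum (I : Type) (r : seq I) U (F : I -> 'rV[R]_n -> R) : open U ->
  (forall i, smooth_on U (F i)) ->
  smooth_on U (fun x => \sum_(i <- r) F i x).
Proof.
move=> oU sF; elim: r => [|i r IH].
  by under [X in smooth_on _ X]funext do rewrite big_nil; exact: smooth_cst.
under [X in smooth_on _ X]funext do rewrite big_cons.
exact: (smoothD oU (sF i) IH).
Qed.

Lemma derive_linear_proj m (L : {linear 'rV[R]_m -> 'rV[R]_n}) f
    (z v : 'rV[R]_m) : derivable f (L z) (L v) ->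
  is_derive z v (f \o L) ('D_(L v) f (L z)).
Proof.
have E : (fun h : R => h^-1 *: (f (L (h *: v + z)) - f (L z))) =
         (fun h : R => h^-1 *: (f (h *: L v + L z) - f (L z))).
  by apply/funext => h; rewrite linearP.
by move=> d; apply: DeriveDef; [rewrite /derivable /= E|rewrite /derive /= E].
Qed.

Lemma smooth_differentiable U f x : open U -> smooth_on U f -> U x ->
  differentiable f x.
Proof.
move=> oU sf Ux; apply: (partials_differentiable oU Ux) => [y i Uy|i].
  exact: smooth_derivable sf Uy.
exact: (smooth_continuous (smooth_partial i sf) Ux).
Qed.

(** By the chain rule, a partial derivative of f \o L is 0 or the composite with L of a
partial derivative of f. *)
Lemma smooth_comp_proj m (L : {linear 'rV[R]_m -> 'rV[R]_n}) U f : open U ->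
  (forall k, L (basis_vec k) = 0 \/ exists i, L (basis_vec k) = basis_vec i) ->
  smooth_on U f -> smooth_on (L @^-1` U) (f \o L).
Proof.
move=> oU HL sf s z Uz.
have oV : open (L @^-1` U).
  by apply: open_comp => // x _; exact: linear_rV_continuous.
suff H t : exists2 g, smooth_on U g &
    forall u, (L @^-1` U) u -> iter_partial t (f \o L) u = (g \o L) u.
  have [g sg gE] := H s.
  have gE' : {near z, (g \o L) =1 iter_partial s (f \o L)}.
    by apply: near_open oV Uz _ => y Uy; rewrite gE.
  split.
    apply: near_eq_continuous gE' _.
    apply: (@continuous_comp _ _ _ L g); first exact: linear_rV_continuous.
    exact: smooth_continuous sg Uz.
  move=> i; apply: near_eq_derivable gE' _.
  have [] // := @derive_linear_proj m L g z (basis_vec i).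
  have [->|[j ->]] := HL i; first exact: derivable0.
  exact: smooth_derivable sg Uz.
elim: t => [|k t [g sg gE]]; first by exists f.
have dE u k' : (L @^-1` U) u -> 'D_(basis_vec k') (iter_partial t (f \o L)) u =
    'D_(basis_vec k') (g \o L) u.
  by move=> Ux; apply: near_eq_derive; apply: near_open oV Ux gE.
have [L0|[j Lj]] := HL k.
  exists (cst 0); first exact: smooth_cst.
  move=> x Ux /=; rewrite dE//.
  have d0 : derivable g (L x) (L (basis_vec k)) by rewrite L0; exact: derivable0.
  have D := derive_linear_proj d0; rewrite L0 in D.
  by rewrite (@derive_val _ _ _ _ _ _ _ D) derive0.
exists (fun x => 'D_(basis_vec j) g x); first exact: smooth_partial.
move=> x Ux /=; rewrite dE//.
have dj : derivable g (L x) (L (basis_vec k)).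
  by rewrite Lj; exact: smooth_derivable sg Ux.
have D := derive_linear_proj dj; rewrite Lj in D.
by rewrite (@derive_val _ _ _ _ _ _ _ D).
Qed.

Lemma coord_differentiable x i : differentiable (fun y : 'rV[R]_n => y 0 i) x.
Proof. exact: differentiable_coord. Qed.

Lemma is_derive_coord x v i : is_derive x v (fun y : 'rV[R]_n => y 0 i) (v 0 i).
Proof.
have @f : {linear 'rV[R]_n -> R}.
  by exists (fun N : 'rV[R]_n => N 0 i); do 2![eexists]; do ?[constructor];
     rewrite ?mxE// => ? *; rewrite ?mxE//; move=> ?; rewrite !mxE.
have fc : continuous f by exact: linear_rV_continuous.
apply: DeriveDef; first exact/diff_derivable/coord_differentiable.
rewrite deriveE; last exact: coord_differentiable.
by rewrite (_ : (fun _ => _) = f)// diff_lin.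
Qed.

Lemma smooth_coord U i : open U -> smooth_on U (fun x => x 0 i).
Proof.
move=> oU; apply: (@smooth_coind U (fun f => (exists i, f = (fun x => x 0 i)) \/
   exists c : R, f = cst c)) => //; last by left; exists i.
- move=> f [[j ->]|[c ->]] x _; last exact: cst_continuous.
  exact/differentiable_continuous/coord_differentiable.
- move=> f [[j ->]|[c ->]] k; split.
  + by move=> x _; have [] := is_derive_coord x (basis_vec k) j.
  + exists (cst (j == k)%:R); first by right; exists (j == k)%:R.
    move=> x _; rewrite (@derive_val _ _ _ _ _ _ _ (is_derive_coord _ _ _)).
    by rewrite basis_vecE.
  + by move=> x _; exact: derivable_cst.
  + by exists (cst 0) => [|x _]; [right; exists 0|rewrite derive_cst].
Qed.

End SmoothFunctions.

(** * Curves, second derivatives and Lipschitz bounds *)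

Section Paths.
Context {R : realType}.

Lemma is_derive_rowP n (x : R -> 'rV[R]_n) (t : R) v :
  is_derive t 1 x v <-> forall i, is_derive t 1 (fun s => x s 0 i) (v 0 i).
Proof.
split=> [[dx <-] i|h].
  apply: DeriveDef; first by move: dx => /derivable_mxP/(_ 0 i).
  by rewrite (derive_mx dx) mxE.
have dx : derivable x t 1.
  by apply/derivable_mxP => i j; rewrite ord1; have [] := h j.
apply: DeriveDef => //; apply/rowP => i; rewrite (derive_mx dx) mxE.
by rewrite (@derive_val _ _ _ _ _ _ _ (h i)).
Qed.

Lemma is_derive_path_cont (V : normedModType R) (x : R -> V) (t : R) v :
  is_derive t 1 x v -> {for t, continuous x}.
Proof. by move=> [/derivable1_diffP/differentiable_continuous]. Qed.

Lemma derive_sum_partials n (f : 'rV[R]_n -> R) x v : differentiable f x ->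
  'D_v f x = \sum_i v 0 i * 'D_(basis_vec i) f x.
Proof.
move=> df; rewrite deriveE//.
have -> : 'd f x v = 'd f x (\sum_i v 0 i *: basis_vec i) by rewrite -row_basis.
by rewrite linear_sum; apply: eq_bigr => i _; rewrite linearZZ deriveE.
Qed.

Lemma is_derive_comp_row n (f : 'rV[R]_n -> R) (x : R -> 'rV[R]_n) (t : R) v :
  differentiable f (x t) -> is_derive t 1 x v ->
  is_derive t 1 (fun s => f (x s)) (\sum_i v 0 i * 'D_(basis_vec i) f (x t)).
Proof.
move=> df [/derivable1_diffP dx dxE].
have dfx : differentiable (f \o x) t by exact: differentiable_comp.
apply: DeriveDef; first exact/derivable1_diffP.
rewrite -/(f \o x) deriveE// diff_comp//= -(deriveE _ dx) dxE.
by rewrite -deriveE// derive_sum_partials.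
Qed.

Lemma mvt_norm_le (f df : R -> R) (a b B : R) :
  (forall t : R, Num.min a b <= t <= Num.max a b ->
     is_derive t 1 f (df t) /\ `|df t| <= B) ->
  `|f b - f a| <= B * `|b - a|.
Proof.
wlog ab : a b / a <= b => [hw|] H.
  have [/hw|ba] := leP a b; first exact.
  rewrite distrC [X in _ * X]distrC; apply: (hw _ _ (ltW ba)) => t.
  by rewrite minC maxC => /H.
move: H; rewrite (min_idPl ab) (max_idPr ab) => H.
have fc : {within `[a, b], continuous f}.
  by apply: derivable_within_continuous => t; rewrite in_itv/= => /H[[]].
have fd (t : R) : t \in `]a, b[%R -> is_derive t 1 f (df t).
  by rewrite in_itv/= => /andP[at_ tb]; apply: (H t _).1; rewrite !ltW.
have [c] := @MVT_segment R f df a b ab fd fc.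
rewrite in_itv/= => /H[_ cB] ->.
by rewrite normrM ler_wpM2r.
Qed.

Lemma mvt_norm_row_le n (x dx : R -> 'rV[R]_n) (a b B : R) :
  (forall t : R, Num.min a b <= t <= Num.max a b ->
     is_derive t 1 x (dx t) /\ `|dx t| <= B) ->
  `|x b - x a| <= B * `|b - a|.
Proof.
move=> H.
have B0 : 0 <= B.
  have [|_] := H a; first by rewrite ge_min lexx le_max lexx.
  exact: le_trans.
apply: norm_row_le => [|i]; first by rewrite mulr_ge0.
rewrite !mxE; apply: (@mvt_norm_le (fun t => x t 0 i) (fun t => dx t 0 i)).
move=> t /H[/is_derive_rowP/(_ i) xd dB]; split => //.
exact: le_trans (norm_coord _ _) dB.
Qed.

Lemma const_of_derive0 (f : R -> R) (a b s t : R) :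
  (forall u : R, a < u < b -> is_derive u 1 f 0) ->
  a < s < b -> a < t < b -> f s = f t.
Proof.
move=> H /andP[as_ sb] /andP[at_ tb]; apply/eqP; rewrite -subr_eq0 -normr_le0.
rewrite -(mul0r `|s - t|).
apply: (@mvt_norm_le f (cst 0)) => u /andP[].
rewrite ge_min le_max => /orP u1 /orP u2; split; last by rewrite normr0.
apply: H; apply/andP; split.
  by case: u1; apply: lt_le_trans.
by case: u2 => h; apply: le_lt_trans h _.
Qed.

(** A locally constant indicator function has derivative 0. *)
Lemma locally_const (P : R -> Prop) (a b s t : R) :
  (forall u : R, a < u < b -> exists2 e : R, 0 < e &
     forall v : R, u - e < v < u + e -> (P v <-> P u)) ->
  a < s < b -> a < t < b -> P s -> P t.
Proof.
move=> H sab tab Ps.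
pose f u : R := if `[< P u >] then 1 else 0.
have fd (u : R) : a < u < b -> is_derive u 1 f 0.
  move=> /H[e e0 he].
  have c0 : is_derive u 1 (cst (f u) : R -> R) 0 by exact: is_derive_cst.
  apply: near_eq_is_derive c0.
  apply/near_normP; exists e => // v; rewrite ltr_distl => /he hv.
  by rewrite /f /= (asbool_equiv_eq hv).
have := const_of_derive0 fd sab tab; rewrite /f (asboolT Ps).
by case: ifPn => [/asboolP//|_ /eqP]; rewrite oner_eq0.
Qed.

End Paths.

Section SecondOrder.
Context {R : realType} {n : nat}.
Implicit Types (U : set 'rV[R]_n) (f : 'rV[R]_n -> R) (x y v : 'rV[R]_n).

Lemma is_derive_translate f x v c : derivable f (x + c) v ->
  is_derive x v (fun y => f (y + c)) ('D_v f (x + c)).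
Proof.
have E : (fun h : R => h^-1 *: (f (h *: v + x + c) - f (x + c))) =
         (fun h : R => h^-1 *: (f (h *: v + (x + c)) - f (x + c))).
  by apply/funext => h; rewrite addrA.
by move=> d; apply: DeriveDef; [rewrite /derivable /= E|rewrite /derive /= E].
Qed.

Lemma second_difference U f x i j (r h : R) :
  (forall y, `|y - x| < r -> U y) -> smooth_on U f -> `|h| < r / 2 ->
  exists2 y, `|y - x| < r &
    f (x + h *: basis_vec i + h *: basis_vec j) - f (x + h *: basis_vec i)
      - f (x + h *: basis_vec j) + f x =
    h * (h * 'D_(basis_vec j) (fun z => 'D_(basis_vec i) f z) y).
Proof.
move=> rU sf hr.
have lt2 (s s' : R) : `|s| <= `|h| -> `|s'| <= `|h| ->
    `|x + s *: basis_vec i + s' *: basis_vec j - x| < r.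
  move=> sh s'h; rewrite -[x + _ + _]addrA [_ - x]addrC addKr.
  apply: le_lt_trans (ler_normD _ _) _; rewrite !normrZ.
  have b (u : R) k : `|u| <= `|h| -> `|u| * `|basis_vec k : 'rV[R]_n| < r / 2.
    move=> uh; apply: le_lt_trans hr; apply: le_trans uh.
    by rewrite ler_piMr// norm_basis_vec.
  by rewrite [ltRHS]splitr ltrD// b.
have lt1 (s : R) : `|s| <= `|h| -> `|x + s *: basis_vec i - x| < r.
  by move=> sh; have := lt2 s 0 sh; rewrite normr0 scale0r addr0; apply.
pose g y := f (y + h *: basis_vec j) - f y.
have gd (s : R) : `|s| <= `|h| -> is_derive (x + s *: basis_vec i) (basis_vec i) g
    ('D_(basis_vec i) f (x + s *: basis_vec i + h *: basis_vec j) -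
     'D_(basis_vec i) f (x + s *: basis_vec i)).
  move=> sh; have d1 : derivable f _ (basis_vec i) := smooth_derivable sf (rU _ (lt1 s sh)).
  have d2 : derivable f _ (basis_vec i) := smooth_derivable sf (rU _ (lt2 s h sh (lexx _))).
  exact: is_deriveB (is_derive_translate d2) (derivableP d1).
have [s sh E] := @mvt_basis _ _ g x i h (fun s sh => @ex_derive _ _ _ _ _ _ _ (gd s sh)).
rewrite (@derive_val _ _ _ _ _ _ _ (gd s sh)) in E.
have [|s' s'h E'] := @mvt_basis _ _ (fun y => 'D_(basis_vec i) f y)
    (x + s *: basis_vec i) j h.
  move=> s' s'h; apply: (smooth_derivable (smooth_partial i sf)).
  by apply: rU; exact: lt2.
exists (x + s *: basis_vec i + s' *: basis_vec j); first exact: lt2.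
rewrite -E' -E /g opprB.
by rewrite addrA; ring.
Qed.

Lemma dist_half (a b c e : R) :
  `|c - a| <= e / 2 -> `|c - b| <= e / 2 -> `|a - b| <= e.
Proof.
move=> ha hb; apply: le_trans (ler_distD c a b) _.
by rewrite (splitr e) lerD// distrC.
Qed.

(** Both mixed derivatives are limits of the same symmetric second difference. *)
Lemma mixed_partials U f x i j : open U -> U x -> smooth_on U f ->
  'D_(basis_vec i) (fun z => 'D_(basis_vec j) f z) x =
  'D_(basis_vec j) (fun z => 'D_(basis_vec i) f z) x.
Proof.
move=> oU Ux sf; set a := LHS; set b := RHS.
apply/eqP; rewrite -subr_eq0 -normr_le0; apply/ler_addgt0Pr => e e0.
rewrite add0r.
have ca := smooth_continuous (smooth_partial i (smooth_partial j sf)) Ux.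
have cb := smooth_continuous (smooth_partial j (smooth_partial i sf)) Ux.
have e20 : 0 < e / 2 by rewrite divr_gt0.
have [r r0 rP] := near_normI (open_normP oU Ux) (near_normI
  ((continuous_normP _ _).1 ca _ e20) ((continuous_normP _ _).1 cb _ e20)).
pose h := r / 4; have h0 : 0 < h by rewrite divr_gt0.
have hr : `|h| < r / 2.
  by rewrite gtr0_norm// /h ltr_pM2l// ltf_pV2 ?posrE ?ltr_nat.
have rU y : `|y - x| < r -> U y by move=> /rP[].
have [y yr E] := @second_difference U f x i j r h rU sf hr.
have [z zr E'] := @second_difference U f x j i r h rU sf hr.
have yz : 'D_(basis_vec j) (fun z => 'D_(basis_vec i) f z) y =
          'D_(basis_vec i) (fun z => 'D_(basis_vec j) f z) z.
  have hn0 : h != 0 by rewrite gt_eqF.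
  have EE : x + h *: basis_vec i + h *: basis_vec j =
            x + h *: basis_vec j + h *: basis_vec i by rewrite addrAC.
  rewrite EE [_ - _ - _]addrAC E' in E.
  by move: E => /(mulfI hn0)/(mulfI hn0) ->.
have [_ [_ /ltW hb]] := rP _ yr; have [_ [/ltW ha _]] := rP _ zr.
rewrite yz in hb.
exact: dist_half ha hb.
Qed.

Lemma smooth_lipschitz U f p : open U -> U p -> smooth_on U f ->
  exists r L : R, [/\ 0 < r, 0 <= L, forall y, `|y - p| <= r -> U y &
    forall y z, `|y - p| <= r -> `|z - p| <= r -> `|f y - f z| <= L * `|y - z|].
Proof.
move=> oU Up sf.
have H : exists2 r : R, 0 < r & forall y, `|y - p| < r ->
    forall i, `|'D_(basis_vec i) f y| <= `|'D_(basis_vec i) f p| + 1.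
  apply: near_norm_forall => i.
  have ci := smooth_continuous (smooth_partial i sf) Up.
  have [r r0 rP] := (continuous_normP _ _).1 ci _ ltr01.
  exists r => // y /rP/ltW yp; rewrite -lerBlDl.
  exact: le_trans (lerB_dist _ _) yp.
have [r r0 rP] := near_normI (open_normP oU Up) H.
pose L := \sum_i (`|'D_(basis_vec i) f p| + 1).
have r2 y : `|y - p| <= r / 2 -> `|y - p| < r.
  by move=> yr; apply: le_lt_trans yr _; rewrite ltr_pdivrMr// ltr_pMr// ltr1n.
exists (r / 2), L; split; first by rewrite divr_gt0.
- by apply: sumr_ge0 => i _; rewrite addr_ge0.
- by move=> y /r2/rP[].
move=> y z yr zr.
have seg (s : R) : 0 <= s <= 1 -> `|z + s *: (y - z) - p| < r.
  move=> /andP[s0 s1]; apply: r2.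
  have -> : z + s *: (y - z) - p = s *: (y - p) + (1 - s) *: (z - p).
    by apply/rowP => k; rewrite !mxE; ring.
  apply: le_trans (ler_normD _ _) _; rewrite !normrZ.
  rewrite (ger0_norm s0) [`|1 - s|]ger0_norm ?subr_ge0//.
  apply: (@le_trans _ _ (s * (r / 2) + (1 - s) * (r / 2))).
    by rewrite lerD// ler_wpM2l ?subr_ge0.
  by rewrite -mulrDl subrKC mul1r.
have dif (s : R) : 0 <= s <= 1 -> differentiable f (z + s *: (y - z)).
  by move=> /seg/rP[Us _]; exact: smooth_differentiable sf Us.
have der (s : R) : 0 <= s <= 1 -> derivable f (z + s *: (y - z)) (y - z).
  by move=> /dif ds; exact: diff_derivable.
have [s s01] := @mvt_line _ _ f z (y - z) der.
rewrite subrKC => ->; rewrite derive_sum_partials; last exact: dif.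
apply: le_trans (ler_norm_sum _ _ _) _; rewrite /L mulr_suml.
apply: ler_sum => i _; rewrite normrM mulrC.
rewrite ler_pM// ?norm_coord//.
by have [_] := rP _ (seg _ s01); exact.
Qed.

End SecondOrder.

Lemma smooth_map_lipschitz {R : realType} n m (U : set 'rV[R]_n)
    (F : 'rV[R]_n -> 'rV[R]_m) p : open U -> U p -> smooth_map_on U F ->
  exists r L : R, [/\ 0 < r, 0 <= L, forall y, `|y - p| <= r -> U y &
    forall y z, `|y - p| <= r -> `|z - p| <= r -> `|F y - F z| <= L * `|y - z|].
Proof.
move=> oU Up sF.
have lip i : exists rL : R * R, [/\ 0 < rL.1, 0 <= rL.2,
    forall y, `|y - p| <= rL.1 -> U y &
    forall y z, `|y - p| <= rL.1 -> `|z - p| <= rL.1 ->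
      `|F y 0 i - F z 0 i| <= rL.2 * `|y - z|].
  by have [r [L [r0 L0 rU rL]]] := smooth_lipschitz oU Up (sF i); exists (r, L).
have [q qP] := choice lip.
have [r0 r00 r0U] := open_normP oU Up.
pose r := \big[Num.min/(r0 / 2)]_i (q i).1.
have rle i : r <= (q i).1 by exact: bigmin_le_cond.
have rle0 : r <= r0 / 2 by exact: bigmin_le_id.
exists r, (\sum_i (q i).2); split.
- by apply: lt_bigmin => [|i _]; [rewrite divr_gt0|have [] := qP i].
- by apply: sumr_ge0 => i _; have [] := qP i.
- move=> y yr; apply: r0U; apply: le_lt_trans yr _.
  by apply: le_lt_trans rle0 _; rewrite ltr_pdivrMr// ltr_pMr// ltr1n.
move=> y z yr zr.
apply: norm_row_le => [|i].
  by rewrite mulr_ge0// sumr_ge0// => i _; have [] := qP i.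
have [_ _ _ /(_ y z)] := qP i; rewrite !mxE.
move=> /(_ (le_trans yr (rle i)) (le_trans zr (rle i))) h.
apply: le_trans h _; rewrite ler_wpM2r// (bigD1 i)//= lerDl.
by apply: sumr_ge0 => j _; have [] := qP j.
Qed.

(** * Ordinary differential equations *)

Section Picard.
Context {R : realType}.

Lemma between0 (B c s : R) : - B <= c <= B ->
  Num.min 0 c <= s <= Num.max 0 c -> - B <= s <= B.
Proof.
move=> /andP[c1 c2]; rewrite ge_min le_max.
by move=> /andP[/orP[] ? /orP[] ?]; apply/andP; split; lra.
Qed.

(** With L * T <= 1/2 the mean value inequality bounds the supremum m of the
norm of u by its initial value plus m / 2; no exponential is needed. *)
Lemma gronwall n (u du : R -> 'rV[R]_n) (T L : R) : 0 <= L -> L * T <= 2^-1 ->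
  (forall t, - T < t < T -> is_derive t 1 u (du t) /\ `|du t| <= L * `|u t|) ->
  forall t, - T < t < T -> `|u t| <= 2 * `|u 0|.
Proof.
move=> L0 LT H t tT.
have tT' (s : R) : - `|t| <= s <= `|t| -> - T < s < T.
  rewrite -ler_norml -ltr_norml => st; apply: le_lt_trans st _.
  by rewrite ltr_norml.
have tt : - `|t| <= `|t| by rewrite ge0_cp.
have uc : {within `[- `|t|, `|t|], continuous (fun s => `|u s|)}.
  apply: continuous_in_subspaceT => s; rewrite inE/= in_itv/= => /tT'/H[us _].
  apply: continuous_comp; last exact: norm_continuous.
  exact: is_derive_path_cont us.
have [c ct cmax] := @EVT_max R (fun s => `|u s|) _ _ tt uc.
rewrite in_itv/= in ct.
have ut : `|u t| <= `|u c|.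
  by apply: cmax; rewrite in_itv/= lerNnormlW ?ler_norm.
apply: le_trans ut _.
have cle : `|c| <= T.
  by have /tT' := ct; rewrite -ltr_norml => /ltW.
have : `|u c - u 0| <= (L * `|u c|) * `|c - 0|.
  apply: (@mvt_norm_row_le _ _ u du) => s /andP[s1 s2].
  have sc : - `|t| <= s <= `|t| by apply: between0 ct _; apply/andP.
  have [d1 d2] := H s (tT' s sc); split => //; apply: le_trans d2 _.
  by rewrite ler_wpM2l// cmax// in_itv.
rewrite subr0 => h.
have : `|u c| <= `|u 0| + `|u c| / 2.
  rewrite -lerBlDl; apply: le_trans (lerB_dist _ _) _; apply: le_trans h _.
  rewrite mulrAC mulrC ler_wpM2l//; apply: le_trans LT.
  by rewrite ler_wpM2l.
by lra.
Qed.

Lemma antiderivative (f : R -> R) (K : R) : 0 < K -> continuous f ->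
  exists A : R -> R, A 0 = 0 /\ forall t, - K < t < K -> is_derive t 1 A (f t).
Proof.
move=> K0 cf.
pose F x := (\int[lebesgue_measure]_(t in [set` `[- K, x]]) (f t))%R.
have dF t : - K < t < K -> is_derive t 1 F (f t).
  move=> /andP[Kt tK].
  have fi : lebesgue_measure.-integrable `[- K, K] (EFin \o f).
    apply: continuous_compact_integrable; first exact: segment_compact.
    exact: continuous_subspaceT.
  have [d1 d2] := @continuous_FTC1_closed R f (- K) t K tK fi Kt (cf t).
  by apply: DeriveDef; [exact: d1|rewrite -derive1E d2].
exists (fun x => F x - F 0); split; first by rewrite subrr.
move=> t /dF dt; have dc : is_derive t 1 (cst (F 0) : R -> R) 0 by exact: is_derive_cst.
by have := is_deriveB dt dc; rewrite subr0.
Qed.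

Lemma geometric_limit (a : nat -> R) (B : R) :
  (forall k, `|a k.+1 - a k| <= B / 2 ^+ k) ->
  exists l, forall k, `|a k - l| <= 2 * B / 2 ^+ k.
Proof.
move=> aB.
pose b k := 2 * B / 2 ^+ k.
have bS k : b k.+1 = b k / 2.
  by rewrite /b exprS invfM mulrCA mulrC -mulrA [_ ^-1 * 2^-1]mulrC !mulrA.
have bk k : B / 2 ^+ k = b k / 2.
  by rewrite /b mulrAC [2 * B]mulrC mulfK.
have lo k m : a k - b k <= a (k + m)%N - b (k + m)%N.
  elim: m => [|m IH]; first by rewrite addn0.
  apply: le_trans IH _; rewrite addnS bS.
  by have := aB (k + m)%N; rewrite bk ler_norml => /andP[]; lra.
have up k m : a (k + m)%N + b (k + m)%N <= a k + b k.
  elim: m => [|m IH]; first by rewrite addn0.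
  apply: le_trans _ IH; rewrite addnS bS.
  by have := aB (k + m)%N; rewrite bk ler_norml => /andP[]; lra.
have B0 : 0 <= B.
  by have := aB 0%N; rewrite expr0 divr1; apply: le_trans.
have b0 k : 0 <= b k by rewrite /b mulr_ge0 ?invr_ge0 ?exprn_ge0 ?mulr_ge0.
have bd k m : a m - b m <= a k + b k.
  have := lo m (maxn k m - m)%N; rewrite subnKC ?leq_maxr// => h1.
  have := up k (maxn k m - k)%N; rewrite subnKC ?leq_maxl// => h2.
  by have := b0 (maxn k m); lra.
pose E := [set a k - b k | k in [set: nat]].
have hE : has_sup E.
  split; first by exists (a 0%N - b 0%N), 0%N.
  by exists (a 0%N + b 0%N) => _ [m _ <-].
exists (sup E) => k; rewrite -/(b k) ler_distlC; apply/andP; split.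
  by apply: sup_upper_bound => //; exists k.
by apply: sup_le_ub => [|_ [m _ <-]]; [exact: hE.1|exact: bd].
Qed.

Lemma le_geometric_eq0 (B x : R) : (forall k, `|x| <= B / 2 ^+ k) -> x = 0.
Proof.
move=> xB; apply/eqP; rewrite -normr_le0; apply/ler_addgt0Pr => e e0; rewrite add0r.
have [k Bk] : exists k, B / 2 ^+ k <= e.
  exists (Num.truncn (`|B| / e)).+1.
  rewrite ler_pdivrMr ?exprn_gt0// mulrC -ler_pdivrMr//.
  apply: (@le_trans _ _ (`|B| / e)); first by rewrite ler_pM2r ?invr_gt0// ler_norm.
  apply/ltW; apply: lt_le_trans (truncnS_gt _) _.
  rewrite -natrX ler_nat; exact/ltnW/ltn_expl.
exact: le_trans (xB k) Bk.
Qed.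

Definition clampt (T t : R) : R := Num.max (- T) (Num.min t T).

Lemma clampt_id T t : - T <= t <= T -> clampt T t = t.
Proof. by move=> /andP[a b]; rewrite /clampt (min_idPl b) (max_idPr a). Qed.

Lemma clampt_in T t : 0 <= T -> - T <= clampt T t <= T.
Proof.
move=> T0; rewrite /clampt le_max lexx /= ge_max ge_min lexx orbT andbT.
by rewrite ge0_cp.
Qed.

Lemma max_dist (p y z : R) : `|Num.max p y - Num.max p z| <= `|y - z|.
Proof.
have h1 := ler_norm (y - z); have h2 := ler_norm (- (y - z)); rewrite normrN in h2.
by case: (leP p y) => a; case: (leP p z) => b; rewrite ler_norml;
  apply/andP; split; lra.
Qed.

Lemma min_dist (y z q : R) : `|Num.min y q - Num.min z q| <= `|y - z|.
Proof.
have h1 := ler_norm (y - z); have h2 := ler_norm (- (y - z)); rewrite normrN in h2.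
by case: (leP y q) => a; case: (leP z q) => b; rewrite ler_norml;
  apply/andP; split; lra.
Qed.

Lemma clampt_dist (p q y z : R) :
  `|Num.max p (Num.min y q) - Num.max p (Num.min z q)| <= `|y - z|.
Proof. exact: le_trans (max_dist _ _ _) (min_dist _ _ _). Qed.

Lemma clampt_cont T : continuous (clampt T).
Proof.
move=> t; apply/continuous_normP => e e0; exists e => // s st.
exact: le_lt_trans (clampt_dist _ _ _ _) st.
Qed.

(** Successive approximations, run on the clamped time so that all the iterates
are defined and estimated on the whole line. *)
Theorem picard n (F : 'rV[R]_n -> 'rV[R]_n) (L T : R) : 0 <= L -> 0 < T ->
  L * T <= 2^-1 -> (forall y z, `|F y - F z| <= L * `|y - z|) ->
  forall z0, exists2 x : R -> 'rV[R]_n, x 0 = z0 &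
    forall t, - T < t < T -> is_derive t 1 x (F (x t)).
Proof.
move=> L0 T0 LT FL z0.
have T20 : 0 < 2 * T by rewrite mulr_gt0.
pose c := clampt T.
have cin t : - T <= c t <= T by apply: clampt_in; exact: ltW.
have Tin s : - T <= s <= T -> - (2 * T) < s < 2 * T.
  by move=> /andP[? ?]; apply/andP; split; lra.
have cin2 t : - (2 * T) < c t < 2 * T by exact/Tin/cin.
have Fc : continuous F.
  move=> y; apply/continuous_normP => e e0.
  exists (e / (L + 1)) => [|z zy]; first by rewrite divr_gt0// ltr_wpDl.
  apply: le_lt_trans (FL _ _) _.
  apply: (@le_lt_trans _ _ ((L + 1) * `|z - y|)).
    by rewrite ler_wpM2r// lerDl.
  by rewrite mulrC -ltr_pdivlMr// ltr_wpDl.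
have [A AP] : exists A : (R -> 'rV[R]_n) -> R -> 'rV[R]_n, forall u,
    continuous u -> A u 0 = z0 /\
    forall t, - (2 * T) < t < 2 * T -> is_derive t 1 (A u) (F (u (c t))).
  suff H (u : R -> 'rV[R]_n) : exists a : R -> 'rV[R]_n, continuous u ->
      a 0 = z0 /\
      forall t, - (2 * T) < t < 2 * T -> is_derive t 1 a (F (u (c t))).
    by have [A AP] := choice H; exists A.
  have [uc|] := pselect (continuous u); last by exists (cst z0).
  have fc i : continuous (fun t => F (u (c t)) 0 i).
    move=> t; apply: (@continuous_comp _ _ _ (fun t => F (u (c t))) (fun v => v 0 i));
      last exact: matrix_normedtype.coord_continuous.
    apply: (@continuous_comp _ _ _ (fun t => u (c t)) F); last exact: Fc.
    by apply: (@continuous_comp _ _ _ c u); [exact: clampt_cont|exact: uc].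
  have [a aP] := choice (fun i => antiderivative T20 (fc i)).
  exists (fun t => z0 + \row_i a i t) => _; split.
    by apply/rowP => i; rewrite !mxE (aP i).1 addr0.
  move=> t tT; apply/is_derive_rowP => i.
  have := is_deriveD (is_derive_cst (z0 0 i) t 1) ((aP i).2 t tT).
  rewrite add0r; congr (is_derive _ _ _ _).
  by apply/funext => s; rewrite !mxE.
have Ac u t : continuous u -> {for c t, continuous (A u)}.
  by move=> uc; apply: is_derive_path_cont ((AP u uc).2 _ (cin2 t)).
have Acc u : continuous u -> continuous (A u \o c).
  move=> uc t; apply: continuous_comp; first exact: clampt_cont.
  exact: Ac.
(* the Picard operator is a contraction of ratio 1/2 for the sup norm *)
have contr u v B : continuous u -> continuous v -> 0 <= B ->
    (forall t, `|u t - v t| <= B) -> forall t, `|A u (c t) - A v (c t)| <= B / 2.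
  move=> uc vc B0 uv t.
  have := @mvt_norm_row_le _ n (fun s => A u s - A v s)
    (fun s => F (u (c s)) - F (v (c s))) 0 (c t) (L * B).
  rewrite (AP u uc).1 (AP v vc).1 subrr !subr0 => h; apply: le_trans (h _) _.
    move=> s /(between0 (cin t))/Tin sT.
    split; first by apply: is_deriveB; [exact: (AP u uc).2|exact: (AP v vc).2].
    by apply: le_trans (FL _ _) _; rewrite ler_wpM2l.
  have ct : `|c t| <= T by rewrite ler_norml.
  rewrite mulrAC mulrC ler_wpM2l//; apply: le_trans LT; exact: ler_wpM2l.
pose u k := iter k (fun u => A u \o c) (cst z0).
have uc k : continuous (u k).
  by elim: k => [|k IH]; [exact: cst_continuous|exact: Acc].
pose B := T * `|F z0|.
have uB k t : `|u k.+1 t - u k t| <= B / 2 ^+ k.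
  elim: k t => [|k IH] t.
    rewrite expr0 divr1 /u /=.
    have := @mvt_norm_row_le _ n (A (cst z0)) (fun=> F z0) 0 (c t) `|F z0|.
    have zc : continuous (cst z0 : R -> 'rV[R]_n) by exact: cst_continuous.
    rewrite (AP _ zc).1 subr0 => h; apply: le_trans (h _) _.
      by move=> s /(between0 (cin t))/Tin sT; split=> //; exact: (AP _ zc).2.
    by rewrite mulrC ler_wpM2r// ler_norml.
  have := contr (u k.+1) (u k) (B / 2 ^+ k) (uc _) (uc _).
  rewrite exprSr invfM mulrA; apply => //.
  by rewrite !mulr_ge0 ?invr_ge0 ?exprn_ge0// ltW.
have [l lP] : exists l : R -> 'rV[R]_n, forall t k i,
    `|u k t 0 i - l t 0 i| <= 2 * B / 2 ^+ k.
  have H ti : exists l, forall k, `|u k ti.1 0 ti.2 - l| <= 2 * B / 2 ^+ k.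
    apply: geometric_limit => k; apply: le_trans _ (uB k ti.1).
    by have := norm_coord (u k.+1 ti.1 - u k ti.1) ti.2; rewrite !mxE.
  have [l lP] := choice H; exists (fun t => \row_i l (t, i)) => t k i.
  by rewrite mxE; exact: (lP (t, i)).
have B0 : 0 <= B by rewrite mulr_ge0// ltW.
have b0 k : 0 <= 2 * B / 2 ^+ k.
  by apply: divr_ge0; [exact: mulr_ge0|exact: exprn_ge0].
have ul k t : `|u k t - l t| <= 2 * B / 2 ^+ k.
  by apply: norm_row_le => [|i]; rewrite ?b0// !mxE.
have lc : continuous l.
  move=> t; apply/continuous_normP => e e0.
  have e30 : 0 < e / 3 by rewrite divr_gt0.
  have [k kP] : exists k, 2 * B / 2 ^+ k < e / 3.
    apply: contrapT => /forallNP H.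
    have : e / 3 = 0.
      apply: (@le_geometric_eq0 (2 * B)) => k; rewrite gtr0_norm//.
      by have /negP := H k; rewrite -leNgt.
    by move/eqP; rewrite gt_eqF.
  have [r r0 rP] := (continuous_normP _ _).1 (uc k t) _ e30.
  exists r => // s /rP us.
  apply: le_lt_trans (ler_distD (u k s) _ _) _.
  have h1 := ul k s; have h2 := ul k t.
  have := ler_distD (u k t) (u k s) (l t).
  by rewrite distrC in h1; lra.
have fix_l t : A l (c t) = l t.
  apply/eqP; rewrite -subr_eq0 -normr_eq0; apply/eqP.
  apply: (@le_geometric_eq0 (2 * B)) => k; rewrite normr_id.
  apply: le_trans (ler_distD (u k.+1 t) _ _) _.
  have h1 := ul k.+1 t.
  have h2 := contr l (u k) (2 * B / 2 ^+ k) lc (uc _) (b0 k).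
  have {}h2 : `|A l (c t) - u k.+1 t| <= 2 * B / 2 ^+ k / 2.
    by apply: h2 => s; rewrite distrC.
  by move: h1; rewrite exprSr invfM mulrA; lra.
exists (A l); first exact: (AP l lc).1.
move=> t /andP[t1 t2].
have ct : c t = t by rewrite /c clampt_id// !ltW.
have := (AP l lc).2 t; rewrite ct -fix_l ct; apply.
by apply/andP; split; lra.
Qed.

Definition clamp_row n (p : 'rV[R]_n) (r : R) (z : 'rV[R]_n) : 'rV[R]_n :=
  \row_i Num.max (p 0 i - r) (Num.min (z 0 i) (p 0 i + r)).

Lemma clamp_row_dist n (p : 'rV[R]_n) r y z :
  `|clamp_row p r y - clamp_row p r z| <= `|y - z|.
Proof.
apply: norm_row_le => // i; rewrite !mxE; apply: le_trans (clampt_dist _ _ _ _) _.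
by have := norm_coord (y - z) i; rewrite !mxE.
Qed.

Lemma clamp_row_in n (p : 'rV[R]_n) r z : 0 <= r -> `|clamp_row p r z - p| <= r.
Proof.
move=> r0; apply: norm_row_le => // i; rewrite !mxE ler_distl.
rewrite ge_max le_max ge_min lexx !lexx /= orbT andbT.
lra.
Qed.

Lemma clamp_row_id n (p : 'rV[R]_n) r z : `|z - p| <= r -> clamp_row p r z = z.
Proof.
move=> zp; apply/rowP => i; rewrite !mxE.
have := le_trans (norm_coord (z - p) i) zp; rewrite !mxE ler_distlC => /andP[a b].
rewrite (min_idPl _) ?(max_idPr _)//; lra.
Qed.

Definition solution n (F : 'rV[R]_n -> 'rV[R]_n) (x : R -> 'rV[R]_n) (a b : R) :=
  forall t, a < t < b -> is_derive t 1 x (F (x t)).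

(** Composing the field with the projection onto a box makes it Lipschitz on the whole
space, and solutions starting near the centre stay in the box for a short time. *)
Theorem local_flow n (U : set 'rV[R]_n) (F : 'rV[R]_n -> 'rV[R]_n) p :
  open U -> U p -> smooth_map_on U F ->
  exists r L T : R, [/\ 0 < r, 0 <= L, 0 < T, L * T <= 2^-1 &
    [/\ forall y, `|y - p| <= r -> U y,
     forall y z, `|y - p| <= r -> `|z - p| <= r -> `|F y - F z| <= L * `|y - z| &
     forall z, `|z - p| < r / 2 -> exists x, [/\ x 0 = z, solution F x (- T) T &
       forall t, - T < t < T -> `|x t - p| < r]]].
Proof.
move=> oU Up sF.
have [r [L [r0 L0 rU rL]]] := smooth_map_lipschitz oU Up sF.
pose Fc z := F (clamp_row p r z).
have cin z : `|clamp_row p r z - p| <= r by apply: clamp_row_in; exact: ltW.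
have FcL y z : `|Fc y - Fc z| <= L * `|y - z|.
  apply: le_trans (rL _ _ (cin y) (cin z)) _.
  by rewrite ler_wpM2l// clamp_row_dist.
pose N := `|F p| + L * r.
have N0 : 0 <= N by rewrite addr_ge0// mulr_ge0// ltW.
have FcN z : `|Fc z| <= N.
  rewrite -lerBlDl; apply: le_trans (lerB_dist _ _) _.
  have p0 : `|p - p| <= r by rewrite subrr normr0 ltW.
  by apply: le_trans (rL _ _ (cin z) p0) _; rewrite ler_wpM2l.
pose T := (2 * (L + 1) + 2 * (N + 1) / r)^-1.
have N1 : 0 <= 2 * (N + 1) / r.
  by apply: divr_ge0; [apply: mulr_ge0 => //; exact: addr_ge0|exact: ltW].
have D0 : 0 < 2 * (L + 1) + 2 * (N + 1) / r.
  by apply: ltr_pwDl => //; apply: mulr_gt0 => //; apply: ltr_wpDl.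
have T0 : 0 < T by rewrite invr_gt0.
have LT : L * T <= 2^-1.
  by rewrite /T ler_pdivrMr// ler_pdivlMl//; lra.
have NT : N * T <= r / 2.
  rewrite /T ler_pdivrMr// mulrDr.
  have -> : r / 2 * (2 * (N + 1) / r) = N + 1 by field; rewrite gt_eqF.
  have : 0 <= r / 2 * (2 * (L + 1)).
    apply: mulr_ge0; first by apply: divr_ge0 => //; exact: ltW.
    by apply: mulr_ge0 => //; exact: addr_ge0.
  lra.
exists r, L, T; split => //; split => // z zp.
have [x x0 xF] := picard L0 T0 LT FcL z.
have xr t : - T < t < T -> `|x t - p| < r.
  move=> /andP[tT1 tT2].
  have : `|x t - x 0| <= N * `|t - 0|.
    apply: (@mvt_norm_row_le _ _ x (fun t => Fc (x t))) => s s0.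
    split => //; apply: xF.
    have tn : - `|t| <= t <= `|t| by rewrite -ler_norml.
    have := between0 tn s0; rewrite -ler_norml => st.
    by rewrite -ltr_norml; apply: le_lt_trans st _; rewrite ltr_norml tT1.
  rewrite subr0 x0 => h.
  apply: le_lt_trans (ler_distD z _ _) _.
  have tn : `|t| <= T by rewrite ler_norml !ltW.
  have : N * `|t| <= N * T by rewrite ler_wpM2l.
  by lra.
exists x; split => // t tT; have := xF t tT.
by rewrite /Fc clamp_row_id// ltW// xr.
Qed.

(** The difference of two solutions satisfies the hypothesis of gronwall. *)
Lemma solution_dist n (F : 'rV[R]_n -> 'rV[R]_n) p r L T x y : 0 <= L ->
  L * T <= 2^-1 ->
  (forall y z, `|y - p| <= r -> `|z - p| <= r -> `|F y - F z| <= L * `|y - z|) ->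
  solution F x (- T) T -> solution F y (- T) T ->
  (forall t, - T < t < T -> `|x t - p| <= r) ->
  (forall t, - T < t < T -> `|y t - p| <= r) ->
  forall t, - T < t < T -> `|x t - y t| <= 2 * `|x 0 - y 0|.
Proof.
move=> L0 LT FL xF yF xr yr.
apply: (@gronwall _ (fun t => x t - y t) (fun t => F (x t) - F (y t)) T L) => // t tT.
split; first by apply: is_deriveB; [exact: xF|exact: yF].
by apply: FL; [exact: xr|exact: yr].
Qed.

Lemma solution_shift n (F : 'rV[R]_n -> 'rV[R]_n) x a b c :
  solution F x a b -> solution F (fun t => x (t + c)) (a - c) (b - c).
Proof.
move=> xF t tab; have : is_derive (t + c) 1 x (F (x (t + c))).
  by apply: xF; move: tab; rewrite ltrBlDr ltrBrDr.
move=> /is_derive_rowP h; apply/is_derive_rowP => i.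
have dc : is_derive t 1 (fun s : R => s + c) 1.
  have := is_deriveD (is_derive_id t 1) (is_derive_cst c t 1).
  by rewrite addr0.
by have := @is_derive1_comp R (fun s => x s 0 i) _ t _ _ (h i) dc; rewrite mulr1.
Qed.

End Picard.

(** * Change of chart *)

Section TwoByTwo.
Context {R : realType}.
Implicit Types (v w : 'rV[R]_2) (A : 'M[R]_2).

Lemma sum2 (V : nmodType) (F : 'I_2 -> V) : \sum_i F i = F 0 + F 1.
Proof. by rewrite !big_ord_recl big_ord0 addr0; congr (_ + F _); apply: val_inj. Qed.

Lemma row2P v w : v 0 0 = w 0 0 -> v 0 1 = w 0 1 -> v = w.
Proof.
move=> h0 h1; apply/rowP => i.
by case: i => [[|[|//]] hi]; [move: h0|move: h1]; congr (v _ _ = w _ _); apply: val_inj.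
Qed.

Lemma mul2 v A k : (v *m A) 0 k = v 0 0 * A 0 k + v 0 1 * A 1 k.
Proof. by rewrite mxE sum2. Qed.

Lemma bil2 v A w : (v *m A *m w^T) 0 0 =
  (v 0 0 * A 0 0 + v 0 1 * A 1 0) * w 0 0 + (v 0 0 * A 0 1 + v 0 1 * A 1 1) * w 0 1.
Proof. by rewrite mxE sum2 !mul2 !mxE. Qed.

Lemma row2_neq0 v : v != 0 -> v 0 0 != 0 \/ v 0 1 != 0.
Proof.
move=> v0; have [h0|] := eqVneq (v 0 0) 0; last by left.
have [h1|] := eqVneq (v 0 1) 0; last by right.
by move/eqP: v0; case; apply: row2P; rewrite mxE.
Qed.

Lemma pos_def2 A : A^T = A -> (forall v, v != 0 -> 0 < (v *m A *m v^T) 0 0) ->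
  [/\ A 1 0 = A 0 1, 0 < A 0 0, 0 < A 1 1 & 0 < A 0 0 * A 1 1 - A 0 1 ^+ 2].
Proof.
move=> As Ap.
have s : A 1 0 = A 0 1 by rewrite -{1}As mxE.
have P a b : (a != 0) || (b != 0) -> 0 < a ^+ 2 * A 0 0 + 2 * a * b * A 0 1 + b ^+ 2 * A 1 1.
  move=> ab; pose v : 'rV[R]_2 := \row_i (if i == 0 then a else b).
  have v0 : v 0 0 = a by rewrite mxE.
  have v1 : v 0 1 = b by rewrite mxE.
  have vn : v != 0.
    apply: contraTneq ab => vE; rewrite -v0 -v1 vE !mxE eqxx //.
  have := Ap v vn; rewrite bil2 v0 v1 s; congr (_ < _); ring.
have p0 : 0 < A 0 0.
  have := P 1 0; rewrite oner_neq0 => /(_ isT); congr (_ < _); ring.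
have p1 : 0 < A 1 1.
  have := P 0 1; rewrite oner_neq0 orbT => /(_ isT); congr (_ < _); ring.
split => //.
have := P (- A 0 1) (A 0 0); rewrite (gt_eqF p0) orbT => /(_ isT) h.
by rewrite -(pmulr_rgt0 _ p0); apply: lt_le_trans h _; rewrite le_eqVlt; apply/orP; left; apply/eqP; ring.
Qed.

Lemma invmx2 A (d := A 0 0 * A 1 1 - A 0 1 * A 1 0) : d != 0 ->
  [/\ A \in unitmx, invmx A 0 0 = A 1 1 / d, invmx A 0 1 = - A 0 1 / d,
      invmx A 1 0 = - A 1 0 / d & invmx A 1 1 = A 0 0 / d].
Proof.
move=> d0.
have [e00 e11] : (0 == 0 :> 'I_2) = true /\ (1 == 1 :> 'I_2) = true by [].
have [e01 e10] : (0 == 1 :> 'I_2) = false /\ (1 == 0 :> 'I_2) = false by [].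
pose B : 'M[R]_2 := \matrix_(i, j) ((if i == 0 then if j == 0 then A 1 1 else - A 0 1
   else if j == 0 then - A 1 0 else A 0 0) / d).
have AB : A *m B = 1%:M.
  apply/matrixP => i j; rewrite !mxE sum2 !mxE e00 e10.
  have [->|->] : i = 0 \/ i = 1.
    by case: i => [[|[|//]] hi]; [left|right]; apply: val_inj.
  - have [->|->] : j = 0 \/ j = 1.
      by case: j => [[|[|//]] hj]; [left|right]; apply: val_inj.
    + by rewrite ?(e00, e01, e10, e11, mulr1n, mulr0n); move: d0; rewrite /d => d0; field.
    + by rewrite ?(e00, e01, e10, e11, mulr1n, mulr0n); move: d0; rewrite /d => d0; field.
  - have [->|->] : j = 0 \/ j = 1.
      by case: j => [[|[|//]] hj]; [left|right]; apply: val_inj.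
    + by rewrite ?(e00, e01, e10, e11, mulr1n, mulr0n); move: d0; rewrite /d => d0; field.
    + by rewrite ?(e00, e01, e10, e11, mulr1n, mulr0n); move: d0; rewrite /d => d0; field.
have [Au _] := mulmx1_unit AB.
have -> : invmx A = B by rewrite -[invmx A]mulmx1 -AB mulKmx.
by split => //; rewrite mxE.
Qed.

Lemma is_derive_quad2 (a b d : R) (p v : 'rV[R]_2) :
  is_derive p v (fun q => a * q 0 0 ^+ 2 + b * (q 0 0 * q 0 1) + d * q 0 1 ^+ 2)
    (2 * a * p 0 0 * v 0 0 + b * (p 0 0 * v 0 1 + p 0 1 * v 0 0) +
     2 * d * p 0 1 * v 0 1).
Proof.
pose x i (q : 'rV[R]_2) : R := q 0 i.
have dx i : is_derive p v (x i) (v 0 i) by exact: is_derive_coord.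
pose f : 'rV[R]_2 -> R :=
  a \*: (x 0 * x 0) + b \*: (x 0 * x 1) + d \*: (x 1 * x 1).
have -> : (fun q : 'rV[R]_2 =>
    a * q 0 0 ^+ 2 + b * (q 0 0 * q 0 1) + d * q 0 1 ^+ 2) = f.
  by apply/funext => q; rewrite !expr2.
have D := is_deriveD (is_deriveD (is_deriveZ a
  (is_deriveM (dx 0) (dx 0))) (is_deriveZ b (is_deriveM (dx 0) (dx 1))))
  (is_deriveZ d (is_deriveM (dx 1) (dx 1))).
by apply: is_derive_eq D _; rewrite /GRing.scale /= /x; ring.
Qed.

End TwoByTwo.

Section RowMaps.
Context {R : realType}.

Lemma differentiable_rowP m n (F : 'rV[R]_m -> 'rV[R]_n) x :
  (forall k, differentiable (fun y => F y 0 k) x) -> differentiable F x.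
Proof.
move=> dF.
have -> : F = \sum_k (fun y => F y 0 k *: basis_vec k).
  by apply/funext => y; rewrite {1}(row_basis (F y)) fct_sumE.
apply: differentiable_sum => k; exact: differentiableZl.
Qed.

Lemma jacobianE m n (F : 'rV[R]_m -> 'rV[R]_n) x i k :
  (forall j, differentiable (fun y => F y 0 j) x) ->
  jacobian F x i k = 'D_(basis_vec i) (fun y => F y 0 k) x.
Proof.
move=> /[dup] dF /differentiable_rowP d.
have -> : jacobian F x i k = (basis_vec i *m jacobian F x) 0 k.
  by rewrite /basis_vec -rowE [RHS]mxE.
by rewrite -deriveEjacobian// derive_mx ?mxE//; exact: diff_derivable.
Qed.

Lemma is_derive_comp_map m n (F : 'rV[R]_m -> 'rV[R]_n) (x : R -> 'rV[R]_m)
    (t : R) v : (forall j, differentiable (fun y => F y 0 j) (x t)) ->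
  is_derive t 1 x v -> is_derive t 1 (F \o x) (v *m jacobian F (x t)).
Proof.
move=> dF dx; apply/is_derive_rowP => k.
rewrite mxE; have := is_derive_comp_row (dF k) dx.
by under eq_bigr do rewrite -jacobianE//.
Qed.

Lemma is_derive_affine n (y v : 'rV[R]_n) (t : R) :
  is_derive t 1 (fun s : R => y + s *: v) v.
Proof.
apply/is_derive_rowP => i.
have := is_deriveD (is_derive_cst (y 0 i) t 1) (is_deriveZ (v 0 i) (is_derive_id t 1)).
rewrite add0r [_ *: 1]mulr1; congr (is_derive _ _ _ _).
by apply/funext => s; rewrite !mxE [s * _]mulrC.
Qed.

Lemma preimage_norm (V : normedModType R) (N : topologicalType) (f : V -> N)
    (x : V) (O : set N) : {for x, continuous f} -> open O -> O (f x) ->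
  exists2 r : R, 0 < r & forall y, `|y - x| < r -> O (f y).
Proof.
by move=> fc oO Of; apply/(near_normP x (fun y => O (f y))); apply: fc;
  apply: open_nbhs_nbhs.
Qed.

Lemma is_derive_unique (V : normedModType R) (f : R -> V) (t : R) v w :
  is_derive t 1 f v -> is_derive t 1 f w -> v = w.
Proof. by move=> [_ <-] [_ <-]. Qed.

End RowMaps.

Section Charts.
Context {R : realType} {M : topologicalType} (S : surface R M).
Implicit Types (c : chart S) (x : M).

Lemma chart_image_open c (O : set M) : open O -> open (coord c @` (O `&` dom c)).
Proof.
move=> oO; apply: open_norm => _ [x [Ox cx] <-].
have im : img c (coord c x) by exists x.
have near_O := preimage_norm (point_continuous im) oO.
rewrite (coordK cx) in near_O.
have [r r0 rP] := near_normI (open_normP (@img_open _ _ S c) im) (near_O Ox).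
exists r => // y /rP[[z cz <-]]; rewrite (coordK cz) => Oz.
by exists z.
Qed.

Lemma img_point c y : img c y -> dom c (point c y) /\ coord c (point c y) = y.
Proof. by move=> [x cx <-]; rewrite coordK. Qed.

Definition overlap c c' : set 'rV[R]_2 := coord c @` (dom c `&` dom c').

Lemma overlap_open c c' : open (overlap c c').
Proof.
have := @chart_image_open c _ (@dom_open _ _ S c').
by rewrite /overlap setIC.
Qed.

Lemma change_differentiable c c' x k : in_both c c' x ->
  differentiable (fun y => (coord c' \o point c) y 0 k) (coord c x).
Proof.
move=> [cx c'x]; apply: (smooth_differentiable (@overlap_open c c')).
  exact: transition_smooth.
by exists x.
Qed.

Lemma near_in_chart c (g : R -> M) (y : R -> 'rV[R]_2) (t : R) :
  img c (y t) -> {for t, continuous y} -> g = point c \o y ->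
  exists2 e : R, 0 < e & forall s, t - e < s < t + e ->
    dom c (g s) /\ coord c (g s) = y s.
Proof.
move=> ct yc ->.
have [r r0 rP] := open_normP (@img_open _ _ S c) ct.
have [e e0 eP] := (continuous_normP _ _).1 yc _ r0.
by exists e => // s; rewrite -ltr_distl => /eP/rP/img_point.
Qed.

Lemma vel_change c c' (g : R -> M) (t e : R) v : in_both c c' (g t) -> 0 < e ->
  (forall s, t - e < s < t + e -> dom c (g s)) ->
  is_derive t 1 (coord c \o g) v ->
  is_derive t 1 (coord c' \o g) (v *m transition c c' (g t)).
Proof.
move=> tt e0 ec gv.
have := @is_derive_comp_map R _ _ (coord c' \o point c) (coord c \o g) t v
  (fun k => change_differentiable k tt) gv.
apply: near_eq_is_derive; apply/near_normP; exists e => // s.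
by rewrite ltr_distl => /ec cs /=; rewrite coordK.
Qed.

(** Either side, applied to v, is the velocity of the line through x in the direction of
v, read in the other chart and back. *)
Lemma transitionK c c' x : in_both c c' x ->
  transition c c' x *m transition c' c x = 1%:M.
Proof.
move=> [cx c'x].
apply/row_matrixP => i; rewrite !rowE mulmx1 mulmxA.
set v := delta_mx 0 i.
pose y (s : R) := coord c x + s *: v.
pose g := point c \o y.
have y0 : y 0 = coord c x by rewrite /y scale0r addr0.
have g0 : g 0 = x by rewrite /g /= y0 coordK.
have dy : is_derive (0:R) 1 y v := is_derive_affine _ _ _.
have imx : img c (y 0) by rewrite y0; exists x.
have [e e0 eP] := near_in_chart imx (is_derive_path_cont dy) (erefl g).
have gc s : 0 - e < s < 0 + e -> dom c (g s) by move=> /eP[].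
have dg : is_derive (0:R) 1 (coord c \o g) v.
  apply: near_eq_is_derive dy; apply/near_normP; exists e => // s.
  by rewrite ltr_distl => /eP[_ h]; rewrite /= h.
have dg' : is_derive (0:R) 1 (coord c' \o g) (v *m transition c c' (g 0)).
  by apply: vel_change gc dg => //; rewrite g0.
have gcont : {for 0, continuous g}.
  apply: continuous_comp; first exact: is_derive_path_cont dy.
  exact: point_continuous.
have [e' e'0 e'P] : exists2 e' : R, 0 < e' & forall s, 0 - e' < s < 0 + e' -> dom c' (g s).
  have gc' : dom c' (g 0) by rewrite g0.
  have [e' e'0 e'P] := preimage_norm gcont (@dom_open _ _ S c') gc'.
  by exists e' => // s; rewrite -ltr_distl => /e'P.
have dg'' : is_derive (0:R) 1 (coord c \o g)
    (v *m transition c c' (g 0) *m transition c' c (g 0)).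
  by apply: vel_change e'P dg' => //; rewrite g0.
by have := is_derive_unique dg'' dg; rewrite g0.
Qed.

End Charts.

Section ChangeOfForms.
Context {R : realType} {M : topologicalType} (S : surface R M) (G : metric S).
Implicit Types (c : chart S) (x : M).

Lemma inner_change c c' x v w : in_both c c' x ->
  inner G c (coord c x) v w =
  inner G c' (coord c' x) (v *m transition c c' x) (w *m transition c c' x).
Proof.
by move=> cc; rewrite /inner (gram_change G cc) trmx_mul !mulmxA.
Qed.

Lemma speed_change c c' x v : in_both c c' x ->
  speed G c (coord c x) v = speed G c' (coord c' x) (v *m transition c c' x).
Proof. by move=> cc; rewrite /speed (inner_change _ _ cc). Qed.

Lemma vform_change (I : quadratic_integral G) c c' x v : in_both c c' x ->
  vform I c (coord c x) v = vform I c' (coord c' x) (v *m transition c c' x).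
Proof.
by move=> cc; rewrite /vform (gram_change G cc) !mulmxA (coef_change I _ cc).
Qed.

Lemma gram_pos_def c y : img c y -> [/\ gram G c y 1 0 = gram G c y 0 1,
  0 < gram G c y 0 0, 0 < gram G c y 1 1 &
  0 < gram G c y 0 0 * gram G c y 1 1 - gram G c y 0 1 ^+ 2].
Proof.
move=> cy; apply: pos_def2; first exact: gram_sym.
by move=> v; exact: gram_pos.
Qed.

End ChangeOfForms.

(** * The geodesic flow in charts *)

Section PhaseSpace.
Context {R : realType}.
Implicit Types (m n : nat).

Lemma row_mx_addl m n (x : 'rV[R]_m) (p : 'rV[R]_n) (h : R) i :
  h *: basis_vec (lshift n i) + row_mx x p = row_mx (h *: basis_vec i + x) p.
Proof.
apply/rowP => k; rewrite [LHS]mxE [X in X + _]mxE basis_vecE.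
case: (split_ordP k) => l ->; rewrite ?row_mxEl ?row_mxEr ?eq_lshift ?eq_rlshift.
  by rewrite [RHS]mxE [X in _ = X + _]mxE basis_vecE.
by rewrite mulr0 add0r.
Qed.

Lemma row_mx_addr m n (x : 'rV[R]_m) (p : 'rV[R]_n) (h : R) i :
  h *: basis_vec (rshift m i) + row_mx x p = row_mx x (h *: basis_vec i + p).
Proof.
apply/rowP => k; rewrite [LHS]mxE [X in X + _]mxE basis_vecE.
case: (split_ordP k) => l ->; rewrite ?row_mxEl ?row_mxEr ?eq_rshift ?eq_lrshift.
  by rewrite mulr0 add0r.
by rewrite [RHS]mxE [X in _ = X + _]mxE basis_vecE.
Qed.

Lemma derive_lshift m n (f : 'rV[R]_(m + n) -> R) x p i :
  'D_(basis_vec (lshift n i)) f (row_mx x p) =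
  'D_(basis_vec i) (fun y => f (row_mx y p)) x.
Proof.
have E : (fun h : R => h^-1 *: (f (h *: basis_vec (lshift n i) + row_mx x p) -
    f (row_mx x p))) = (fun h : R => h^-1 *: (f (row_mx (h *: basis_vec i + x) p) -
    f (row_mx x p))).
  by apply/funext => h; rewrite row_mx_addl.
by rewrite /derive /= E.
Qed.

Lemma derive_rshift m n (f : 'rV[R]_(m + n) -> R) x p i :
  'D_(basis_vec (rshift m i)) f (row_mx x p) =
  'D_(basis_vec i) (fun y => f (row_mx x y)) p.
Proof.
have E : (fun h : R => h^-1 *: (f (h *: basis_vec (rshift m i) + row_mx x p) -
    f (row_mx x p))) = (fun h : R => h^-1 *: (f (row_mx x (h *: basis_vec i + p)) -
    f (row_mx x p))).
  by apply/funext => h; rewrite row_mx_addr.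
by rewrite /derive /= E.
Qed.

Lemma is_derive_row_mx m n (x : R -> 'rV[R]_m) (p : R -> 'rV[R]_n) (t : R) v w :
  is_derive t 1 x v -> is_derive t 1 p w ->
  is_derive t 1 (fun s => row_mx (x s) (p s)) (row_mx v w).
Proof.
move=> /is_derive_rowP dx /is_derive_rowP dp; apply/is_derive_rowP => k.
case: (split_ordP k) => l ->.
  rewrite row_mxEl; have := dx l; congr (is_derive _ _ _ _).
  by apply/funext => s; rewrite row_mxEl.
rewrite row_mxEr; have := dp l; congr (is_derive _ _ _ _).
by apply/funext => s; rewrite row_mxEr.
Qed.

Lemma is_derive_lsubmx m n (z : R -> 'rV[R]_(m + n)) (t : R) w :
  is_derive t 1 z w -> is_derive t 1 (fun s => lsubmx (z s)) (lsubmx w).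
Proof.
move=> /is_derive_rowP dz; apply/is_derive_rowP => k.
have := dz (lshift n k); rewrite mxE; congr (is_derive _ _ _ _).
by apply/funext => s; rewrite mxE.
Qed.

Lemma is_derive_rsubmx m n (z : R -> 'rV[R]_(m + n)) (t : R) w :
  is_derive t 1 z w -> is_derive t 1 (fun s => rsubmx (z s)) (rsubmx w).
Proof.
move=> /is_derive_rowP dz; apply/is_derive_rowP => k.
have := dz (rshift m k); rewrite mxE; congr (is_derive _ _ _ _).
by apply/funext => s; rewrite mxE.
Qed.

Lemma smooth_lsubmx m n (U : set 'rV[R]_m) f : open U -> smooth_on U f ->
  smooth_on [set z : 'rV[R]_(m + n) | U (lsubmx z)] (fun z => f (lsubmx z)).
Proof.
move=> oU; apply: (@smooth_comp_proj _ _ _ (@lsubmx R 1 m n) U f oU) => k.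
case: (split_ordP k) => l ->; last first.
  by left; apply/rowP => j; rewrite !mxE eq_lrshift andbF.
right; exists l; apply/rowP => j.
by rewrite !mxE eq_lshift.
Qed.

Lemma open_lsubmx m n (U : set 'rV[R]_m) : open U ->
  open [set z : 'rV[R]_(m + n) | U (lsubmx z)].
Proof.
move=> oU; apply: (@open_comp _ _ (@lsubmx R 1 m n)) => // x _.
exact: linear_rV_continuous.
Qed.

End PhaseSpace.

Section HamiltonianFlow.
Context {R : realType} {M : topologicalType} (S : surface R M) (G : metric S).
Implicit Types (c : chart S) (x p : R -> 'rV[R]_2).

Definition phase c : set 'rV[R]_(2 + 2) := [set z | img c (lsubmx z)].

Definition hamz c (z : 'rV[R]_(2 + 2)) : R := hamiltonian G c (lsubmx z) (rsubmx z).

Definition hamfield c (z : 'rV[R]_(2 + 2)) : 'rV[R]_(2 + 2) :=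
  row_mx (\row_k 'D_(basis_vec (rshift 2 k)) (hamz c) z)
         (\row_k - 'D_(basis_vec (lshift 2 k)) (hamz c) z).

Lemma phase_open c : open (phase c).
Proof. exact/open_lsubmx/img_open. Qed.

Lemma gram_unit c y : img c y -> gram G c y \in unitmx.
Proof.
move=> /(gram_pos_def G)[s _ _ d0].
have [] // := @invmx2 _ (gram G c y); rewrite s -expr2 gt_eqF//.
Qed.

Lemma hamiltonianE c y (q : 'rV[R]_2) : img c y -> hamiltonian G c y q =
  (2 * (gram G c y 0 0 * gram G c y 1 1 - gram G c y 0 1 ^+ 2))^-1 *
  (gram G c y 1 1 * q 0 0 ^+ 2 - 2 * gram G c y 0 1 * (q 0 0 * q 0 1) +
   gram G c y 0 0 * q 0 1 ^+ 2).
Proof.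
move=> /(gram_pos_def G)[s _ _ d0].
have dn0 : gram G c y 0 0 * gram G c y 1 1 - gram G c y 0 1 * gram G c y 1 0 != 0.
  by rewrite s -expr2 gt_eqF.
have [_ i00 i01 i10 i11] := invmx2 dn0.
rewrite /hamiltonian bil2 i00 i01 i10 i11; rewrite s in dn0 *.
by field; rewrite dn0.
Qed.

Lemma hamz_smooth c : smooth_on (phase c) (hamz c).
Proof.
have oP := @phase_open c; have oI := @img_open _ _ S c.
have sg i j : smooth_on (phase c) (fun z => gram G c (lsubmx z) i j).
  exact: (@smooth_lsubmx R 2 2 (img c) (fun y => gram G c y i j) oI
    (@gram_smooth _ _ _ G c i j)).
have sq i : smooth_on (phase c) (fun z => rsubmx z 0 i).
  have -> : (fun z : 'rV[R]_(2 + 2) => rsubmx z 0 i) = (fun z => z 0 (rshift 2 i)).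
    by apply/funext => z; rewrite mxE.
  exact: smooth_coord.
have E z : phase c z -> (2 * (gram G c (lsubmx z) 0 0 * gram G c (lsubmx z) 1 1 -
    gram G c (lsubmx z) 0 1 ^+ 2))^-1 *
  (gram G c (lsubmx z) 1 1 * rsubmx z 0 0 ^+ 2 -
   2 * gram G c (lsubmx z) 0 1 * (rsubmx z 0 0 * rsubmx z 0 1) +
   gram G c (lsubmx z) 0 0 * rsubmx z 0 1 ^+ 2) = hamz c z.
  by move=> cz; rewrite /hamz hamiltonianE.
apply: (smooth_ext oP E); apply: (smoothM oP).
  apply: (smoothV oP) => [z cz|].
    have [_ _ _ d0] := gram_pos_def G cz.
    by rewrite mulf_neq0// gt_eqF.
  apply: (smoothZ _ oP); apply: (smoothB oP); first exact: smoothM.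
  exact: smooth_sqr.
apply: (smoothD oP); first apply: (smoothB oP).
- by apply: (smoothM oP) => //; exact: smooth_sqr.
- by apply: (smoothM oP); [exact: smoothZ|exact: smoothM].
- by apply: (smoothM oP) => //; exact: smooth_sqr.
Qed.

Lemma hamfield_smooth c : smooth_map_on (phase c) (hamfield c).
Proof.
move=> i; have oP := @phase_open c; have sH := @hamz_smooth c.
case: (split_ordP i) => l ->.
  apply: (smooth_ext oP _ (smooth_partial (rshift 2 l) sH)) => z _.
  by rewrite row_mxEl mxE.
apply: (smooth_ext oP _ (smoothN oP (smooth_partial (lshift 2 l) sH))) => z _.
by rewrite row_mxEr mxE.
Qed.

Lemma hamz_row c y q : hamz c (row_mx y q) = hamiltonian G c y q.
Proof. by rewrite /hamz row_mxKl row_mxKr. Qed.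

Lemma derive_hamz_p c y q k : img c y ->
  'D_(basis_vec (rshift 2 k)) (hamz c) (row_mx y q) = (q *m invmx (gram G c y)) 0 k.
Proof.
move=> cy; rewrite derive_rshift.
have [s _ _ d0] := gram_pos_def G cy.
have dn0 : gram G c y 0 0 * gram G c y 1 1 - gram G c y 0 1 * gram G c y 1 0 != 0.
  by rewrite s -expr2 gt_eqF.
have [_ i00 i01 i10 i11] := invmx2 dn0.
set d := _ - _ in i00 i01 i10 i11.
have -> : (fun y0 => hamz c (row_mx y y0)) = (fun q =>
    (gram G c y 1 1 / (2 * d)) * q 0 0 ^+ 2 +
    (- gram G c y 0 1 / d) * (q 0 0 * q 0 1) +
    (gram G c y 0 0 / (2 * d)) * q 0 1 ^+ 2).
  apply/funext => q'; rewrite hamz_row hamiltonianE// /d; rewrite s in dn0 *.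
  by field; rewrite dn0.
rewrite (@derive_val _ _ _ _ _ _ _ (is_derive_quad2 _ _ _ _ _)) mul2 !basis_vecE.
have [->|->] : k = 0 \/ k = 1.
    by case: k => [[|[|//]] hk]; [left|right]; apply: val_inj.
  rewrite i00 i10 s /=; rewrite /d s in dn0 *; by field; rewrite dn0.
rewrite i01 i11 /=; rewrite /d s in dn0 *; by field; rewrite dn0.
Qed.

Lemma hamilton_solutionP c x p a b : hamilton_solution G c x p a b <->
  (forall t, a < t < b -> img c (x t)) /\
  solution (hamfield c) (fun t => row_mx (x t) (p t)) a b.
Proof.
have E t k : 'D_(basis_vec k) (hamiltonian G c (x t)) (p t) =
    'D_(basis_vec (rshift 2 k)) (hamz c) (row_mx (x t) (p t)).
  have F : hamiltonian G c (x t) = (fun q => hamz c (row_mx (x t) q)).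
    by apply/funext => q; rewrite hamz_row.
  by rewrite F; exact: esym (derive_rshift (hamz c) (x t) (p t) k).
have E' t k : 'D_(basis_vec k) (fun y => hamiltonian G c y (p t)) (x t) =
    'D_(basis_vec (lshift 2 k)) (hamz c) (row_mx (x t) (p t)).
  have F : (fun y => hamiltonian G c y (p t)) = (fun y => hamz c (row_mx y (p t))).
    by apply/funext => q; rewrite hamz_row.
  by rewrite F; exact: esym (derive_lshift (hamz c) (x t) (p t) k).
split=> [H|[cx H] t tab].
  split=> [t /H[]//|t /H[ct dx dp h]].
  have Dx : is_derive t 1 x (\row_k 'D_(basis_vec (rshift 2 k)) (hamz c)
      (row_mx (x t) (p t))).
    apply: DeriveDef; first exact: dx.
    by rewrite -derive1E; apply/rowP => k; rewrite mxE -E; have [->] := h k.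
  have Dp : is_derive t 1 p (\row_k - 'D_(basis_vec (lshift 2 k)) (hamz c)
      (row_mx (x t) (p t))).
    apply: DeriveDef; first exact: dp.
    by rewrite -derive1E; apply/rowP => k; rewrite mxE -E'; have [_ ->] := h k.
  exact: is_derive_row_mx Dx Dp.
have dz := H t tab.
have dx : is_derive t 1 x (lsubmx (hamfield c (row_mx (x t) (p t)))).
  have := is_derive_lsubmx dz; congr (is_derive _ _ _ _).
  by apply/funext => s; rewrite row_mxKl.
have dp : is_derive t 1 p (rsubmx (hamfield c (row_mx (x t) (p t)))).
  have := is_derive_rsubmx dz; congr (is_derive _ _ _ _).
  by apply/funext => s; rewrite row_mxKr.
split; [exact: cx|by have [] := dx|by have [] := dp|move=> k].
rewrite !derive1E (@derive_val _ _ _ _ _ _ _ dx) (@derive_val _ _ _ _ _ _ _ dp).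
by rewrite /hamfield row_mxKl row_mxKr E E' !mxE.
Qed.

Lemma hamilton_velocity c x p a b t : hamilton_solution G c x p a b ->
  a < t < b -> is_derive t 1 x (p t *m invmx (gram G c (x t))).
Proof.
move=> /[dup] /hamilton_solutionP[cx _] H tab; have [ct dx _ h] := H t tab.
apply: DeriveDef; first exact: dx.
rewrite -derive1E; apply/rowP => k.
have F : hamiltonian G c (x t) = (fun q => hamz c (row_mx (x t) q)).
  by apply/funext => q; rewrite hamz_row.
have [-> _] := h k; rewrite -derive_hamz_p// F.
exact: esym (derive_rshift (hamz c) (x t) (p t) k).
Qed.

Lemma hamiltonian_vel c y v : img c y ->
  hamiltonian G c y (v *m gram G c y) = 2^-1 * inner G c y v v.
Proof.
move=> cy; rewrite /hamiltonian /inner trmx_mul gram_sym//.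
by rewrite -[v *m _ *m _]mulmxA mulmxV ?gram_unit// mulmx1 mulmxA.
Qed.

Lemma hamiltonian_conserved c x p a b s t : hamilton_solution G c x p a b ->
  a < s < b -> a < t < b ->
  hamiltonian G c (x s) (p s) = hamiltonian G c (x t) (p t).
Proof.
move=> /hamilton_solutionP[cx H]; rewrite -!hamz_row.
apply: (@const_of_derive0 _ (fun s => hamz c (row_mx (x s) (p s)))) => u uab.
have pz : phase c (row_mx (x u) (p u)) by rewrite /phase /= row_mxKl; exact: cx.
have df := smooth_differentiable (@phase_open c) (@hamz_smooth c) pz.
have := is_derive_comp_row df (H u uab); congr (is_derive _ _ _ _).
rewrite big_split_ord /= -big_split; apply: big1 => k _ /=.
rewrite /hamfield row_mxEl row_mxEr.
rewrite [X in X * _ + _]mxE.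
rewrite [X in _ + X * _]mxE.
move: (derive _ _ _) (derive _ _ _) => da db.
by rewrite mulNr mulrC subrr.
Qed.

End HamiltonianFlow.

(** * Geodesics and their invariants *)

Section HamiltonChange.
Context {R : realType} {M : topologicalType} (S : surface R M) (G : metric S).
Implicit Types (c : chart S).

Lemma overlap_both c c' y : overlap c c' y -> in_both c c' (point c y) /\
  coord c (point c y) = y.
Proof. by move=> [z [cz c'z] <-]; rewrite coordK. Qed.

Lemma overlap_img c c' y : overlap c c' y -> img c y.
Proof. by move=> [z [cz _] <-]; exists z. Qed.

Lemma overlap_sym c c' y : overlap c c' y ->
  overlap c' c ((coord c' \o point c) y) /\
  point c' ((coord c' \o point c) y) = point c y.
Proof.
by move=> [z [cz c'z] <-] /=; rewrite (coordK cz) (coordK c'z); split => //; exists z.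
Qed.

Lemma transition_entry c c' x i k : in_both c c' x ->
  transition c c' x i k =
  'D_(basis_vec i) (fun y => (coord c' \o point c) y 0 k) (coord c x).
Proof. by move=> cc; apply: jacobianE => j; exact: change_differentiable. Qed.

Lemma hamiltonian_change c c' z q : in_both c c' z ->
  hamiltonian G c (coord c z) (q *m (transition c c' z)^T) =
  hamiltonian G c' (coord c' z) q.
Proof.
move=> cc; have [cz c'z] := cc.
have i1 : img c (coord c z) by exists z.
have i2 : img c' (coord c' z) by exists z.
have gE := gram_change G cc.
have TT := transitionK (conj c'z cz).
move: (transition c c' z) (transition c' c z) gE TT
  (@inner_change _ _ _ G c' c z) => J J' gE TT inn.
have -> : q = (q *m invmx (gram G c' (coord c' z))) *m gram G c' (coord c' z).
  by rewrite mulmxKV// gram_unit.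
move: (q *m invmx _) => v.
have J1 : v *m J' *m J = v by rewrite -mulmxA TT mulmx1.
have -> : v *m gram G c' (coord c' z) *m J^T = (v *m J') *m gram G c (coord c z).
  by rewrite gE !mulmxA J1.
rewrite !hamiltonian_vel//; congr (_ * _).
by rewrite (inn v v (conj c'z cz)).
Qed.

Lemma sum_row_mx (v w : 'rV[R]_2) (F : 'I_(2 + 2) -> R) :
  \sum_i row_mx v w 0 i * F i =
  \sum_i v 0 i * F (lshift 2 i) + \sum_i w 0 i * F (rshift 2 i).
Proof.
by rewrite big_split_ord; congr (_ + _); apply: eq_bigr => i _;
  rewrite ?row_mxEl ?row_mxEr.
Qed.

Lemma sum_basis_vec (k : 'I_2) (F : 'I_2 -> R) :
  \sum_i (basis_vec k : 'rV[R]_2) 0 i * F i = F k.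
Proof.
rewrite (bigD1 k)//= basis_vecE eqxx mul1r big1 ?addr0// => i ik.
by rewrite basis_vecE (negbTE ik) mul0r.
Qed.

Lemma momentum_identity (A p0 p1 a0 a1 b0 b1 v0 v1 d00 d01 d10 d11 : R) :
  A + ((p0 * d00 + p1 * d01) * v0 + (p0 * d10 + p1 * d11) * v1) =
    a0 * b0 + a1 * b1 ->
  p0 * (v0 * d00 + v1 * d10) + a0 * - b0 +
    (p1 * (v0 * d01 + v1 * d11) + a1 * - b1) = - A.
Proof.
move=> h; have -> : A = a0 * b0 + a1 * b1 -
    ((p0 * d00 + p1 * d01) * v0 + (p0 * d10 + p1 * d11) * v1) by rewrite -h addrK.
by ring.
Qed.

Lemma velocity_change (g g' J J' : 'M[R]_2) (q : 'rV[R]_2) :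
  g \in unitmx -> g' \in unitmx -> J *m J' = 1%:M -> g' = J' *m g *m J'^T ->
  q *m invmx g *m J = q *m J'^T *m invmx g'.
Proof.
move=> gu gu' JJ gE; apply: (can_inj (mulmxK gu')).
rewrite mulmxKV// gE !mulmxA.
have -> : q *m invmx g *m J *m J' = q *m invmx g by rewrite -mulmxA JJ mulmx1.
by rewrite mulmxKV.
Qed.

(** The canonical transformation induced on momenta by a change of coordinates
preserves Hamilton's equations; the second derivatives of the change of
coordinates cancel by symmetry. *)
Lemma hamilton_change c c' (x p : R -> 'rV[R]_2) a b : hamilton_solution G c x p a b ->
  (forall t, a < t < b -> overlap c c' (x t)) ->
  hamilton_solution G c' (coord c' \o point c \o x)
    (fun t => p t *m (transition c' c (point c (x t)))^T) a b.
Proof.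
move=> H ov; apply/hamilton_solutionP.
pose psi := coord c' \o point c; pose phi := coord c \o point c'.
split=> [t /ov/overlap_sym[h _]|t tab]; first exact: overlap_img h.
have ovt := ov t tab; have [ov' _] := overlap_sym ovt.
have [z [both xE pz]] : exists z,
    [/\ in_both c c' z, coord c z = x t & point c (x t) = z].
  by have [both xE] := overlap_both ovt; exists (point c (x t)).
have [cz c'z] := both; have both' : in_both c' c z := conj c'z cz.
have icz : img c (coord c z) := ex_intro2 _ _ z cz (erefl _).
have zE : (coord c' \o point c) (x t) = coord c' z by rewrite /= pz.
rewrite zE in ov'.
have oO := @overlap_open _ _ S c' c.
have sphi j : smooth_on (overlap c' c) (fun y => phi y 0 j) := transition_smooth j.
pose D1 k j (y : 'rV[R]_2) : R := 'D_(basis_vec k) (fun y => phi y 0 j) y.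
have sD1 k j : smooth_on (overlap c' c) (D1 k j) by exact: smooth_partial.
have TE y : overlap c' c y -> forall k j,
    transition c' c (point c' y) k j = D1 k j y.
  move=> oy k j; have [by_ yE] := overlap_both oy.
  by rewrite transition_entry// yE.
pose X := coord c' z; pose Q := p t *m (transition c' c z)^T.
have zX : point c' X = z := coordK c'z.
pose V := Q *m invmx (gram G c' X).
have iX : img c' X by exact: overlap_img ov'.
have dpsi : is_derive t 1 (psi \o x) V.
  have dx := hamilton_velocity H tab.
  have dd k : differentiable (fun y => psi y 0 k) (x t).
    by rewrite -xE; exact: change_differentiable.
  have h := is_derive_comp_map dd dx.
  have E : jacobian psi (x t) = transition c c' z by rewrite -xE.
  rewrite E -xE in h; apply: (is_derive_eq h); rewrite /V /Q.
  apply: velocity_change.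
  - exact: (gram_unit G icz).
  - exact: (gram_unit G iX).
  - exact: (transitionK both).
  - exact: (gram_change G both').
have dy : is_derive t 1 (psi \o x) V by [].
have H' := H t tab; have [_ _ dp _] := H'.
pose B j := 'D_(basis_vec (lshift 2 j)) (hamz G c) (row_mx (coord c z) (p t)).
have dpt j : is_derive t 1 (fun s => p s 0 j) (- B j).
  have /hamilton_solutionP[_ /(_ t tab)/is_derive_rsubmx] := H.
  move=> /is_derive_rowP/(_ j); rewrite /hamfield row_mxKr mxE -xE.
  congr (is_derive _ _ _ _); apply/funext => s.
  by rewrite row_mxKr.
pose D2 l k j : R := 'D_(basis_vec l) (D1 k j) X.
have D2sym l k j : D2 l k j = D2 k l j by apply: mixed_partials (sphi j) => //.
have D1d k j : differentiable (D1 k j) X by exact: smooth_differentiable (sD1 k j) ov'.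
(* differentiate the two expressions of the energy at fixed old momentum *)
have key k : 'D_(basis_vec (lshift 2 k)) (hamz G c') (row_mx X Q) +
    \sum_l (\sum_j p t 0 j * D2 k l j) * V 0 l = \sum_j D1 k j X * B j.
  pose y (s : R) := X + s *: basis_vec k.
  have y0 : y 0 = X by rewrite /y scale0r addr0.
  have dyk : is_derive (0:R) 1 y (basis_vec k) := is_derive_affine _ _ _.
  pose q (s : R) : 'rV[R]_2 := \row_l \sum_j p t 0 j * D1 l j (y s).
  have q0 : q 0 = Q.
    apply/rowP => l; rewrite mxE y0 mxE; apply: eq_bigr => j _.
    by rewrite mxE -(TE X ov' l j) zX.
  have dD1 l j : is_derive (0:R) 1 (fun s => D1 l j (y s)) (D2 k l j).
    have dd : differentiable (D1 l j) (y 0) by rewrite y0.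
    have := is_derive_comp_row dd dyk; congr (is_derive _ _ _ _).
    by rewrite y0 (sum_basis_vec k (fun i => 'D_(basis_vec i) (D1 l j) X)).
  have dq : is_derive (0:R) 1 q (\row_l \sum_j p t 0 j * D2 k l j).
    apply/is_derive_rowP => l; rewrite mxE.
    have := is_deriveD (is_deriveZ (p t 0 0) (dD1 l 0)) (is_deriveZ (p t 0 1) (dD1 l 1)).
    rewrite sum2; congr (is_derive _ _ _ _).
    by apply/funext => s; rewrite mxE sum2.
  have dl := is_derive_row_mx dyk dq.
  have pz' : phase c' (row_mx (y 0) (q 0)) by rewrite /phase /= row_mxKl y0.
  have dH' := smooth_differentiable (@phase_open _ _ S c') (@hamz_smooth _ _ _ G c') pz'.
  have e1 := is_derive_comp_row dH' dl.
  have dphi : is_derive (0:R) 1 (phi \o y) (\row_j D1 k j X).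
    apply/is_derive_rowP => j; rewrite mxE.
    have dd : differentiable (fun y => phi y 0 j) (y 0).
      by rewrite y0; exact: smooth_differentiable (sphi j) ov'.
    have := is_derive_comp_row dd dyk; congr (is_derive _ _ _ _).
    by rewrite y0 (sum_basis_vec k (fun i => 'D_(basis_vec i) (fun y => phi y 0 j) X)).
  have dr := is_derive_row_mx dphi (is_derive_cst (p t) (0:R) 1).
  have phi0 : phi X = coord c z by rewrite /phi /= zX.
  have E0 : (phi \o y) 0 = coord c z by rewrite -phi0 /= y0.
  have ph : phase c (row_mx ((phi \o y) 0) (p t)).
    by rewrite E0 /phase /= row_mxKl; exact: icz.
  have dH := smooth_differentiable (@phase_open _ _ S c) (@hamz_smooth _ _ _ G c) ph.
  have e2 := is_derive_comp_row dH dr.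
  have [r r0 rP] := preimage_norm (is_derive_path_cont dyk) oO (eq_ind_r _ ov' y0).
  have e12 : is_derive (0:R) 1 (fun s => hamz G c' (row_mx (y s) (q s)))
     (\sum_i row_mx (\row_j D1 k j X) (0 : 'rV[R]_2) 0 i *
        'D_(basis_vec i) (hamz G c) (row_mx ((phi \o y) 0) (p t))).
    apply: near_eq_is_derive e2; apply/near_normP; exists r => // s /rP ys.
    have [bs ysE] := overlap_both ys.
    rewrite !hamz_row; have h := hamiltonian_change (p t) bs.
    rewrite ysE in h; apply: etrans (esym h) _.
    congr (hamiltonian _ _ _ _); apply/rowP => l.
    rewrite !mxE; apply: eq_bigr => j _.
    by rewrite mxE (TE (y s) ys l j).
  have := is_derive_unique e1 e12.
  rewrite !sum_row_mx [X in _ = _ + X]big1 => [|j _]; last by rewrite mxE mul0r.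
  rewrite addr0 y0 q0 => h.
  have -> : \sum_j D1 k j X * B j = \sum_i (\row_j D1 k j X) 0 i *
      'D_(basis_vec (lshift 2 i)) (hamz G c) (row_mx ((phi \o y) 0) (p t)).
    by apply: eq_bigr => j _; rewrite E0 mxE.
  rewrite -h; apply: f_equal2.
    exact: esym (sum_basis_vec k
      (fun i => 'D_(basis_vec (lshift 2 i)) (hamz G c') (row_mx X Q))).
  by apply: eq_bigr => l _; rewrite [X in _ = X * _]mxE (derive_hamz_p G Q l iX).
have -> : row_mx (((coord c' \o point c) \o x) t)
    (p t *m (transition c' c (point c (x t)))^T) = row_mx X Q.
  by rewrite /Q /= pz.
rewrite /hamfield; apply: is_derive_row_mx.
  apply: (is_derive_eq dpsi); apply/rowP => k.
  by rewrite [RHS]mxE (derive_hamz_p G Q k iX).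
apply/is_derive_rowP => k; rewrite mxE.
have dD1 j : is_derive t 1 (fun s => D1 k j ((psi \o x) s)) (\sum_l V 0 l * D2 l k j).
  have EX : (psi \o x) t = X := zE.
  have dd : differentiable (D1 k j) ((psi \o x) t) by rewrite EX; exact: D1d.
  by apply: (is_derive_eq (is_derive_comp_row dd dy)); rewrite EX.
have := is_deriveD (is_deriveM (dpt 0) (dD1 0)) (is_deriveM (dpt 1) (dD1 1)).
have cont_x : {for t, continuous x} := is_derive_path_cont (hamilton_velocity H tab).
have [r r0 rP] := preimage_norm cont_x (@overlap_open _ _ S c c') ovt.
move=> d; have {d}d := near_eq_is_derive _ d.
have {}d := d (fun s => (p s *m (transition c' c (point c (x s)))^T) 0 k).
apply: (is_derive_eq (d _)).
  apply/near_normP; exists r => // s /rP ys.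
  have [ys' yE] := overlap_sym ys.
  have T1 j : transition c' c (point c (x s)) k j = D1 k j (psi (x s)).
    by rewrite -(TE _ ys' k j) yE.
  by rewrite [RHS]mxE sum2 [X in _ = _ * X + _]mxE [X in _ = _ + _ * X]mxE !T1.
have EX : (psi \o x) t = X := zE.
have E := key k; rewrite EX.
move: E D2sym; clear -D2 V B D1; clearbody D2 V B D1 => E D2sym.
rewrite !sum2 (D2sym k 0 0) (D2sym k 1 0) (D2sym k 0 1) (D2sym k 1 1) in E.
rewrite !sum2.
exact: (momentum_identity E).
Qed.

End HamiltonChange.

Section Geodesics.
Context {R : realType} {M : topologicalType} (S : surface R M) (G : metric S).
Implicit Types (c : chart S) (g : R -> M).

Lemma velE c g (t : R) v : is_derive t 1 (coord c \o g) v -> vel c g t = v.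
Proof. by move=> [_ dv]; rewrite /vel derive1E. Qed.

Lemma vel_is_derive c g (t : R) : derivable (coord c \o g) t 1 ->
  is_derive t 1 (coord c \o g) (vel c g t).
Proof. by move=> d; rewrite /vel derive1E; exact: derivableP. Qed.

Lemma vel_transition c c' g (t e : R) : 0 < e -> in_both c c' (g t) ->
  (forall s, t - e < s < t + e -> dom c (g s)) ->
  derivable (coord c \o g) t 1 ->
  is_derive t 1 (coord c' \o g) (vel c g t *m transition c c' (g t)) /\
  vel c' g t = vel c g t *m transition c c' (g t).
Proof.
move=> e0 cc ec /vel_is_derive dv.
by have dv' := vel_change cc e0 ec dv; split => //; exact: velE.
Qed.

Lemma transition_unit c c' x (v : 'rV[R]_2) : in_both c c' x -> v != 0 ->
  v *m transition c c' x != 0.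
Proof.
move=> cc; apply: contraNneq => vJ.
by rewrite -[v]mulmx1 -(transitionK cc) mulmxA vJ mul0mx.
Qed.

Lemma chart_curve_continuous c g (t e : R) : 0 < e ->
  (forall s, t - e < s < t + e -> dom c (g s)) ->
  derivable (coord c \o g) t 1 -> {for t, continuous g}.
Proof.
move=> e0 ec /vel_is_derive /is_derive_path_cont dc.
have te : t - e < t < t + e by rewrite ltrBlDr ltrDl e0.
have gc : {for t, continuous (point c \o (coord c \o g))}.
  apply: continuous_comp; first exact: dc.
  apply: point_continuous; exact: (ex_intro2 _ _ (g t) (ec t te) (erefl _)).
apply: near_eq_continuous gc; apply/near_normP; exists e => // s.
by rewrite ltr_distl => /ec cs; rewrite /= coordK.
Qed.

Lemma near_dom c g (t : R) : {for t, continuous g} -> dom c (g t) ->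
  exists2 e : R, 0 < e & forall s, t - e < s < t + e -> dom c (g s).
Proof.
move=> gc ct; have [e e0 eP] := preimage_norm gc (@dom_open _ _ S c) ct.
by exists e => // s; rewrite -ltr_distl => /eP.
Qed.

Lemma geodesic_chart c g (a b t : R) : geodesic G g a b -> a < t < b ->
  dom c (g t) -> exists (e : R) p, [/\ 0 < e,
    forall s, t - e < s < t + e -> dom c (g s),
    hamilton_solution G c (coord c \o g) p (t - e) (t + e),
    is_derive t 1 (coord c \o g) (vel c g t) & vel c g t != 0].
Proof.
move=> gg tab ct; have [v0 [e [p [e0 ec H]]]] := gg t c tab ct.
have te : t - e < t < t + e by rewrite ltrBlDr ltrDl e0.
have [_ d _ _] := H t te.
by exists e, p; split; [exact: e0|exact: ec|exact: H|exact: vel_is_derive|exact: v0].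
Qed.

Lemma geodesic_continuous g (a b t : R) : geodesic G g a b -> a < t < b ->
  {for t, continuous g}.
Proof.
move=> gg tab; have [c ct] := dom_cover S (g t).
have [e [p [e0 ec _ [d _] _]]] := geodesic_chart gg tab ct.
exact: chart_curve_continuous e0 ec d.
Qed.

(** The velocity does not vanish because the momentum does not; hamilton_change carries
the momentum to the other charts. *)
Lemma geodesic_of_solution c x p (a b : R) : hamilton_solution G c x p a b ->
  (forall t, a < t < b -> p t != 0) -> geodesic G (point c \o x) a b.
Proof.
move=> H p0 t c' tab c't.
have [xc xs] := (hamilton_solutionP G c x p a b).1 H.
have ct := xc t tab; have [pc pE] := img_point ct.
have both : in_both c c' (point c (x t)) by [].
have dx := hamilton_velocity H tab.
have [r r0 rP] := preimage_norm (is_derive_path_cont dx) (@overlap_open _ _ S c c')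
  (ex_intro2 _ _ (point c (x t)) both pE).
have [m m0 mab] : exists2 m : R, 0 < m & forall s, t - m < s < t + m -> a < s < b.
  exists (Num.min (t - a) (b - t)).
    by rewrite lt_min !subr_gt0.
  move=> s; rewrite -ltr_distl lt_min => /andP[]; rewrite !ltr_distl.
  by move=> /andP[h1 _] /andP[_ h2]; apply/andP; split; lra.
pose e := Num.min r m.
have e0 : 0 < e by rewrite lt_min r0 m0.
have eov s : t - e < s < t + e -> overlap c c' (x s).
  by rewrite -ltr_distl lt_min => /andP[/rP].
have eab s : t - e < s < t + e -> a < s < b.
  by rewrite -ltr_distl lt_min ltr_distl => /andP[_]; rewrite ltr_distl => /mab.
have te : t - e < t < t + e by rewrite ltrBlDr ltrDl e0.
have He : hamilton_solution G c x p (t - e) (t + e) by move=> s /eab; exact: H.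
have H' := hamilton_change He eov.
split; last first.
  exists e; eexists; split; [exact: e0| |exact: H'].
  by move=> s /eov/overlap_both[[]].
have dx' : is_derive t 1 (coord c \o (point c \o x)) (p t *m invmx (gram G c (x t))).
  apply: near_eq_is_derive dx; apply/near_normP; exists e => // s.
  by rewrite ltr_distl => /eov/overlap_both[_ h]; rewrite /= h.
have [|_ ->] := @vel_transition c c' (point c \o x) t e e0 both _ (ex_derive (is_derive := dx')).
  by move=> s /eov/overlap_both[[]].
apply: transition_unit both _; rewrite (velE dx').
have gu : gram G c (x t) \in unitmx by exact: gram_unit.
apply: contraNneq (p0 t tab) => h.
by rewrite -[p t](mulmxKV gu) h mul0mx.
Qed.

Lemma solution_energy c x p (a b s : R) : hamilton_solution G c x p a b ->
  a < s < b -> p s != 0 -> forall t, a < t < b -> p t != 0.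
Proof.
move=> H sab ps t tab; apply: contraNneq ps => pt.
have ct : img c (x s) by have [] := H s sab.
have gu := gram_unit G ct.
have E := hamiltonian_conserved H sab tab.
have pE : p s = p s *m invmx (gram G c (x s)) *m gram G c (x s) by rewrite mulmxKV.
have h0 : inner G c (x s) (p s *m invmx (gram G c (x s)))
   (p s *m invmx (gram G c (x s))) = 0.
  move: E; rewrite {1}pE hamiltonian_vel// pt /hamiltonian mul0mx mul0mx mxE mulr0.
  by move/eqP; rewrite mulf_eq0 invr_eq0 pnatr_eq0 => /eqP.
have [v0|v0] := eqVneq (p s *m invmx (gram G c (x s))) 0.
  by rewrite pE v0 mul0mx.
by have := @gram_pos _ _ _ G c _ _ ct v0; rewrite -/(inner _ _ _ _ _) h0 ltxx.
Qed.

Definition tangent_invariant (Q : chart S -> 'rV[R]_2 -> 'rV[R]_2 -> R) :=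
  forall c c' x v, in_both c c' x ->
    Q c (coord c x) v = Q c' (coord c' x) (v *m transition c c' x).

Lemma vel_invariant Q g c c' (t : R) : tangent_invariant Q ->
  {for t, continuous g} -> derivable (coord c \o g) t 1 -> in_both c c' (g t) ->
  Q c (coord c (g t)) (vel c g t) = Q c' (coord c' (g t)) (vel c' g t).
Proof.
move=> QI gc gd cc; have [e e0 ec] := near_dom gc cc.1.
by have [_ ->] := vel_transition e0 cc ec gd; exact: QI.
Qed.

(** The value is locally constant in time: in one chart by conservation, and from one
chart to the next by invariance. *)
Lemma geodesic_invariant Q : tangent_invariant Q ->
  (forall c x p (a b s t : R), hamilton_solution G c x p a b ->
     a < s < b -> a < t < b ->
     Q c (x s) (p s *m invmx (gram G c (x s))) =
     Q c (x t) (p t *m invmx (gram G c (x t)))) ->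
  forall g (a b s t : R) c c', geodesic G g a b -> a < s < b -> a < t < b ->
    dom c (g s) -> dom c' (g t) ->
    Q c (coord c (g s)) (vel c g s) = Q c' (coord c' (g t)) (vel c' g t).
Proof.
move=> QI QH g a b s t c c' gg sab tab cs c't.
have [ch chP] := choice (dom_cover S).
have gd u (d : chart S) : a < u < b -> dom d (g u) -> derivable (coord d \o g) u 1.
  by move=> uab du; have [e [p [_ _ _ [dd _] _]]] := geodesic_chart gg uab du.
pose V u := Q (ch (g u)) (coord (ch (g u)) (g u)) (vel (ch (g u)) g u).
have VE u (d : chart S) : a < u < b -> dom d (g u) -> Q d (coord d (g u)) (vel d g u) = V u.
  move=> uab du; apply: (vel_invariant QI (geodesic_continuous gg uab)) => //.
  exact: gd.
rewrite (VE s c sab cs) (VE t c' tab c't).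
apply: (const_of_derive0 _ sab tab) => u uab.
set d := ch (g u); have du : dom d (g u) by exact: chP.
have [e [p [e0 ec H _ _]]] := geodesic_chart gg uab du.
have ue : u - e < u < u + e by rewrite ltrBlDr ltrDl e0.
have QE v : u - e < v < u + e -> Q d (coord d (g v)) (vel d g v) = V u.
  move=> ve; have -> : V u = Q d (coord d (g u)) (vel d g u) by [].
  have := QH d _ p _ _ v u H ve ue.
  by rewrite -(velE (hamilton_velocity H ve)) -(velE (hamilton_velocity H ue)).
have c0 : is_derive u 1 (cst (V u) : R -> R) 0 by exact: is_derive_cst.
apply: near_eq_is_derive c0; apply/near_normP.
exists (Num.min e (Num.min (u - a) (b - u))).
  by rewrite !lt_min e0 !subr_gt0.
move=> v; rewrite !lt_min !ltr_distl => /andP[ve /andP[/andP[h1 _] /andP[_ h2]]].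
have vab : a < v < b by apply/andP; split; lra.
by rewrite -(VE v d vab (ec v ve)) QE.
Qed.

Lemma inner_tangent_invariant : tangent_invariant (fun c y v => inner G c y v v).
Proof. by move=> c c' x v; exact: inner_change. Qed.

Lemma geodesic_inner_const g (a b s t : R) c c' : geodesic G g a b ->
  a < s < b -> a < t < b -> dom c (g s) -> dom c' (g t) ->
  inner G c (coord c (g s)) (vel c g s) (vel c g s) =
  inner G c' (coord c' (g t)) (vel c' g t) (vel c' g t).
Proof.
apply: (geodesic_invariant inner_tangent_invariant) => {}c x p {}a {}b {}s {}t H sab tab.
have E u : a < u < b -> inner G c (x u) (p u *m invmx (gram G c (x u)))
    (p u *m invmx (gram G c (x u))) = 2 * hamiltonian G c (x u) (p u).
  move=> uab; have cu : img c (x u) by have [] := H u uab.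
  rewrite -{3}[p u](mulmxKV (gram_unit G cu)) hamiltonian_vel//.
  by rewrite mulrA divff ?mul1r.
by rewrite !E// (hamiltonian_conserved H sab tab).
Qed.

Lemma vform_tangent_invariant (I : quadratic_integral G) :
  tangent_invariant (fun c y v => vform I c y v).
Proof. by move=> c c' x v; exact: vform_change. Qed.

Lemma geodesic_vform_const (I : quadratic_integral G) g (a b s t : R) c c' :
  geodesic G g a b -> a < s < b -> a < t < b -> dom c (g s) -> dom c' (g t) ->
  vform I c (coord c (g s)) (vel c g s) = vform I c' (coord c' (g t)) (vel c' g t).
Proof.
apply: (geodesic_invariant (@vform_tangent_invariant I))
  => {}c x p {}a {}b {}s {}t H sab tab.
have cu u : a < u < b -> img c (x u) by move=> /H[].
rewrite /vform !mulmxKV ?gram_unit//; try exact: cu.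
exact: (coef_first_integral I H).
Qed.

End Geodesics.

(** * Simultaneous diagonalization of two binary quadratic forms *)

Section Eigenvalues.
Context {R : realType}.
Implicit Types (A B M : 'M[R]_2) (v w u : 'rV[R]_2).

Definition symm2 A := A 1 0 = A 0 1.
Definition disc2 A : R := A 0 0 * A 1 1 - A 0 1 ^+ 2.
Definition mixed2 A B : R := A 0 0 * B 1 1 + A 1 1 * B 0 0 - 2 * A 0 1 * B 0 1.

(** The root of the sign of s of det (B - l A), for A definite and B indefinite. *)
Definition eigval (s : R) A B : R :=
  (mixed2 A B + s * Num.sqrt (mixed2 A B ^+ 2 - 4 * disc2 A * disc2 B)) /
  (2 * disc2 A).

Lemma disc2_pencil A B (l : R) :
  disc2 (B - l *: A) = disc2 A * l ^+ 2 - mixed2 A B * l + disc2 B.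
Proof. by rewrite /disc2 /mixed2 !mxE; ring. Qed.

Lemma symm2_pencil A B (l : R) : symm2 A -> symm2 B -> symm2 (B - l *: A).
Proof. by rewrite /symm2 !mxE => -> ->. Qed.

Lemma eigval_spec (s : R) A B : s ^+ 2 = 1 -> 0 < disc2 A -> disc2 B < 0 ->
  disc2 (B - eigval s A B *: A) = 0 /\ 0 < s * eigval s A B.
Proof.
move=> s2 dA dB; rewrite disc2_pencil.
have D0 : 0 < mixed2 A B ^+ 2 - 4 * disc2 A * disc2 B.
  have := sqr_ge0 (mixed2 A B); have := mulr_gt0 dA (etrans (oppr_gt0 _) dB).
  by rewrite mulrN; lra.
set r := Num.sqrt (mixed2 A B ^+ 2 - 4 * disc2 A * disc2 B).
have r2 : r ^+ 2 = mixed2 A B ^+ 2 - 4 * disc2 A * disc2 B by rewrite sqr_sqrtr// ltW.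
have r0 : 0 < r by rewrite sqrtr_gt0.
have dA0 : disc2 A != 0 by rewrite gt_eqF.
rewrite /eigval -/r; split.
  have -> : disc2 A * ((mixed2 A B + s * r) / (2 * disc2 A)) ^+ 2 -
     mixed2 A B * ((mixed2 A B + s * r) / (2 * disc2 A)) + disc2 B =
     (s ^+ 2 * r ^+ 2 - mixed2 A B ^+ 2 + 4 * disc2 A * disc2 B) / (4 * disc2 A).
    by field.
  by rewrite s2 r2 mul1r; apply/eqP; rewrite mulf_eq0; apply/orP; left; apply/eqP; ring.
rewrite mulrA; apply: divr_gt0; last by rewrite mulr_gt0.
rewrite mulrDr mulrA -expr2 s2 mul1r.
have : `|s * mixed2 A B| < r.
  rewrite -(@ltr_pXn2r _ 2)// ?nnegrE ?ltW// real_normK ?num_real// exprMn s2 mul1r r2.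
  by have := mulr_gt0 dA (etrans (oppr_gt0 _) dB); rewrite mulrN; lra.
by rewrite ltr_norml => /andP[]; lra.
Qed.

Lemma eigval_unique (s l : R) A B : s ^+ 2 = 1 -> 0 < disc2 A -> disc2 B < 0 ->
  disc2 (B - l *: A) = 0 -> 0 < s * l -> l = eigval s A B.
Proof.
move=> s2 dA dB.
have [] := eigval_spec s2 dA dB; set m := eigval s A B.
rewrite !disc2_pencil => m0 sm l0 sl.
have h : (l - m) * (disc2 A * (l + m) - mixed2 A B) = 0.
  transitivity ((disc2 A * l ^+ 2 - mixed2 A B * l + disc2 B) -
    (disc2 A * m ^+ 2 - mixed2 A B * m + disc2 B)); first by ring.
  by rewrite l0 m0 subrr.
move/eqP: h; rewrite mulf_eq0 => /orP[|/eqP h]; first by rewrite subr_eq0 => /eqP.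
have pm : 0 < l * m.
  have -> : l * m = (s * l) * (s * m) by rewrite -[LHS]mul1r -s2; ring.
  exact: mulr_gt0.
have : disc2 A * (l * m) = disc2 B.
  have E : mixed2 A B = disc2 A * (l + m) by apply/eqP; rewrite eq_sym -subr_eq0 h.
  have := m0; rewrite E => /eqP; rewrite addrC addr_eq0 => /eqP ->; ring.
by have := mulr_gt0 dA pm; lra.
Qed.

Lemma mul2_eq0 v M : symm2 M -> v *m M = 0 <->
  v 0 0 * M 0 0 + v 0 1 * M 0 1 = 0 /\ v 0 0 * M 0 1 + v 0 1 * M 1 1 = 0.
Proof.
move=> sM; split=> [h|[h0 h1]].
  by rewrite -{1}sM -!mul2 h !mxE.
by apply: row2P; rewrite mul2 !mxE ?sM.
Qed.

Lemma degenerate2 v M : symm2 M -> v != 0 -> v *m M = 0 -> disc2 M = 0.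
Proof.
move=> sM v0 /(mul2_eq0 _ sM)[h0 h1].
have e0 : v 0 0 * disc2 M = 0.
  have -> : v 0 0 * disc2 M = (v 0 0 * M 0 0 + v 0 1 * M 0 1) * M 1 1 -
    (v 0 0 * M 0 1 + v 0 1 * M 1 1) * M 0 1 by rewrite /disc2; ring.
  by rewrite h0 h1 !mul0r subrr.
have e1 : v 0 1 * disc2 M = 0.
  have -> : v 0 1 * disc2 M = (v 0 0 * M 0 1 + v 0 1 * M 1 1) * M 0 0 -
    (v 0 0 * M 0 0 + v 0 1 * M 0 1) * M 0 1 by rewrite /disc2; ring.
  by rewrite h0 h1 !mul0r subrr.
have [n|n] := row2_neq0 v0; first by apply: (mulfI n); rewrite e0 mulr0.
by apply: (mulfI n); rewrite e1 mulr0.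
Qed.

Definition pencil (s : R) A B := B - eigval s A B *: A.

(** Otherwise B would be a multiple of the definite form A. *)
Lemma pencil_neq0 (s : R) A B : s ^+ 2 = 1 -> symm2 A -> symm2 B ->
  0 < disc2 A -> disc2 B < 0 -> pencil s A B 0 0 != 0 \/ pencil s A B 1 1 != 0.
Proof.
move=> s2 sA sB dA dB; have [d0 _] := eigval_spec s2 dA dB.
have [h0|] := eqVneq (pencil s A B 0 0) 0; last by left.
have [h1|] := eqVneq (pencil s A B 1 1) 0; last by right.
have h2 : pencil s A B 0 1 = 0.
  move: d0; rewrite -/(pencil s A B) /disc2 h0 mul0r sub0r => /eqP.
  by rewrite oppr_eq0 sqrf_eq0 => /eqP.
move: h0 h1 h2; rewrite !mxE => /eqP; rewrite subr_eq0 => /eqP h0.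
move=> /eqP; rewrite subr_eq0 => /eqP h1 /eqP; rewrite subr_eq0 => /eqP h2.
have : disc2 B = (eigval s A B) ^+ 2 * disc2 A by rewrite /disc2 h0 h1 h2; ring.
have := mulr_ge0 (sqr_ge0 (eigval s A B)) (ltW dA); lra.
Qed.

Lemma kernel2_line v w M : symm2 M -> M 0 0 != 0 \/ M 1 1 != 0 -> v != 0 ->
  v *m M = 0 -> w *m M = 0 -> exists k : R, w = k *: v.
Proof.
move=> sM M0 v0 /(mul2_eq0 _ sM)[v1 v2] /(mul2_eq0 _ sM)[w1 w2].
have cr : w 0 0 * v 0 1 - w 0 1 * v 0 0 = 0.
  case: M0 => n; apply: (mulIf n); rewrite mul0r.
    transitivity ((w 0 0 * M 0 0 + w 0 1 * M 0 1) * v 0 1 -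
      (v 0 0 * M 0 0 + v 0 1 * M 0 1) * w 0 1); first by ring.
    by rewrite w1 v1 !mul0r subrr.
  transitivity ((v 0 0 * M 0 1 + v 0 1 * M 1 1) * w 0 0 -
      (w 0 0 * M 0 1 + w 0 1 * M 1 1) * v 0 0); first by ring.
  by rewrite w2 v2 !mul0r subrr.
have [n|n] := row2_neq0 v0.
  exists (w 0 0 / v 0 0); apply: row2P; rewrite mxE; first by rewrite divfK.
  have : w 0 0 * v 0 1 = w 0 1 * v 0 0 by apply/eqP; rewrite -subr_eq0 cr.
  by move=> h; rewrite mulrAC h mulfK.
exists (w 0 1 / v 0 1); apply: row2P; rewrite mxE; last by rewrite divfK.
have : w 0 0 * v 0 1 = w 0 1 * v 0 0 by apply/eqP; rewrite -subr_eq0 cr.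
by move=> h; rewrite mulrAC -h mulfK.
Qed.

(** A degenerate quadratic form is plus or minus a square, so that its isotropic
vectors form its kernel. *)
Lemma isotropic_kernel v M : symm2 M -> M 0 0 != 0 \/ M 1 1 != 0 ->
  disc2 M = 0 -> (v *m M *m v^T) 0 0 = 0 -> v *m M = 0.
Proof.
move=> sM M0 d0; rewrite bil2 sM => h; apply/(mul2_eq0 _ sM).
have d1 : M 0 1 ^+ 2 = M 0 0 * M 1 1.
  by apply/eqP; rewrite eq_sym -subr_eq0; apply/eqP.
case: M0 => n.
  have e : v 0 0 * M 0 0 + v 0 1 * M 0 1 = 0.
    apply/eqP; rewrite -sqrf_eq0; apply/eqP.
    transitivity (M 0 0 * ((v 0 0 * M 0 0 + v 0 1 * M 0 1) * v 0 0 +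
      (v 0 0 * M 0 1 + v 0 1 * M 1 1) * v 0 1) +
      v 0 1 ^+ 2 * (M 0 1 ^+ 2 - M 0 0 * M 1 1)); first by ring.
    by rewrite h d1 subrr !mulr0 addr0.
  split => //; apply: (mulfI n); rewrite mulr0.
  transitivity (M 0 1 * (v 0 0 * M 0 0 + v 0 1 * M 0 1) -
    v 0 1 * (M 0 1 ^+ 2 - M 0 0 * M 1 1)); first by ring.
  by rewrite e d1 subrr !mulr0 subrr.
have e : v 0 0 * M 0 1 + v 0 1 * M 1 1 = 0.
  apply/eqP; rewrite -sqrf_eq0; apply/eqP.
  transitivity (M 1 1 * ((v 0 0 * M 0 0 + v 0 1 * M 0 1) * v 0 0 +
    (v 0 0 * M 0 1 + v 0 1 * M 1 1) * v 0 1) +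
    v 0 0 ^+ 2 * (M 0 1 ^+ 2 - M 0 0 * M 1 1)); first by ring.
  by rewrite h d1 subrr !mulr0 addr0.
split => //; apply: (mulfI n); rewrite mulr0.
transitivity (M 0 1 * (v 0 0 * M 0 1 + v 0 1 * M 1 1) -
  v 0 0 * (M 0 1 ^+ 2 - M 0 0 * M 1 1)); first by ring.
by rewrite e d1 subrr !mulr0 subrr.
Qed.

Definition cross2 v w : R := v 0 0 * w 0 1 - v 0 1 * w 0 0.

Lemma row_free_cross2 v w : row_free (col_mx v w) -> cross2 v w != 0.
Proof.
move=> vw.
have comb (a b : R) : a *: v + b *: w = 0 -> a = 0 /\ b = 0.
  move=> h; have /eqP : row_mx a%:M b%:M *m col_mx v w = 0 :> 'rV[R]_2.
    by rewrite mul_row_col !mul_scalar_mx.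
  rewrite (mulmx_free_eq0 _ vw) => /eqP E.
  have ea : (a%:M : 'M[R]_1) = lsubmx (0 : 'rV[R]_(1 + 1)) by rewrite -E row_mxKl.
  have eb : (b%:M : 'M[R]_1) = rsubmx (0 : 'rV[R]_(1 + 1)) by rewrite -E row_mxKr.
  move/matrixP: ea => /(_ 0 0); move/matrixP: eb => /(_ 0 0).
  by rewrite !mxE !mulr1n.
apply/eqP => c0.
have E (j : 'I_2) : w 0 j *: v + - v 0 j *: w = 0.
  have [->|->] : j = 0 \/ j = 1.
      by case: j => [[|[|//]] hj]; [left|right]; apply: val_inj.
    by apply: row2P; rewrite !mxE; move: c0; rewrite /cross2; lra.
  by apply: row2P; rewrite !mxE; move: c0; rewrite /cross2; lra.
have w0 : w = 0 by apply/rowP => j; rewrite mxE; have [] := comb _ _ (E j).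
have h : 0 *: v + 1 *: w = 0 by rewrite w0 scaler0 scale0r add0r.
by have [_ /eqP] := comb _ _ h; rewrite oner_eq0.
Qed.

Lemma row_eq0_pairing u v w : cross2 v w != 0 ->
  (u *m v^T) 0 0 = 0 -> (u *m w^T) 0 0 = 0 -> u = 0.
Proof.
move=> c0; rewrite !mxE !sum2 !mxE => h1 h2.
have e0 : u 0 0 * cross2 v w = (u 0 0 * v 0 0 + u 0 1 * v 0 1) * w 0 1 -
    (u 0 0 * w 0 0 + u 0 1 * w 0 1) * v 0 1 by rewrite /cross2; ring.
have e1 : u 0 1 * cross2 v w = (u 0 0 * w 0 0 + u 0 1 * w 0 1) * v 0 0 -
    (u 0 0 * v 0 0 + u 0 1 * v 0 1) * w 0 0 by rewrite /cross2; ring.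
by apply: row2P; rewrite mxE; apply: (mulIf c0); rewrite mul0r ?e0 ?e1 h1 h2
  !mul0r subrr.
Qed.

(** The sum and the difference of two unit isotropic vectors of B are orthogonal
for A and for B, hence eigenvectors of the pencil. *)
Lemma bisector_eigen n1 n2 A B : symm2 A -> symm2 B -> cross2 n1 n2 != 0 ->
  (n1 *m A *m n1^T) 0 0 = 1 -> (n2 *m A *m n2^T) 0 0 = 1 ->
  (n1 *m B *m n1^T) 0 0 = 0 -> (n2 *m B *m n2^T) 0 0 = 0 ->
  forall l : R, (((n1 + n2) *m B *m (n1 + n2)^T) 0 0) =
    l * (((n1 + n2) *m A *m (n1 + n2)^T) 0 0) ->
  (n1 + n2) *m (B - l *: A) = 0.
Proof.
move=> sA sB c0 a1 a2 b1 b2 l hl; apply: (row_eq0_pairing c0).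
  apply: (mulfI (_ : (2 : R) != 0)) => //; rewrite mulr0.
  transitivity ((((n1 + n2) *m B *m (n1 + n2)^T) 0 0 -
    l * (((n1 + n2) *m A *m (n1 + n2)^T) 0 0)) +
    ((n1 *m B *m n1^T) 0 0 - (n2 *m B *m n2^T) 0 0) -
    l * ((n1 *m A *m n1^T) 0 0 - (n2 *m A *m n2^T) 0 0)).
    by rewrite !bil2 sA sB !mxE sA sB; ring.
  by rewrite hl a1 a2 b1 b2; ring.
apply: (mulfI (_ : (2 : R) != 0)) => //; rewrite mulr0.
transitivity ((((n1 + n2) *m B *m (n1 + n2)^T) 0 0 -
  l * (((n1 + n2) *m A *m (n1 + n2)^T) 0 0)) -
  ((n1 *m B *m n1^T) 0 0 - (n2 *m B *m n2^T) 0 0) +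
  l * ((n1 *m A *m n1^T) 0 0 - (n2 *m A *m n2^T) 0 0)).
  by rewrite !bil2 sA sB !mxE sA sB; ring.
by rewrite hl a1 a2 b1 b2; ring.
Qed.

(** In a basis of isotropic vectors the matrix is antidiagonal. *)
Lemma isotropic_disc2 v1 v2 B : symm2 B -> cross2 v1 v2 != 0 ->
  (forall v, (v *m B *m v^T) 0 0 = 0 <-> exists k : R, v = k *: v1 \/ v = k *: v2) ->
  disc2 B < 0.
Proof.
move=> sB c0 H.
have h1 : (v1 *m B *m v1^T) 0 0 = 0 by apply/H; exists 1; left; rewrite scale1r.
have h2 : (v2 *m B *m v2^T) 0 0 = 0 by apply/H; exists 1; right; rewrite scale1r.
have b0 : (v1 *m B *m v2^T) 0 0 != 0.
  apply/eqP => h3; have : ((v1 + v2) *m B *m (v1 + v2)^T) 0 0 = 0.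
    transitivity ((v1 *m B *m v1^T) 0 0 + (v2 *m B *m v2^T) 0 0 +
      2 * (v1 *m B *m v2^T) 0 0); first by rewrite !bil2 sB !mxE; ring.
    by rewrite h1 h2 h3; ring.
  have cE v : cross2 v v = 0 by rewrite /cross2 mulrC subrr.
  move=> /H[k [E|E]].
    have : cross2 v1 (v1 + v2) = cross2 v1 (k *: v1) by rewrite E.
    have -> : cross2 v1 (v1 + v2) = cross2 v1 v2 by rewrite /cross2 !mxE; ring.
    have -> : cross2 v1 (k *: v1) = 0 by rewrite /cross2 !mxE; ring.
    by move/eqP; rewrite (negbTE c0).
  have : cross2 (v1 + v2) v2 = cross2 (k *: v2) v2 by rewrite E.
  have -> : cross2 (v1 + v2) v2 = cross2 v1 v2 by rewrite /cross2 !mxE; ring.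
  have -> : cross2 (k *: v2) v2 = 0 by rewrite /cross2 !mxE; ring.
  by move/eqP; rewrite (negbTE c0).
have E : cross2 v1 v2 ^+ 2 * disc2 B =
    (v1 *m B *m v1^T) 0 0 * (v2 *m B *m v2^T) 0 0 - (v1 *m B *m v2^T) 0 0 ^+ 2.
  by rewrite !bil2 sB /cross2 /disc2; ring.
have c2 : 0 < cross2 v1 v2 ^+ 2 by rewrite exprn_even_gt0.
rewrite -(pmulr_rlt0 _ c2) E h1 mul0r sub0r oppr_lt0.
by rewrite exprn_even_gt0.
Qed.

End Eigenvalues.

(** * The eigenvalue of the integral along the bisector foliation *)

Section SmoothEigenvalue.
Context {R : realType} {n : nat} (U : set 'rV[R]_n) (A B : 'rV[R]_n -> 'M[R]_2).
Hypothesis oU : open U.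
Hypothesis sA : forall i j, smooth_on U (fun y => A y i j).
Hypothesis sB : forall i j, smooth_on U (fun y => B y i j).

Lemma smooth_disc2 (C : 'rV[R]_n -> 'M[R]_2) :
  (forall i j, smooth_on U (fun y => C y i j)) ->
  smooth_on U (fun y => disc2 (C y)).
Proof.
by move=> sC; exact: (smoothB oU (smoothM oU (sC 0 0) (sC 1 1)) (smooth_sqr oU (sC 0 1))).
Qed.

Lemma smooth_mixed2 : smooth_on U (fun y => mixed2 (A y) (B y)).
Proof.
exact: (smoothB oU (smoothD oU (smoothM oU (sA 0 0) (sB 1 1))
  (smoothM oU (sA 1 1) (sB 0 0))) (smoothM oU (smoothZ 2 oU (sA 0 1)) (sB 0 1))).
Qed.

Lemma smooth_eigval (s : R) : (forall y, U y -> 0 < disc2 (A y)) ->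
  (forall y, U y -> disc2 (B y) < 0) ->
  smooth_on U (fun y => eigval s (A y) (B y)).
Proof.
move=> dA dB; have sm := smooth_mixed2.
have sd := smooth_disc2 sA; have sd' := smooth_disc2 sB.
have sD := smoothB oU (smooth_sqr oU sm) (smoothM oU (smoothZ 4 oU sd) sd').
have D0 y : U y -> 0 < mixed2 (A y) (B y) ^+ 2 - 4 * disc2 (A y) * disc2 (B y).
  move=> Uy; have := mulr_gt0 (dA y Uy) (etrans (oppr_gt0 _) (dB y Uy)).
  have := sqr_ge0 (mixed2 (A y) (B y)); rewrite mulrN; lra.
have n0 y : U y -> 2 * disc2 (A y) != 0.
  by move=> /dA dy; rewrite mulf_neq0// gt_eqF.
have sS := smooth_sqrt oU D0 sD.
exact: (smoothM oU (smoothD oU sm (smoothZ s oU sS)) (smoothV oU n0 (smoothZ 2 oU sd))).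
Qed.

Lemma smooth_pencil (s : R) i j : (forall y, U y -> 0 < disc2 (A y)) ->
  (forall y, U y -> disc2 (B y) < 0) ->
  smooth_on U (fun y => pencil s (A y) (B y) i j).
Proof.
move=> dA dB; have sP := smoothB oU (sB i j) (smoothM oU (smooth_eigval s dA dB) (sA i j)).
by apply: (smooth_ext oU _ sP) => y _; rewrite !mxE.
Qed.

End SmoothEigenvalue.

Section EigenField.
Context {R : realType} {M : topologicalType} (S : surface R M) (G : metric S).
Context (I : quadratic_integral G) (Om : set M) (D : directions S).
Hypothesis Om_open : open Om.
Hypothesis zero_real : forall x, Om x -> two_real_zero_directions I x.
Hypothesis D_bisector : bisector_foliation I Om D.
Implicit Types (c : chart S) (x : M) (y v w : 'rV[R]_2) (s : R).

Definition qmat c y : 'M[R]_2 := \matrix_(i, j)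
  if i == 0 then (if j == 0 then coef0 I c y else coef1 I c y / 2)
  else (if j == 0 then coef1 I c y / 2 else coef2 I c y).

Definition vmat c y : 'M[R]_2 := gram G c y *m qmat c y *m gram G c y.

Lemma quad_formE c y (p : 'rV[R]_2) :
  quad_form (coef0 I) (coef1 I) (coef2 I) c y p = (p *m qmat c y *m p^T) 0 0.
Proof. by rewrite bil2 !mxE /= /quad_form; field. Qed.

Lemma vform_vmat c y v : img c y -> vform I c y v = (v *m vmat c y *m v^T) 0 0.
Proof.
by move=> cy; rewrite /vform quad_formE trmx_mul gram_sym// /vmat !mulmxA.
Qed.

Lemma gram_symm2 c y : img c y -> symm2 (gram G c y).
Proof. by move=> /(gram_pos_def G)[]. Qed.

Lemma gram_disc2 c y : img c y -> 0 < disc2 (gram G c y).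
Proof. by move=> /(gram_pos_def G)[]. Qed.

Lemma vmat_symm2 c y : img c y -> symm2 (vmat c y).
Proof.
move=> cy; have sG := gram_sym G cy.
have sQ : (qmat c y)^T = qmat c y.
  apply/matrixP => i j; rewrite !mxE.
  by case: (i == 0); case: (j == 0).
have : (vmat c y)^T = vmat c y by rewrite /vmat !trmx_mul sG sQ mulmxA.
by move=> h; rewrite /symm2 -{1}h mxE.
Qed.

Lemma quad_scale (A : 'M[R]_2) v (k : R) :
  ((k *: v) *m A *m (k *: v)^T) 0 0 = k ^+ 2 * (v *m A *m v^T) 0 0.
Proof. by rewrite !bil2 !mxE; ring. Qed.

Lemma inner_gt0 c y v : img c y -> v != 0 -> 0 < inner G c y v v.
Proof. exact: gram_pos. Qed.

Lemma vmat_disc2 x c : Om x -> dom c x -> disc2 (vmat c (coord c x)) < 0.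
Proof.
move=> Ox cx; have cy : img c (coord c x) by exists x.
have [v1 [v2 [fr H]]] := zero_real Ox cx.
apply: (isotropic_disc2 (vmat_symm2 cy) (row_free_cross2 fr)) => v.
by rewrite -vform_vmat.
Qed.

Lemma D_line x c : Om x -> dom c x -> exists2 X : 'rV[R]_2, X != 0 &
  forall v, D c (coord c x) v <-> exists k : R, v = k *: X.
Proof.
move=> Ox cx; have [[_ loc] _] := D_bisector.
have [Ob [X [_ Oy _ H]]] := loc c x Ox cx.
by have [] := H (coord c x) (conj Oy (ex_intro2 _ _ x (conj Ox cx) (erefl _)));
  exists (X (coord c x)).
Qed.

(** By bisector_eigen; the eigenvalue is nonzero because the form is nondegenerate where
its zero directions are distinct. *)
Lemma D_eigen x c v : Om x -> dom c x -> D c (coord c x) v -> v != 0 ->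
  exists l : R, [/\ l != 0, v *m (vmat c (coord c x) - l *: gram G c (coord c x)) = 0 &
    vform I c (coord c x) v = l * inner G c (coord c x) v v].
Proof.
move=> Ox cx Dv v0; have cy : img c (coord c x) by exists x.
have [_ bis] := D_bisector.
have [n1 [n2 [k [fr [u1 u2] [z1 z2] vE]]]] := bis x c v Ox cx Dv.
have k0 : k != 0 by apply: contraNneq v0 => k0; rewrite vE k0 scale0r.
have n0 : n1 + n2 != 0 by apply: contraNneq v0 => n0; rewrite vE n0 scaler0.
set y := coord c x in cy u1 u2 z1 z2 *.
have sA := gram_symm2 cy; have sB := vmat_symm2 cy.
pose l := vform I c y (n1 + n2) / inner G c y (n1 + n2) (n1 + n2).
have i0 : inner G c y (n1 + n2) (n1 + n2) != 0 by rewrite gt_eqF// inner_gt0.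
have lE : vform I c y (n1 + n2) = l * inner G c y (n1 + n2) (n1 + n2).
  by rewrite /l divfK.
have ker : (n1 + n2) *m (vmat c y - l *: gram G c y) = 0.
  apply: (bisector_eigen sA sB (row_free_cross2 fr) u1 u2).
  - by rewrite -vform_vmat.
  - by rewrite -vform_vmat.
  - by rewrite -vform_vmat.
exists l; split.
- have := degenerate2 (symm2_pencil l sA sB) n0 ker.
  rewrite disc2_pencil; apply: contra_eqN => /eqP ->.
  by rewrite expr2 !mulr0 subr0 add0r lt_eqF// vmat_disc2.
- by rewrite vE -scalemxAl ker scaler0.
- rewrite vform_vmat// /inner vE !quad_scale -vform_vmat// lE /inner.
  by rewrite mulrCA.
Qed.

(** The two eigenvalues of the integral have opposite signs, so that the sign of the form
tells which of them belongs to the foliation. *)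
Definition sign_part s : set M := [set x | Om x /\
  forall c v, dom c x -> D c (coord c x) v -> v != 0 ->
    0 < s * vform I c (coord c x) v].

Definition eiglam s c y : R := eigval s (gram G c y) (vmat c y).

Definition eigmat s c y : 'M[R]_2 := pencil s (gram G c y) (vmat c y).

Lemma D_change x c c' v : Om x -> in_both c c' x ->
  D c (coord c x) v <-> D c' (coord c' x) (v *m transition c c' x).
Proof. by move=> Ox cc; have [[h _] _] := D_bisector; exact: h. Qed.

Lemma sign_partP s x c v : Om x -> dom c x -> D c (coord c x) v -> v != 0 ->
  0 < s * vform I c (coord c x) v -> sign_part s x.
Proof.
move=> Ox cx Dv v0 sv; split=> // c' w c'x Dw w0.
have cc : in_both c c' x by [].
have [X X0 XP] := D_line Ox c'x.
have [k kE] := (XP _).1 ((D_change v Ox cc).1 Dv).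
have [m mE] := (XP _).1 Dw.
have k0 : k != 0.
  apply: contraTneq (transition_unit cc v0) => k0.
  by rewrite kE k0 scale0r eqxx.
have m0 : m != 0 by apply: contraNneq w0 => m0; rewrite mE m0 scale0r.
have c'y : img c' (coord c' x) by exists x.
have hom (a : R) : vform I c' (coord c' x) (a *: X) =
    a ^+ 2 * vform I c' (coord c' x) X.
  by rewrite !vform_vmat// quad_scale.
move: sv; rewrite (vform_change I v cc) kE mE !hom.
rewrite mulrCA [s * (m ^+ 2 * _)]mulrCA.
have k2 : 0 < k ^+ 2 by rewrite exprn_even_gt0.
have m2 : 0 < m ^+ 2 by rewrite exprn_even_gt0.
by rewrite (pmulr_rgt0 _ k2) (pmulr_rgt0 _ m2).
Qed.

Lemma sign_part_cover x : Om x -> sign_part 1 x \/ sign_part (-1) x.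
Proof.
move=> Ox; have [c cx] := dom_cover S x.
have [X X0 XP] := D_line Ox cx.
have DX : D c (coord c x) X by apply/XP; exists 1; rewrite scale1r.
have [l [l0 _ lE]] := D_eigen Ox cx DX X0.
have i0 : 0 < inner G c (coord c x) X X by apply: inner_gt0 => //; exists x.
have : vform I c (coord c x) X != 0 by rewrite lE mulf_neq0// gt_eqF.
rewrite neq_lt => /orP[h|h]; [right|left]; apply: (sign_partP Ox cx DX X0).
  by rewrite mulN1r oppr_gt0.
by rewrite mul1r.
Qed.

Lemma eigmat_spec s x c : s ^+ 2 = 1 -> Om x -> dom c x ->
  [/\ symm2 (eigmat s c (coord c x)), disc2 (eigmat s c (coord c x)) = 0 &
   eigmat s c (coord c x) 0 0 != 0 \/ eigmat s c (coord c x) 1 1 != 0].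
Proof.
move=> s2 Ox cx; have cy : img c (coord c x) by exists x.
have sA := gram_symm2 cy; have sB := vmat_symm2 cy; have dA := gram_disc2 cy.
have dB := vmat_disc2 Ox cx.
split; [exact: symm2_pencil|by have [] := eigval_spec s2 dA dB|exact: pencil_neq0].
Qed.

Lemma D_eigmat s x c v : s ^+ 2 = 1 -> sign_part s x -> dom c x ->
  D c (coord c x) v <-> v *m eigmat s c (coord c x) = 0.
Proof.
move=> s2 [Ox sx] cx; have cy : img c (coord c x) by exists x.
have [X X0 XP] := D_line Ox cx.
have DX : D c (coord c x) X by apply/XP; exists 1; rewrite scale1r.
have [l [l0 kX lE]] := D_eigen Ox cx DX X0.
have sl : 0 < s * l.
  have := sx c X cx DX X0; rewrite lE mulrA pmulr_lgt0//.
  exact: inner_gt0.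
have lam : l = eiglam s c (coord c x).
  apply: (eigval_unique s2 (gram_disc2 cy) (vmat_disc2 Ox cx) _ sl).
  apply: degenerate2 X0 kX.
  exact: symm2_pencil (gram_symm2 cy) (vmat_symm2 cy).
have {}kX : X *m eigmat s c (coord c x) = 0 by move: kX; rewrite lam.
have [sM _ M0] := eigmat_spec s2 Ox cx.
split=> [/XP[k ->]|vM].
  by rewrite -scalemxAl kX scaler0.
by apply/XP; exact: kernel2_line sM M0 X0 kX vM.
Qed.

Lemma vform_eiglam s x c v : dom c x ->
  (v *m eigmat s c (coord c x) *m v^T) 0 0 =
  vform I c (coord c x) v - eiglam s c (coord c x) * inner G c (coord c x) v v.
Proof.
move=> cx; have cy : img c (coord c x) by exists x.
by rewrite vform_vmat// /inner !bil2 /eigmat /pencil !mxE /eiglam; ring.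
Qed.

(** The form vform - eiglam * inner is degenerate, hence its isotropic vectors are its
kernel, which is the line of the foliation. *)
Lemma D_vform s x c v : s ^+ 2 = 1 -> sign_part s x -> dom c x ->
  D c (coord c x) v <->
  vform I c (coord c x) v = eiglam s c (coord c x) * inner G c (coord c x) v v.
Proof.
move=> s2 sx cx; have [Ox _] := sx.
have [sM dM M0] := eigmat_spec s2 Ox cx.
split=> [/(D_eigmat v s2 sx cx) h|h].
  apply/eqP; rewrite -subr_eq0 -vform_eiglam// h mul0mx mxE//.
apply/(D_eigmat v s2 sx cx); apply: isotropic_kernel sM M0 dM _.
by rewrite vform_eiglam// h subrr.
Qed.

Lemma eiglam_change s x c c' : s ^+ 2 = 1 -> sign_part s x -> in_both c c' x ->
  eiglam s c (coord c x) = eiglam s c' (coord c' x).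
Proof.
move=> s2 sx cc; have [Ox _] := sx; have [cx c'x] := cc.
have [X X0 XP] := D_line Ox cx.
have DX : D c (coord c x) X by apply/XP; exists 1; rewrite scale1r.
have e1 := (D_vform X s2 sx cx).1 DX.
have e2 := (D_vform _ s2 sx c'x).1 ((D_change X Ox cc).1 DX).
have i0 : inner G c (coord c x) X X != 0.
  by rewrite gt_eqF// inner_gt0//; exists x.
apply: (mulIf i0); rewrite -e1 (vform_change I X cc) e2.
by rewrite (inner_change G X X cc).
Qed.

Definition om_image c : set 'rV[R]_2 := coord c @` (Om `&` dom c).

Lemma om_image_open c : open (om_image c).
Proof. exact: chart_image_open. Qed.

Lemma om_image_img c y : om_image c y -> img c y.
Proof. by move=> [x [_ cx] <-]; exists x. Qed.

Lemma om_image_disc2 c y : om_image c y -> disc2 (vmat c y) < 0.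
Proof. by move=> [x [Ox cx] <-]; exact: vmat_disc2. Qed.

Lemma gram_smooth_om c i j : smooth_on (om_image c) (fun y => gram G c y i j).
Proof.
by apply: (smooth_sub (@om_image_img c)); exact: gram_smooth.
Qed.

Lemma qmat_smooth c i j : smooth_on (img c) (fun y => qmat c y i j).
Proof.
have oI := @img_open _ _ S c.
have h : smooth_on (img c) (fun y => coef1 I c y / 2).
  have -> : (fun y => coef1 I c y / 2) = (fun y => 2^-1 * coef1 I c y).
    by apply/funext => y; rewrite mulrC.
  by apply: (smoothZ _ oI); exact: coef1_smooth.
have E : (fun y => qmat c y i j) =
  if i == 0 then (if j == 0 then coef0 I c else (fun y => coef1 I c y / 2))
  else (if j == 0 then (fun y => coef1 I c y / 2) else coef2 I c).
  by apply/funext => y; rewrite mxE; case: (i == 0); case: (j == 0).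
rewrite E; case: (i == 0); case: (j == 0); [exact: coef0_smooth|exact: h|exact: h|].
exact: coef2_smooth.
Qed.

Lemma vmat_smooth_img c i j : smooth_on (img c) (fun y => vmat c y i j).
Proof.
have oI := @img_open _ _ S c.
have -> : (fun y => vmat c y i j) = (fun y => \sum_k
    (\sum_l gram G c y i l * qmat c y l k) * gram G c y k j).
  by apply/funext => y; rewrite mxE; apply: eq_bigr => k _; rewrite mxE.
apply: (smooth_sum _ oI) => k; apply: (smoothM oI); last exact: gram_smooth.
apply: (smooth_sum _ oI) => l; apply: (smoothM oI); first exact: gram_smooth.
exact: qmat_smooth.
Qed.

Lemma vmat_smooth c i j : smooth_on (om_image c) (fun y => vmat c y i j).
Proof.
exact: (smooth_sub (@om_image_img c)) (@vmat_smooth_img c i j).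
Qed.

Lemma eiglam_smooth s c : smooth_on (om_image c) (eiglam s c).
Proof.
apply: (smooth_eigval (@om_image_open c) (@gram_smooth_om c) (@vmat_smooth c)).
  by move=> y /om_image_img; exact: gram_disc2.
exact: om_image_disc2.
Qed.

Lemma eigmat_smooth s c i j : smooth_on (om_image c) (fun y => eigmat s c y i j).
Proof.
apply: (smooth_pencil (@om_image_open c) (@gram_smooth_om c) (@vmat_smooth c)).
  by move=> y /om_image_img; exact: gram_disc2.
exact: om_image_disc2.
Qed.

(** A continuous nonzero field in the foliation keeps the sign of the form nearby. *)
Lemma sign_part_open s : open (sign_part s).
Proof.
rewrite openE => x [Ox sx]; have [c cx] := dom_cover S x.
have [[_ loc] _] := D_bisector.
have [Ob [X [oO Oy Xc H]]] := loc c x Ox cx.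
set V := Ob `&` coord c @` (Om `&` dom c) in Xc H.
have oV : open V by apply: openI => //; exact: om_image_open.
have Vy : V (coord c x) by split => //; exists x.
have {}Xc : {for coord c x, continuous X}.
  by move: Xc; rewrite (continuous_open_subspace X oV) => /(_ _ (mem_set Vy)).
have [X0 XP] := H _ Vy.
have DX : D c (coord c x) (X (coord c x)) by apply/XP; exists 1; rewrite scale1r.
have pos := sx c _ cx DX X0.
pose F (y : 'rV[R]_2) : R := s * (X y *m vmat c y *m (X y)^T) 0 0.
have cX i : {for coord c x, continuous (fun y => X y 0 i)}.
  apply: (@continuous_comp _ _ _ X (fun v : 'rV[R]_2 => v 0 i)); first exact: Xc.
  exact: matrix_normedtype.coord_continuous.
have cv i j : {for coord c x, continuous (fun y => vmat c y i j)}.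
  by apply: smooth_continuous (@vmat_smooth c i j) _; exists x.
have cF : {for coord c x, continuous F}.
  have -> : F = (fun y => s * ((X y 0 0 * vmat c y 0 0 + X y 0 1 * vmat c y 1 0) * X y 0 0
     + (X y 0 0 * vmat c y 0 1 + X y 0 1 * vmat c y 1 1) * X y 0 1)).
    by apply/funext => y; rewrite /F bil2.
  apply: (@continuousM _ _ (cst s)); first exact: cst_continuous.
  apply: (@continuousD _ _ _ (fun y => _ * X y 0 0) (fun y => _ * X y 0 1)).
    apply: (@continuousM _ _ _ (fun y => X y 0 0)); last exact: cX.
    apply: (@continuousD _ _ _ (fun y => X y 0 0 * _) (fun y => X y 0 1 * _)).
      by apply: (@continuousM _ _ (fun y => X y 0 0)); [exact: cX|exact: cv].
    by apply: (@continuousM _ _ (fun y => X y 0 1)); [exact: cX|exact: cv].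
  apply: (@continuousM _ _ _ (fun y => X y 0 1)); last exact: cX.
  apply: (@continuousD _ _ _ (fun y => X y 0 0 * _) (fun y => X y 0 1 * _)).
    by apply: (@continuousM _ _ (fun y => X y 0 0)); [exact: cX|exact: cv].
  by apply: (@continuousM _ _ (fun y => X y 0 1)); [exact: cX|exact: cv].
have F0 : 0 < F (coord c x) by rewrite /F -vform_vmat//; exists x.
have [r r0 rP] := near_normI (open_normP oV Vy) ((continuous_normP _ _).1 cF _ F0).
have near_x : nbhs x [set z | dom c z /\ `|coord c z - coord c x| < r].
  apply: filterI; first by apply: open_nbhs_nbhs; split => //; exact: dom_open.
  have cc : {for x, continuous (coord c)} by exact: coord_continuous.
  have h : nbhs (coord c x) [set y | `|y - coord c x| < r].
    by apply/near_normP; exists r.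
  exact: cc h.
apply: filterS near_x => z [cz /rP[Vz Fz]].
have Oz : Om z.
  by move: Vz => [_ [u [Ou cu] uz]]; rewrite -(coordK cz) -uz (coordK cu).
have [Xz XzP] := H _ Vz.
apply: (@sign_partP s z c (X (coord c z))) => //.
  by apply/XzP; exists 1; rewrite scale1r.
have iz : img c (coord c z) by exists z.
rewrite vform_vmat// -/(F (coord c z)).
by move: Fz; rewrite ltr_distl => /andP[+ _]; rewrite subrr.
Qed.

End EigenField.

(** * Conserved functions and their critical points *)

Section CriticalPoints.
Context {R : realType} {n : nat}.
Implicit Types (f : 'rV[R]_n -> R) (F : 'rV[R]_n -> 'rV[R]_n).

Lemma critical_littleo f p : differentiable f p ->
  (forall i, 'D_(basis_vec i) f p = 0) ->
  forall e : R, 0 < e -> exists2 d : R, 0 < d &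
    forall q, `|q - p| < d -> `|f q - f p| <= e * `|q - p|.
Proof.
move=> df d0 e e0.
have := (diff_locally df); move=> /eqaddoP /(_ e e0) /near_normP[d dgt dP].
exists d => // q qp.
have := dP (q - p); rewrite subr0 => /(_ qp).
have z : 'd f p (q - p) = 0.
  rewrite -deriveE// derive_sum_partials// big1// => i _.
  by rewrite d0 mulr0.
by rewrite !fctE /= subrK z addr0.
Qed.

Lemma derive_bound f x v (K : R) : derivable f x v -> 0 <= K ->
  (exists2 d : R, 0 < d & forall h : R, `|h| < d ->
     `|f (h *: v + x) - f x| <= K * `|h|) -> `|'D_v f x| <= K.
Proof.
move=> dv K0 [d d0 dK].
apply/ler_addgt0Pr => e e0.
have := dv; rewrite /derivable => /cvg_ex[l lP].
have lE : 'D_v f x = l by rewrite /derive; apply/cvg_lim.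
rewrite lE; move/cvgrPdist_le : lP => /(_ e e0) lP.
have H : \forall h \near (0 : R)^', `|h| < d by exact: dnbhs0_lt.
near (0 : R)^' => h.
have h0 : h != 0 by near: h; exact: nbhs_dnbhs_neq.
have q : `|l - h^-1 *: (f (h *: v + x) - f x)| <= e by near: h; exact: lP.
have hd : `|h| < d by near: h; exact: H.
rewrite -lerBlDr; apply: le_trans (_ : `|h^-1 *: (f (h *: v + x) - f x)| <= K).
  have := ler_distD 0 l (h^-1 *: (f (h *: v + x) - f x)).
  have := lerB_dist l (h^-1 *: (f (h *: v + x) - f x)); lra.
rewrite normrZ normfV mulrC ler_pdivrMr ?normr_gt0//.
exact: dK.
Unshelve. all: by end_near. Qed.

(** A conserved function is carried back to the critical point by the flow, which
expands distances by at most a factor 2. *)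
Lemma critical_flow (U : set 'rV[R]_n) F f p : open U -> U p ->
  smooth_map_on U F -> smooth_on U f ->
  (forall x (a b s t : R), solution F x a b -> (forall u, a < u < b -> U (x u)) ->
     a < s < b -> a < t < b -> f (x s) = f (x t)) ->
  (forall i, 'D_(basis_vec i) f p = 0) ->
  exists (T : R) z, [/\ 0 < T, z 0 = p, solution F z (- T) T &
    forall t, - T < t < T -> U (z t) /\ forall i, 'D_(basis_vec i) f (z t) = 0].
Proof.
move=> oU Up sF sf cons crit.
have [r [L [T [r0 L0 T0 LT [rU rL flow]]]]] := local_flow oU Up sF.
have [|z [z0 zF zr]] := flow p; first by rewrite subrr normr0 divr_gt0.
have tin (t : R) : - T < t < T -> U (z t) by move=> /zr/ltW/rU.
have T00 : - T < 0 < T by rewrite oppr_lt0 T0.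
have zc := is_derive_path_cont (zF 0 T00).
have [m m0 mP] := (continuous_normP _ _).1 zc (r / 4) (divr_gt0 r0 (ltr0n _ 4)).
pose T' := Num.min m (T / 2).
have T'0 : 0 < T' by rewrite lt_min m0 divr_gt0.
exists T', z.
have T'T (t : R) : - T' < t < T' -> `|t| < T / 2 /\ `|z t - p| < r / 4.
  rewrite -ltr_norml lt_min => /andP[tm tT]; split => //.
  by have := mP t; rewrite subr0 z0; apply.
have half (t : R) : `|t| < T / 2 -> - T < t < T.
  by move=> h; rewrite -ltr_norml; apply: lt_trans h _; rewrite ltr_pdivrMr// ltr_pMr// ltr1n.
split => //; first by move=> t /T'T[/half h _]; exact: zF.
move=> t1 /T'T[t1T t1r]; have t1T' := half _ t1T; split; first exact: tin.
move=> i; have d1 := smooth_derivable (i := i) sf (tin _ t1T').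
apply/eqP; rewrite -normr_le0; apply/ler_addgt0Pr => e e0; rewrite add0r.
apply: derive_bound d1 (ltW e0) _.
have dfp := smooth_differentiable oU sf Up.
have [d dgt dP] := critical_littleo dfp crit (divr_gt0 e0 (ltr0n _ 2)).
exists (Num.min (r / 4) (d / 2)).
  by rewrite lt_min !divr_gt0.
move=> h; rewrite lt_min => /andP[hr hd].
set z1 := h *: basis_vec i + z t1.
have z1d : `|z1 - z t1| <= `|h|.
  rewrite /z1 addrK normrZ ler_piMr//; exact: norm_basis_vec.
have z1r : `|z1 - p| < r / 2.
  have := ler_distD (z t1) z1 p; lra.
have [y [y0 yF yr]] := flow z1 z1r.
have zs := solution_shift (c := t1) zF.
have sub (a b a' b' : R) (q : R -> 'rV[R]_n) : a <= a' -> b' <= b ->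
    solution F q a b -> solution F q a' b'.
  by move=> aa bb H t /andP[ta tb]; apply: H; apply/andP; split; lra.
have t1n : - (T / 2) < t1 < T / 2 by rewrite -ltr_norml.
have T2T (u : R) : - (T / 2) < u < T / 2 -> - T < u < T.
  by rewrite -ltr_norml => /half.
have T2T1 (u : R) : - (T / 2) < u < T / 2 -> - T < u + t1 < T.
  by move: t1n => /andP[? ?] /andP[? ?]; apply/andP; split; lra.
have zs' : solution F (fun t => z (t + t1)) (- (T / 2)) (T / 2).
  by apply: sub zs; move: t1n => /andP[? ?]; lra.
have ys' : solution F y (- (T / 2)) (T / 2) by apply: sub yF; lra.
have LT2 : L * (T / 2) <= 2^-1.
  by apply: le_trans LT; rewrite ler_wpM2l// ler_pdivrMr// ler_peMr ?(ltW T0)// ler1n.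
have yr' u : - (T / 2) < u < T / 2 -> `|y u - p| <= r by move=> /T2T/yr/ltW.
have zr' u : - (T / 2) < u < T / 2 -> `|z (u + t1) - p| <= r by move=> /T2T1/zr/ltW.
have mt1 : - (T / 2) < - t1 < T / 2.
  by move: t1n => /andP[? ?]; apply/andP; split; lra.
have := solution_dist L0 LT2 rL ys' zs' yr' zr' mt1.
rewrite addNr add0r y0 z0 => dist.
have yp : `|y (- t1) - p| <= 2 * `|h| by apply: le_trans dist _; lra.
have f1 : f z1 = f (y (- t1)).
  rewrite -y0; apply: (cons y _ _ _ _ yF) => //; last exact: T2T.
  by move=> u /yr/ltW/rU.
have f2 : f (z t1) = f p by rewrite -z0; apply: (cons z _ _ _ _ zF).
rewrite -/z1 f1 f2; apply: le_trans (dP _ _) _; first by apply: le_lt_trans yp _; lra.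
by apply: le_trans (ler_wpM2l (ltW (divr_gt0 e0 (ltr0n _ 2))) yp) _; lra.
Qed.

End CriticalPoints.

Section DegenerateForm.
Context {R : realType}.

(** To first order, a degenerate form is insensitive to the variation of a kernel
vector, and its own variation vanishes on the kernel since its determinant stays 0. *)
Lemma is_derive_degenerate (v0 v1 m00 m01 m11 : R -> R) (a0 a1 b00 b01 b11 : R) :
  is_derive (0:R) 1 v0 a0 -> is_derive (0:R) 1 v1 a1 ->
  is_derive (0:R) 1 m00 b00 -> is_derive (0:R) 1 m01 b01 -> is_derive (0:R) 1 m11 b11 ->
  (exists2 d : R, 0 < d & forall s : R, `|s| < d -> m00 s * m11 s = m01 s * m01 s) ->
  v0 0 * m00 0 + v1 0 * m01 0 = 0 -> v0 0 * m01 0 + v1 0 * m11 0 = 0 ->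
  (m00 0 != 0 \/ m11 0 != 0) ->
  is_derive (0:R) 1 (fun s => (v0 s * m00 s + v1 s * m01 s) * v0 s +
    (v0 s * m01 s + v1 s * m11 s) * v1 s) 0.
Proof.
move=> d0 d1 e00 e01 e11 [d dgt dP] k0 k1 mn.
have E : m00 0 * b11 + m11 0 * b00 = m01 0 * b01 + m01 0 * b01.
  have h1 := is_deriveM e00 e11; have h2 := is_deriveM e01 e01.
  apply: is_derive_unique h1 _; apply: near_eq_is_derive h2.
  by apply/near_normP; exists d => // s; rewrite subr0 => /dP h; exact: esym h.
have dt := is_deriveD (is_deriveM (is_deriveD (is_deriveM d0 e00) (is_deriveM d1 e01)) d0)
  (is_deriveM (is_deriveD (is_deriveM d0 e01) (is_deriveM d1 e11)) d1).
apply: (is_derive_eq dt).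
rewrite [LHS](_ : _ = (v0 0 * m00 0 + v1 0 * m01 0) * a0 + v0 0 *
  ((v0 0 * b00 + m00 0 * a0) + (v1 0 * b01 + m01 0 * a1)) +
  ((v0 0 * m01 0 + v1 0 * m11 0) * a1 + v1 0 *
  ((v0 0 * b01 + m01 0 * a0) + (v1 0 * b11 + m11 0 * a1))))//.
have q : v0 0 ^+ 2 * b00 + 2 * v0 0 * v1 0 * b01 + v1 0 ^+ 2 * b11 = 0.
  have sq : m00 0 * m11 0 = m01 0 * m01 0 by apply: dP; rewrite normr0.
  case: mn => n.
    apply: (mulfI n); rewrite mulr0; apply: (mulfI n); rewrite mulr0.
    transitivity ((v0 0 * m00 0 + v1 0 * m01 0) * (v0 0 * m00 0 - v1 0 * m01 0) * b00 +
      2 * (v0 0 * m00 0 + v1 0 * m01 0) * m00 0 * v1 0 * b01 +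
      v1 0 ^+ 2 * (m01 0 * m01 0 * b00 - 2 * m01 0 * m00 0 * b01 + m00 0 ^+ 2 * b11)).
      by ring.
    rewrite k0 -sq !mul0r mulr0 !mul0r !add0r.
    transitivity (v1 0 ^+ 2 * m00 0 * (m00 0 * b11 + m11 0 * b00 -
      (m01 0 * b01 + m01 0 * b01))); first by ring.
    by rewrite E subrr mulr0.
  apply: (mulfI n); rewrite mulr0; apply: (mulfI n); rewrite mulr0.
  transitivity ((v0 0 * m01 0 + v1 0 * m11 0) * (v1 0 * m11 0 - v0 0 * m01 0) * b11 +
    2 * (v0 0 * m01 0 + v1 0 * m11 0) * m11 0 * v0 0 * b01 +
    v0 0 ^+ 2 * (m01 0 * m01 0 * b11 - 2 * m01 0 * m11 0 * b01 + m11 0 ^+ 2 * b00)).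
    by ring.
  rewrite k1 -sq !mul0r mulr0 !mul0r !add0r.
  transitivity (v0 0 ^+ 2 * m11 0 * (m00 0 * b11 + m11 0 * b00 -
    (m01 0 * b01 + m01 0 * b01))); first by ring.
  by rewrite E subrr mulr0.
rewrite k0 k1 !mul0r !add0r -[RHS]q.
transitivity ((v0 0 * m00 0 + v1 0 * m01 0) * a0 + (v0 0 * m01 0 + v1 0 * m11 0) * a1 +
  (v0 0 ^+ 2 * b00 + 2 * v0 0 * v1 0 * b01 + v1 0 ^+ 2 * b11)); first by ring.
by rewrite k0 k1 !mul0r !add0r.
Qed.

End DegenerateForm.

Section PhaseGeodesics.
Context {R : realType} {M : topologicalType} (S : surface R M) (G : metric S).
Implicit Types (c : chart S).

Lemma phase_hamilton c (z : R -> 'rV[R]_(2 + 2)) (a b : R) :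
  solution (hamfield G c) z a b -> (forall t, a < t < b -> phase c (z t)) ->
  hamilton_solution G c (fun t => lsubmx (z t)) (fun t => rsubmx (z t)) a b.
Proof.
move=> zF zU; apply/hamilton_solutionP; split; first exact: zU.
have -> : (fun t => row_mx (lsubmx (z t)) (rsubmx (z t))) = z.
  by apply/funext => t; rewrite hsubmxK.
exact: zF.
Qed.

Lemma phase_geodesic c (z : R -> 'rV[R]_(2 + 2)) (a b s : R) :
  solution (hamfield G c) z a b -> (forall t, a < t < b -> phase c (z t)) ->
  a < s < b -> rsubmx (z s) != 0 ->
  let g := fun t => point c (lsubmx (z t)) in
  [/\ geodesic G g a b,
   (forall t, a < t < b -> dom c (g t) /\ coord c (g t) = lsubmx (z t)) &
   (forall t, a < t < b -> let v := rsubmx (z t) *m invmx (gram G c (lsubmx (z t))) in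
      is_derive t 1 (coord c \o g) v /\ vel c g t = v)].
Proof.
move=> zF zU sab zs g; have H := phase_hamilton zF zU.
have cg t : a < t < b -> dom c (g t) /\ coord c (g t) = lsubmx (z t).
  by move=> /zU zt; exact: img_point.
split; [|exact: cg|].
  exact: (geodesic_of_solution H (solution_energy H sab zs)).
move=> t tab v; have dv : is_derive t 1 (coord c \o g) v.
  apply: near_eq_is_derive (hamilton_velocity H tab).
  apply/near_normP; exists (Num.min (t - a) (b - t)); first by rewrite lt_min !subr_gt0.
  move=> u; rewrite lt_min !ltr_distl => /andP[/andP[h1 _] /andP[_ h2]].
  have uab : a < u < b by apply/andP; split; lra.
  by have [_ h] := cg u uab; exact: esym h.
by split => //; exact: velE.
Qed.

End PhaseGeodesics.

Section EigenvalueDerivative.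
Context {R : realType} {M : topologicalType} (S : surface R M) (G : metric S).
Context (I : quadratic_integral G) (Om : set M) (D : directions S).
Hypothesis Om_open : open Om.
Hypothesis zero_real : forall x, Om x -> two_real_zero_directions I x.
Hypothesis D_bisector : bisector_foliation I Om D.
Implicit Types (c : chart S) (x : M) (y v q : 'rV[R]_2) (s l : R).

Definition intz c (z : 'rV[R]_(2 + 2)) : R :=
  quad_form (coef0 I) (coef1 I) (coef2 I) c (lsubmx z) (rsubmx z).

(** The first integral that is critical at the eigencovectors of eigenvalue l. *)
Definition penz l c (z : 'rV[R]_(2 + 2)) : R := intz c z - (2 * l) * hamz G c z.

Lemma intz_smooth c : smooth_on (phase c) (intz c).
Proof.
have oP := @phase_open _ _ S c; have oI := @img_open _ _ S c.
have s0 := @smooth_lsubmx R 2 2 _ _ oI (@coef0_smooth _ _ _ _ I c).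
have s1 := @smooth_lsubmx R 2 2 _ _ oI (@coef1_smooth _ _ _ _ I c).
have s2 := @smooth_lsubmx R 2 2 _ _ oI (@coef2_smooth _ _ _ _ I c).
have sq i : smooth_on (phase c) (fun z => rsubmx z 0 i).
  have -> : (fun z : 'rV[R]_(2 + 2) => rsubmx z 0 i) = (fun z => z 0 (rshift 2 i)).
    by apply/funext => z; rewrite mxE.
  exact: smooth_coord.
exact: (smoothD oP (smoothD oP (smoothM oP s0 (smooth_sqr oP (sq 0)))
  (smoothM oP s1 (smoothM oP (sq 0) (sq 1)))) (smoothM oP s2 (smooth_sqr oP (sq 1)))).
Qed.

Lemma penz_smooth l c : smooth_on (phase c) (penz l c).
Proof.
have oP := @phase_open _ _ S c.
exact: (smoothB oP (@intz_smooth c) (smoothZ (2 * l) oP (@hamz_smooth _ _ _ G c))).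
Qed.

Lemma intz_row c y q : intz c (row_mx y q) =
  quad_form (coef0 I) (coef1 I) (coef2 I) c y q.
Proof. by rewrite /intz row_mxKl row_mxKr. Qed.

Lemma penz_row l c y q (v := q *m invmx (gram G c y)) : img c y ->
  penz l c (row_mx y q) = (v *m (vmat I c y - l *: gram G c y) *m v^T) 0 0.
Proof.
move=> cy; have qE : q = v *m gram G c y by rewrite /v mulmxKV// gram_unit.
rewrite /penz intz_row hamz_row qE hamiltonian_vel// -/(vform I c y v) vform_vmat//.
by rewrite /inner !bil2 !mxE; field.
Qed.

Lemma derive_penz_p l c y q k (v := q *m invmx (gram G c y)) : img c y ->
  'D_(basis_vec (rshift 2 k)) (penz l c) (row_mx y q) =
  2 * (v *m (vmat I c y - l *: gram G c y) *m invmx (gram G c y)) 0 k.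
Proof.
move=> cy; have gu := gram_unit G cy.
have pz : phase c (row_mx y q) by rewrite /phase /= row_mxKl.
have -> : v *m (vmat I c y - l *: gram G c y) *m invmx (gram G c y) =
    q *m qmat I c y - l *: (q *m invmx (gram G c y)).
  rewrite mulmxBr mulmxBl /v /vmat -scalemxAr -scalemxAl !mulmxA (mulmxKV gu).
  by rewrite mulmxK.
have dI : is_derive (row_mx y q) (basis_vec (rshift 2 k)) (intz c)
    (2 * (q *m qmat I c y) 0 k).
  apply: DeriveDef; first exact: smooth_derivable (@intz_smooth c) pz.
  rewrite derive_rshift.
  have -> : (fun q => intz c (row_mx y q)) = (fun q => coef0 I c y * q 0 0 ^+ 2 +
     coef1 I c y * (q 0 0 * q 0 1) + coef2 I c y * q 0 1 ^+ 2).
    by apply/funext => q'; rewrite intz_row.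
  rewrite (@derive_val _ _ _ _ _ _ _ (is_derive_quad2 _ _ _ _ _)) mul2 !basis_vecE.
  have [->|->] : k = 0 \/ k = 1.
      by case: k => [[|[|//]] hk]; [left|right]; apply: val_inj.
    by rewrite !mxE /=; field.
  by rewrite !mxE /=; field.
have dH : is_derive (row_mx y q) (basis_vec (rshift 2 k)) (hamz G c)
    ((q *m invmx (gram G c y)) 0 k).
  apply: DeriveDef; first exact: smooth_derivable (@hamz_smooth _ _ _ G c) pz.
  exact: derive_hamz_p.
have d := is_deriveB dI (is_deriveZ (2 * l) dH).
rewrite (@derive_val _ _ _ _ _ _ _ d) [in RHS]mxE [X in _ = _ * (_ + X)]mxE.
by rewrite [X in _ = _ * (_ + - X)]mxE mulrBr mulrA.
Qed.

Lemma penz_conserved l c z (a b s t : R) : solution (hamfield G c) z a b ->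
  (forall u, a < u < b -> phase c (z u)) -> a < s < b -> a < t < b ->
  penz l c (z s) = penz l c (z t).
Proof.
move=> zF zU sab tab; have H := phase_hamilton zF zU.
rewrite /penz; congr (_ - _ * _).
  exact: (coef_first_integral I H sab tab).
exact: (hamiltonian_conserved H sab tab).
Qed.

Lemma derive_penz_x s c x v k (y := coord c x) : s ^+ 2 = 1 -> sign_part I Om D s x ->
  dom c x -> D c y v -> v != 0 ->
  'D_(basis_vec (lshift 2 k)) (penz (eiglam I s c y) c) (row_mx y (v *m gram G c y)) =
  'D_(basis_vec k) (eiglam I s c) y * inner G c y v v.
Proof.
move=> s2 sx cx Dv v0; have [Ox _] := sx.
have cy : img c y by exists x.
have oy : om_image Om c y by exists x.
set l := eiglam I s c y; set q := v *m gram G c y.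
have gu := gram_unit G cy.
have vE : q *m invmx (gram G c y) = v by rewrite /q mulmxK.
have [sM dM M0] := eigmat_spec zero_real s2 Ox cx.
have kM := (D_eigmat zero_real D_bisector v s2 sx cx).1 Dv.
pose L (h : R) := y + h *: basis_vec k.
have L0 : L 0 = y by rewrite /L scale0r addr0.
have dL : is_derive (0:R) 1 L (basis_vec k) := is_derive_affine _ _ _.
have dz : is_derive (0:R) 1 (fun h => row_mx (L h) q) (row_mx (basis_vec k) 0).
  exact: is_derive_row_mx dL (is_derive_cst q (0:R) 1).
have pz : phase c (row_mx (L 0) q) by rewrite /phase /= row_mxKl L0.
have along f : smooth_on (phase c) f ->
    is_derive (0:R) 1 (fun h => f (row_mx (L h) q))
      ('D_(basis_vec (lshift 2 k)) f (row_mx y q)).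
  move=> sf; have df := smooth_differentiable (@phase_open _ _ S c) sf pz.
  apply: (is_derive_eq (is_derive_comp_row df dz)).
  rewrite sum_row_mx (sum_basis_vec k (fun i => 'D_(basis_vec (lshift 2 i)) f _)).
  by rewrite big1 ?addr0 ?L0// => i _; rewrite mxE mul0r.
have along2 f : smooth_on (om_image Om c) f ->
    is_derive (0:R) 1 (fun h => f (L h)) ('D_(basis_vec k) f y).
  move=> sf; have oL : om_image Om c (L 0) by rewrite L0.
  have df := smooth_differentiable (@om_image_open _ _ _ _ Om_open c) sf oL.
  apply: (is_derive_eq (is_derive_comp_row df dL)).
  by rewrite (sum_basis_vec k (fun i => 'D_(basis_vec i) f _)) L0.
pose V i (h : R) : R := 'D_(basis_vec (rshift 2 i)) (hamz G c) (row_mx (L h) q).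
pose m i j (h : R) : R := eigmat I s c (L h) i j.
have dV i := along _ (smooth_partial (rshift 2 i) (@hamz_smooth _ _ _ G c)).
have dm i j := along2 _ (@eigmat_smooth _ _ _ _ I _ Om_open zero_real s c i j).
have [d dgt dP] := preimage_norm (is_derive_path_cont dL)
  (@om_image_open _ _ _ _ Om_open c) (eq_ind_r _ oy L0).
have VE i h : `|h| < d -> V i h = (q *m invmx (gram G c (L h))) 0 i.
  move=> hd; apply: derive_hamz_p; apply: (@om_image_img _ _ _ Om c).
  by apply: dP; rewrite subr0.
have mE h : `|h| < d -> [/\ symm2 (eigmat I s c (L h)), m 0 0 h * m 1 1 h = m 0 1 h * m 0 1 h
    & img c (L h)].
  move=> hd; have [z [Oz cz] zE] : om_image Om c (L h) by apply: dP; rewrite subr0.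
  have [h1 h2 _] := eigmat_spec zero_real s2 Oz cz; rewrite zE in h1 h2.
  split; [exact: h1| |by exists z].
  by apply/eqP; rewrite -expr2 -subr_eq0; apply/eqP.
have d00 : `|(0 : R)| < d by rewrite normr0.
have V0 i : V i 0 = v 0 i by rewrite VE// L0 vE.
have := (mul2_eq0 v sM).1 kM => -[k0 k1].
have dT := is_derive_degenerate (dV 0) (dV 1) (dm 0 0) (dm 0 1) (dm 1 1).
have {}dT : is_derive (0:R) 1 (fun h => (V 0 h * m 0 0 h + V 1 h * m 0 1 h) * V 0 h +
    (V 0 h * m 0 1 h + V 1 h * m 1 1 h) * V 1 h) 0.
  apply: dT.
  - by exists d => // h /mE[].
  - by rewrite -/(V 0 0) -/(V 1 0) !V0 L0.
  - by rewrite -/(V 0 0) -/(V 1 0) !V0 L0.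
  - by rewrite L0.
have dlam := along2 _ (@eiglam_smooth _ _ _ _ I _ Om_open zero_real s c).
have dH := along _ (@hamz_smooth _ _ _ G c).
have dprod := is_deriveM (is_deriveB dlam (is_derive_cst l (0:R) 1))
  (is_deriveZ 2 dH).
have dsum := is_deriveD dT dprod.
have dP0 := along _ (@penz_smooth l c).
have e1 : is_derive (0:R) 1 (fun h => penz l c (row_mx (L h) q))
  (0 + ((eiglam I s c (L 0) - l) * (2 * 'D_(basis_vec (lshift 2 k)) (hamz G c) (row_mx y q)) +
   (2 * hamz G c (row_mx (L 0) q)) * ('D_(basis_vec k) (eiglam I s c) y - 0))).
  apply: near_eq_is_derive dsum; apply/near_normP; exists d => // h.
  rewrite subr0 => hd; have [sh _ ch] := mE h hd.
  rewrite (penz_row l q ch).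
  have <- : (q *m invmx (gram G c (L h)) *m eigmat I s c (L h) *m
     (q *m invmx (gram G c (L h)))^T) 0 0 +
     (eiglam I s c (L h) - l) * (2 * hamz G c (row_mx (L h) q)) =
     (q *m invmx (gram G c (L h)) *m (vmat I c (L h) - l *: gram G c (L h)) *m
       (q *m invmx (gram G c (L h)))^T) 0 0.
    have gh := gram_unit G ch.
    have Hq : 2 * hamz G c (row_mx (L h) q) = inner G c (L h)
        (q *m invmx (gram G c (L h))) (q *m invmx (gram G c (L h))).
      rewrite hamz_row -{1}[q](mulmxKV gh) hamiltonian_vel// mulrA divff// mul1r//.
    rewrite Hq /inner /eigmat /pencil -/(eiglam I s c (L h)).
    move: (q *m invmx (gram G c (L h))) (eiglam I s c (L h)) => u mu.
    by rewrite !bil2 !mxE; ring.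
  by rewrite bil2 sh -(VE 0 h hd) -(VE 1 h hd).
have := is_derive_unique dP0 e1 => ->.
rewrite L0 -/l subrr mul0r add0r add0r subr0 hamz_row hamiltonian_vel//.
by rewrite [2 * _]mulrA divff// mul1r mulrC.
Qed.

Lemma eigen_critical_p s c x v k (y := coord c x) : s ^+ 2 = 1 ->
  sign_part I Om D s x -> dom c x -> D c y v ->
  'D_(basis_vec (rshift 2 k)) (penz (eiglam I s c y) c) (row_mx y (v *m gram G c y)) = 0.
Proof.
move=> s2 sx cx Dv; have cy : img c y by exists x.
rewrite derive_penz_p// mulmxK ?gram_unit//.
have := (D_eigmat zero_real D_bisector v s2 sx cx).1 Dv.
by rewrite /eigmat /pencil -/(eiglam I s c y) => ->; rewrite mul0mx mxE mulr0.
Qed.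

(** The eigenvalue is constant along the foliation: differentiate the conserved
function penz along the geodesic tangent to the foliation. *)
Lemma eiglam_along s c x v (y := coord c x) : s ^+ 2 = 1 ->
  sign_part I Om D s x -> dom c x -> D c y v ->
  \sum_k v 0 k * 'D_(basis_vec k) (eiglam I s c) y = 0.
Proof.
move=> s2 sx cx Dv; have cy : img c y by exists x.
have [->|v0] := eqVneq v 0; first by apply: big1 => k _; rewrite mxE mul0r.
set l := eiglam I s c y; set q := v *m gram G c y.
have oP := @phase_open _ _ S c.
have pz : phase c (row_mx y q) by rewrite /phase /= row_mxKl.
have [r [L [T [r0 L0 T0 LT [rU rL flow]]]]] := local_flow oP pz (@hamfield_smooth _ _ _ G c).
have [|z [z0 zF zr]] := flow (row_mx y q); first by rewrite subrr normr0 divr_gt0.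
have zU t : - T < t < T -> phase c (z t) by move=> /zr/ltW/rU.
have T00 : - T < 0 < T by rewrite oppr_lt0 T0.
have df : differentiable (penz l c) (z 0).
  by rewrite z0; exact: smooth_differentiable oP (@penz_smooth l c) pz.
have d1 := is_derive_comp_row df (zF 0 T00).
have c0 : is_derive (0:R) 1 (cst (penz l c (z 0)) : R -> R) 0 by exact: is_derive_cst.
have d2 : is_derive (0:R) 1 (fun t => penz l c (z t)) 0.
  apply: near_eq_is_derive c0; apply/near_normP; exists T => // t.
  rewrite subr0 ltr_norml => tT; exact: (penz_conserved l zF zU T00 tT).
have := is_derive_unique d1 d2; rewrite z0 /hamfield sum_row_mx.
rewrite [X in _ + X]big1 => [|k _]; last first.
  by rewrite (eigen_critical_p k s2 sx cx Dv) mulr0.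
rewrite addr0 => h.
have i0 : inner G c y v v != 0 by rewrite gt_eqF// inner_gt0.
apply: (mulIf i0); rewrite mul0r -[RHS]h mulr_suml; apply: eq_bigr => k _.
rewrite [X in _ = X * _]mxE derive_hamz_p// mulmxK ?gram_unit//.
by rewrite (derive_penz_x k s2 sx cx Dv v0) mulrA.
Qed.

Definition sign_image s c : set 'rV[R]_2 := coord c @` (sign_part I Om D s `&` dom c).

Lemma sign_image_open s c : open (sign_image s c).
Proof. by apply: chart_image_open; exact: (sign_part_open Om_open D_bisector). Qed.

Lemma sign_image_img s c y : sign_image s c y -> img c y.
Proof. by move=> [x [_ cx] <-]; exists x. Qed.

(** Where the eigenvalue is critical, the tangent geodesic stays critical for the
conserved function, hence tangent to the foliation. *)
Lemma critical_geodesic s c x v (y := coord c x) : s ^+ 2 = 1 ->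
  sign_part I Om D s x -> dom c x -> D c y v -> v != 0 ->
  (forall k, 'D_(basis_vec k) (eiglam I s c) y = 0) ->
  exists (T B : R) g, [/\ 0 < T, geodesic G g (- T) T, g 0 = x, vel c g 0 = v &
    forall t, - T < t < T -> [/\ dom c (g t), sign_part I Om D s (g t),
      is_derive t 1 (coord c \o g) (vel c g t), D c (coord c (g t)) (vel c g t) &
      `|vel c g t| <= B]].
Proof.
move=> s2 sx cx Dv v0 crit; have cy : img c y by exists x.
set l := eiglam I s c y; set q := v *m gram G c y.
have gu := gram_unit G cy.
pose U : set 'rV[R]_(2 + 2) := [set z | sign_image s c (lsubmx z)].
have oU : open U by apply: open_lsubmx; exact: sign_image_open.
have Uph z : U z -> phase c z by move=> /sign_image_img.
have Uq : U (row_mx y q) by rewrite /U /= row_mxKl; exists x.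
have cr i : 'D_(basis_vec i) (penz l c) (row_mx y q) = 0.
  case: (split_ordP i) => k ->; last exact: eigen_critical_p.
  by rewrite (derive_penz_x k s2 sx cx Dv v0) crit mul0r.
have sF : smooth_map_on U (hamfield G c).
  by move=> i; apply: (smooth_sub Uph); exact: hamfield_smooth.
have sf : smooth_on U (penz l c) by apply: (smooth_sub Uph); exact: penz_smooth.
have cons z (a b u t : R) : solution (hamfield G c) z a b ->
    (forall u, a < u < b -> U (z u)) -> a < u < b -> a < t < b ->
    penz l c (z u) = penz l c (z t).
  by move=> zF zU; apply: (penz_conserved l zF) => t' /zU/Uph.
have [T [B [z [T0 z0 zF zC zB]]]] : exists (T B : R) z, [/\ 0 < T,
    z 0 = row_mx y q, solution (hamfield G c) z (- T) T,
    (forall t, - T < t < T -> U (z t) /\ forall i, 'D_(basis_vec i) (penz l c) (z t) = 0) &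
    forall t, - T < t < T -> `|hamfield G c (z t)| <= B].
  have [T [z [T0 z0 zF zC]]] := critical_flow oU Uq sF sf cons cr.
  have T00 : - T < 0 < T by rewrite oppr_lt0 T0.
  have Uz : U (z 0) by rewrite z0.
  have [r [L [r0 L0 rU rL]]] := smooth_map_lipschitz oU Uz sF.
  have zc := is_derive_path_cont (zF 0 T00).
  have [m m0 mP] := (continuous_normP _ _).1 zc r r0.
  exists (Num.min T m), (`|hamfield G c (z 0)| + L * r), z; split.
  - by rewrite lt_min T0 m0.
  - exact: z0.
  - by move=> t; rewrite -ltr_norml lt_min => /andP[+ _]; rewrite ltr_norml => /zF.
  - by move=> t; rewrite -ltr_norml lt_min => /andP[+ _]; rewrite ltr_norml => /zC.
  move=> t; rewrite -ltr_norml lt_min => /andP[_ tm].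
  have zt : `|z t - z 0| <= r by apply/ltW/mP; rewrite subr0.
  have z00 : `|z 0 - z 0| <= r by rewrite subrr normr0 ltW.
  rewrite -lerBlDl; apply: le_trans (lerB_dist _ _) _.
  by apply: le_trans (rL _ _ zt z00) _; rewrite ler_wpM2l.
have zU t : - T < t < T -> phase c (z t) by move=> /zC[/Uph].
have T00 : - T < 0 < T by rewrite oppr_lt0 T0.
have q0 : rsubmx (z 0) != 0.
  rewrite z0 row_mxKr; apply: contraNneq v0 => h.
  by rewrite -[v](mulmxK gu) -/q h mul0mx.
have [gg gc gv] := phase_geodesic zF zU T00 q0.
exists T, B, (fun t => point c (lsubmx (z t))); split => //.
- by rewrite z0 row_mxKl coordK.
- by have [_ ->] := gv 0 T00; rewrite z0 row_mxKl row_mxKr mulmxK.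
move=> t tT; have [ct ctE] := gc t tT; have [dv vE] := gv t tT.
have [[x' [sx' cx'] xE'] dz] := zC t tT.
have sxt : sign_part I Om D s (point c (lsubmx (z t))) by rewrite -xE' coordK.
have ig := zU t tT.
suff Dt : D c (coord c (point c (lsubmx (z t))))
    (vel c (fun t => point c (lsubmx (z t))) t).
  split => //; first by rewrite vE.
  apply: le_trans (zB t tT); apply: norm_row_le => // i.
  have -> : vel c (fun t => point c (lsubmx (z t))) t 0 i =
      hamfield G c (z t) 0 (lshift 2 i).
    by rewrite vE /hamfield row_mxEl [in RHS]mxE -[in RHS](hsubmxK (z t)) derive_hamz_p.
  exact: norm_coord.
apply/(D_eigmat zero_real D_bisector _ s2 sxt ct).
have [Oxt _] := sxt.
set p := rsubmx (z t) in dv vE.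
have kz : vel c (fun t => point c (lsubmx (z t))) t *m
    (vmat I c (lsubmx (z t)) - l *: gram G c (lsubmx (z t))) = 0.
  have gut := gram_unit G ig.
  apply: (can_inj (mulmxKV gut)); rewrite mul0mx; apply/rowP => k.
  have := dz (rshift 2 k); rewrite -{1}[z t]hsubmxK derive_penz_p// => /eqP.
  by rewrite mulf_eq0 pnatr_eq0 /= => /eqP; rewrite vE => ->; rewrite mxE.
rewrite ctE; suff -> : eigmat I s c (lsubmx (z t)) =
  vmat I c (lsubmx (z t)) - l *: gram G c (lsubmx (z t)) by exact: kz.
rewrite /eigmat /pencil; congr (_ - _ *: _); apply/esym.
have dB : disc2 (vmat I c (lsubmx (z t))) < 0.
  by rewrite -ctE; exact: (vmat_disc2 zero_real Oxt ct).
have sl : 0 < s * l.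
  have h := (D_vform zero_real D_bisector v s2 sx cx).1 Dv.
  have [_ /(_ c v cx Dv v0)] := sx; rewrite h mulrA pmulr_lgt0//.
  exact: inner_gt0.
have vn0 : vel c (fun t => point c (lsubmx (z t))) t != 0.
  by have [] := gg t c tT ct.
apply: (eigval_unique s2 (gram_disc2 G ig) dB _ sl).
apply: degenerate2 vn0 kz; apply: symm2_pencil.
  exact: (gram_symm2 G ig).
exact: (vmat_symm2 I ig).
Qed.

End EigenvalueDerivative.

(** * Zeros of functions and uniqueness of solutions *)

Lemma nonzero_near {R : realType} (V : normedModType R) (f : V -> R) (p : V) :
  {for p, continuous f} -> f p != 0 -> exists m r sg : R,
    [/\ 0 < m, 0 < r, `|sg| = 1 & forall y, `|y - p| < r -> m <= sg * f y].
Proof.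
move=> fc f0; have dn : 0 < `|f p| / 2 by rewrite divr_gt0 ?normr_gt0.
have [r r0 rP] := (continuous_normP _ _).1 fc _ dn.
exists (`|f p| / 2), r, (Num.sg (f p)); split => //; first by rewrite normr_sg f0.
move=> y /rP h.
have : `|Num.sg (f p) * f y - `|f p| | < `|f p| / 2.
  by rewrite [X in _ - X]normrEsg -mulrBr normrM normr_sg f0 mul1r.
by rewrite ltr_distl => /andP[+ _]; lra.
Qed.

Section ZeroFinder.
Context {R : realType} {n : nat}.
Implicit Types (U : set 'rV[R]_n) (f : 'rV[R]_n -> R).

(** The derivative along the basis vector is at least m, so that a displacement of
|f y| / m is enough to change the sign of f. *)
Lemma zero_finder U f p j (m r0 sg : R) : open U -> smooth_on U f ->
  (forall y, `|y - p| < r0 -> U y) -> 0 < r0 -> f p = 0 -> 0 < m -> `|sg| = 1 ->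
  (forall y, `|y - p| < r0 -> m <= sg * 'D_(basis_vec j) f y) ->
  exists2 r : R, 0 < r & forall y, `|y - p| < r -> exists t : R,
    [/\ f (y + t *: basis_vec j) = 0, `|t| <= m^-1 * `|f y| &
        forall u : R, `|u| <= `|t| -> `|y + u *: basis_vec j - p| < r0].
Proof.
move=> oU sf rU r00 fp m0 sg1 mP.
have Up : U p by apply: rU; rewrite subrr normr0.
have e0 : 0 < m * (r0 / 2) by rewrite mulr_gt0 ?divr_gt0.
have [r r_0 rP] := (continuous_normP _ _).1 (smooth_continuous sf Up) _ e0.
exists (Num.min r (r0 / 2)); first by rewrite lt_min r_0 divr_gt0.
move=> y; rewrite lt_min => /andP[yr yr0].
have fy : `|f y| < m * (r0 / 2) by have := rP y yr; rewrite fp subr0.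
pose a := m^-1 * `|f y|.
have a0 : 0 <= a by rewrite mulr_ge0// invr_ge0 ltW.
have ar : a < r0 / 2 by rewrite /a mulrC ltr_pdivrMr// mulrC.
have ma : a * m = `|f y| by rewrite mulrC /a mulrA divff ?mul1r// gt_eqF.
have inb (u : R) : `|u| <= a -> `|y + u *: basis_vec j - p| < r0.
  move=> ua; rewrite addrAC; apply: le_lt_trans (ler_normD _ _) _.
  have h1 : `|u *: basis_vec j : 'rV[R]_n| <= `|u|.
    by rewrite normrZ ler_piMr// norm_basis_vec.
  lra.
have der (u : R) : `|u| <= a -> derivable f (y + u *: basis_vec j) (basis_vec j).
  by move=> /inb/rU; exact: smooth_derivable.
have step (u : R) : `|u| <= a -> exists2 d : R, m <= sg * d &
    f (y + u *: basis_vec j) = f y + u * d.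
  move=> ua; have dd (s : R) : `|s| <= `|u| ->
      derivable f (y + s *: basis_vec j) (basis_vec j).
    by move=> su; apply: der; exact: le_trans su ua.
  have [s su E] := @mvt_basis _ _ f y j u dd.
  exists ('D_(basis_vec j) f (y + s *: basis_vec j)); last by rewrite -E subrKC.
  by apply: mP; apply: inb; exact: le_trans su ua.
pose g (u : R) : R := sg * f (y + u *: basis_vec j).
have gc : {within `[- a, a], continuous g}.
  apply: derivable_within_continuous => u; rewrite in_itv/= -ler_norml => /der du.
  by have [] := is_deriveZ sg (derivable_line du).
have aa : - a <= a by rewrite ge0_cp.
have an : `|a| <= a by rewrite ger0_norm.
have ana : `|- a| <= a by rewrite normrN ger0_norm.
have sf0 : `|sg * f y| = `|f y| by rewrite normrM sg1 mul1r.
have ga : 0 <= g a.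
  have [d dm E] := step a an.
  rewrite /g E mulrDr mulrCA.
  have := ler_norm (- (sg * f y)); have := ler_wpM2l a0 dm.
  by rewrite normrN ma sf0; lra.
have gna : g (- a) <= 0.
  have [d dm E] := step (- a) ana.
  rewrite /g E mulrDr mulrCA mulNr.
  have := ler_norm (sg * f y); have := ler_wpM2l a0 dm.
  by rewrite ma sf0; lra.
have [c ca gc0] : exists2 c, c \in `[- a, a]%R & g c = 0.
  by apply: IVT => //; rewrite ge_min gna orTb le_max ga orbT.
have sgn0 : sg != 0 by rewrite -normr_eq0 sg1 oner_eq0.
exists c; have ca' : `|c| <= a by rewrite ler_norml; move: ca; rewrite in_itv.
split; [|exact: ca'|].
  by move/eqP: gc0; rewrite mulf_eq0 (negbTE sgn0) => /eqP.
by move=> u uc; apply: inb; apply: le_trans uc ca'.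
Qed.

Lemma partial_sign U f p j : open U -> U p -> smooth_on U f ->
  'D_(basis_vec j) f p != 0 -> exists (m r0 sg : R), [/\ 0 < m, 0 < r0, `|sg| = 1 &
    forall y, `|y - p| < r0 -> U y /\ m <= sg * 'D_(basis_vec j) f y].
Proof.
move=> oU Up sf d0.
have cd := smooth_continuous (smooth_partial j sf) Up.
have [m [r [sg [m0 r0 sg1 H]]]] := nonzero_near cd d0.
have [q q0 qP] := near_normI (open_normP oU Up) (ex_intro2 _ _ r r0 H).
by exists m, q, sg.
Qed.

Lemma is_derive_of_lt (g : R -> R) (d : R) : is_derive (0:R) 1 g d -> 0 < d ->
  exists2 e : R, 0 < e & forall t, 0 < t < e -> g 0 < g t.
Proof.
move=> [/cvg_ex[l lP] dE] d0.
have lE : l = d by rewrite -dE /derive; apply/esym/cvg_lim.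
move: lP; rewrite lE => /cvgrPdist_lt /(_ d d0) /= H.
have [e e0 eP] : exists2 e : R, 0 < e & forall h : R, `|h| < e -> h != 0 ->
    `|d - h^-1 *: (g (h *: 1 + 0) - g 0)| < d.
  have [e e0 eP] := H; exists e => // h he h0; apply: eP => //.
  by rewrite /ball_ /= sub0r normrN.
exists e => // t /andP[t0 te].
have := eP t; rewrite gtr0_norm// => /(_ te (lt0r_neq0 t0)).
rewrite addr0 [t *: 1]mulr1 ltr_distlC => /andP[+ _]; rewrite subrr.
by rewrite pmulr_rgt0 ?invr_gt0// subr_gt0.
Qed.

End ZeroFinder.

Lemma dist_self_lt {R : realType} (t e : R) : 0 < e -> `|t - t| < e.
Proof. by rewrite subrr normr0. Qed.

Lemma itv_nbhd {R : realType} (a b t : R) : a < t < b ->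
  exists2 e : R, 0 < e & forall u, `|u - t| < e -> a < u < b.
Proof.
move=> /andP[ta tb]; exists (Num.min (t - a) (b - t)).
  by rewrite lt_min !subr_gt0 ta tb.
move=> u; rewrite lt_min !ltr_norml => /andP[/andP[u1 u2] /andP[u3 u4]].
by apply/andP; split; clear -u1 u2 u3 u4; lra.
Qed.

Lemma near_itvP {R : realType} (a b t : R) : a < t < b -> \near t, a < t < b.
Proof. by move=> /itv_nbhd[e e0 eP]; apply/near_normP; exists e. Qed.

Section SolutionSmooth.
Context {R : realType} {n m : nat}.

(** Along a solution of an autonomous smooth equation, a smooth function has a
derivative which is again a smooth function of the position. *)
Lemma solution_smooth (U : set 'rV[R]_n) (X : 'rV[R]_n -> 'rV[R]_n)
    (F : 'rV[R]_n -> 'rV[R]_m) (x : R -> 'rV[R]_n) (a b : R) : open U ->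
  smooth_map_on U X -> smooth_map_on U F -> solution X x a b ->
  (forall t, a < t < b -> U (x t)) -> smooth_path_on a b (F \o x).
Proof.
move=> oU sX sF xX xU.
have der (H : 'rV[R]_n -> 'rV[R]_m) : smooth_map_on U H -> forall t, a < t < b ->
    is_derive t 1 (H \o x) (\row_i \sum_l X (x t) 0 l * 'D_(basis_vec l) (fun y => H y 0 i) (x t)).
  move=> sH t tab; apply/is_derive_rowP => i; rewrite mxE.
  exact: is_derive_comp_row (smooth_differentiable oU (sH i) (xU t tab)) (xX t tab).
have iter k : exists2 H : 'rV[R]_n -> 'rV[R]_m, smooth_map_on U H &
    forall t, a < t < b -> derive1n k (F \o x) t = H (x t).
  elim: k => [|k [H sH HE]]; first by exists F.
  exists (fun y => \row_i \sum_l X y 0 l * 'D_(basis_vec l) (fun y => H y 0 i) y).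
    move=> i; apply: (smooth_ext oU (f := fun y => \sum_l X y 0 l *
        'D_(basis_vec l) (fun y => H y 0 i) y)); first by move=> y _; rewrite mxE.
    apply: (smooth_sum _ oU) => l; apply: (smoothM oU); first exact: sX.
    exact: (smooth_partial l (sH i)).
  move=> t tab; rewrite derive1nS.
  suff [_ <-] : is_derive t 1 (derive1n k (F \o x)) (\row_i \sum_l X (x t) 0 l *
     'D_(basis_vec l) (fun y => H y 0 i) (x t)) by rewrite derive1E.
  apply: near_eq_is_derive (der H sH t tab).
  by apply: filterS (near_itvP tab) => u uab; rewrite HE.
move=> k t tab; have [H sH HE] := iter k.
suff [h _] : is_derive t 1 (derive1n k (F \o x)) (\row_i \sum_l X (x t) 0 l *
   'D_(basis_vec l) (fun y => H y 0 i) (x t)) by [].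
apply: near_eq_is_derive (der H sH t tab).
by apply: filterS (near_itvP tab) => u uab; rewrite HE.
Qed.

End SolutionSmooth.

Section Uniqueness.
Context {R : realType}.

Lemma sign_or (k : R) : k ^+ 2 = 1 -> k = 1 \/ k = -1.
Proof.
move=> /eqP; rewrite -[1 in X in X -> _](expr1n _ 2) eqf_sqr => /orP[/eqP ->|/eqP ->].
  by left.
by right.
Qed.

Lemma same_sign (k l p q : R) : k ^+ 2 = 1 -> l ^+ 2 = 1 -> p != 0 ->
  `|l * q ^+ 2 - k * p ^+ 2| < `|k * p ^+ 2| -> k = l.
Proof.
move=> k1 l1 p0; have pp : 0 < p ^+ 2 by rewrite exprn_even_gt0.
have qq := sqr_ge0 q; move: (p ^+ 2) (q ^+ 2) pp qq => P Q PP QQ.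
have [->|->] := sign_or k1; have [->|->] := sign_or l1 => //.
  by rewrite mul1r mulN1r (gtr0_norm PP) ltr_distl => /andP[]; lra.
by rewrite mul1r mulN1r normrN (gtr0_norm PP) ltr_distl => /andP[]; lra.
Qed.

Lemma solution_unique n (U : set 'rV[R]_n) (X : 'rV[R]_n -> 'rV[R]_n)
    (x y : R -> 'rV[R]_n) (t e : R) : open U -> smooth_map_on U X -> 0 < e ->
  solution X x (t - e) (t + e) -> solution X y (t - e) (t + e) -> x t = y t ->
  U (x t) -> exists2 d : R, 0 < d & forall u, `|u - t| < d -> x u = y u.
Proof.
move=> oU sX e0 xX yX xy Ux.
have te : t - e < t < t + e by rewrite ltrBlDr ltrDl e0.
have [r [L [r0 L0 _ lip]]] := smooth_map_lipschitz oU Ux sX.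
have [d1 d10 P1] := (continuous_normP _ _).1 (is_derive_path_cont (xX t te)) r r0.
have [d2 d20 P2] := (continuous_normP _ _).1 (is_derive_path_cont (yX t te)) r r0.
pose T := Num.min (Num.min e (2 * (L + 1))^-1) (Num.min d1 d2).
have L1 : 0 < 2 * (L + 1) by rewrite mulr_gt0// ltr_wpDl.
have T0 : 0 < T by rewrite !lt_min e0 d10 d20 invr_gt0 L1.
have LT : L * T <= 2^-1.
  apply: le_trans (_ : L * (2 * (L + 1))^-1 <= _).
    by rewrite ler_wpM2l// /T !ge_min lexx orbT.
  by rewrite ler_pdivrMr//; lra.
have sh z : solution X z (t - e) (t + e) -> solution X (fun u => z (u + t)) (- T) T.
  move=> zX u uT; apply: (solution_shift zX).
  have Te : T <= e by rewrite /T !ge_min lexx.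
  by move: uT => /andP[u1 u2]; apply/andP; split; clear -u1 u2 Te; lra.
exists T => // u ut.
have uT : - T < u - t < T by rewrite -ltr_norml.
have := solution_dist L0 LT lip (sh x xX) (sh y yX) _ _ uT.
rewrite subrK add0r xy subrr normr0 mulr0 normr_le0 subr_eq0 => h; apply/eqP; apply: h.
  move=> v; rewrite -ltr_norml => vT; rewrite -xy; apply: ltW; apply: P1.
  by rewrite addrK; apply: lt_le_trans vT _; rewrite /T !ge_min lexx orbT.
move=> v; rewrite -ltr_norml => vT; apply: ltW; apply: P2.
by rewrite addrK; apply: lt_le_trans vT _; rewrite /T !ge_min lexx !orbT.
Qed.

End Uniqueness.

(** * Functions on intervals *)

Section RealLine.
Context {R : realType}.

Lemma sweep (f df : R -> R) (sg m T a : R) : 0 < T -> `|sg| = 1 ->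
  (forall t, - T < t < T -> is_derive t 1 f (df t) /\ m <= sg * df t) ->
  `|a - f 0| <= m * (T / 2) -> exists2 t : R, - T < t < T & f t = a.
Proof.
move=> T0 sg1 H af; pose h := T / 2; have h0 : 0 < h by rewrite divr_gt0.
have hT : h < T by rewrite /h; lra.
have inT (t : R) : - h <= t <= h -> - T < t < T by move=> /andP[u v]; apply/andP; split; lra.
pose g (t : R) : R := sg * f t.
have dg (t : R) : - T < t < T -> is_derive t 1 g (sg * df t).
  by move=> /H[d _]; exact: is_deriveZ.
have gc (x y : R) : - h <= x -> y <= h -> {within `[x, y], continuous g}.
  move=> hx hy; apply: derivable_within_continuous => t; rewrite in_itv/= => /andP[u v].
  by have [] := dg t (inT t _); first by rewrite (le_trans hx u) (le_trans v hy).
have grow (x y : R) : - h <= x -> y <= h -> x < y -> m * (y - x) <= g y - g x.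
  move=> hx hy xy; have [|z zxy ->] := @MVT R g (fun t => sg * df t) x y xy _ (gc x y hx hy).
    move=> t; rewrite in_itv/= => /andP[u v]; apply: dg; apply: inT.
    by rewrite (le_trans hx (ltW u)) (le_trans (ltW v) hy).
  apply: ler_wpM2r; first by rewrite subr_ge0 ltW.
  move: zxy; rewrite in_itv/= => /andP[u v]; have [] := H z => //; apply: inT.
  by rewrite (le_trans hx (ltW u)) (le_trans (ltW v) hy).
have hh : - h <= h by rewrite ge0_cp// ltW.
have nh0 : - h < 0 by rewrite oppr_lt0.
have g1 := grow 0 h (ltW nh0) (lexx _) h0; have g2 := grow (- h) 0 (lexx _) (ltW h0) nh0.
rewrite subr0 in g1; rewrite sub0r opprK in g2.
have saf : `|sg * a - g 0| <= m * h by rewrite /g -mulrBr normrM sg1 mul1r.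
have [t th gt] : exists2 t, t \in `[- h, h]%R & g t = sg * a.
  apply: IVT => //; first exact: gc.
  move: saf; rewrite ler_norml => /andP[s1 s2].
  rewrite ge_min le_max; apply/andP; split; apply/orP; [left|right]; lra.
exists t; first by apply: inT; move: th; rewrite in_itv.
have sg0 : sg != 0 by rewrite -normr_eq0 sg1 oner_eq0.
exact: mulfI sg0 _ _ gt.
Qed.

(** Under these hypotheses Q a (max a u) is locally constant in u. *)
Lemma interval_induction (Q : R -> R -> Prop) (a b : R) :
  (forall x y z, x <= y <= z -> Q x y -> Q y z -> Q x z) ->
  (forall x y z, x <= y <= z -> Q x z -> Q x y) ->
  (forall t, exists2 d : R, 0 < d & forall x y, t - d < x -> x <= y -> y < t + d -> Q x y) ->
  a <= b -> Q a b.
Proof.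
move=> Qadd Qsub Qloc ab.
suff : Q a (Num.max a b) by rewrite max_r.
apply: (@locally_const _ (fun u => Q a (Num.max a u)) (a - 1) (b + 1) a b).
- move=> u _; have [d d0 H] := Qloc (Num.max a u); exists d => // v /andP[v1 v2].
  have au : a <= Num.max a u by rewrite le_max lexx.
  have av : a <= Num.max a v by rewrite le_max lexx.
  have dv : `|Num.max a v - Num.max a u| < d.
    by apply: le_lt_trans (max_dist _ _ _) _; rewrite ltr_distl v1 v2.
  move: dv; rewrite ltr_distl => /andP[w1 w2].
  have dd : Num.max a u < Num.max a u + d by rewrite ltrDl.
  have dd' : Num.max a u - d < Num.max a u by rewrite ltrBlDr ltrDl.
  have [uv|/ltW vu] := leP (Num.max a u) (Num.max a v); split => q.
  + by apply: Qsub q; rewrite au uv.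
  + by apply: Qadd q _; [rewrite au uv|exact: H].
  + by apply: Qadd q _; [rewrite av vu|exact: H].
  + by apply: Qsub q; rewrite av vu.
- by rewrite ltrBlDr ltrDl ltr01 (le_lt_trans ab)// ltrDl.
- by rewrite [b < _]ltrDl ltr01 andbT (lt_le_trans _ ab)// ltrBlDr ltrDl.
rewrite max_l//; have [d d0 H] := Qloc a; apply: H => //.
  by rewrite ltrBlDr ltrDl.
by rewrite ltrDl.
Qed.

(** The infimum of the times spent outside W is attained, since the complement of W is
closed. *)
Lemma first_exit (N : topologicalType) (k : R -> N) (W : set N) (a b : R) : open W -> a <= b ->
  (forall t, a <= t <= b -> {for t, continuous k}) -> W (k a) -> ~ W (k b) ->
  exists2 t : R, a < t <= b & ~ W (k t) /\ forall u, a <= u < t -> W (k u).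
Proof.
move=> oW ab kc Wa Wb; pose A := [set t : R | a <= t <= b /\ ~ W (k t)].
have Ab : A b by split => //; rewrite ab lexx.
have hA : has_inf A.
  by split; [exists b|exists a => t [/andP[]]].
pose t0 := inf A.
have t0a : a <= t0 by apply: lb_le_inf; [exists b|move=> t [/andP[]]].
have t0b : t0 <= b by apply: ge_inf; [exact: hA.2|].
have Wu u : a <= u < t0 -> W (k u).
  move=> /andP[au ut]; apply: contrapT => nW.
  have : t0 <= u by apply: ge_inf; [exact: hA.2|split => //; rewrite au (le_trans (ltW ut))].
  by rewrite leNgt ut.
have t0ab : a <= t0 <= b by rewrite t0a.
have nW : ~ W (k t0).
  move=> W0; have [r r0 rP] := preimage_norm (kc t0 t0ab) oW W0.
  have [v [/andP[av vb] nWv] vr] := inf_adherent r0 hA.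
  have t0v : t0 <= v by apply: ge_inf; [exact: hA.2|split => //; rewrite av vb].
  by apply: nWv; apply: rP; rewrite ger0_norm ?subr_ge0// ltrBlDl.
exists t0 => //; rewrite t0b andbT lt_neqAle t0a andbT.
by apply/eqP => E; apply: nW; rewrite -E.
Qed.

Lemma first_zero (f : R -> R) (d t1 : R) : is_derive (0:R) 1 f d -> 0 < d -> f 0 = 0 ->
  0 < t1 -> (forall t, 0 <= t <= t1 -> {for t, continuous f}) -> f t1 < 0 ->
  exists2 l : R, 0 < l <= t1 & f l = 0 /\ forall t, 0 < t < l -> 0 < f t.
Proof.
move=> df d0 f0 t10 fc ft1; have [e e0 eP] := is_derive_of_lt df d0.
rewrite f0 in eP.
pose a := Num.min (e / 2) t1.
have a0 : 0 < a by rewrite lt_min divr_gt0.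
have ae : a < e by rewrite /a gt_min; apply/orP; left; lra.
have at1 : a <= t1 by rewrite /a ge_min lexx orbT.
have oW : open [set u : R | 0 < u] by exact: open_gt.
have fc' t : a <= t <= t1 -> {for t, continuous f}.
  by move=> /andP[ta tt]; apply: fc; rewrite (le_trans (ltW a0) ta) tt.
have Wa : [set u : R | 0 < u] (f a) by apply: eP; rewrite a0.
have Wb : ~ [set u : R | 0 < u] (f t1) by move=> /=; rewrite ltNge (ltW ft1).
have [l /andP[al lt] [nW Wu]] := first_exit oW at1 fc' Wa Wb.
have pos t : 0 < t < l -> 0 < f t.
  move=> /andP[t0 tl]; have [ta|ta] := leP a t; first by apply: Wu; rewrite ta.
  by apply: eP; rewrite t0 (lt_trans ta ae).
exists l; first by rewrite (lt_trans a0 al).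
split => //; apply/eqP; rewrite eq_le; apply/andP; split.
  by rewrite leNgt; apply/negP.
rewrite leNgt; apply/negP => fl.
have oN : open [set u : R | u < 0] by exact: open_lt.
have alt : a <= l <= t1 by rewrite (ltW al).
have [r r0 rP] := preimage_norm (fc' l alt) oN fl.
pose u := Num.max a (l - r / 2).
have ul : u < l by rewrite gt_max al /=; lra.
have ua : a <= u by rewrite le_max lexx.
have ur : l - r / 2 <= u by rewrite le_max lexx orbT.
have h1 : 0 < f u by apply: Wu; rewrite ua ul.
have h2 : f u < 0 by apply: rP; rewrite ltr_distl; apply/andP; split; lra.
by move: (lt_trans h1 h2); rewrite ltxx.
Qed.

Definition rot2 (q : 'rV[R]_2) : 'rV[R]_2 := \row_i (if i == 0 then - q 0 1 else q 0 0).

Lemma rot2E q : rot2 q 0 0 = - q 0 1 /\ rot2 q 0 1 = q 0 0.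
Proof. by rewrite !mxE. Qed.

Lemma rot2_eq0 q : rot2 q = 0 -> q 0 0 = 0 /\ q 0 1 = 0.
Proof.
have [h0 h1] := rot2E q; move=> h; move: h0 h1; rewrite h !mxE => h0 <-.
by split => //; apply/eqP; rewrite -oppr_eq0 -h0.
Qed.

Lemma half_plus_twice (a b k e : R) : a < e / 2 -> b < 2 * k -> k <= e / 4 -> b + a < e.
Proof. by lra. Qed.

Lemma twice_quarter (k e : R) : 0 < k -> k <= e / 4 -> 2 * k <= e.
Proof. by lra. Qed.

Lemma cos_sin_near (k : R) : 0 < k -> exists2 e : R, 0 < e &
  forall t, `|t| < e -> `|cos t - 1| < k /\ `|sin t| < k.
Proof.
move=> k0.
have [e e0 eP] := (continuous_normP _ _).1 (@continuous_cos R 0) k k0.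
have [d d0 dP] := (continuous_normP _ _).1 (@continuous_sin R 0) k k0.
exists (Num.min e d); first by rewrite lt_min e0.
move=> t; rewrite lt_min => /andP[te td]; split.
  by have := eP t; rewrite subr0 cos0; apply.
by have := dP t; rewrite subr0 sin0 subr0; apply.
Qed.

Lemma norm_lsubmx m n (z : 'rV[R]_(m + n)) : `|lsubmx z| <= `|z|.
Proof.
apply: norm_row_le => [|i]; first exact: normr_ge0.
by rewrite mxE; exact: norm_coord.
Qed.

End RealLine.

(** * The eigenvalue as a function on the surface *)

Section WallGeometry.
Context {R : realType} {M : topologicalType} (S : surface R M) (G : metric S).
Context (I : quadratic_integral G) (Om : set M) (D : directions S).
Hypothesis Om_open : open Om.
Hypothesis zero_real : forall x, Om x -> two_real_zero_directions I x.
Hypothesis D_bisector : bisector_foliation I Om D.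
Implicit Types (c : chart S) (x : M) (y v : 'rV[R]_2) (g : R -> M).

Lemma smooth_curve_chart c g (a b t : R) : smooth_curve S g a b -> a < t < b ->
  dom c (g t) -> exists e : R, [/\ 0 < e, forall u, t - e < u < t + e -> dom c (g u) &
    forall u, t - e < u < t + e -> derivable (coord c \o g) u 1].
Proof.
move=> sg tab ct; have [e e0 [ec eS]] := sg t c tab ct.
by exists e; split => // u ue; exact: (eS 0%N u ue).
Qed.

Lemma smooth_curve_continuous g (a b t : R) : smooth_curve S g a b -> a < t < b ->
  {for t, continuous g}.
Proof.
move=> sg tab; have [c ct] := dom_cover S (g t).
have [e [e0 ec ed]] := smooth_curve_chart sg tab ct.
apply: (chart_curve_continuous e0 ec); apply: ed.
by rewrite ltrBlDr ltrDl e0.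
Qed.

Lemma smooth_curve_vel c g (a b t : R) : smooth_curve S g a b -> a < t < b ->
  dom c (g t) -> is_derive t 1 (coord c \o g) (vel c g t).
Proof.
move=> sg tab ct; have [e [e0 ec ed]] := smooth_curve_chart sg tab ct.
by apply: vel_is_derive; apply: ed; rewrite ltrBlDr ltrDl e0.
Qed.

Lemma in_itv1 (t : R) : t - 1 < t < t + 1.
Proof. by rewrite ltrBlDr ltrDl ltr01. Qed.

Definition chart_at x : chart S := sval (cid (dom_cover S x)).

Lemma chart_atP x : dom (chart_at x) x.
Proof. by rewrite /chart_at; case: cid. Qed.

(** On sign_part the value does not depend on the chart. *)
Definition lamM (s : R) x : R := eiglam I s (chart_at x) (coord (chart_at x) x).

Section Sign.
Variable s : R.
Hypothesis s2 : s ^+ 2 = 1.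
Let sp := sign_part I Om D s.
Let lam c := eiglam I s c.

Lemma lamM_chart x c : sp x -> dom c x -> lamM s x = lam c (coord c x).
Proof.
move=> sx cx; apply: (eiglam_change zero_real D_bisector s2 sx).
by split; [exact: chart_atP|].
Qed.

Definition dlam c x v : R := \sum_k v 0 k * 'D_(basis_vec k) (lam c) (coord c x).

Lemma dlam_scale c x (k : R) v : dlam c x (k *: v) = k * dlam c x v.
Proof. by rewrite /dlam mulr_sumr; apply: eq_bigr => i _; rewrite scale_row mulrA. Qed.

Lemma dlam_add c x (u : 'rV[R]_2) v : dlam c x (u + v) = dlam c x u + dlam c x v.
Proof.
by rewrite /dlam -big_split /=; apply: eq_bigr => i _; rewrite add_row mulrDl.
Qed.

Lemma lam_differentiable c x : Om x -> dom c x -> differentiable (lam c) (coord c x).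
Proof.
move=> Ox cx; apply: (smooth_differentiable (@om_image_open _ _ _ _ Om_open c)
  (eiglam_smooth (I:=I) Om_open zero_real s (c:=c))).
by exists x.
Qed.

Lemma sp_open : open sp.
Proof. exact: (sign_part_open Om_open D_bisector). Qed.

Lemma lamM_derive c g (t : R) v : sp (g t) -> dom c (g t) -> {for t, continuous g} ->
  is_derive t 1 (coord c \o g) v -> is_derive t 1 (lamM s \o g) (dlam c (g t) v).
Proof.
move=> st ct gc dv; have [Ot _] := st.
have d := is_derive_comp_row (lam_differentiable Ot ct) dv.
have [r r0 rP] := preimage_norm gc (openI sp_open (@dom_open _ _ S c)) (conj st ct).
apply: near_eq_is_derive d; apply/near_normP; exists r => // u /rP[su cu].
by rewrite /= (lamM_chart su cu).
Qed.

Lemma dlam_change c c' x v : sp x -> in_both c c' x ->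
  dlam c x v = dlam c' x (v *m transition c c' x).
Proof.
move=> sx cc; have [cx c'x] := cc.
pose L (h : R) := coord c x + h *: v; pose g := point c \o L.
have L0 : L 0 = coord c x by rewrite /L scale0r addr0.
have g0 : g 0 = x by rewrite /g /= L0 coordK.
have dL : is_derive (0:R) 1 L v := is_derive_affine _ _ _.
have iL : img c (L 0) by rewrite L0; exists x.
have [e e0 eP] := near_in_chart iL (is_derive_path_cont dL) (erefl g).
have ec u : 0 - e < u < 0 + e -> dom c (g u) by move=> /eP[].
have dg : is_derive (0:R) 1 (coord c \o g) v.
  apply: near_eq_is_derive dL; apply/near_normP; exists e => // u.
  by rewrite ltr_distl => /eP[_ h]; rewrite /= h.
have gd : derivable (coord c \o g) 0 1 by have [] := dg.
have gc := chart_curve_continuous e0 ec gd.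
have cc0 : in_both c c' (g 0) by rewrite g0.
have [dg' _] := vel_transition e0 cc0 ec gd.
rewrite (velE dg) in dg'.
have s0 : sp (g 0) by rewrite g0.
have h1 := lamM_derive s0 cc0.1 gc dg; have h2 := lamM_derive s0 cc0.2 gc dg'.
by have := is_derive_unique h1 h2; rewrite g0.
Qed.

Lemma dlam_D c x v : sp x -> dom c x -> D c (coord c x) v -> dlam c x v = 0.
Proof. by move=> sx cx; exact: (eiglam_along Om_open zero_real D_bisector s2 sx cx). Qed.

Lemma lamM_integral_curve g (a b u t : R) (A : set M) : (forall x, A x -> sp x) ->
  integral_curve D A g a b -> a < u < b -> a < t < b -> lamM s (g u) = lamM s (g t).
Proof.
move=> Asp [[sg _] H]; apply: (const_of_derive0 (f := lamM s \o g)) => r rab.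
have [/Asp sr Dr] := H r rab; have [c cr] := dom_cover S (g r).
have := lamM_derive sr cr (smooth_curve_continuous sg rab) (smooth_curve_vel sg rab cr).
by rewrite (dlam_D sr cr (Dr c cr)).
Qed.

(** Both sides are lines in v, and one contains the other by dlam_D. *)
Lemma D_dlam c x v : sp x -> dom c x ->
  (exists k, 'D_(basis_vec k) (lam c) (coord c x) != 0) ->
  D c (coord c x) v <-> dlam c x v = 0.
Proof.
move=> sx cx [k k0]; split; first exact: dlam_D.
move=> dv; have [Ox _] := sx.
have [X X0 XP] := D_line D_bisector Ox cx.
have DX : D c (coord c x) X by apply/XP; exists 1; rewrite scale1r.
have := dlam_D sx cx DX; move: dv; rewrite /dlam !sum2 => dv dX.
set d0 := 'D_(basis_vec 0) _ _ in dv dX; set d1 := 'D_(basis_vec 1) _ _ in dv dX.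
have dn : d0 != 0 \/ d1 != 0.
  by move: k0; have [->|->] : k = 0 \/ k = 1;
    [case: k => [[|[|//]] hk]; [left|right]; apply: val_inj|left|right].
have cr : v 0 0 * X 0 1 - v 0 1 * X 0 0 = 0.
  clearbody d0 d1; case: dn => n; apply: (mulfI n); rewrite mulr0.
    transitivity ((v 0 0 * d0 + v 0 1 * d1) * X 0 1 - (X 0 0 * d0 + X 0 1 * d1) * v 0 1).
      by ring.
    by rewrite dv dX !mul0r subrr.
  transitivity ((X 0 0 * d0 + X 0 1 * d1) * v 0 0 - (v 0 0 * d0 + v 0 1 * d1) * X 0 0).
    by ring.
  by rewrite dv dX !mul0r subrr.
apply/XP; have e : v 0 0 * X 0 1 = v 0 1 * X 0 0 by apply/eqP; rewrite -subr_eq0 cr.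
have [n|n] := row2_neq0 X0.
  exists (v 0 0 / X 0 0); apply: row2P; rewrite mxE; first by rewrite divfK.
  by rewrite mulrAC e mulfK.
exists (v 0 1 / X 0 1); apply: row2P; rewrite mxE; last by rewrite divfK.
by rewrite mulrAC -e mulfK.
Qed.

Lemma ord2P (k : 'I_2) : k = 0 \/ k = 1.
Proof. by case: k => [[|[|//]] hk]; [left|right]; apply: val_inj. Qed.

Lemma gradient_transfer (v : 'rV[R]_2) (f h : 'I_2 -> R) (j k : 'I_2) : v != 0 ->
  v 0 0 * f 0 + v 0 1 * f 1 = 0 -> v 0 0 * h 0 + v 0 1 * h 1 = 0 ->
  f j != 0 -> h k != 0 -> h j != 0.
Proof.
move=> v0 vf vh fj hk; apply/eqP => hj; case/negP: v0; apply/eqP.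
move: fj hk hj vf vh; have [->|->] := ord2P j; have [->|->] := ord2P k;
  move=> fj hk hj; rewrite ?hj ?eqxx// in hk *.
- rewrite mulr0 add0r => vf /eqP; rewrite mulf_eq0 (negbTE hk) orbF => /eqP v1.
  move: vf; rewrite v1 mul0r addr0 => /eqP; rewrite mulf_eq0 (negbTE fj) orbF => /eqP v0.
  by apply: row2P; rewrite ?v0 ?v1 mxE.
- rewrite mulr0 addr0 => vf /eqP; rewrite mulf_eq0 (negbTE hk) orbF => /eqP v0.
  move: vf; rewrite v0 mul0r add0r => /eqP; rewrite mulf_eq0 (negbTE fj) orbF => /eqP v1.
  by apply: row2P; rewrite ?v0 ?v1 mxE.
Qed.

Lemma sign_image_lam c : smooth_on (sign_image I Om D s c) (lam c).
Proof.
apply: (smooth_sub _ (eiglam_smooth (I:=I) Om_open zero_real s (c:=c))).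
by move=> y [x [[Ox _] cx] <-]; exists x.
Qed.

Lemma lam_attains c y (V : set 'rV[R]_2) k : sign_image I Om D s c y -> open V -> V y ->
  'D_(basis_vec k) (lam c) y != 0 -> exists2 r : R, 0 < r & forall a : R,
    `|a - lam c y| < r -> exists2 z, V z & lam c z = a.
Proof.
move=> sy oV Vy kn; pose U := V `&` sign_image I Om D s c.
have oU : open U by apply: openI => //; exact: sign_image_open Om_open D_bisector s c.
have Uy : U y by split.
have sl : smooth_on U (lam c) by apply: smooth_sub (@sign_image_lam c) => z [].
have [m [r [sg [m0 r0 sg1 H]]]] := partial_sign oU Uy sl kn.
pose h := r / 2; have h0 : 0 < h by rewrite divr_gt0.
have hr (u : R) : `|u| <= h -> `|y + u *: basis_vec k - y| < r.
  move=> uh; rewrite addrAC subrr add0r.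
  have h1 : `|u *: basis_vec k : 'rV[R]_2| <= `|u|.
    by rewrite normrZ ler_piMr// norm_basis_vec.
  by move: h1 uh h0; rewrite /h => h1 uh h0; lra.
have dd (u : R) : `|u| <= h -> derivable (lam c) (y + u *: basis_vec k) (basis_vec k).
  by move=> /hr/H[Uz _]; exact: smooth_derivable sl Uz.
exists (m * h); first by rewrite mulr_gt0.
move=> a ar; pose g (u : R) : R := sg * lam c (y + u *: basis_vec k).
have gc : {within `[- h, h], continuous g}.
  apply: derivable_within_continuous => u; rewrite in_itv/= -ler_norml => /dd du.
  by have [] := is_deriveZ sg (derivable_line du).
have step (u : R) : `|u| <= h -> exists2 d : R, m <= sg * d &
    lam c (y + u *: basis_vec k) = lam c y + u * d.
  move=> uh; have du (z : R) : `|z| <= `|u| ->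
      derivable (lam c) (y + z *: basis_vec k) (basis_vec k).
    by move=> zu; apply: dd; exact: le_trans zu uh.
  have [z zu E] := mvt_basis du.
  exists ('D_(basis_vec k) (lam c) (y + z *: basis_vec k)); last by rewrite -E subrKC.
  by have [] := H _ (hr z (le_trans zu uh)).
have hh : `|h| <= h by rewrite gtr0_norm.
have hnh : `|- h| <= h by rewrite normrN gtr0_norm.
have sga : `|sg * (a - lam c y)| < m * h by rewrite normrM sg1 mul1r.
have [u ua gu] : exists2 u, u \in `[- h, h]%R & g u = sg * a.
  apply: IVT => //; first by rewrite ge0_cp// ltW.
  have [d1 d1m E1] := step _ hh; have [d2 d2m E2] := step _ hnh.
  rewrite ge_min le_max /g E1 E2; move: sga; rewrite ltr_norml => /andP[a1 a2].
  have q1 := ler_wpM2r (ltW h0) d1m; have q2 := ler_wpM2r (ltW h0) d2m.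
  apply/andP; split; apply/orP; [left|right]; clear -a1 a2 q1 q2; lra.
have sg0 : sg != 0 by rewrite -normr_eq0 sg1 oner_eq0.
exists (y + u *: basis_vec k); last exact: mulfI sg0 _ _ gu.
have uh : `|u| <= h by rewrite ler_norml; move: ua; rewrite in_itv.
by have [[]] := H _ (hr u uh).
Qed.

(** * Arcs of the foliation *)

Definition good : set M := [set x | sp x /\ exists c, dom c x /\
  exists k, 'D_(basis_vec k) (lam c) (coord c x) != 0].

Definition good_image c := coord c @` (good `&` dom c).

Lemma good_chart c x : good x -> dom c x ->
  exists k, 'D_(basis_vec k) (lam c) (coord c x) != 0.
Proof.
move=> [sx [c' [c'x [k kn]]]] cx; apply: contrapT => /forallNP crit.
have {}crit i : 'D_(basis_vec i) (lam c) (coord c x) = 0.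
  by apply/eqP; apply: contrapT => /negP h; exact: (crit i h).
have cc : in_both c' c x by [].
case/negP: kn; apply/eqP.
transitivity (dlam c' x (basis_vec k)).
  rewrite /dlam (bigD1 k)//= basis_vecE eqxx mul1r big1 ?addr0// => i ik.
  by rewrite basis_vecE (negbTE ik) mul0r.
rewrite (dlam_change _ sx cc) /dlam big1// => i _.
by rewrite crit mulr0.
Qed.

Lemma good_sp x : good x -> sp x. Proof. by case. Qed.

Lemma good_Om x : good x -> Om x. Proof. by case=> [[]]. Qed.

Lemma good_open : open good.
Proof.
rewrite openE => x [sx [c [cx [k kn]]]].
have sy : sign_image I Om D s c (coord c x) by exists x.
have oS : open (sign_image I Om D s c) by exact: sign_image_open.
have [m [r [sg [m0 r0 _ rP]]]] := partial_sign oS sy (@sign_image_lam c) kn.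
have cc := coord_continuous cx.
have H1 : \forall y \near coord c x, ('D_(basis_vec k) (lam c)) y != 0.
  apply/near_normP; exists r => // y /rP[_ h]; apply/eqP => d0.
  by move: (lt_le_trans m0 h); rewrite d0 mulr0 ltxx.
have H2 : \forall z \near x, 'D_(basis_vec k) (lam c) (coord c z) != 0 by exact: cc H1.
have H3 : \forall z \near x, (sp `&` dom c) z.
  by apply: open_nbhs_nbhs; split; [apply: openI; [exact: sp_open|exact: dom_open]|].
apply: filterS2 H2 H3 => z kz [sz cz]; split => //.
by exists c; split => //; exists k.
Qed.

Lemma good_image_open c : open (good_image c).
Proof. exact: chart_image_open good_open. Qed.

Lemma good_image_sign c y : good_image c y -> sign_image I Om D s c y.
Proof. by move=> [x [[sx _] cx] <-]; exists x. Qed.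

Lemma good_image_img c y : good_image c y -> img c y.
Proof. by move=> [x [_ cx] <-]; exists x. Qed.

Lemma good_imageP c y : good_image c y -> good (point c y) /\ dom c (point c y).
Proof. by move=> [x [gx cx] <-]; rewrite (coordK cx). Qed.

Definition levdir c y : 'rV[R]_2 :=
  \row_k (if k == 0 then 'D_(basis_vec 1) (lam c) y else - 'D_(basis_vec 0) (lam c) y).

(** The sign depends on the orientation of the chart; only the field up to sign is
global. *)
Definition ufield c y : 'rV[R]_2 := (speed G c y (levdir c y))^-1 *: levdir c y.

Lemma levdir_neq0 c x : good x -> dom c x -> levdir c (coord c x) != 0.
Proof.
move=> gx cx; have [k kn] := good_chart gx cx.
apply/eqP => /rowP h; have h0 := h 0; have h1 := h 1; rewrite !mxE /= in h0 h1.
case/negP: kn; have [->|->] := ord2P k; first by rewrite -[X in X == _]opprK h1 oppr0.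
by rewrite h0.
Qed.

Lemma levdir_D c x v : good x -> dom c x ->
  D c (coord c x) v <-> exists k : R, v = k *: levdir c (coord c x).
Proof.
move=> gx cx; have sx := good_sp gx; have Ox := good_Om gx.
have n0 := levdir_neq0 gx cx; have ex := good_chart gx cx.
have DL : D c (coord c x) (levdir c (coord c x)).
  by apply/(D_dlam _ sx cx ex); rewrite /dlam sum2 !row_entry /=; ring.
have [X X0 XP] := D_line D_bisector Ox cx.
have [a aE] := (XP _).1 DL.
have a0 : a != 0 by apply/eqP => a0; case/negP: n0; rewrite aE a0 scale0r.
split=> [/XP[k ->]|[k ->]].
  by exists (k / a); rewrite aE scalerA divfK.
by apply/XP; exists (k * a); rewrite aE scalerA.
Qed.

Lemma levdir_speed c x : good x -> dom c x ->
  0 < inner G c (coord c x) (levdir c (coord c x)) (levdir c (coord c x)).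
Proof.
by move=> gx cx; apply: inner_gt0; [exists x|exact: levdir_neq0].
Qed.

Lemma ufield_D c x v : good x -> dom c x ->
  D c (coord c x) v <-> exists k : R, v = k *: ufield c (coord c x).
Proof.
move=> gx cx; rewrite (levdir_D _ gx cx).
have n : speed G c (coord c x) (levdir c (coord c x)) != 0.
  by rewrite /speed gt_eqF// sqrtr_gt0 levdir_speed.
split=> [[k ->]|[k ->]].
  by exists (k * speed G c (coord c x) (levdir c (coord c x))); rewrite /ufield scalerA mulfK.
by eexists; rewrite /ufield scalerA.
Qed.

Lemma ufield_unit c x : good x -> dom c x ->
  inner G c (coord c x) (ufield c (coord c x)) (ufield c (coord c x)) = 1.
Proof.
move=> gx cx; have p := levdir_speed gx cx.
rewrite /ufield /inner quad_scale -/(inner G c (coord c x) _ _) exprVn.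
by rewrite /speed sqr_sqrtr ?ltW// mulVf ?gt_eqF.
Qed.

Lemma unit_multiple c x v : good x -> dom c x -> D c (coord c x) v ->
  inner G c (coord c x) v v = 1 ->
  exists k : R, k ^+ 2 = 1 /\ v = k *: ufield c (coord c x).
Proof.
move=> gx cx /(ufield_D _ gx cx)[k ->]; rewrite /inner quad_scale.
rewrite -/(inner G c (coord c x) _ _) (ufield_unit gx cx) mulr1 => k1.
by exists k.
Qed.

Lemma levdir_smooth c : smooth_map_on (good_image c) (levdir c).
Proof.
have sl := smooth_sub (@good_image_sign c) (@sign_image_lam c).
move=> i; have [->|->] := ord2P i.
  apply: (smooth_ext (@good_image_open c) _ (smooth_partial 1 sl)).
  by move=> y _; rewrite mxE.
apply: (smooth_ext (@good_image_open c) _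
  (smoothN (@good_image_open c) (smooth_partial 0 sl))).
by move=> y _; rewrite mxE.
Qed.

Lemma ufield_smooth c : smooth_map_on (good_image c) (ufield c).
Proof.
move=> i; have oU := @good_image_open c; have sL := @levdir_smooth c.
have sG j k := smooth_sub (@good_image_img c) (@gram_smooth _ _ _ G c j k).
have pos y : good_image c y -> 0 < inner G c y (levdir c y) (levdir c y).
  by move=> [x [gx cx] <-]; exact: levdir_speed.
have sI : smooth_on (good_image c) (fun y => inner G c y (levdir c y) (levdir c y)).
  apply: (smooth_ext oU (f := fun y =>
   (levdir c y 0 0 * gram G c y 0 0 + levdir c y 0 1 * gram G c y 1 0) * levdir c y 0 0 +
   (levdir c y 0 0 * gram G c y 0 1 + levdir c y 0 1 * gram G c y 1 1) * levdir c y 0 1)).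
    by move=> y _; rewrite /inner bil2.
  have sM j k l := smoothM oU (sL j) (sG k l).
  exact: (smoothD oU (smoothM oU (smoothD oU (sM 0 0 0) (sM 1 1 0)) (sL 0))
                     (smoothM oU (smoothD oU (sM 0 0 1) (sM 1 1 1)) (sL 1))).
have nz y : good_image c y -> Num.sqrt (inner G c y (levdir c y) (levdir c y)) != 0.
  by move=> /pos p; rewrite gt_eqF// sqrtr_gt0.
have sF := smoothM oU (smoothV oU nz (smooth_sqrt oU pos sI)) (sL i).
by apply: (smooth_ext oU _ sF) => y _; rewrite [RHS]mxE.
Qed.

(** Curves that locally solve the unit field equation in some chart.  This is the
form in which curves can be glued and reversed. *)
Definition arc_at g (t : R) : Prop := exists c (k e : R),
  [/\ dom c (g t), k ^+ 2 = 1, 0 < e &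
    forall u, `|u - t| < e -> [/\ good (g u), dom c (g u) &
      is_derive u 1 (coord c \o g) (k *: ufield c (coord c (g u)))]].

Definition arc g (a b : R) : Prop := forall t, a < t < b -> arc_at g t.

Lemma arc_of_solution c (z : R -> 'rV[R]_2) (a b : R) : solution (ufield c) z a b ->
  (forall t, a < t < b -> good_image c (z t)) -> arc (point c \o z) a b.
Proof.
move=> zX zg t tab; have /good_imageP[gt ct] := zg t tab.
have zt u : a < u < b -> coord c (point c (z u)) = z u.
  by move=> /zg/good_image_img/img_point[].
have [e e0 eP] := itv_nbhd tab.
exists c, 1, e; split => //; first by rewrite expr1n.
move=> u /eP uab; have /good_imageP[gu cu] := zg u uab; split => //.
rewrite scale1r /= (zt u uab); apply: near_eq_is_derive (zX u uab).
by apply: filterS (near_itvP uab) => v vab; rewrite /= zt.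
Qed.

Lemma arc_continuous g (a b t : R) : arc g a b -> a < t < b -> {for t, continuous g}.
Proof.
move=> ag tab; have [c [k [e [ct _ e0 H]]]] := ag t tab.
have ec u : t - e < u < t + e -> dom c (g u) by rewrite -ltr_distl => /H[].
apply: (chart_curve_continuous e0 ec).
by have [_ _ []] := H t (dist_self_lt t e0).
Qed.

(** Smoothness in all charts is solution_smooth applied to the changes of chart. *)
Lemma arc_integral g (a b : R) : arc g a b -> integral_curve D good g a b /\
  forall t c, a < t < b -> dom c (g t) ->
    inner G c (coord c (g t)) (vel c g t) (vel c g t) = 1.
Proof.
move=> ag.
have loc t c' : a < t < b -> dom c' (g t) -> D c' (coord c' (g t)) (vel c' g t) /\
    inner G c' (coord c' (g t)) (vel c' g t) (vel c' g t) = 1.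
  move=> tab c't; have [c [k [e [ct k1 e0 H]]]] := ag t tab.
  have ec u : t - e < u < t + e -> dom c (g u) by rewrite -ltr_distl => /H[].
  have [gt _ dt] := H t (dist_self_lt t e0).
  have cc : in_both c c' (g t) by [].
  have [_ ->] := vel_transition e0 cc ec (ex_derive (is_derive := dt)).
  have [Ot _] := good_sp gt.
  rewrite -(D_change D_bisector _ Ot cc) -(inner_change G _ _ cc) (velE dt); split.
    by apply/(ufield_D _ gt ct); exists k.
  by rewrite /inner quad_scale -/(inner G c _ _ _) (ufield_unit gt ct) k1 mulr1.
split; last by move=> t c tab ct; have [] := loc t c tab ct.
split; last first.
  move=> t tab; split.
    by have [c [k [e [_ _ e0 H]]]] := ag t tab; have [] := H t (dist_self_lt t e0).
  by move=> c ct; have [] := loc t c tab ct.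
split; last first.
  move=> t c tab ct; apply/eqP => v0; have [_] := loc t c tab ct.
  rewrite v0 /inner !mul0mx mxE => /eqP; by rewrite eq_sym oner_eq0.
move=> t c' tab c't; have [c [k [e [ct k1 e0 H]]]] := ag t tab.
have [gt _ dt] := H t (dist_self_lt t e0).
have oO : open (dom c `&` dom c') by apply: openI; exact: dom_open.
have [e1 e10 H1] := preimage_norm (arc_continuous ag tab) oO (conj ct c't).
exists (Num.min e e1); first by rewrite lt_min e0 e10.
have sm u : t - Num.min e e1 < u < t + Num.min e e1 -> `|u - t| < e /\ `|u - t| < e1.
  by rewrite -ltr_distl lt_min => /andP[].
split=> [u /sm[_ /H1[]]//|].
pose U := coord c @` ((good `&` dom c') `&` dom c).
have oU : open U.
  by apply: chart_image_open; apply: openI; [exact: good_open|exact: dom_open].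
have sX : smooth_map_on U (fun y => k *: ufield c y).
  move=> i; apply: (smooth_ext oU (f := fun y => k * ufield c y 0 i)).
    by move=> y _; rewrite [RHS]mxE.
  apply: (smoothZ k oU); apply: (smooth_sub _ (@ufield_smooth c i)).
  by move=> y [x [[gx _] cx] <-]; exists x.
have sF : smooth_map_on U (coord c' \o point c).
  move=> i; apply: (smooth_sub _ (@transition_smooth _ _ S c c' i)).
  by move=> y [x [[_ c'x] cx] <-]; exists x.
have xX : solution (fun y => k *: ufield c y) (coord c \o g)
    (t - Num.min e e1) (t + Num.min e e1).
  by move=> u /sm[/H[]].
have xU u : t - Num.min e e1 < u < t + Num.min e e1 -> U ((coord c \o g) u).
  by move=> /sm[/H[gu cu _] /H1[_ c'u]]; exists (g u).
have sp' := solution_smooth oU sX sF xX xU.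
have E u : t - Num.min e e1 < u < t + Num.min e e1 ->
    ((coord c' \o point c) \o (coord c \o g)) u = (coord c' \o g) u.
  by move=> /sm[/H[_ cu _] _]; rewrite /= coordK.
have En j u : t - Num.min e e1 < u < t + Num.min e e1 ->
   \near u, derive1n j ((coord c' \o point c) \o (coord c \o g)) u = derive1n j (coord c' \o g) u.
  elim: j u => [|j IH] u ut; first by apply: filterS (near_itvP ut) => v /E.
  apply: filterS (near_itvP ut) => v /IH Ev.
  by rewrite !derive1nS !derive1E; apply: near_eq_derive.
move=> j u ut; have dj := sp' j u ut.
have [//] : is_derive u 1 (derive1n j (coord c' \o g))
  ('D_1 (derive1n j ((coord c' \o point c) \o (coord c \o g))) u).
by apply: near_eq_is_derive (En j u ut) _; exact: derivableP.
Qed.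

Lemma arc_at_near g f (t d : R) : 0 < d -> (forall u, `|u - t| < d -> g u = f u) ->
  arc_at g t -> arc_at f t.
Proof.
move=> d0 gf [c [k [e [ct k1 e0 H]]]]; exists c, k, (Num.min e d); split => //.
- by rewrite -gf//; exact: dist_self_lt.
- by rewrite lt_min e0 d0.
move=> u; rewrite lt_min => /andP[ue ud]; have [gu cu du] := H u ue.
rewrite -(gf u ud); split => //; apply: near_eq_is_derive du.
have [r r0 rP] := itv_nbhd (a := t - d) (b := t + d) (t := u) (etrans (esym (ltr_distl _ _ _)) ud).
by apply/near_normP; exists r => // v /rP; rewrite -ltr_distl => /gf /= ->.
Qed.

Lemma arc_glue g h (a b a' b' t d : R) : arc g a b -> arc h a' b' -> a < t < b ->
  a' < t < b' -> 0 < d -> (forall u, `|u - t| < d -> g u = h u) ->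
  arc (fun u => if u < t then g u else h u) a b'.
Proof.
move=> ag ah tab tab' d0 gh u /andP[ua ub'].
have /andP[ta tb] := tab; have /andP[ta' tb'] := tab'.
have [ut|ut|->] := ltgtP u t.
- have utp : 0 < t - u by rewrite subr_gt0.
  apply: (arc_at_near (g := g) utp); last by apply: ag; rewrite ua (lt_trans ut).
  by move=> v /ltr_distlDr; rewrite subrKC => ->.
- have utp : 0 < u - t by rewrite subr_gt0.
  apply: (arc_at_near (g := h) utp); last by apply: ah; rewrite ub' (lt_trans ta' ut).
  by move=> v; rewrite ltr_distl subKr => /andP[h1 _]; rewrite ltNge (ltW h1).
apply: (arc_at_near (g := g) d0); last by apply: ag.
by move=> v vd; case: ifP => // _; exact: gh.
Qed.

Lemma arc_sub g (a b a' b' : R) : a <= a' -> b' <= b -> arc g a b -> arc g a' b'.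
Proof.
by move=> aa bb ag t /andP[ta tb]; apply: ag; rewrite (le_lt_trans aa) ?(lt_le_trans tb).
Qed.

Definition arc_sign c (k : R) g (t : R) : Prop := exists2 e : R, 0 < e &
  forall u, `|u - t| < e -> [/\ good (g u), dom c (g u) &
    is_derive u 1 (coord c \o g) (k *: ufield c (coord c (g u)))].

Lemma arc_sign_affine c (k l m t : R) g : l ^+ 2 = 1 -> arc_sign c k g (l * t + m) ->
  arc_sign c (l * k) (fun u => g (l * u + m)) t.
Proof.
move=> l1 [e e0 P]; exists e => //.
have l1' : `|l| = 1 by have [->|->] := sign_or l1; rewrite ?normrN normr1.
move=> u ut; have [|gu cu du] := P (l * u + m).
  by rewrite opprD addrACA subrr addr0 -mulrBr normrM l1' mul1r.
split => //; move/is_derive_rowP: du => du; apply/is_derive_rowP => i.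
have da : is_derive u 1 (fun u : R => l * u + m) l.
  have := is_deriveD (is_deriveZ l (is_derive_id u 1)) (is_derive_cst m u 1).
  by rewrite addr0 [l *: 1]mulr1.
have := @is_derive1_comp R (fun v : R => coord c (g v) 0 i) (fun v : R => l * v + m)
  u _ _ (du i) da.
by congr (is_derive _ _ _ _); rewrite [_ 0 i]mxE [RHS]mxE; ring.
Qed.

Lemma arc_affine g (a b a' b' l m : R) : l ^+ 2 = 1 -> arc g a b ->
  (forall u, a' < u < b' -> a < l * u + m < b) -> arc (fun u => g (l * u + m)) a' b'.
Proof.
move=> l1 ag H t /H tab; have [c [k [e [ct k1 e0 P]]]] := ag _ tab.
have [f f0 Q] := arc_sign_affine l1 (ex_intro2 _ _ e e0 P).
by exists c, (l * k), f; split => //; rewrite exprMn l1 k1 mulr1.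
Qed.

(** The velocity and the unit field are continuous, so that the sign relating them is
locally constant. *)
Lemma arc_chart c g (a b t : R) : arc g a b -> a < t < b -> dom c (g t) ->
  exists2 k : R, k ^+ 2 = 1 & arc_sign c k g t.
Proof.
move=> ag tab ct; have [[[sg _] ig] ug] := arc_integral ag.
have [e1 e10 [ec es]] := sg t c tab ct.
have [e2 e20 H2] := itv_nbhd tab.
have te1 : t - e1 < t < t + e1 by rewrite -ltr_distl; exact: dist_self_lt.
have dv u : t - e1 < u < t + e1 -> is_derive u 1 (coord c \o g) (vel c g u).
  by move=> ue; apply: vel_is_derive; exact: (es 0%N u ue).
have mult u : t - e1 < u < t + e1 -> a < u < b -> exists k : R, k ^+ 2 = 1 /\
    vel c g u = k *: ufield c (coord c (g u)).
  move=> ue uab; have [gu Du] := ig u uab; have cu := ec u ue.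
  exact: (unit_multiple gu cu (Du c cu) (ug u c uab cu)).
have [gt _] := ig t tab; have [k [k1 kE]] := mult t te1 tab.
have cv : {for t, continuous (vel c g)}.
  have d1 : derivable (vel c g) t 1 by have := es 1%N t te1; rewrite derive1n1.
  by apply: (@is_derive_path_cont _ _ _ _ ('D_1 (vel c g) t)); exact: derivableP.
have Ut : good_image c (coord c (g t)) by exists (g t).
have [X0|X0] := eqVneq (ufield c (coord c (g t))) 0.
  have := ufield_unit gt ct; rewrite X0 /inner !mul0mx mxE => /eqP.
  by rewrite eq_sym oner_eq0.
have [i i0] : exists i, ufield c (coord c (g t)) 0 i != 0.
  by have [h|h] := row2_neq0 X0; [exists 0|exists 1].
have cx : {for t, continuous (fun u => ufield c (coord c (g u)) 0 i)}.
  exact: (is_derive_path_cont (is_derive_comp_row (x := coord c \o g)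
    (smooth_differentiable (@good_image_open c) (@ufield_smooth c i) Ut) (dv t te1))).
have cvi : {for t, continuous (fun u => vel c g u 0 i)}.
  apply/continuous_normP => r r0; have [r1 r10 H] := (continuous_normP _ _).1 cv r r0.
  exists r1 => // u /H; apply: le_lt_trans.
  by have := norm_coord (vel c g u - vel c g t) i; rewrite !mxE.
have ch := continuousM cvi cx.
have ht0 : 0 < `|k * ufield c (coord c (g t)) 0 i ^+ 2|.
  rewrite normr_gt0 mulf_neq0 ?sqrf_eq0//.
  by apply/eqP => k0; move: k1; rewrite k0 expr0n => /eqP; rewrite eq_sym oner_eq0.
have [e3 e30 H3] := (continuous_normP _ _).1 ch _ ht0.
exists k; first exact: k1.
exists (Num.min e1 (Num.min e2 e3)); first by rewrite !lt_min e10 e20 e30.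
move=> u; rewrite !lt_min => /andP[u1 /andP[u2 u3]].
have ue : t - e1 < u < t + e1 by rewrite -ltr_distl.
have uab := H2 u u2; have [gu _] := ig u uab; split; [exact: gu|exact: ec|].
have [l [l1 lE]] := mult u ue uab.
have := dv u ue; rewrite lE; suff -> : k = l by [].
apply: (same_sign k1 l1 i0 (q := ufield c (coord c (g u)) 0 i)).
have E (p r : R) : p * r * r = p * r ^+ 2 by rewrite -mulrA -expr2.
by have := H3 u u3; rewrite /= lE kE (scale_row l) (scale_row k) !E.
Qed.

Lemma neq_near g h (t : R) : {for t, continuous g} -> {for t, continuous h} ->
  g t <> h t -> exists2 e : R, 0 < e & forall u, `|u - t| < e -> g u <> h u.
Proof.
move=> gc hc gh; have := surface_hausdorff S; rewrite open_hausdorff => H.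
have [[A B] /= [/set_mem Ag /set_mem Bh] [oA oB /eqP AB]] := H _ _ (introN eqP gh).
have [r r0 rP] := preimage_norm gc oA Ag; have [q q0 qP] := preimage_norm hc oB Bh.
exists (Num.min r q); first by rewrite lt_min r0 q0.
move=> u; rewrite lt_min => /andP[/rP Au /qP Bu] E.
have : (A `&` B) (g u) by split => //; rewrite E.
by rewrite AB.
Qed.

Lemma ufield_neq0 c x : good x -> dom c x -> ufield c (coord c x) != 0.
Proof.
move=> gx cx; apply/eqP => X0; have := ufield_unit gx cx.
by rewrite X0 /inner !mul0mx mxE => /eqP; rewrite eq_sym oner_eq0.
Qed.

Lemma kufield_smooth c (k : R) : smooth_map_on (good_image c) (fun y => k *: ufield c y).
Proof.
move=> i; have oU := @good_image_open c.
apply: (smooth_ext oU (f := fun y => k * ufield c y 0 i)).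
  by move=> y _; rewrite [RHS]mxE.
exact: (smoothZ k oU (@ufield_smooth c i)).
Qed.

Lemma arc_sign_agree c (k t : R) g h : arc_sign c k g t -> arc_sign c k h t -> g t = h t ->
  exists2 d : R, 0 < d & forall u, `|u - t| < d -> g u = h u.
Proof.
move=> [e e0 P] [f f0 Q] gh; pose d := Num.min e f.
have d0 : 0 < d by rewrite lt_min e0 f0.
have xX : solution (fun y => k *: ufield c y) (coord c \o g) (t - d) (t + d).
  by move=> u; rewrite -ltr_distl lt_min => /andP[/P[]].
have yX : solution (fun y => k *: ufield c y) (coord c \o h) (t - d) (t + d).
  by move=> u; rewrite -ltr_distl lt_min => /andP[_ /Q[]].
have Ug : good_image c ((coord c \o g) t).
  by have [gt ct _] := P t (dist_self_lt t e0); exists (g t).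
have E0 : (coord c \o g) t = (coord c \o h) t by rewrite /= gh.
have [r r0 H] := solution_unique (@good_image_open c) (@kufield_smooth c k) d0 xX yX E0 Ug.
exists (Num.min r d); first by rewrite lt_min r0 d0.
move=> u; rewrite !lt_min => /and3P[ur ue uf].
have [_ cu _] := P u ue; have [_ cu' _] := Q u uf.
by rewrite -(coordK cu) -(coordK cu') [coord c (g u)](H u ur).
Qed.

(** Agreement near a time is an open condition on the time, and so is its failure: arcs
that meet without agreeing run in opposite directions. *)
Lemma arc_unique g h (a b t u : R) : arc g a b -> arc h a b -> a < t < b -> a < u < b ->
  (exists2 d : R, 0 < d & forall r : R, `|r - t| < d -> g r = h r) -> g u = h u.
Proof.
move=> ag ah tab uab gh.
pose P (v : R) := exists2 d : R, 0 < d & forall u, `|u - v| < d -> g u = h u.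
suff : P u by move=> [d d0 /(_ u (dist_self_lt u d0))].
apply: (@locally_const _ P a b t u) => // v vab.
have [[d d0 dP]|nP] := pselect (P v).
  exists d => // x; rewrite -ltr_distl => xd; split=> _; first by exists d.
  have [r r0 rP] := itv_nbhd (a := v - d) (b := v + d) (t := x) (etrans (esym (ltr_distl _ _ _)) xd).
  by exists r => // y /rP; rewrite -ltr_distl => /dP.
suff [d d0 dP] : exists2 d : R, 0 < d & forall q : R, `|q - v| < d -> ~ P q.
  by exists d => // x; rewrite -ltr_distl => /dP.
have [gv|gv] := pselect (g v = h v); last first.
  have [d d0 dP] := neq_near (arc_continuous ag vab) (arc_continuous ah vab) gv.
  by exists d => // x /dP gx [r r0 /(_ x (dist_self_lt x r0))].
have [c cv] := dom_cover S (g v); have cv' : dom c (h v) by rewrite -gv.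
have [k k1 gs] := arc_chart ag vab cv; have [l l1 hs] := arc_chart ah vab cv'.
have [kl|kl] := eqVneq k l.
  by rewrite -kl in hs; have [d d0 dP] := arc_sign_agree gs hs gv; case: nP; exists d.
have [e e0 Q] := gs; have [f f0 Q'] := hs.
exists (Num.min e f); first by rewrite lt_min e0 f0.
move=> x; rewrite lt_min => /andP[/Q[gx cx dx] /Q'[gx' cx' dx']] [r r0 rP].
have xx := rP x (dist_self_lt x r0).
have dx2 : is_derive x 1 (coord c \o g) (l *: ufield c (coord c (h x))).
  apply: near_eq_is_derive dx'; apply/near_normP; exists r => // y /rP /= ->.
  by [].
have := is_derive_unique dx dx2; rewrite xx => /eqP.
rewrite -subr_eq0 -scalerBl scaler_eq0 subr_eq0 (negbTE kl) /= => /eqP X0.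
by have := ufield_neq0 gx' cx'; rewrite X0 eqxx.
Qed.

Definition linked (x y : M) : Prop := exists g a b t u,
  [/\ arc g a b, a < t < b, a < u < b, g t = x & g u = y].

Lemma linked_sym (x y : M) : linked x y -> linked y x.
Proof. by move=> [g [a [b [t [u [ag tab uab gt gu]]]]]]; exists g, a, b, u, t. Qed.

Lemma linked_forward (x y : M) : linked x y -> exists g (a b t : R),
  [/\ arc g a b, a < 0 < b, 0 <= t < b, g 0 = x & g t = y].
Proof.
move=> [g [a [b [t [u [ag /andP[ta tb] /andP[ua ub] gt gu]]]]]].
have [tu|/ltW ut] := leP t u.
  exists (fun v : R => g (1 * v + t)), (a - t), (b - t), (u - t).
  split; rewrite ?mul1r ?add0r ?subrK//.
  - apply: (arc_affine _ ag); first by rewrite expr1n.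
    by move=> v; rewrite mul1r ltrBlDr ltrBrDr.
  - by rewrite subr_lt0 subr_gt0 ta tb.
  - by rewrite subr_ge0 tu ltrD2r ub.
exists (fun v : R => g (-1 * v + t)), (t - b), (t - a), (t - u).
split; rewrite ?mulr0 ?add0r ?mulN1r ?opprB ?subrK//.
- apply: (arc_affine _ ag); first by rewrite sqrrN expr1n.
  by move=> v /andP[v1 v2]; rewrite mulN1r; apply/andP; split; lra.
- by rewrite subr_lt0 subr_gt0 ta tb.
- by rewrite subr_ge0 ut ltrD2l ltrN2 ua.
Qed.

(** Two arcs through y run either in the same direction, and then the longer one contains
both points, or in opposite directions, and then one of them can be reversed and glued
to the other. *)
Lemma linked_trans (y x z : M) : linked x y -> linked y z -> linked x z.
Proof.
move=> /linked_sym/linked_forward[g [a [b [t [ag ab0 /andP[t0 tb] g0 gt]]]]].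
move=> /linked_forward[h [a' [b' [u [ah ab0' /andP[u0 ub] h0 hu]]]]].
have gh : g 0 = h 0 by rewrite g0 h0.
have [c cg] := dom_cover S (g 0); have ch : dom c (h 0) by rewrite -gh.
have [k k1 gs] := arc_chart ag ab0 cg; have [l l1 hs] := arc_chart ah ab0' ch.
have /andP[a0 b0] := ab0; have /andP[a0' b0'] := ab0'.
have [kl|kl] := eqVneq k l.
  rewrite -kl in hs; have near0 := arc_sign_agree gs hs gh.
  pose A := Num.max a a'; pose B := Num.min b b'.
  have agA : arc g A B by apply: arc_sub ag; rewrite /A /B ?le_max ?ge_min lexx.
  have ahA : arc h A B by apply: arc_sub ah; rewrite /A /B ?le_max ?ge_min lexx orbT.
  have A0 : A < 0 by rewrite gt_max a0 a0'.
  have AB0 : A < 0 < B by rewrite A0 lt_min b0 b0'.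
  have [tu|ut] := leP t u.
    have tAB : A < t < B by rewrite (lt_le_trans A0 t0) lt_min tb (le_lt_trans tu ub).
    exists h, a', b', t, u; split => //.
    - by rewrite (lt_le_trans a0' t0) (le_lt_trans tu ub).
    - by rewrite (lt_le_trans a0' u0) ub.
    - by rewrite -(arc_unique agA ahA AB0 tAB near0).
  have uAB : A < u < B by rewrite (lt_le_trans A0 u0) lt_min ub (lt_trans ut tb).
  exists g, a, b, t, u; split => //.
  - by rewrite (lt_le_trans a0 t0) tb.
  - by rewrite (lt_le_trans a0 u0) (lt_trans ut tb).
  - by rewrite (arc_unique agA ahA AB0 uAB near0).
have lk : l = -1 * k.
  by move: kl; have [->|->] := sign_or k1; have [->|->] := sign_or l1;
    rewrite ?eqxx// mulN1r ?opprK.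
have N1 : (-1 : R) ^+ 2 = 1 by rewrite sqrrN expr1n.
have z0 : -1 * 0 + 0 = 0 :> R by rewrite mulr0 addr0.
have gs' : arc_sign c k g (-1 * 0 + 0) := eq_ind_r (arc_sign c k g) gs z0.
have rs := arc_sign_affine N1 gs'; rewrite -lk in rs.
have ag' : arc (fun v : R => g (-1 * v + 0)) (- b) (- a).
  apply: (arc_affine N1 ag) => v /andP[v1 v2].
  by rewrite mulN1r addr0; apply/andP; split; lra.
have gh' : g (-1 * 0 + 0) = h 0 by rewrite mulr0 addr0.
have [d d0 dP] := arc_sign_agree rs hs gh'.
have ab0'' : - b < 0 < - a by rewrite oppr_lt0 oppr_gt0 b0 a0.
have ak := arc_glue ag' ah ab0'' ab0' d0 dP.
exists (fun v : R => if v < 0 then g (-1 * v + 0) else h v), (- b), b', (- t), u; split => //.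
- by rewrite ltrN2 tb (le_lt_trans _ b0')// oppr_le0.
- by rewrite ub andbT (lt_le_trans _ u0)// oppr_lt0.
- rewrite oppr_lt0 mulN1r opprK addr0; case: ltgtP t0 => // t0 _.
  by rewrite -t0 oppr0 -gt -t0 -gh.
by rewrite ltNge u0.
Qed.

Lemma lamM_arc g (a b u t : R) : arc g a b -> a < u < b -> a < t < b ->
  lamM s (g u) = lamM s (g t).
Proof.
move=> ag; have [ig _] := arc_integral ag.
exact: (lamM_integral_curve good_sp ig).
Qed.

(** Near a noncritical point the level sets of the eigenvalue are arcs: running
along the unit field, one coordinate sweeps an interval, and two points of the same
level that share this coordinate are equal. *)
Lemma flow_box c x : good x -> dom c x -> exists2 r : R, 0 < r &
  forall y z, `|y - coord c x| < r -> `|z - coord c x| < r ->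
    good_image c y /\ (lam c y = lam c z -> linked (point c y) (point c z)).
Proof.
move=> gx cx; set p := coord c x; have Up : good_image c p by exists x.
have oU := @good_image_open c.
have sl := smooth_sub (@good_image_sign c) (@sign_image_lam c).
have [k kn] := good_chart gx cx.
have [i ik [iX jE]] : exists2 i : 'I_2, i != k & ufield c p 0 i != 0 /\
    (forall y z : 'rV[R]_2, y 0 i = z 0 i -> y = z + (y 0 k - z 0 k) *: basis_vec k).
  have n0 : (speed G c p (levdir c p))^-1 != 0.
    by rewrite invr_eq0 /speed gt_eqF// sqrtr_gt0; exact: levdir_speed.
  move: kn; have [->|->] := ord2P k => kn; [exists 1|exists 0] => //.
    split; first by rewrite /ufield scale_row mulf_neq0// mxE /= oppr_eq0.
    move=> y z yz; apply: row2P; rewrite mxE scale_row basis_vecE /= ?mulr1 ?mulr0 ?addr0//.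
    by rewrite subrKC.
  split; first by rewrite /ufield scale_row mulf_neq0// mxE.
  move=> y z yz; apply: row2P; rewrite mxE scale_row basis_vecE /= ?mulr1 ?mulr0 ?addr0//.
  by rewrite subrKC.
have [m1 [r1 [sg1 [m10 r10 sg11 H1]]]] :=
  nonzero_near (smooth_continuous (@ufield_smooth c i) Up) iX.
have [m2 [r2 [sg2 [m20 r20 sg21 H2]]]] := partial_sign oU Up sl kn.
pose q := Num.min r1 (r2 / 3).
have q0 : 0 < q by rewrite lt_min r10 divr_gt0.
pose U' := good_image c `&` [set y | `|y - p| < q].
have oU' : open U'.
  apply: openI => //; apply: open_norm => y /= yq; exists (q - `|y - p|).
    by rewrite subr_gt0.
  move=> z zy; have := ler_normD (z - y) (y - p); rewrite subrKA => h.
  by apply: le_lt_trans h _; rewrite -ltrBrDr.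
have Up' : U' p by split => //=; rewrite subrr normr0.
have sX' : smooth_map_on U' (ufield c).
  by move=> j; apply: smooth_sub (@ufield_smooth c j) => y [].
have [r [L [T [r0 L0 T0 LT [rU rL fl]]]]] := local_flow oU' Up' sX'.
pose rho := Num.min (r / 2) (m1 * (T / 2) / 2).
have rho0 : 0 < rho by rewrite lt_min !divr_gt0// mulr_gt0// divr_gt0.
exists rho => // y z yr zr.
have rr : r / 2 <= r by lra.
have rho2 : rho <= r / 2 by rewrite /rho ge_min lexx.
have yr2 := lt_le_trans yr rho2; have zr2 := lt_le_trans zr rho2.
have Uy : U' y by apply: rU; exact: ltW (lt_le_trans yr2 rr).
have Uz : U' z by apply: rU; exact: ltW (lt_le_trans zr2 rr).
split=> [|lyz]; first by have [] := Uy.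
have [w' [w0 wX wr]] := fl y yr2.
have wU t : - T < t < T -> U' (w' t) by move=> /wr/ltW; exact: rU.
have aw : arc (point c \o w') (- T) T.
  by apply: arc_of_solution wX _ => t /wU[].
have [t tT tz] : exists2 t : R, - T < t < T & w' t 0 i = z 0 i.
  apply: (sweep (m := m1) (df := fun t => ufield c (w' t) 0 i) T0 sg11).
    move=> t tT; split; first by have /is_derive_rowP := wX t tT.
    apply: H1; have [_ /= h] := wU t tT; apply: lt_le_trans h _.
    by rewrite /q ge_min lexx.
  rewrite w0; apply: le_trans (_ : `|z - y| <= _).
    by have := norm_coord (z - y) i; rewrite !mxE.
  have := ler_normB (z - p) (y - p); rewrite opprB subrKA => /le_trans; apply.
  have : rho <= m1 * (T / 2) / 2 by rewrite /rho ge_min lexx orbT.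
  by move: (ltW yr) (ltW zr) => {}yr {}zr h; apply: le_trans (lerD zr yr) _; lra.
have T00 : - T < 0 < T by rewrite oppr_lt0 T0.
have lz : lam c (w' t) = lam c z.
  have Uw := wU t tT; have Uw0 := wU 0 T00; rewrite w0 in Uw0.
  have [/good_imageP[gt ct] _] := Uw; have [/good_imageP[gy cy] _] := Uw0.
  have := lamM_arc aw tT T00; rewrite /= w0.
  rewrite (lamM_chart (good_sp gt) ct) (lamM_chart (good_sp gy) cy).
  have [_ ->] := img_point (good_image_img Uw.1); have [_ ->] := img_point (good_image_img Uw0.1).
  by move=> ->.
have wz : w' t = z.
  have E := jE _ _ tz; set h := (_ - _ : R) in E.
  have hr : `|h| <= q + q.
    apply: le_trans (_ : `|w' t - z| <= _).
      by have := norm_coord (w' t - z) k; rewrite !mxE.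
    have := ler_normB (w' t - p) (z - p); rewrite opprB subrKA => /le_trans; apply.
    by have [_ /= /ltW h1] := wU t tT; have [_ /= /ltW h2] := Uz; exact: lerD.
  have q3 : q + q + q <= r2.
    have : q <= r2 / 3 by rewrite /q ge_min lexx orbT.
    by lra.
  have near (u : R) : `|u| <= `|h| -> `|z + u *: basis_vec k - p| < r2.
    move=> uh; rewrite addrAC; apply: le_lt_trans (ler_normD _ _) _.
    have h1 : `|u *: basis_vec k : 'rV[R]_2| <= `|u|.
      by rewrite normrZ ler_piMr// norm_basis_vec.
    have [_ /= h2] := Uz; apply: lt_le_trans q3; rewrite -addrA.
    by apply: ltr_leD h2 _; apply: le_trans h1 _; exact: le_trans uh hr.
  have dd (u : R) : `|u| <= `|h| -> derivable (lam c) (z + u *: basis_vec k) (basis_vec k).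
    by move=> /near/H2[Uu _]; exact: smooth_derivable sl Uu.
  have [u uh] := mvt_basis dd; rewrite -E lz subrr => /esym/eqP.
  have [_ dk] := H2 _ (near u uh); rewrite mulf_eq0 => /orP[/eqP h0|/eqP d0].
    by rewrite E h0 scale0r addr0.
  by move: (lt_le_trans m20 dk); rewrite d0 mulr0 ltxx.
exists (point c \o w'), (- T), T, 0, t; split => //=; first by rewrite w0.
by rewrite wz.
Qed.

(** * The wall *)

Section Wall.
Variables (T : set M) (w : R -> M).
Hypothesis w_leaf : closed_leaf D Om w.
Hypothesis T_table : one_sided_table S T w.
Hypothesis w_convex : wall_convex G T w.
Hypothesis w_sp : forall t, sp (w t).

Lemma w_smooth a b : smooth_curve S w a b.
Proof. by have [[h _] _] := w_leaf; have [] := h a b. Qed.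

Lemma w_continuous t : {for t, continuous w}.
Proof. exact: (smooth_curve_continuous (@w_smooth (t - 1) (t + 1)) (in_itv1 t)). Qed.

Lemma w_vel c t : dom c (w t) -> is_derive t 1 (coord c \o w) (vel c w t).
Proof. exact: (smooth_curve_vel (@w_smooth (t - 1) (t + 1)) (in_itv1 t)). Qed.

Lemma w_vel_neq0 c t : dom c (w t) -> vel c w t != 0.
Proof.
by have [[h _] _] := w_leaf; have [_] := h (t - 1) (t + 1); apply; exact: in_itv1.
Qed.

Lemma w_D c t : dom c (w t) -> D c (coord c (w t)) (vel c w t).
Proof.
move=> ct; have [_ h] := w_leaf.
by have [_ /(_ t (in_itv1 t))[_]] := h (t - 1) (t + 1); apply.
Qed.

Definition lam0 : R := lamM s (w 0).

Lemma lamM_wall t : lamM s (w t) = lam0.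
Proof.
apply: (@const_of_derive0 _ (lamM s \o w) (- (`|t| + 1)) (`|t| + 1)).
- move=> r _; have [c cr] := dom_cover S (w r).
  have := lamM_derive (w_sp r) cr (@w_continuous r) (w_vel cr).
  by rewrite (dlam_D (w_sp r) cr (w_D cr)).
- by rewrite -ltr_norml ltrDl.
- by rewrite -ltr_norml normr0 ltr_wpDl.
Qed.

Lemma tangent_everywhere g c t (v : 'rV[R]_2) (k : R) : g 0 = w t -> dom c (w t) ->
  {for (0:R), continuous g} -> is_derive (0:R) 1 (coord c \o g) v -> k != 0 ->
  v = k *: vel c w t -> forall c', dom c' (w t) -> collinear (vel c' g 0) (vel c' w t).
Proof.
move=> g0 ct gc dv k0 vE c' c't; have cc : in_both c c' (w t) by [].
have cc' : in_both c c' (g 0) by rewrite g0.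
have [e e0 ec] := near_dom (@w_continuous t) ct.
have [e' e'0 ec'] := near_dom gc cc'.1.
have [_ wE] := vel_transition e0 cc ec (ex_derive (is_derive := w_vel ct)).
have [_ gE] := vel_transition e'0 cc' ec' (ex_derive (is_derive := dv)).
exists k; first exact: k0.
by rewrite wE gE (velE dv) vE -scalemxAl g0.
Qed.

Lemma wall_chart c t (y0 := coord c (w t)) : dom c (w t) ->
  exists (U : set 'rV[R]_2) (F : 'rV[R]_2 -> R) j, [/\ open U, U y0, smooth_on U F,
    forall y, U y -> sign_image I Om D s c y &
    'D_(basis_vec j) F y0 != 0 /\
    forall y, U y -> (range w (point c y) <-> F y = 0) /\ (T (point c y) <-> 0 <= F y)].
Proof.
move=> ct; have [Ob [f [oO Ow sf fd fT]]] := T_table t.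
have [j jn] := fd (w t) c Ow ct.
pose U := coord c @` ((Ob `&` sp) `&` dom c).
have oU : open U by apply: chart_image_open; exact: openI oO sp_open.
exists U, (f \o point c), j; split => //.
- by exists (w t) => //; split => //; split => //; exact: w_sp.
- have sub y : U y -> (coord c @` (Ob `&` dom c)) y.
    by move=> [x [[Ox sx] cx] <-]; exists x.
  exact: smooth_sub sub (sf c).
- by move=> y [x [[Ox sx] cx] <-]; exists x.
split => // _ [x [[Ox _] cx] <-]; rewrite /= (coordK cx).
exact: fT.
Qed.

Lemma defining_function_wall c t (U : set 'rV[R]_2) (F : 'rV[R]_2 -> R) : open U ->
  smooth_on U F -> (forall y, U y -> (range w (point c y) <-> F y = 0)) ->
  dom c (w t) -> U (coord c (w t)) ->
  \sum_k vel c w t 0 k * 'D_(basis_vec k) F (coord c (w t)) = 0.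
Proof.
move=> oU sF FU ct Ut.
have df := smooth_differentiable oU sF Ut.
have d := is_derive_comp_row (x := coord c \o w) df (w_vel ct).
have [e e0 ec] := near_dom (@w_continuous t) ct.
have [r r0 rP] := preimage_norm (is_derive_path_cont (w_vel ct)) oU Ut.
have c0 : is_derive t 1 (cst 0 : R -> R) 0 by exact: is_derive_cst.
apply: is_derive_unique d _; apply: near_eq_is_derive c0.
apply/near_normP; exists (Num.min e r); first by rewrite lt_min e0 r0.
move=> u; rewrite lt_min => /andP[]; rewrite ltr_distl => /ec cu /rP Uu.
by apply/esym/(FU _ Uu); rewrite /= coordK//; exists u.
Qed.

(** If the eigenvalue were critical at a point of the wall, the tangent geodesic
would be a leaf of the foliation, hence run inside the wall, which convexity
excludes. *)
Lemma wall_noncritical c t : dom c (w t) ->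
  exists k, 'D_(basis_vec k) (lam c) (coord c (w t)) != 0.
Proof.
move=> ct; apply: contrapT => /forallNP crit.
have {}crit k : 'D_(basis_vec k) (lam c) (coord c (w t)) = 0.
  by apply/eqP; apply: contrapT => /negP h; exact: (crit k h).
have st := w_sp t; have [Ot _] := st.
have [tau [B [g [tau0 gg g0 gv gP]]]] := critical_geodesic Om_open zero_real D_bisector
  s2 st ct (w_D ct) (w_vel_neq0 ct) crit.
have tau00 : - tau < 0 < tau by rewrite oppr_lt0 tau0.
have [_ _ dg0 _ _] := gP 0 tau00.
have v1 : vel c g 0 = 1 *: vel c w t by rewrite scale1r gv.
have col := tangent_everywhere g0 ct (geodesic_continuous gg tau00) dg0 (oner_neq0 R) v1.
have [e e0 eT] := w_convex gg tau00 g0 col.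
have [U [F [j [oU Uy sF Usp [jn FU]]]]] := wall_chart ct.
have Fy : F (coord c (w t)) = 0.
  by apply/((FU _ Uy).1); rewrite coordK//; exists t.
have [_ _ Mn] := eigmat_spec zero_real s2 Ot ct.
have oOm := @om_image_open _ _ S _ Om_open c.
have sM i k : smooth_on U (fun y => eigmat I s c y i k).
  apply: (smooth_sub _ (eigmat_smooth (I:=I) Om_open zero_real s (c:=c) i k)).
  by move=> y /Usp[x [[Ox _] cx] <-]; exists x.
have symM y : U y -> symm2 (eigmat I s c y).
  move=> /Usp[x [[Ox _] cx] <-].
  by have [] := eigmat_spec zero_real s2 Ox cx.
have kerD x v : sp x -> dom c x -> D c (coord c x) v -> v *m eigmat I s c (coord c x) = 0.
  by move=> sx cx; exact: (D_eigmat zero_real D_bisector _ s2 sx cx).1.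
have [k [i ki]] : exists k i, eigmat I s c (coord c (w t)) i k != 0.
  by case: Mn => n; [exists 0, 0|exists 1, 1].
(* the derivative of F in the direction of the foliation, up to a factor; it
   vanishes on the wall, hence is bounded by a multiple of F *)
pose h (y : 'rV[R]_2) : R := eigmat I s c y 0 k * 'D_(basis_vec 1) F y -
  eigmat I s c y 1 k * 'D_(basis_vec 0) F y.
have sh : smooth_on U h.
  exact: (smoothB oU (smoothM oU (sM 0 k) (smooth_partial 1 sF))
                     (smoothM oU (sM 1 k) (smooth_partial 0 sF))).
have kerE x v : sp x -> dom c x -> D c (coord c x) v ->
    v 0 0 * eigmat I s c (coord c x) 0 k + v 0 1 * eigmat I s c (coord c x) 1 k = 0.
  by move=> sx cx /(kerD _ _ sx cx) E; rewrite -mul2 E mxE.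
have h_wall y : U y -> F y = 0 -> h y = 0.
  move=> Uy' /((FU _ Uy').1)[u _ uE].
  have [cy yE] := img_point (sign_image_img (Usp _ Uy')).
  have cu : dom c (w u) by rewrite uE.
  have yu : coord c (w u) = y by rewrite uE yE.
  have d := defining_function_wall oU sF (fun y Uy => (FU y Uy).1) cu.
  rewrite yu in d; have {d} := d Uy'; rewrite sum2 => d.
  have := kerE _ _ (w_sp u) cu (w_D cu); rewrite yu => m.
  have := row2_neq0 (w_vel_neq0 cu); rewrite /h.
  move: (vel c w u) (eigmat I s c y 0 k) (eigmat I s c y 1 k)
    ('D_(basis_vec 0) F y) ('D_(basis_vec 1) F y) d m => v m0 m1 f0 f1 d m.
  case=> n; apply: (mulfI n); rewrite mulr0.
    transitivity ((v 0 0 * m0 + v 0 1 * m1) * f1 - (v 0 0 * f0 + v 0 1 * f1) * m1).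
      by ring.
    by rewrite d m !mul0r subrr.
  transitivity ((v 0 0 * f0 + v 0 1 * f1) * m0 - (v 0 0 * m0 + v 0 1 * m1) * f0).
    by ring.
  by rewrite d m !mul0r subrr.
have [m [r0 [sg [m0 r00 sg1 mP]]]] := partial_sign oU Uy sF jn.
have [rh [Lh [rh0 Lh0 rhU rhL]]] := smooth_lipschitz oU Uy sh.
pose r1 := Num.min r0 rh.
have r10 : 0 < r1 by rewrite lt_min r00 rh0.
have rU1 y : `|y - coord c (w t)| < r1 -> U y.
  by rewrite lt_min => /andP[/mP[]].
have mP1 y : `|y - coord c (w t)| < r1 -> m <= sg * 'D_(basis_vec j) F y.
  by rewrite lt_min => /andP[/mP[]].
have [r2 r20 zf] := zero_finder oU sF rU1 r10 Fy m0 sg1 mP1.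
have hF y : `|y - coord c (w t)| < r2 -> `|h y| <= Lh * (m^-1 * `|F y|).
  move=> yr; have [u [Fu ua ub]] := zf y yr.
  have b1 := ub u (lexx _).
  have b0 : `|y - coord c (w t)| < r1.
    by have := ub 0; rewrite normr0 scale0r addr0; apply.
  have hz : h (y + u *: basis_vec j) = 0 by apply: h_wall (rU1 _ b1) Fu.
  have := rhL y (y + u *: basis_vec j).
  rewrite hz subr0 => /(_ _ _)/le_trans; apply.
  - by move: b0; rewrite lt_min => /andP[_ /ltW].
  - by move: b1; rewrite lt_min => /andP[_ /ltW].
  apply: ler_wpM2l => //; apply: le_trans ua.
  rewrite opprD addNKr normrN normrZ ler_piMr//; exact: norm_basis_vec.
have cmi := smooth_continuous (sM i k) Uy.
pose q := `|eigmat I s c (coord c (w t)) i k| / 2.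
have q0 : 0 < q by rewrite divr_gt0 ?normr_gt0.
have [r3 r30 mi] := (continuous_normP _ _).1 cmi q q0.
have {}mi y : `|y - coord c (w t)| < r3 -> q <= `|eigmat I s c y i k|.
  move=> /mi; have := lerB_dist (eigmat I s c (coord c (w t)) i k) (eigmat I s c y i k).
  by rewrite distrC /q; set a := `|_|; set b := `|_|; set d := `|_|; lra.
have r230 : 0 < Num.min r2 r3 by rewrite lt_min r20 r30.
have [e1 e10 e1P] := (continuous_normP _ _).1 (is_derive_path_cont dg0) _ r230.
pose K := q^-1 * (`|B| * (Lh * m^-1)).
have K0 : 0 <= K.
  by rewrite /K mulr_ge0 ?invr_ge0 ?(ltW q0)// mulr_ge0// mulr_ge0// invr_ge0 ltW.
pose T1 := Num.min (Num.min tau e1) (2 * (K + 1))^-1.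
have KK : 0 < 2 * (K + 1) by rewrite mulr_gt0// ltr_wpDl.
have T10 : 0 < T1 by rewrite !lt_min tau0 e10 invr_gt0.
have KT : K * T1 <= 2^-1.
  apply: le_trans (_ : K * (2 * (K + 1))^-1 <= _).
    by rewrite ler_wpM2l// /T1 ge_min lexx orbT.
  by rewrite ler_pdivrMr//; lra.
pose u (t' : R) : 'rV[R]_1 := \row_ _ F (coord c (g t')).
pose du (t' : R) : 'rV[R]_1 := \row_ _ \sum_l vel c g t' 0 l * 'D_(basis_vec l) F (coord c (g t')).
have inT t' : - T1 < t' < T1 -> - tau < t' < tau /\
    `|coord c (g t') - coord c (w t)| < Num.min r2 r3.
  rewrite -ltr_norml !lt_min => /andP[/andP[h1 h2] _]; split.
    by rewrite -ltr_norml.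
  rewrite -lt_min; have := e1P t'; rewrite subr0 => /(_ h2); by rewrite /= g0.
have norm1 (z : 'rV[R]_1) (a : R) : (forall o, z 0 o = a) -> `|z| = `|a|.
  move=> za; apply/eqP; rewrite eq_le; apply/andP; split.
    by apply: norm_row_le => // o; rewrite za.
  by rewrite -(za 0) norm_coord.
have gron t' : - T1 < t' < T1 -> is_derive t' 1 u (du t') /\ `|du t'| <= K * `|u t'|.
  move=> /inT[ttau tr]; have [cg sgt dg Dg Bg] := gP t' ttau.
  move: (tr); rewrite lt_min => /andP[tr2 tr3].
  have Ug : U (coord c (g t')).
    by have [v [_ _ ub]] := zf _ tr2; apply: rU1; have := ub 0; rewrite normr0 scale0r addr0; apply.
  split.
    apply/is_derive_rowP => o; rewrite mxE.
    have := is_derive_comp_row (x := coord c \o g) (smooth_differentiable oU sF Ug) dg.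
    by congr (is_derive _ _ _ _); apply/funext => o'; rewrite mxE.
  rewrite (norm1 (du t') (\sum_l vel c g t' 0 l * 'D_(basis_vec l) F (coord c (g t'))));
    last by move=> o; rewrite mxE.
  rewrite (norm1 (u t') (F (coord c (g t')))); last by move=> o; rewrite mxE.
  have kE := kerE _ _ sgt cg Dg; have qm := mi _ tr3; have hh := hF _ tr2.
  have vB l : `|vel c g t' 0 l| <= `|B|.
    by apply: le_trans (norm_coord _ _) _; apply: le_trans Bg (ler_norm _).
  rewrite sum2 /K -mulrA [_^-1 * _]mulrC ler_pdivlMr// mulrC.
  have bound : `|eigmat I s c (coord c (g t')) i k| *
      `|vel c g t' 0 0 * 'D_(basis_vec 0) F (coord c (g t')) +
        vel c g t' 0 1 * 'D_(basis_vec 1) F (coord c (g t'))| <= `|B| * `|h (coord c (g t'))|.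
    rewrite -normrM; have [->|->] : i = 0 \/ i = 1.
        by case: (i) => [[|[|//]] hi]; [left|right]; apply: val_inj.
      have -> : eigmat I s c (coord c (g t')) 0 k *
         (vel c g t' 0 0 * 'D_(basis_vec 0) F (coord c (g t')) +
          vel c g t' 0 1 * 'D_(basis_vec 1) F (coord c (g t'))) =
         vel c g t' 0 1 * h (coord c (g t')) + 'D_(basis_vec 0) F (coord c (g t')) *
         (vel c g t' 0 0 * eigmat I s c (coord c (g t')) 0 k +
          vel c g t' 0 1 * eigmat I s c (coord c (g t')) 1 k) by rewrite /h; ring.
      by rewrite kE mulr0 addr0 normrM ler_wpM2r.
    have -> : eigmat I s c (coord c (g t')) 1 k *
       (vel c g t' 0 0 * 'D_(basis_vec 0) F (coord c (g t')) +
        vel c g t' 0 1 * 'D_(basis_vec 1) F (coord c (g t'))) =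
       - vel c g t' 0 0 * h (coord c (g t')) + 'D_(basis_vec 1) F (coord c (g t')) *
       (vel c g t' 0 0 * eigmat I s c (coord c (g t')) 0 k +
        vel c g t' 0 1 * eigmat I s c (coord c (g t')) 1 k) by rewrite /h; ring.
    by rewrite kE mulr0 addr0 normrM normrN ler_wpM2r.
  apply: le_trans (ler_wpM2r (normr_ge0 _) qm) _; apply: le_trans bound _.
  by rewrite -!mulrA ler_wpM2l.
(* F vanishes along the tangent geodesic, which thus stays in the wall *)
have uz := gronwall K0 KT gron.
have u0 : u 0 = 0 by apply/rowP => o; rewrite !mxE g0 Fy.
pose t2 := Num.min (T1 / 2) (e / 2).
have t20 : 0 < t2 by rewrite lt_min !divr_gt0.
have t2T : - T1 < t2 < T1.
  rewrite -ltr_norml gtr0_norm// /t2 gt_min; apply/orP; left.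
  by rewrite ltr_pdivrMr// ltr_pMr// ltr1n.
have := uz t2 t2T; rewrite u0 normr0 mulr0 normr_le0 => /eqP ut.
have Ft : F (coord c (g t2)) = 0 by move/rowP: ut => /(_ 0); rewrite !mxE.
have [ttau tr] := inT _ t2T; have [cg _ _ _ _] := gP t2 ttau.
have Ug : U (coord c (g t2)).
  move: tr; rewrite lt_min => /andP[tr2 _].
  by have [v [_ _ ub]] := zf _ tr2; apply: rU1; have := ub 0; rewrite normr0 scale0r addr0; apply.
have := (FU _ Ug).2; rewrite coordK// Ft => TT.
apply: (eT t2); last by apply/TT.
rewrite subr0 gtr0_norm// t20 /= /t2 gt_min; apply/orP; right.
by rewrite ltr_pdivrMr// ltr_pMr// ltr1n.
Qed.

(** Both the defining function of the table and lam - lam0 vanish on the wall, and their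
differentials are proportional there since they kill its velocity; hence both change
sign together along an axis transverse to the wall. *)
Lemma wall_local c t : dom c (w t) -> exists r ep : R, [/\ 0 < r, `|ep| = 1 &
  forall y, `|y - coord c (w t)| < r -> [/\ sign_image I Om D s c y,
    exists k, 'D_(basis_vec k) (lam c) y != 0,
    range w (point c y) <-> lam c y = lam0 &
    T (point c y) <-> 0 <= ep * (lam c y - lam0)]].
Proof.
move=> ct; have [U [F [j [oU Uy sF Usp [jn FU]]]]] := wall_chart ct.
have [k kn] := wall_noncritical ct.
have sl : smooth_on U (lam c) by exact: smooth_sub Usp (@sign_image_lam c).
have dF := defining_function_wall oU sF (fun y Uy => (FU y Uy).1) ct Uy.
have dl := dlam_D (w_sp t) ct (w_D ct).
rewrite /dlam sum2 in dl; rewrite sum2 in dF.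
have jl := gradient_transfer (f := fun k => 'D_(basis_vec k) F _)
  (h := fun k => 'D_(basis_vec k) (lam c) _) (w_vel_neq0 ct) dF dl jn kn.
rewrite /= in jl.
have [mF [rF [sgF [mF0 rF0 sgF1 FP]]]] := partial_sign oU Uy sF jn.
have [ml [rl [sgl [ml0 rl0 sgl1 lP]]]] := partial_sign oU Uy sl jl.
have Fy : F (coord c (w t)) = 0 by apply/((FU _ Uy).1); rewrite coordK//; exists t.
pose r1 := Num.min rF rl.
have r10 : 0 < r1 by rewrite lt_min rF0 rl0.
have P1 y : `|y - coord c (w t)| < r1 -> U y.
  by rewrite lt_min => /andP[/FP[]].
have P2 y : `|y - coord c (w t)| < r1 -> mF <= sgF * 'D_(basis_vec j) F y.
  by rewrite lt_min => /andP[/FP[]].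
have P3 y : `|y - coord c (w t)| < r1 -> ml <= sgl * 'D_(basis_vec j) (lam c) y.
  by rewrite lt_min => /andP[_ /lP[]].
have [r r0 zf] := zero_finder oU sF P1 r10 Fy mF0 sgF1 P2.
exists r, (sgF * sgl); split => //; first by rewrite normrM sgF1 sgl1 mulr1.
move=> y yr; have [u [Fu _ ub]] := zf y yr.
have b0 : `|y - coord c (w t)| < r1.
  by have := ub 0; rewrite normr0 scale0r addr0; apply.
have Uy' := P1 _ b0; have Uu := P1 _ (ub u (lexx _)).
have lu : lam c (y + u *: basis_vec j) = lam0.
  have [u' _ uE] := ((FU _ Uu).1).2 Fu.
  have [cz zE] := img_point (sign_image_img (Usp _ Uu)).
  rewrite -(lamM_wall u') (lamM_chart (c := c) (w_sp u')) uE//.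
  by rewrite zE.
have lE : exists2 d : R, 0 < sgl * d & lam c y - lam0 = - u * d.
  have dd (z : R) : `|z| <= `|u| -> derivable (lam c) (y + z *: basis_vec j) (basis_vec j).
    by move=> /ub/P1; exact: smooth_derivable.
  have [z zu E] := mvt_basis dd; exists ('D_(basis_vec j) (lam c) (y + z *: basis_vec j)).
    by apply: lt_le_trans ml0 _; apply: P3; exact: ub.
  by rewrite mulNr -E lu opprB.
have FE : exists2 d : R, 0 < sgF * d & F y = - u * d.
  have dd (z : R) : `|z| <= `|u| -> derivable F (y + z *: basis_vec j) (basis_vec j).
    by move=> /ub/P1; exact: smooth_derivable.
  have [z zu E] := mvt_basis dd; exists ('D_(basis_vec j) F (y + z *: basis_vec j)).
    by apply: lt_le_trans mF0 _; apply: P2; exact: ub.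
  by rewrite mulNr -E Fu sub0r opprK.
have [dlm dlm0 {}lE] := lE; have [dFm dFm0 {}FE] := FE.
have nz (a b : R) : 0 < a * b -> b != 0.
  by move=> h; apply/eqP => b0'; move: h; rewrite b0' mulr0 ltxx.
split; first exact: Usp.
- exists j; apply: (nz sgl); apply: lt_le_trans ml0 _; exact: P3.
- have [-> _] := FU y Uy'; rewrite FE; split => /eqP.
    rewrite mulf_eq0 (negbTE (nz _ _ dFm0)) orbF => /eqP u0.
    by apply/eqP; rewrite -subr_eq0 lE u0 mul0r.
  rewrite -subr_eq0 lE mulf_eq0 (negbTE (nz _ _ dlm0)) orbF => /eqP ->.
  by rewrite mul0r.
have [_ ->] := FU y Uy'; rewrite FE lE.
have sq (a : R) : `|a| = 1 -> a * a = 1 by move=> a1; rewrite -expr2 -real_normK ?num_real// a1 expr1n.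
have -> : - u * dFm = sgF * - u * (sgF * dFm) by
  rewrite -mulrA [- u * (_ * _)]mulrCA !mulrA sq// mul1r.
have -> : sgF * sgl * (- u * dlm) = sgF * - u * (sgl * dlm) by ring.
by rewrite (pmulr_lge0 _ dFm0) (pmulr_lge0 _ dlm0).
Qed.

(** * A strip along the wall *)

(** A region along the wall in which the eigenvalue is a global transverse coordinate; ep
tells on which side of the wall the table lies. *)
Definition strip (U : set M) (ep del : R) : Prop :=
  [/\ open U, forall x, U x -> good x,
      forall x, U x -> (range w x <-> lamM s x = lam0) /\
        (T x <-> 0 <= ep * (lamM s x - lam0)),
      0 < del & forall x y : M, U x -> U y -> lamM s x = lamM s y ->
        `|lamM s x - lam0| < del -> linked x y].

Definition strip_along (a b : R) : Prop := exists (ep : R) (U V C : set M) (del : R),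
  [/\ `|ep| = 1, strip U ep del, open V, compact C &
      [/\ V `<=` C, C `<=` U & forall t, a <= t <= b -> V (w t)]].

Lemma w_good t : good (w t).
Proof.
have [c ct] := dom_cover S (w t); split; first exact: w_sp.
by exists c; split => //; exact: wall_noncritical.
Qed.

Lemma point_ball_open c p (r : R) : (forall y, `|y - p| < r -> img c y) ->
  open [set x | dom c x /\ `|coord c x - p| < r].
Proof.
move=> H; have -> : [set x | dom c x /\ `|coord c x - p| < r] =
    dom c `&` [set x | dom c x -> `|coord c x - p| < r].
  by apply/seteqP; split => [x [cx h]|x [cx h]]; split => //; exact: h.
rewrite openE => x [cx /(_ cx) h].
have h0 : 0 < r - `|coord c x - p| by rewrite subr_gt0.
have H1 : \forall y \near coord c x, `|y - p| < r.
  apply/near_normP; exists (r - `|coord c x - p|) => // y yx.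
  have := ler_normD (y - coord c x) (coord c x - p); rewrite subrKA => hh.
  by apply: le_lt_trans hh _; rewrite -ltrBrDr.
have H2 : \forall z \near x, `|coord c z - p| < r := coord_continuous cx H1.
have H3 : \forall z \near x, dom c z.
  by apply: open_nbhs_nbhs; split => //; exact: dom_open.
by apply: filterS2 H2 H3 => z ? ?; split.
Qed.

Lemma closed_ball_compact (p : 'rV[R]_2) (r : R) : compact [set y | `|y - p| <= r].
Proof.
apply: bounded_closed_compact.
  exists (`|p| + r); split; first exact: num_real.
  move=> m hm y /= yp; have := ler_normD (y - p) p; rewrite subrK => h.
  by apply: le_trans h _; apply: ltW; apply: le_lt_trans hm; rewrite addrC lerD2l.
have -> : [set y | `|y - p| <= r] = ~` [set y | r < `|y - p|].
  by apply/seteqP; split => y /=; rewrite leNgt => /negP.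
apply: open_closedC; apply: open_norm => y /= yr; exists (`|y - p| - r).
  by rewrite subr_gt0.
move=> z; rewrite distrC => zy; have := ler_normD (y - z) (z - p); rewrite subrKA.
by move: zy; set a := `|_|; set b := `|_|; set d := `|_|; lra.
Qed.

Lemma strip_local t : exists (ep : R) (U V C : set M) (del : R),
  [/\ `|ep| = 1, strip U ep del, open V /\ V (w t), compact C & V `<=` C /\ C `<=` U].
Proof.
have [c ct] := dom_cover S (w t); set p := coord c (w t).
have [r1 [ep [r10 ep1 H1]]] := wall_local ct.
have [r2 r20 H2] := flow_box (w_good t) ct.
pose r := Num.min r1 r2; have r0 : 0 < r by rewrite lt_min r10 r20.
have G0 y : `|y - p| < r -> good_image c y.
  rewrite lt_min => /andP[_ y2].
  by have [] := H2 y y y2 y2.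
pose B (q : R) := [set x | dom c x /\ `|coord c x - p| < q].
have oB q : q <= r -> open (B q).
  move=> qr; apply: point_ball_open => y yq; apply: (@good_image_img c); apply: G0.
  exact: lt_le_trans yq qr.
have Bg x : B r x -> good x.
  by move=> [cx /G0/good_imageP[]]; rewrite coordK.
have Bl x : B r x -> lamM s x = lam c (coord c x).
  by move=> Bx; apply: lamM_chart (good_sp (Bg x Bx)) Bx.1.
have rr : r / 2 <= r by lra.
have r20' : 0 < r / 2 by rewrite divr_gt0.
have Bw q : 0 < q -> B q (w t) by move=> q0; split => //; rewrite subrr normr0.
exists ep, (B r), (B (r / 2)), (point c @` [set y | `|y - p| <= r / 2]), 1; split => //.
- split => //; first exact: oB.
    move=> x Bx; have [cx] := Bx; rewrite lt_min => /andP[x1 _].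
    by have [_ _] := H1 _ x1; rewrite (coordK cx) (Bl x Bx).
  move=> x y Bx By; rewrite (Bl x Bx) (Bl y By) => E _.
  have [cx] := Bx; have [cy] := By; rewrite !lt_min => /andP[_ y2] /andP[_ x2].
  by have [_ /(_ E)] := H2 _ _ x2 y2; rewrite !coordK.
- by split; [exact: oB|exact: Bw].
- apply: continuous_compact; last exact: closed_ball_compact.
  apply: continuous_in_subspaceT => y /set_mem /= yr; apply: point_continuous.
  by apply: (@good_image_img c); apply: G0; apply: le_lt_trans yr _; lra.
split=> [x [cx h]|_ [y /= yr <-]].
  by exists (coord c x); [exact: ltW|rewrite coordK].
have yr' : `|y - p| < r by apply: le_lt_trans yr _; lra.
have [cy E] := img_point (good_image_img (G0 _ yr')).
by split => //; rewrite E.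
Qed.

Lemma lamM_continuous x : sp x -> {for x, continuous (lamM s)}.
Proof.
move=> sx; have [c cx] := dom_cover S x.
have sy : sign_image I Om D s c (coord c x) by exists x.
have lc := smooth_continuous (@sign_image_lam c) sy.
have H : \forall z \near x, (sp `&` dom c) z.
  by apply: open_nbhs_nbhs; split; [apply: openI; [exact: sp_open|exact: dom_open]|].
apply: (near_eq_continuous (f := lam c \o coord c)).
  by apply: filterS H => z [sz cz]; rewrite /= (lamM_chart sz cz).
exact: continuous_comp (coord_continuous cx) lc.
Qed.

Lemma unit_sqr (k : R) : `|k| = 1 -> k ^+ 2 = 1.
Proof. by move=> k1; rewrite -real_normK ?num_real// k1 expr1n. Qed.

Lemma wall_levels (U : set M) t : open U -> U (w t) -> exists2 r : R, 0 < r &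
  forall a : R, `|a - lam0| < r -> exists2 z, U z & lamM s z = a.
Proof.
move=> oU Ut; have [c ct] := dom_cover S (w t).
have [k kn] := wall_noncritical ct.
have oV : open (coord c @` ((U `&` sp) `&` dom c)).
  by apply: chart_image_open; apply: openI => //; exact: sp_open.
have Vt : (coord c @` ((U `&` sp) `&` dom c)) (coord c (w t)).
  by exists (w t) => //; split => //; split => //; exact: w_sp.
have sy : sign_image I Om D s c (coord c (w t)) by exists (w t) => //; split => //; exact: w_sp.
have [r r0 H] := lam_attains sy oV Vt kn.
exists r => // a; have := lamM_wall t; rewrite (lamM_chart (w_sp t) ct) => <- /H[y [z [[Uz sz] cz] <-] E].
by exists z => //; rewrite (lamM_chart sz cz).
Qed.

Lemma strip_sign U U' (ep ep' del del' : R) t : strip U ep del -> strip U' ep' del' ->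
  `|ep| = 1 -> `|ep'| = 1 -> U (w t) -> U' (w t) -> ep = ep'.
Proof.
move=> [oU _ UT _ _] [oU' _ UT' _ _] /unit_sqr e1 /unit_sqr e1' Ut Ut'.
have [r r0 H] := wall_levels (openI oU oU') (conj Ut Ut').
have r2 : 0 < r / 2 by rewrite divr_gt0.
have en : `|ep| = 1 by have [->|->] := sign_or e1; rewrite ?normrN normr1.
have [|z [Uz U'z] zE] := H (lam0 + ep * (r / 2)).
  by rewrite addrAC subrr add0r normrM en mul1r gtr0_norm//; lra.
have [_ T1] := UT z Uz; have [_ T2] := UT' z U'z.
have Tz : T z by apply/T1; rewrite zE addrAC subrr add0r mulrA -expr2 e1 mul1r ltW.
have := T2.1 Tz; rewrite zE addrAC subrr add0r.
by have [->|->] := sign_or e1; have [->|->] := sign_or e1' => // h; exfalso; lra.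
Qed.

(** Points of the same level, one in each strip, are both linked to a point of that level
near w t. *)
Lemma strip_union U U' (ep del del' : R) t : strip U ep del -> strip U' ep del' ->
  U (w t) -> U' (w t) -> exists del'' : R, strip (U `|` U') ep del''.
Proof.
move=> [oU Ug UT d0 UL] [oU' Ug' UT' d0' UL'] Ut Ut'.
have [r r0 H] := wall_levels (openI oU oU') (conj Ut Ut').
exists (Num.min r (Num.min del del')); split.
- exact: openU.
- by move=> x [/Ug|/Ug'].
- by move=> x [/UT|/UT'].
- by rewrite !lt_min r0 d0 d0'.
have link (x y : M) : U x -> U' y -> lamM s x = lamM s y ->
    `|lamM s x - lam0| < Num.min r (Num.min del del') -> linked x y.
  rewrite !lt_min => Ux U'y E /and3P[xr xd xd'].
  have [z [Uz U'z] zE] := H _ xr.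
  apply: (linked_trans (y := z)); first exact: UL.
  by apply: UL' => //; rewrite zE.
move=> x y [Ux|Ux] [Uy|Uy] E h.
- by apply: UL => //; move: h; rewrite !lt_min => /and3P[].
- exact: link.
- by apply: linked_sym; apply: link => //; rewrite -E.
- by apply: UL' => //; move: h; rewrite !lt_min => /and3P[].
Qed.

Lemma strip_along_all (a b : R) : a <= b -> strip_along a b.
Proof.
apply: interval_induction.
- move=> x y z /andP[xy yz].
  move=> [ep [U [V [C [d [e1 sU oV cC [VC CU Vw]]]]]]].
  move=> [ep' [U' [V' [C' [d' [e1' sU' oV' cC' [VC' CU' Vw']]]]]]].
  have Vy : V (w y) by apply: Vw; rewrite xy lexx.
  have Vy' : V' (w y) by apply: Vw'; rewrite yz lexx.
  have Uy := CU _ (VC _ Vy); have Uy' := CU' _ (VC' _ Vy').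
  have ee := strip_sign sU sU' e1 e1' Uy Uy'; rewrite -ee in sU'.
  have [d'' sU''] := strip_union sU sU' Uy Uy'.
  exists ep, (U `|` U'), (V `|` V'), (C `|` C'), d''; split => //.
  + exact: openU.
  + exact: compactU.
  split; [exact: setUSS|exact: setUSS|].
  move=> t /andP[xt tz]; have [ty|/ltW yt] := leP t y.
    by left; apply: Vw; rewrite xt ty.
  by right; apply: Vw'; rewrite yt tz.
- move=> x y z /andP[xy yz] [ep [U [V [C [d [e1 sU oV cC [VC CU Vw]]]]]]].
  exists ep, U, V, C, d; split => //; split => // t /andP[xt ty].
  by apply: Vw; rewrite xt (le_trans ty).
move=> t; have [ep [U [V [C [d [e1 sU [oV Vt] cC [VC CU]]]]]]] := strip_local t.
have [r r0 rP] := preimage_norm (@w_continuous t) oV Vt.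
exists r => // x y tx xy yt; exists ep, U, V, C, d; split => //; split => // u /andP[xu uy].
by apply: rP; rewrite ltr_distl (lt_le_trans tx xu) (le_lt_trans uy yt).
Qed.

Lemma w_unit_interval t : exists2 u : R, 0 <= u <= 1 & w u = w t.
Proof.
have /andP[f1 f2] := Num.Theory.floor_itv t.
exists (t - (Num.floor t)%:~R).
  by rewrite subr_ge0 f1 lerBlDr addrC -[1]/(1%:~R) -intrD (ltW f2).
have [[_ per] _] := w_leaf; apply/per; exists (Num.floor t).
by rewrite subrK.
Qed.

(** The wall has an open neighbourhood V contained in a compact part C of a strip.  On
C minus V the eigenvalue stays away from lam0 by compactness, and W is the part of V on
which it is closer to lam0: this seals W for the leaves and for the curves along which
the eigenvalue changes little. *)
Lemma wall_neighbourhood : exists (W : set M) (ep del : R), [/\ open W /\ range w `<=` W,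
  0 < del /\ (forall x, W x -> good x /\ `|lamM s x - lam0| < del),
  `|ep| = 1 /\ (forall x, W x -> (T x <-> 0 <= ep * (lamM s x - lam0))),
  (forall x y : M, W x -> W y -> lamM s x = lamM s y -> linked x y) &
  forall (k : R -> M) (a b : R), a <= b -> (forall t, a <= t <= b -> {for t, continuous k}) ->
    W (k a) -> ~ W (k b) -> exists2 t : R, a < t <= b &
    [/\ forall u, a <= u < t -> W (k u), good (k t), del <= `|lamM s (k t) - lam0|,
      (range w (k t) -> lamM s (k t) = lam0) &
      T (k t) -> 0 <= ep * (lamM s (k t) - lam0)]].
Proof.
have [ep [U [V [C [d [ep1 sU oV cC [VC CU Vw]]]]]]] := strip_along_all ler01.
have {}Vw t : V (w t) by have [u /Vw + <-] := w_unit_interval t.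
have [oU Ug UT d0 UL] := sU.
have fc x : U x -> {for x, continuous (fun x => `|lamM s x - lam0|)}.
  move=> /Ug/good_sp/lamM_continuous lc.
  apply: (continuous_comp (f := fun x => lamM s x - lam0)); last exact: norm_continuous.
  by apply: cvgB; [exact: lc|exact: cvg_cst].
have cK : compact (C `&` ~` V) by apply: compact_closedI => //; exact: open_closedC.
have cI : compact ((fun x => `|lamM s x - lam0|) @` (C `&` ~` V)).
  apply: continuous_compact => //; apply: continuous_in_subspaceT.
  by move=> x /set_mem[/CU Ux _]; exact: fc.
have nI : ~ ((fun x => `|lamM s x - lam0|) @` (C `&` ~` V)) 0.
  move=> [x [Cx nV]] /eqP; rewrite normr_eq0 subr_eq0 => /eqP xl.
  have [[_ /(_ xl)[t _ tE]] _] := UT x (CU x Cx).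
  by apply: nV; rewrite -tE.
have oI := closed_openC (compact_closed (@Rhausdorff R) cI).
have [r r0 rP] := open_normP oI nI.
pose del := Num.min d r; have del0 : 0 < del by rewrite lt_min d0 r0.
pose W := V `&` [set x | `|lamM s x - lam0| < del].
have WV x : W x -> V x by case.
have WU x : W x -> U x by move=> /WV/VC/CU.
have oW : open W.
  rewrite openE => x Wx; have [Vx xd] := Wx.
  have H1 : \forall y \near `|lamM s x - lam0|, (y : R) < del.
    by apply: open_nbhs_nbhs; split => //; exact: open_lt.
  have H2 : \forall z \near x, `|lamM s z - lam0| < del := fc x (WU x Wx) _ H1.
  have H3 : \forall z \near x, V z by apply: open_nbhs_nbhs.
  by apply: filterS2 H2 H3.
exists W, ep, del; split.
- split => // _ [t _ <-]; split; first exact: Vw.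
  by rewrite /= lamM_wall subrr normr0.
- by split => // x Wx; split; [exact: Ug (WU x Wx)|have [] := Wx].
- by split => // x /WU/UT[].
- move=> x y Wx Wy E; apply: UL => //; [exact: WU|exact: WU|].
  by have [_ /= h] := Wx; apply: lt_le_trans h _; rewrite /del ge_min lexx.
move=> k a b ab kc Wa Wb; have [t tab [nW Wu]] := first_exit oW ab kc Wa Wb.
have /andP[at0 tb] := tab.
have Ct : C (k t).
  apply: contrapT => nC; have oC := closed_openC (compact_closed (surface_hausdorff S) cC).
  have tab' : a <= t <= b by rewrite (ltW at0).
  have [e e0 eP] := preimage_norm (kc t tab') oC nC.
  pose u := Num.max a (t - e / 2).
  have ut : u < t by rewrite gt_max at0 /=; lra.
  have au : a <= u by rewrite le_max lexx.
  have ue : t - e / 2 <= u by rewrite le_max lexx orbT.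
  have := eP u; rewrite ltr_distl => /(_ _); apply.
    by apply/andP; split; lra.
  by apply: VC; apply: WV; apply: Wu; rewrite au ut.
have Ut := CU _ Ct; exists t => //; split => //.
- exact: Ug.
- rewrite leNgt; apply/negP => lt; apply: nW; split => //.
  apply: contrapT => nV; have := rP `|lamM s (k t) - lam0|; rewrite subr0 normr_id.
  move=> /(_ (lt_le_trans lt _)); apply; first by rewrite /del ge_min lexx orbT.
  by exists (k t).
- by have [[h _] _] := UT _ Ut.
by have [_ [h _]] := UT _ Ut.
Qed.

(** * Integral and caustics *)

Definition seg_integral (sg : @segment R M) : R := let c := chart_at (track sg 0) in
  vform I c (coord c (track sg 0)) (vel c (track sg) 0).

Lemma segment_vform sg t c : is_segment G T w sg -> 0 <= t <= len sg ->
  dom c (track sg t) ->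
  vform I c (coord c (track sg t)) (vel c (track sg) t) = seg_integral sg.
Proof.
move=> [l0 [e e0 gg] _ _ _] /andP[t0 tl] ct.
apply: (geodesic_vform_const I gg _ _ ct (chart_atP _)).
  by rewrite (lt_le_trans _ t0) ?oppr_lt0// (le_lt_trans tl)// ltrDl.
by rewrite oppr_lt0 e0 addr_gt0.
Qed.

Lemma segment_inner sg t c : is_segment G T w sg -> 0 <= t <= len sg ->
  dom c (track sg t) ->
  inner G c (coord c (track sg t)) (vel c (track sg) t) (vel c (track sg) t) = 1.
Proof.
move=> [l0 [e e0 gg] u _ _] /andP[t0 tl] ct.
have te : - e < t < len sg + e.
  by rewrite (lt_le_trans _ t0) ?oppr_lt0// (le_lt_trans tl)// ltrDl.
have [v0 _] := gg t c te ct.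
have p : 0 < inner G c (coord c (track sg t)) (vel c (track sg) t) (vel c (track sg) t).
  by apply: inner_gt0 => //; exists (track sg t).
have := u t c; rewrite t0 tl => /(_ isT ct); rewrite /speed => h.
by rewrite -[LHS]sqr_sqrtr ?(ltW p)// h expr1n.
Qed.

Lemma geodesic_lamM_derive g (a b t : R) c : geodesic G g a b -> a < t < b ->
  sp (g t) -> dom c (g t) -> is_derive t 1 (lamM s \o g) (dlam c (g t) (vel c g t)).
Proof.
move=> gg tab st ct; have [e [p [_ _ _ dv _]]] := geodesic_chart gg tab ct.
exact: lamM_derive st ct (geodesic_continuous gg tab) dv.
Qed.

Lemma unit_vform c x v : sp x -> dom c x -> inner G c (coord c x) v v = 1 ->
  D c (coord c x) v <-> vform I c (coord c x) v = lamM s x.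
Proof.
move=> sx cx u; rewrite (D_vform zero_real D_bisector v s2 sx cx) u mulr1.
by rewrite (lamM_chart sx cx).
Qed.

(** The vectors of D are isotropic for the degenerate form vform - lam * inner, so
that this form does not see them. *)
Lemma vform_D_shift c x (u : 'rV[R]_2) v (k : R) : sp x -> dom c x -> D c (coord c x) u ->
  vform I c (coord c x) (k *: u + v) -
    lam c (coord c x) * inner G c (coord c x) (k *: u + v) (k *: u + v) =
  vform I c (coord c x) v - lam c (coord c x) * inner G c (coord c x) v v.
Proof.
move=> sx cx Du; have [Ox _] := sx.
have [sM _ _] := eigmat_spec zero_real s2 Ox cx.
have := (D_eigmat zero_real D_bisector u s2 sx cx).1 Du; rewrite (mul2_eq0 _ sM).
have E := vform_eiglam I s (x := x) (c := c); rewrite -!E// => -[h0 h1].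
rewrite !bil2 sM !add_row !scale_row.
move: (eigmat I s c (coord c x)) h0 h1 => A h0 h1.
transitivity ((v 0 0 * A 0 0 + v 0 1 * A 0 1) * v 0 0 +
   (v 0 0 * A 0 1 + v 0 1 * A 1 1) * v 0 1 +
   (k ^+ 2 * u 0 0 + 2 * k * v 0 0) * (u 0 0 * A 0 0 + u 0 1 * A 0 1) +
   (k ^+ 2 * u 0 1 + 2 * k * v 0 1) * (u 0 0 * A 0 1 + u 0 1 * A 1 1)); first by ring.
by rewrite h0 h1 !mulr0 !addr0.
Qed.

(** The wall is tangent to an eigendirection of vform, so that reflection in it
preserves the integral. *)
Lemma seg_integral_reflected sg sg' : is_segment G T w sg -> is_segment G T w sg' ->
  reflected G w sg sg' -> seg_integral sg = seg_integral sg'.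
Proof.
move=> Hs Hs' [E0 R0]; have [l0 _ _ [_ [t _ tE]] _] := Hs; have [l0' _ _ _ _] := Hs'.
have [c ct] := dom_cover S (w t).
have wt' : w t = track sg' 0 by rewrite E0.
have cs : dom c (track sg (len sg)) by rewrite -tE.
have cs' : dom c (track sg' 0) by rewrite -wt'.
have := R0 t c wt' ct; rewrite tE /= => v'E.
have ll : 0 <= len sg <= len sg by rewrite ltW//=.
have ll' : 0 <= (0 : R) <= len sg' by rewrite lexx ltW.
rewrite -(segment_vform Hs ll cs) -(segment_vform Hs' ll' cs').
have i1 := segment_inner Hs ll cs; have i2 := segment_inner Hs' ll' cs'.
have st : sp (track sg (len sg)) by rewrite -tE; exact: w_sp.
have Dt : D c (coord c (track sg (len sg))) (vel c w t) by rewrite -tE; exact: w_D.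
have := vform_D_shift (- vel c (track sg) (len sg))
  (2 * inner G c (coord c (track sg (len sg))) (vel c (track sg) (len sg)) (vel c w t) /
    inner G c (coord c (track sg (len sg))) (vel c w t) (vel c w t)) st cs Dt.
rewrite E0 in i2; have No : forall y v, vform I c y (- v) = vform I c y v.
  by move=> y v; rewrite /vform mulNmx /quad_form !opp_row; ring.
have Ni y v : inner G c y (- v) (- v) = inner G c y v v.
  by rewrite /inner !bil2 !opp_row; ring.
rewrite -v'E No (Ni (coord c (track sg (len sg)))) i1 i2 E0 => /addIr h.
exact: esym h.
Qed.

Lemma seg_integral_trajectory n sg i j : trajectory G T w n sg -> (i <= n)%N -> (j <= n)%N ->
  seg_integral (sg i) = seg_integral (sg j).
Proof.
move=> [Hs Hr]; have H k : (k <= n)%N -> seg_integral (sg k) = seg_integral (sg 0%N).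
  elim: k => // k IH kn; rewrite -(IH (ltnW kn)); apply/esym.
  by apply: seg_integral_reflected; [exact: Hs (ltnW kn)|exact: Hs|exact: Hr].
by move=> /H -> /H ->.
Qed.

(** Otherwise the segment would be tangent to the wall at its initial point, and by
convexity it would run outside the table. *)
Lemma seg_integral_neq sg : is_segment G T w sg -> seg_integral sg <> lam0.
Proof.
move=> Hs E; have [l0 [e e0 gg] _ [[t _ tE] _] inT] := Hs.
have e00 : - e < 0 < len sg + e by rewrite oppr_lt0 e0 addr_gt0.
have ll : 0 <= (0 : R) <= len sg by rewrite lexx ltW.
have st : sp (track sg 0) by rewrite -tE; exact: w_sp.
have col c : dom c (w t) -> collinear (vel c (track sg) 0) (vel c w t).
  move=> ct; have cs : dom c (track sg 0) by rewrite -tE.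
  have Dv : D c (coord c (track sg 0)) (vel c (track sg) 0).
    apply/(unit_vform st cs); first exact: segment_inner Hs ll cs.
    by rewrite (segment_vform Hs ll cs) E -tE lamM_wall.
  have [Ot _] := st; have [X X0 XP] := D_line D_bisector Ot cs.
  have [k kE] := (XP _).1 Dv.
  have [l lE] : exists l : R, vel c w t = l *: X by apply/XP; rewrite -tE; exact: w_D.
  have l00 : l != 0.
    by apply/eqP => lz; move: (w_vel_neq0 ct); rewrite lE lz scale0r eqxx.
  have [v0 _] := gg 0 c e00 cs.
  have k0 : k != 0 by apply/eqP => kz; move: v0; rewrite kE kz scale0r eqxx.
  by exists (k / l); [rewrite mulf_neq0 ?invr_eq0|rewrite kE lE scalerA divfK].
have [d d0 H] := w_convex gg e00 (esym tE) col.
pose u := Num.min (d / 2) (len sg / 2).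
have u0 : 0 < u by rewrite lt_min !divr_gt0.
apply: (H u).
  rewrite subr0 gtr0_norm// u0 gt_min; apply/orP; left; lra.
have [] := inT u; rewrite ?u0 ?gt_min//=; apply/orP; right; lra.
Qed.

Section Caustics.
Variables (W : set M) (ep del : R).
Hypothesis W_open : open W.
Hypothesis W_wall : range w `<=` W.
Hypothesis W_good : forall x, W x -> good x /\ `|lamM s x - lam0| < del.
Hypothesis ep1 : `|ep| = 1.
Hypothesis W_table : forall x, W x -> (T x <-> 0 <= ep * (lamM s x - lam0)).
Hypothesis W_linked : forall x y : M, W x -> W y -> lamM s x = lamM s y -> linked x y.
Hypothesis W_exit : forall (k : R -> M) (a b : R), a <= b ->
  (forall t, a <= t <= b -> {for t, continuous k}) ->
  W (k a) -> ~ W (k b) -> exists2 t : R, a < t <= b &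
    [/\ forall u, a <= u < t -> W (k u), good (k t), del <= `|lamM s (k t) - lam0|,
      (range w (k t) -> lamM s (k t) = lam0) &
      T (k t) -> 0 <= ep * (lamM s (k t) - lam0)].

Lemma W_sp x : W x -> sp x. Proof. by move=> /W_good[/good_sp]. Qed.

Lemma T_level (x y : M) : (W `&` T) x -> W y -> lamM s x = lamM s y -> T y.
Proof. by move=> [Wx Tx] Wy E; apply/(W_table Wy); rewrite -E; apply/(W_table Wx). Qed.

(** The eigenvalue is constant along the arc, which therefore cannot leave W. *)
Lemma leaf_of_level (x y : M) : (W `&` T) x -> W y -> lamM s x = lamM s y -> leaf D (W `&` T) x y.
Proof.
move=> WTx Wy E; have [Wx Tx] := WTx.
have [g [a [b [t [ag ab0 /andP[t0 tb] g0 gt]]]]] := linked_forward (W_linked Wx Wy E).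
have /andP[a0 b0] := ab0.
have lg u : a < u < b -> lamM s (g u) = lamM s x.
  by move=> uab; rewrite -g0; exact: lamM_arc ag uab ab0.
have Wg u : 0 <= u <= t -> W (g u).
  move=> /andP[u0 ut]; apply: contrapT => nW.
  have gc (v : R) : 0 <= v <= u -> {for v, continuous g}.
    move=> /andP[v0 vu]; apply: arc_continuous ag _.
    by rewrite (lt_le_trans a0 v0) (le_lt_trans (le_trans vu ut) tb).
  have W0 : W (g 0) by rewrite g0.
  have [v /andP[v0 vu] [_ _ h _ _]] := W_exit u0 gc W0 nW.
  have vab : a < v < b by rewrite (lt_trans a0 v0) (le_lt_trans (le_trans vu ut) tb).
  by have [_] := W_good Wx; rewrite -(lg v vab) ltNge h.
have tab : a < t < b by rewrite (lt_le_trans a0 t0).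
have ll0 : 0 <= (0 : R) <= t by rewrite lexx.
have llt : 0 <= t <= t by rewrite lexx t0.
have [r1 r10 H1] := preimage_norm (arc_continuous ag ab0) W_open (Wg 0 ll0).
have [r2 r20 H2] := preimage_norm (arc_continuous ag tab) W_open (Wg t llt).
pose a' := Num.max a (- r1); pose b' := Num.min b (t + r2).
have aa' : a <= a' by rewrite le_max lexx.
have bb' : b' <= b by rewrite ge_min lexx.
have a'0 : a' < 0 by rewrite gt_max a0 oppr_lt0.
have tb' : t < b' by rewrite lt_min tb ltrDl.
have Wab u : a' < u < b' -> W (g u).
  move=> /andP[a'u ub']; have [u0|u0] := ltP u 0.
    apply: H1; rewrite subr0 ltr0_norm// ltrNl; apply: le_lt_trans a'u.
    by rewrite le_max lexx orbT.
  have [ut|tu] := leP u t; first by apply: Wg; rewrite u0.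
  apply: H2; rewrite ger0_norm ?subr_ge0 ?(ltW tu)// ltrBlDl.
  by apply: lt_le_trans ub' _; rewrite ge_min lexx orbT.
have [[rg ig] _] := arc_integral (arc_sub aa' bb' ag).
exists g, a', b', 0, t; split => //.
- split => // u uab; have Wu := Wab u uab; split; last by have [] := ig u uab.
  split => //; apply: (T_level WTx Wu); rewrite lg//.
  by move: uab => /andP[u1 u2]; rewrite (le_lt_trans aa' u1) (lt_le_trans u2 bb').
- by rewrite a'0 (le_lt_trans t0 tb').
- by rewrite tb' (lt_le_trans a'0 t0).
Qed.

Lemma lamM_leaf (x y : M) : leaf D (W `&` T) x y -> [/\ W y, T y & lamM s y = lamM s x].
Proof.
move=> [g [a [b [u [t [ig uab tab <- <-]]]]]].
have [_ /(_ t tab)[[Wt Tt] _]] := ig; split => //.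
by apply: lamM_integral_curve ig tab uab => z [/W_sp].
Qed.

(** A geodesic segment tangent to a leaf is so at a point where its unit velocity is
in D, hence the value of the integral is the value of the eigenvalue on the leaf. *)
Lemma tangent_value sg x : is_segment G T w sg -> (W `&` T) x ->
  segment_tangent G sg (leaf D (W `&` T) x) -> seg_integral sg = lamM s x.
Proof.
move=> Hs WTx [g [a [b [t [[/andP[a0 l0] lb] gg gE tab [Kt tan]]]]]].
have [Wt _ lt] := lamM_leaf Kt; have [gt _] := W_good Wt; have st := good_sp gt.
pose h := len sg / 2.
have h0 : 0 < h by rewrite divr_gt0.
have hl : h < len sg by rewrite /h; lra.
have hh : 0 <= h <= len sg by rewrite !ltW.
have hab : a < h < b by rewrite (lt_trans a0 h0) (lt_trans hl lb).
have [c ch] := dom_cover S (track sg h); have [d dt] := dom_cover S (g t).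
have ch' : dom c (g h) by rewrite gE.
have h00 : 0 < h < len sg by rewrite h0.
have velh : vel c g h = vel c (track sg) h.
  rewrite /vel !derive1E; apply: near_eq_derive; apply: filterS (near_itvP h00) => u.
  by move=> /andP[u1 u2]; rewrite /= gE// !ltW.
have i1 : inner G d (coord d (g t)) (vel d g t) (vel d g t) = 1.
  by rewrite (geodesic_inner_const gg tab hab dt ch') velh gE// (segment_inner Hs hh ch).
have v1 : vform I d (coord d (g t)) (vel d g t) = seg_integral sg.
  by rewrite (geodesic_vform_const I gg tab hab dt ch') velh gE// (segment_vform Hs hh ch).
rewrite -v1 -lt; apply/(unit_vform st dt i1).
have [k [e [e0 [sk _] k0 kK [l l0' vE]]]] := tan d dt.
have e00 : - e < 0 < e by rewrite oppr_lt0 e0.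
have dk : dom d (k 0) by rewrite k0.
have sk0 : sp (k 0) by rewrite k0.
have dl := lamM_derive sk0 dk (smooth_curve_continuous sk e00) (smooth_curve_vel sk e00 dk).
have d0 : dlam d (k 0) (vel d k 0) = 0.
  have c0 : is_derive (0:R) 1 (cst (lamM s x) : R -> R) 0 by exact: is_derive_cst.
  apply: is_derive_unique dl _; apply: near_eq_is_derive c0.
  by apply: filterS (near_itvP e00) => u /kK/lamM_leaf[_ _] /= ->.
rewrite vE; apply/(D_dlam _ st dt (good_chart gt dt)).
by rewrite dlam_scale -k0 d0 mulr0.
Qed.

(** The eigenvalue starts from lam0.  If the segment stays in W, it returns to lam0, and
at a critical point in between the velocity lies in D, where the integral equals the
eigenvalue.  If the segment leaves W, the eigenvalue takes the value of the integral
before that. *)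
Lemma segment_touches sg x : is_segment G T w sg -> (W `&` T) x ->
  seg_integral sg = lamM s x -> exists u : R, [/\ 0 < u < len sg, W (track sg u),
    lamM s (track sg u) = lamM s x & forall c, dom c (track sg u) ->
    D c (coord c (track sg u)) (vel c (track sg) u)].
Proof.
move=> Hs [Wx Tx] E; have [l0 [e e0 gg] _ [[t0 _ t0E] [t1 _ t1E]] inT] := Hs.
have xneq : lamM s x <> lam0 by rewrite -E; exact: seg_integral_neq.
have inI u : 0 <= u <= len sg -> - e < u < len sg + e.
  move=> /andP[u0 ul].
  by rewrite (lt_le_trans _ u0) ?oppr_lt0// (le_lt_trans ul)// ltrDl.
have tc u : 0 <= u <= len sg -> {for u, continuous (track sg)}.
  by move=> /inI; exact: geodesic_continuous gg.
have W0 : W (track sg 0) by rewrite -t0E; apply: W_wall; exists t0.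
have f0 : lamM s (track sg 0) = lam0 by rewrite -t0E lamM_wall.
have f1 : lamM s (track sg (len sg)) = lam0 by rewrite -t1E lamM_wall.
have fcont u : 0 <= u <= len sg -> sp (track sg u) ->
    {for u, continuous (lamM s \o track sg)}.
  by move=> ul su; apply: continuous_comp (tc u ul) (lamM_continuous su).
have [WA|] := pselect (forall u, 0 <= u <= len sg -> W (track sg u)).
  have [|||u] := @Rolle R (lamM s \o track sg) 0 (len sg) l0.
  - move=> u; rewrite in_itv/= => /andP[u0 ul].
    have ul' : 0 <= u <= len sg by rewrite !ltW.
    have [c cu] := dom_cover S (track sg u).
    by have [] := geodesic_lamM_derive gg (inI u ul') (W_sp (WA u ul')) cu.
  - apply: continuous_in_subspaceT => u /set_mem /=; rewrite in_itv/= => ul.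
    exact: fcont ul (W_sp (WA u ul)).
  - by rewrite /= f0 f1.
  rewrite in_itv/= => u0l df; have ul : 0 <= u <= len sg.
    by move: u0l => /andP[u1 u2]; rewrite !ltW.
  have Wu := WA u ul; have [gu _] := W_good Wu; have su := W_sp Wu.
  have Du c : dom c (track sg u) -> D c (coord c (track sg u)) (vel c (track sg) u).
    move=> cu; apply/(D_dlam _ su cu (good_chart gu cu)).
    exact: is_derive_unique (geodesic_lamM_derive gg (inI u ul) su cu) df.
  exists u; split => //; have [c cu] := dom_cover S (track sg u).
  have := (unit_vform su cu (segment_inner Hs ul cu)).1 (Du c cu).
  by rewrite (segment_vform Hs ul cu) E.
move=> /existsNP[b /not_implyP[/andP[b0 bl] nWb]].
have bc u : 0 <= u <= b -> {for u, continuous (track sg)}.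
  by move=> /andP[u0 ub]; apply: tc; rewrite u0 (le_trans ub).
have [t /andP[tp tb] [Wt gt dt rt Tt]] := W_exit b0 bc W0 nWb.
have [_ xd] := W_good Wx.
have del0 : 0 < del by apply: le_lt_trans xd.
have tl : t < len sg.
  rewrite lt_neqAle (le_trans tb bl) andbT; apply/eqP => tE.
  move: dt; rewrite rt ?subrr ?normr0 1?leNgt ?del0//.
  by rewrite tE -t1E; exists t1.
have ft := Tt (inT t (introT andP (conj tp tl))).1.
have fx := (W_table Wx).1 Tx.
pose f u : R := ep * (lamM s (track sg u) - lam0).
have spu u : 0 <= u <= t -> sp (track sg u).
  move=> /andP[u0]; rewrite le_eqVlt => /orP[/eqP ->|ut]; first exact: good_sp.
  by apply: W_sp; apply: Wt; rewrite u0.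
have fcs : {within `[0, t], continuous f}.
  apply: continuous_in_subspaceT => u /set_mem /=; rewrite in_itv/= => /andP[u0 ut].
  have ul : 0 <= u <= len sg by rewrite u0 (le_trans ut (ltW tl)).
  have su : sp (track sg u) by apply: spu; rewrite u0.
  have h := fcont u ul su; apply: cvgMr; apply: cvgB; [exact: h|exact: cvg_cst].
have absf z : 0 <= ep * (z - lam0) -> ep * (z - lam0) = `|z - lam0|.
  by move=> h; rewrite -(ger0_norm h) normrM ep1 mul1r.
have [u] : exists2 u, u \in `[0, t] & f u = ep * (lamM s x - lam0).
  apply: IVT => //; first exact: ltW.
  rewrite /f f0 subrr mulr0 ge_min le_max fx /=; apply/orP; right.
  by rewrite (absf _ fx) (absf _ ft); exact: ltW (lt_le_trans xd dt).
have ep0 : ep != 0 by rewrite -normr_eq0 ep1 oner_eq0.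
rewrite in_itv/= => /andP[u0 ut] /(mulfI ep0)/addIr fu.
have u00 : 0 < u.
  by rewrite lt_neqAle u0 andbT; apply/eqP => uE; apply: xneq; rewrite -fu -uE f0.
have utt : u < t.
  rewrite lt_neqAle ut andbT; apply/eqP => uE.
  by move: xd; rewrite -fu uE ltNge dt.
have Wu : W (track sg u) by apply: Wt; rewrite u0.
exists u; split => //; first by rewrite u00 (lt_trans utt).
move=> c cu; have ul : 0 <= u <= len sg by rewrite u0 ltW// (lt_trans utt).
apply/(unit_vform (W_sp Wu) cu (segment_inner Hs ul cu)).
by rewrite (segment_vform Hs ul cu) E fu.
Qed.

Lemma value_tangent sg x : is_segment G T w sg -> (W `&` T) x ->
  seg_integral sg = lamM s x -> segment_tangent G sg (leaf D (W `&` T) x).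
Proof.
move=> Hs WTx E; have [Wx Tx] := WTx; have [l0 [e e0 gg] _ _ inT] := Hs.
have [u [/andP[u0 ul] Wu lu Du]] := segment_touches Hs WTx E.
have uab : - e < u < len sg + e.
  by rewrite (lt_trans _ u0) ?oppr_lt0// (lt_trans ul)// ltrDl.
exists (track sg), (- e), (len sg + e), u; split => //.
  by rewrite oppr_lt0 e0 l0 ltrDl.
split; first by apply: leaf_of_level.
move=> c cu.
have [g [a [b [t [ag ab0 /andP[t0 tb] g0 _]]]]] := linked_forward (W_linked Wu Wu erefl).
have /andP[a0 b0] := ab0.
have W0 : W (g 0) by rewrite g0.
have [r r0 rP] := preimage_norm (arc_continuous ag ab0) W_open W0.
pose d := Num.min r (Num.min (- a) b).
have d0 : 0 < d by rewrite !lt_min r0 oppr_gt0 a0.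
have aab : a <= - d by rewrite lerNr /d !ge_min lexx orbT.
have bab : d <= b by rewrite /d !ge_min lexx !orbT.
have [[rg ig] ug] := arc_integral (arc_sub aab bab ag).
have d00 : - d < 0 < d by rewrite oppr_lt0 d0.
exists g, d; split => //.
  move=> v vd; have Wv : W (g v).
    apply: rP; rewrite subr0; apply: lt_le_trans (_ : d <= r); first by rewrite ltr_norml.
    by rewrite /d ge_min lexx.
  apply: leaf_of_level => //; rewrite -lu -g0.
  apply: (lamM_arc ag ab0); move: vd => /andP[v1 v2].
  by rewrite (le_lt_trans aab v1) (lt_le_trans v2 bab).
have cg : dom c (g 0) by rewrite g0.
have [gg0 Dg] := ig 0 d00.
have [gu _] := W_good Wu.
have ul' : 0 <= u <= len sg by rewrite !ltW.
have [k [k1 kE]] := unit_multiple gu cu (Du c cu) (segment_inner Hs ul' cu).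
have [l [l1 lE]] := unit_multiple gg0 cg (Dg c cg) (ug 0 c d00 cg).
have nz (m : R) : m ^+ 2 = 1 -> m != 0.
  by move=> m1; apply/eqP => m0; move: m1; rewrite m0 expr0n => /eqP; rewrite eq_sym oner_eq0.
exists (k / l); first by rewrite mulf_neq0 ?invr_eq0 ?nz.
by rewrite kE lE g0 scalerA (divfK (nz l l1)).
Qed.

Lemma leaves_caustic x : (W `&` T) x -> caustic G T w (leaf D (W `&` T) x).
Proof.
move=> WTx n sg tr i j ni nj tan; have [Hs _] := tr.
apply: value_tangent => //; first exact: Hs.
rewrite -(tangent_value (Hs i ni) WTx tan); exact: seg_integral_trajectory tr nj ni.
Qed.

Lemma W_smooth_field : smooth_field W D.
Proof.
split=> [c c' x v Wx|c x Wx cx].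
  by have [/good_Om Ox _] := W_good Wx; exact: (D_change D_bisector v Ox).
have Vg y : (setT `&` coord c @` (W `&` dom c)) y -> good_image c y.
  by move=> [_ [z [/W_good[gz _] cz] <-]]; exists z.
exists setT, (ufield c); split => //; first exact: openT.
  by move=> i; apply: (smooth_sub Vg); exact: ufield_smooth.
move=> _ [_ [z [/W_good[gz _] cz] <-]]; split; first exact: ufield_neq0.
by move=> v; exact: ufield_D.
Qed.

Lemma W_closed_leaf : closed_leaf D W w.
Proof.
have [sc il] := w_leaf; split => // a b; split; first by have [] := il a b.
move=> t _; split; first by apply: W_wall; exists t.
by move=> c ct; exact: w_D.
Qed.

End Caustics.

Lemma wall_foliated : foliated_by_caustics G T w.
Proof.
have [W [ep [del [[oW wW] [d0 Wg] [e1 WT] WL WX]]]] := wall_neighbourhood.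
exists W, D; split => //.
- exact: W_smooth_field Wg.
- exact: W_closed_leaf.
move=> x WTx; exact: (leaves_caustic oW wW Wg e1 WT WL WX WTx).
Qed.

(** * Segments leaving the wall at small angles *)

Lemma vform_smooth c :
  smooth_on (phase c) (fun z : 'rV[R]_(2 + 2) => vform I c (lsubmx z) (rsubmx z)).
Proof.
have oU := @phase_open R M S c.
have sg j k : smooth_on (phase c) (fun z : 'rV[R]_(2 + 2) => gram G c (lsubmx z) j k).
  exact: (smooth_lsubmx (@img_open _ _ S c) (@gram_smooth _ _ _ G c j k)).
have sr j : smooth_on (phase c) (fun z : 'rV[R]_(2 + 2) => rsubmx z 0 j).
  apply: (smooth_ext oU (f := fun z => z 0 (rshift 2 j))); last exact: smooth_coord.
  by move=> z _; rewrite mxE.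
have sq k : smooth_on (phase c) (fun z : 'rV[R]_(2 + 2) =>
    (rsubmx z *m gram G c (lsubmx z)) 0 k).
  apply: (smooth_ext oU (f := fun z => rsubmx z 0 0 * gram G c (lsubmx z) 0 k +
      rsubmx z 0 1 * gram G c (lsubmx z) 1 k)); first by move=> z _; rewrite mul2.
  exact: (smoothD oU (smoothM oU (sr 0) (sg 0 k)) (smoothM oU (sr 1) (sg 1 k))).
have s0 := smooth_lsubmx (n := 2) (@img_open _ _ S c) (@coef0_smooth _ _ _ _ I c).
have s1 := smooth_lsubmx (n := 2) (@img_open _ _ S c) (@coef1_smooth _ _ _ _ I c).
have s2' := smooth_lsubmx (n := 2) (@img_open _ _ S c) (@coef2_smooth _ _ _ _ I c).
exact: (smoothD oU (smoothD oU (smoothM oU s0 (smooth_sqr oU (sq 0)))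
  (smoothM oU s1 (smoothM oU (sq 0) (sq 1)))) (smoothM oU s2' (smooth_sqr oU (sq 1)))).
Qed.

Lemma inner_momentum c y (u : 'rV[R]_2) v : inner G c y u v =
  (u *m gram G c y) 0 0 * v 0 0 + (u *m gram G c y) 0 1 * v 0 1.
Proof. by rewrite /inner bil2 !mul2. Qed.

Lemma innerC c y (u : 'rV[R]_2) v : img c y -> inner G c y u v = inner G c y v u.
Proof. by move=> cy; have sG := gram_symm2 G cy; rewrite /inner !bil2 sG; ring. Qed.

Lemma inner_combo c y (u : 'rV[R]_2) v (a b : R) : img c y ->
  inner G c y (a *: u + b *: v) (a *: u + b *: v) =
  a ^+ 2 * inner G c y u u + 2 * a * b * inner G c y u v + b ^+ 2 * inner G c y v v.
Proof.
move=> cy; have sG := gram_symm2 G cy.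
by rewrite /inner !bil2 sG !add_row !scale_row; ring.
Qed.

Lemma inner_combol c y (u : 'rV[R]_2) v (a b m : R) :
  inner G c y (a *: u + b *: v) (m *: u) =
  m * (a * inner G c y u u + b * inner G c y v u).
Proof. by rewrite /inner !bil2 !add_row !scale_row; ring. Qed.

Lemma unit_scale c y v : img c y -> v != 0 -> exists2 k : R, 0 < k &
  inner G c y (k *: v) (k *: v) = 1.
Proof.
move=> cy v0; have p := inner_gt0 G cy v0.
exists (Num.sqrt (inner G c y v v))^-1; first by rewrite invr_gt0 sqrtr_gt0.
by rewrite /inner quad_scale -/(inner G c y v v) exprVn sqr_sqrtr ?(ltW p)// mulVf ?gt_eqF.
Qed.

(** The normal nu is not in D; hence dlam does not kill it, by D_dlam, and its form
differs from the eigenvalue, by unit_vform. *)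
Lemma wall_frame c t (ep : R) (x := w t) (y := coord c x) : dom c x -> ep != 0 ->
  exists (tau nu : 'rV[R]_2) (m : R),
  [/\ 0 < m /\ vel c w t = m *: tau, D c y tau,
      inner G c y tau tau = 1 /\ inner G c y nu nu = 1,
      inner G c y tau nu = 0 &
      0 < ep * dlam c x nu /\ vform I c y nu <> lam c y].
Proof.
move=> ct ep0; have cy : img c y by exists x.
have st : sp x := w_sp t; have [Ot _] := st.
have [k k0 k1] := unit_scale cy (w_vel_neq0 ct).
pose tau := k *: vel c w t.
have Dt : D c y tau.
  have [X X0 XP] := D_line D_bisector Ot ct; have [l lE] := (XP _).1 (w_D ct).
  by apply/XP; exists (k * l); rewrite /tau lE scalerA.
pose q := tau *m gram G c y.
pose n0 := rot2 q; have [n0E n1E] := rot2E q.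
have qt : q 0 0 * tau 0 0 + q 0 1 * tau 0 1 = 1.
  by rewrite -k1 inner_momentum.
have n00 : n0 != 0.
  apply/eqP => /rot2_eq0[h0 h1]; move: qt; rewrite h0 h1 !mul0r addr0 => /eqP.
  by rewrite eq_sym oner_eq0.
have tn (l : R) : inner G c y tau (l *: n0) = 0.
  by rewrite inner_momentum -/q !scale_row n0E n1E; ring.
have [l l0 l1] := unit_scale cy n00.
have unit_nD (a : R) : a ^+ 2 = 1 -> ~ D c y (a *: (l *: n0)).
  move=> a1 Dn; have [X X0 XP] := D_line D_bisector Ot ct.
  have [b bE] := (XP _).1 Dt; have [b' bE'] := (XP _).1 Dn.
  have b0 : b != 0.
    by apply/eqP => b0; move: k1; rewrite -/tau bE b0 scale0r /inner !mul0mx mxE => /eqP;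
      rewrite eq_sym oner_eq0.
  have E : a *: (l *: n0) = (b' / b) *: tau by rewrite bE' bE scalerA divfK.
  have z0 : b' / b = 0.
    transitivity ((b' / b) * inner G c y tau tau); first by rewrite k1 mulr1.
    rewrite -(tn (a * l)) -scalerA E !inner_momentum !scale_row; ring.
  move: E; rewrite z0 scale0r => /eqP.
  rewrite scaler_eq0; have -> : (a == 0) = false.
    by apply/eqP => a0; move: a1; rewrite a0 expr0n => /eqP; rewrite eq_sym oner_eq0.
  by rewrite /= scaler_eq0 gt_eqF//= (negbTE n00).
pose a := Num.sg (ep * dlam c x (l *: n0)).
have dn : ep * dlam c x (l *: n0) != 0.
  rewrite mulf_neq0//; apply/eqP => d0.
  apply: (unit_nD 1); first by rewrite expr1n.
  rewrite scale1r; apply/(D_dlam _ st ct (wall_noncritical ct)).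
  exact: d0.
have a1 : a ^+ 2 = 1 by rewrite /a sqr_sg dn.
exists tau, (a *: (l *: n0)), k^-1; split.
- by rewrite invr_gt0 k0 /tau scalerA mulVf ?scale1r ?gt_eqF.
- exact: Dt.
- split; first exact: k1.
  by rewrite /inner quad_scale a1 mul1r.
- by rewrite scalerA tn.
split; first by rewrite dlam_scale mulrCA /a -normrEsg normr_gt0.
move=> E; apply: (unit_nD a a1); apply/(unit_vform st ct).
  by rewrite /inner quad_scale a1 mul1r.
by rewrite E (lamM_chart st ct).
Qed.

Lemma vel_periodic c t (k : int) : vel c w (t + k%:~R) = vel c w t.
Proof.
have [[_ per] _] := w_leaf.
have wk u : w (u + k%:~R) = w u by apply/esym/per; exists k.
have E : (fun h : R => h^-1 *: ((coord c \o w) (h + (t + k%:~R)) -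
    (coord c \o w) (t + k%:~R))) =
  (fun h : R => h^-1 *: ((coord c \o w) (h + t) - (coord c \o w) t)).
  by apply/funext => h; rewrite /= addrA !wk.
by rewrite /vel /derive1 E.
Qed.

(** By convexity the geodesic tangent to the wall is outside the table after a short
time; so are the geodesics tilted by a small angle, which start into the table and
hence meet the wall again. *)
Lemma tilted_segments : exists c (tau nu : 'rV[R]_2) (m phi1 : R),
  [/\ dom c (w 0), D c (coord c (w 0)) tau, 0 < m /\ vel c w 0 = m *: tau,
      [/\ inner G c (coord c (w 0)) tau tau = 1, inner G c (coord c (w 0)) nu nu = 1,
          inner G c (coord c (w 0)) tau nu = 0 &
          vform I c (coord c (w 0)) nu <> lam c (coord c (w 0))] &
      0 < phi1 /\ forall phi, 0 < phi < phi1 -> exists sg : segment,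
        [/\ is_segment G T w sg, track sg 0 = w 0 &
            vel c (track sg) 0 = cos phi *: tau + sin phi *: nu]].
Proof.
have [c ct] := dom_cover S (w 0); set x0 := coord c (w 0).
have cy : img c x0 by exists (w 0).
have [rH [ep [rH0 ep1 HH]]] := wall_local ct.
have ep0 : ep != 0 by rewrite -normr_eq0 ep1 oner_eq0.
have [tau [nu [m [[m0 mE] Dt [t1 n1] tn [dn vn]]]]] := wall_frame ct ep0.
have [Ot _] := w_sp 0.
pose v (phi : R) : 'rV[R]_2 := cos phi *: tau + sin phi *: nu.
have v1 phi : inner G c x0 (v phi) (v phi) = 1.
  by rewrite (inner_combo _ _ _ _ cy) t1 n1 tn mulr0 addr0 !mulr1 cos2Dsin2.
have v0 : v 0 = tau by rewrite /v cos0 sin0 scale1r scale0r addr0.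
have vn0 phi : v phi != 0.
  apply/eqP => h; have := v1 phi; rewrite h /inner !mul0mx mxE => /eqP.
  by rewrite eq_sym oner_eq0.
pose q (phi : R) := v phi *m gram G c x0.
have qn0 phi : q phi != 0.
  apply/eqP => h; have := v1 phi; rewrite inner_momentum -/(q phi) h !mxE !mul0r addr0.
  by move=> /eqP; rewrite eq_sym oner_eq0.
have qK phi : q phi *m invmx (gram G c x0) = v phi by rewrite mulmxK ?gram_unit.
pose z (phi : R) : 'rV[R]_(2 + 2) := row_mx x0 (q phi).
have pz0 : phase c (z 0) by rewrite /phase /= /z row_mxKl.
have [r [L [T0 [r0 L0 T00 LT [rU rL fl]]]]] :=
  local_flow (@phase_open R M S c) pz0 (@hamfield_smooth R M S G c).
pose A : 'rV[R]_(2 + 2) := row_mx 0 (tau *m gram G c x0).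
pose B : 'rV[R]_(2 + 2) := row_mx 0 (nu *m gram G c x0).
have zE phi : z phi - z 0 = (cos phi - 1) *: A + sin phi *: B.
  rewrite /z /A /B opp_row_mx !scale_row_mx !add_row_mx subrr !scaler0 addr0.
  congr row_mx; rewrite /q v0 -mulmxBl !scalemxAl -mulmxDl /v; congr (_ *m _).
  by rewrite scalerBl scale1r addrAC.
pose K := `|A| + `|B| + 1.
have K0 : 0 < K by rewrite ltr_wpDl// addr_ge0.
have zd (k : R) : 0 < k -> exists2 e : R, 0 < e &
    forall phi, `|phi| < e -> `|z phi - z 0| < k.
  move=> k0; have kK : 0 < k / K by rewrite divr_gt0.
  have [e e0 eP] := cos_sin_near kK; exists e => // phi /eP[/ltW h1 /ltW h2].
  rewrite zE; apply: le_lt_trans (ler_normD _ _) _; rewrite !normrZ.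
  apply: le_lt_trans (_ : k / K * (`|A| + `|B|) < _).
    by rewrite mulrDr; apply: lerD; apply: ler_wpM2r.
  by rewrite mulrAC ltr_pdivrMr// ltr_pM2l// /K ltrDl.
pose g (xi : R -> 'rV[R]_(2 + 2)) (t : R) : M := point c (lsubmx (xi t)).
have T0n : - T0 < 0 < T0 by rewrite oppr_lt0 T00.
have flow phi xi : xi 0 = z phi -> solution (hamfield G c) xi (- T0) T0 ->
    (forall t, - T0 < t < T0 -> `|xi t - z 0| < r) ->
    [/\ geodesic G (g xi) (- T0) T0,
        forall t, - T0 < t < T0 -> dom c (g xi t) /\ coord c (g xi t) = lsubmx (xi t),
        g xi 0 = w 0 &
        is_derive (0:R) 1 (coord c \o g xi) (v phi) /\ vel c (g xi) 0 = v phi].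
  move=> xi0 xiX xir.
  have ph t : - T0 < t < T0 -> phase c (xi t) by move=> /xir/ltW; exact: rU.
  have rn : rsubmx (xi 0) != 0 by rewrite xi0 /z row_mxKr.
  have [gg gc gv] := phase_geodesic xiX ph T0n rn; split => //.
    by rewrite /g xi0 /z row_mxKl coordK.
  by have := gv 0 T0n; rewrite /= xi0 /z row_mxKl row_mxKr qK.
have zz0 : `|z 0 - z 0| < r / 2 by rewrite subrr normr0 divr_gt0.
have [xi0 [xi00 xi0X xi0r]] := fl (z 0) zz0.
have [gg0 gc0 g00 [dv0 _]] := flow 0 xi0 xi00 xi0X xi0r.
have m10 : m^-1 != 0 by rewrite invr_eq0 gt_eqF.
have vm : v 0 = m^-1 *: vel c w 0 by rewrite v0 mE scalerA mulVf ?scale1r ?gt_eqF.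
have [e e0 eT] := w_convex gg0 T0n g00
  (tangent_everywhere g00 ct (geodesic_continuous gg0 T0n) dv0 m10 vm).
have rH2 : 0 < rH / 2 by rewrite divr_gt0.
have [e2 e20 e2P] := (continuous_normP _ _).1 (is_derive_path_cont (xi0X 0 T0n)) _ rH2.
rewrite xi00 in e2P.
pose s1 := Num.min T0 (Num.min e e2) / 2.
have s10 : 0 < s1 by rewrite divr_gt0// !lt_min T00 e0.
have [s1T s1e s1e2] : [/\ s1 < T0, s1 < e & s1 < e2].
  have h : s1 < Num.min T0 (Num.min e e2) by rewrite ltr_pdivrMr// ltr_pMr// ?ltr1n// !lt_min T00 e0.
  by move: h; rewrite !lt_min => /and3P[].
have in1 t : 0 <= t <= s1 -> - T0 < t < T0.
  by move=> /andP[u1 u2]; rewrite (le_lt_trans u2 s1T) (lt_le_trans _ u1)// oppr_lt0.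
have near0 t : 0 <= t <= s1 -> `|xi0 t - z 0| < rH / 2.
  move=> /andP[u1 u2]; apply: e2P; rewrite subr0 ger0_norm//.
  exact: le_lt_trans u2 s1e2.
pose hz (y : 'rV[R]_(2 + 2)) : R := ep * (lam c (lsubmx y) - lam0).
have near_wall (y : 'rV[R]_(2 + 2)) : `|y - z 0| < rH -> [/\ sp (point c (lsubmx y)),
    ep * (lamM s (point c (lsubmx y)) - lam0) = hz y,
    range w (point c (lsubmx y)) <-> hz y = 0 &
    T (point c (lsubmx y)) <-> 0 <= hz y].
  move=> yr; have yx : `|lsubmx y - x0| < rH.
    apply: le_lt_trans yr; have := norm_lsubmx (y - z 0).
    by rewrite linearB /= {1}/z row_mxKl.
  have [[x [sx cx] xE] _ wE TE] := HH _ yx.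
  have px : point c (lsubmx y) = x by rewrite -xE coordK.
  split; [by rewrite px|by rewrite px (lamM_chart sx cx) xE| |exact: TE].
  rewrite wE /hz; split=> [->|/eqP]; first by rewrite subrr mulr0.
  by rewrite mulf_eq0 (negbTE ep0) subr_eq0 => /eqP.
have s1in : 0 <= s1 <= s1 by rewrite ltW//=.
have near1 : `|xi0 s1 - z 0| < rH by apply: lt_trans (near0 s1 s1in) _; lra.
have hneg : hz (xi0 s1) < 0.
  have [_ _ _ TE] := near_wall _ near1.
  rewrite ltNge; apply/negP => /TE; apply: eT.
  by rewrite subr0 gtr0_norm ?s10.
have hc : {for xi0 s1, continuous hz}.
  have Us : [set y : 'rV[R]_(2 + 2) | sign_image I Om D s c (lsubmx y)] (xi0 s1).
    have yx : `|lsubmx (xi0 s1) - x0| < rH.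
      apply: le_lt_trans near1; have := norm_lsubmx (xi0 s1 - z 0).
      by rewrite linearB /= {1}/z row_mxKl.
    by have [] := HH _ yx.
  have oS : open (sign_image I Om D s c) by exact: sign_image_open.
  have oU := open_lsubmx (n := 2) oS.
  have sl := smooth_lsubmx (n := 2) oS (@sign_image_lam c).
  exact: (smooth_continuous (smoothZ ep oU (smoothB oU sl (smooth_cst lam0 oU))) Us).
have oN : open [set u : R | u < 0] by exact: open_lt.
have [eta eta0 etaP] := preimage_norm hc oN hneg.
pose k := Num.min (r / 2) (Num.min (rH / 4) (eta / 4)).
have k0 : 0 < k by rewrite !lt_min !divr_gt0.
have [kr [kH ke]] : k <= r / 2 /\ (k <= rH / 4 /\ k <= eta / 4).
  by rewrite /k !ge_min !lexx !orbT.
have [phi0 phi00 phiP] := zd k k0.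
exists c, tau, nu, m, (Num.min phi0 (pi / 2)); split => //; split.
  by rewrite lt_min phi00 divr_gt0// pi_gt0.
move=> phi /andP[p0]; rewrite lt_min => /andP[pp ppi].
have zphi : `|z phi - z 0| < k by apply: phiP; rewrite gtr0_norm.
have [xi [xi1 xiX xir]] := fl (z phi) (lt_le_trans zphi kr).
have [gg gc g1 [dv gv]] := flow phi xi xi1 xiX xir.
have close t : - T0 < t < T0 -> `|xi t - xi0 t| < 2 * k.
  move=> tT; apply: le_lt_trans (solution_dist L0 LT rL xiX xi0X _ _ tT) _.
  - by move=> u /xir/ltW.
  - by move=> u /xi0r/ltW.
  by rewrite xi1 xi00 ltr_pM2l.
have nearH t : 0 <= t <= s1 -> `|xi t - z 0| < rH.
  move=> t01; have h1 := near0 t t01; have h2 := close t (in1 t t01).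
  have := ler_normD (xi t - xi0 t) (xi0 t - z 0); rewrite subrKA => h3.
  exact: le_lt_trans h3 (half_plus_twice h1 h2 kH).
pose f (t : R) : R := ep * (lamM s (g xi t) - lam0).
have df : is_derive (0:R) 1 f (sin phi * (ep * dlam c (w 0) nu)).
  have cg : dom c (g xi 0) by rewrite g1.
  have sg0 : sp (g xi 0) by rewrite g1; exact: w_sp.
  have h := geodesic_lamM_derive gg T0n sg0 cg.
  have h' := is_deriveZ ep (is_deriveB h (is_derive_cst lam0 (0:R) 1)).
  apply: (is_derive_eq h').
  rewrite subr0 gv g1 /v dlam_add !dlam_scale (dlam_D (w_sp 0) ct Dt) mulr0 add0r.
  exact: mulrCA.
have sphi : 0 < sin phi by apply: sin_gt0_pihalf; rewrite p0.
have d0 : 0 < sin phi * (ep * dlam c (w 0) nu) by rewrite mulr_gt0.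
have f0 : f 0 = 0 by rewrite /f g1 lamM_wall subrr mulr0.
have fc t : 0 <= t <= s1 -> {for t, continuous f}.
  move=> t01; have [st _ _ _] := near_wall _ (nearH t t01).
  have lc : {for t, continuous (lamM s \o g xi)}.
    apply: continuous_comp; first exact: geodesic_continuous gg (in1 t t01).
    exact: lamM_continuous st.
  apply: cvgMr; apply: cvgB; [exact: lc|exact: cvg_cst].
have fs1 : f s1 < 0.
  have [_ E _ _] := near_wall _ (nearH s1 s1in); rewrite /f E; apply: etaP.
  apply: lt_le_trans (close s1 (in1 s1 s1in)) _.
  exact: twice_quarter k0 ke.
have [l /andP[l0 ls] [fl0 fpos]] := first_zero df d0 f0 s10 fc fs1.
have lT := le_lt_trans ls s1T.
have wall t : 0 <= t <= l -> (range w (g xi t) <-> f t = 0) /\ (T (g xi t) <-> 0 <= f t).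
  move=> /andP[u1 u2]; have t01 : 0 <= t <= s1 by rewrite u1 (le_trans u2).
  by have [_ E wE TE] := near_wall _ (nearH t t01); rewrite /f E.
have ge1 : - T0 <= - (T0 - l) by rewrite lerN2 lerBlDr lerDl ltW.
exists (Segment (g xi) l); split; [|exact: g1|exact: gv].
split => //=.
- exists (T0 - l); first by rewrite subr_gt0.
  move=> t c' /andP[u1 u2]; apply: gg; rewrite (le_lt_trans ge1 u1)/=.
  by rewrite -(subrKC l T0).
- move=> t c' /andP[u1 u2] c't; rewrite /speed.
  have tT : - T0 < t < T0.
    by rewrite (le_lt_trans u2 lT) (lt_le_trans _ u1)// oppr_lt0.
  have cg : dom c (g xi 0) by rewrite g1.
  by rewrite (geodesic_inner_const gg tT T0n c't cg) gv g1 v1 sqrtr1.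
- split; first by rewrite g1; exists 0.
  by apply/(wall l _).1 => //; rewrite ltW//=.
move=> t /andP[u1 u2]; have fp : 0 < f t by apply: fpos; rewrite u1.
have tl : 0 <= t <= l by rewrite !ltW.
have [wE TE] := wall t tl; split; first by apply/TE; exact: ltW.
by move=> /wE fz; move: fp; rewrite fz ltxx.
Qed.

Lemma vform_scale c y (a : R) v : img c y -> vform I c y (a *: v) = a ^+ 2 * vform I c y v.
Proof. by move=> cy; rewrite !vform_vmat// quad_scale. Qed.

Lemma tilted_small_angle c (tau nu : 'rV[R]_2) (m phi delta : R) sg :
  dom c (w 0) -> 0 < m -> vel c w 0 = m *: tau ->
  inner G c (coord c (w 0)) tau tau = 1 -> inner G c (coord c (w 0)) tau nu = 0 ->
  0 < phi < pi / 2 -> phi < delta -> is_segment G T w sg -> track sg 0 = w 0 ->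
  vel c (track sg) 0 = cos phi *: tau + sin phi *: nu -> small_angle G w delta sg.
Proof.
move=> ct m0 mE t1 tn /andP[p0 pp] pd Hs g0 gv s' c' + c's.
have cy : img c (coord c (w 0)) by exists (w 0).
rewrite g0 => /esym; have [[_ per] _] := w_leaf => /per[k kE].
have ws : w s' = w 0 by apply/esym/per; exists k.
have vs : vel c' w s' = vel c' w 0 by rewrite kE vel_periodic.
rewrite ws in c's; rewrite ws vs; have cc : in_both c c' (w 0) by [].
have [e e0 ec] := near_dom (@w_continuous 0) ct.
have [_ wE] := vel_transition e0 cc ec (ex_derive (is_derive := w_vel ct)).
have [l0 [f f0 gg] _ _ _] := Hs.
have f00 : - f < 0 < len sg + f by rewrite oppr_lt0 f0 addr_gt0.
have cg : dom c (track sg 0) by rewrite g0.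
have [d [q [d0 dc _ dv _]]] := geodesic_chart gg f00 cg.
have cc' : in_both c c' (track sg 0) by rewrite g0.
have [_ gE] := vel_transition d0 cc' dc (ex_derive (is_derive := dv)).
rewrite gE wE g0 /line_angle -(inner_change G _ _ cc) -!(speed_change G _ cc).
have u1 : inner G c (coord c (w 0)) (vel c (track sg) 0) (vel c (track sg) 0) = 1.
  by have := segment_inner Hs (t := 0) (c := c); rewrite lexx (ltW l0) g0; apply.
rewrite {1}/speed u1 sqrtr1 mul1r gv mE inner_combol (innerC _ _ cy) tn t1.
rewrite /speed /inner quad_scale -/(inner G c _ tau tau) t1 !mulr1 sqrtr_sqr.
rewrite mulr0 addr0 normrM mulrAC mulfV ?mul1r; last by rewrite normr_eq0 gt_eqF.
have cp : 0 <= cos phi.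
  apply: cos_ge0_pihalf; rewrite (ltW pp) andbT.
  by apply: le_trans (ltW p0); rewrite oppr_le0 divr_ge0 ?pi_ge0.
rewrite ger0_norm// cosK// in_itv/= (ltW p0)/=.
by apply: ltW; apply: lt_le_trans pp _; rewrite ler_pdivrMr// ler_peMr ?pi_ge0// ler1n.
Qed.

Lemma seg_motion_integral (delta : R) : 0 < delta ->
  motion_integral G T w delta seg_integral.
Proof.
move=> delta0; split.
- exists (fun c y v => vform I c y v); last first.
    move=> sg Hs c cs; have [l0 _ _ _ _] := Hs.
    by rewrite -(segment_vform Hs (t := 0) (c := c)) ?lexx ?(ltW l0).
  split=> [c|]; last exact: vform_tangent_invariant.
  by apply: (smooth_sub _ (@vform_smooth c)) => z [].
- have [c [tau [nu [m [phi1 [ct Dt [m0 mE] [t1 n1 tn vn] [p10 H]]]]]]] := tilted_segments.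
  have cy : img c (coord c (w 0)) by exists (w 0).
  pose p := Num.min (Num.min phi1 (pi / 2)) delta / 2.
  have p0 : 0 < p by rewrite divr_gt0// !lt_min p10 delta0 divr_gt0// pi_gt0.
  have : p < Num.min (Num.min phi1 (pi / 2)) delta.
    by rewrite ltr_pdivrMr// ltr_pMr ?ltr1n// !lt_min p10 delta0 divr_gt0// pi_gt0.
  rewrite !lt_min => /andP[/andP[pp1 ppi] pd].
  have q0 : 0 < p / 2 by rewrite divr_gt0.
  have qp : p / 2 < p by rewrite ltr_pdivrMr// ltr_pMr// ltr1n.
  have [sg [Hs g0 gv]] : exists sg : segment, [/\ is_segment G T w sg, track sg 0 = w 0 &
      vel c (track sg) 0 = cos p *: tau + sin p *: nu] by apply: H; rewrite p0.
  have [sg' [Hs' g0' gv']] : exists sg : segment, [/\ is_segment G T w sg,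
      track sg 0 = w 0 & vel c (track sg) 0 = cos (p / 2) *: tau + sin (p / 2) *: nu].
    by apply: H; rewrite q0 (lt_trans qp).
  (* the integral at the angle phi; it depends on phi since nu is not in D *)
  have J phi sg1 : is_segment G T w sg1 -> track sg1 0 = w 0 ->
      vel c (track sg1) 0 = cos phi *: tau + sin phi *: nu -> seg_integral sg1 =
      lam c (coord c (w 0)) +
      sin phi ^+ 2 * (vform I c (coord c (w 0)) nu - lam c (coord c (w 0))).
    move=> H1 h0 hv; have [l0 _ _ _ _] := H1; have cs : dom c (track sg1 0) by rewrite h0.
    have ll : 0 <= (0 : R) <= len sg1 by rewrite lexx ltW.
    have u1 := segment_inner H1 ll cs; rewrite -(segment_vform H1 ll cs).
    rewrite h0 hv in u1 *; have := vform_D_shift (sin phi *: nu) (cos phi) (w_sp 0) ct Dt.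
    rewrite u1 mulr1 vform_scale// => /eqP; rewrite subr_eq => /eqP ->.
    by rewrite {1}/inner quad_scale -/(inner G c _ nu nu) n1; ring.
  exists sg, sg'; split => //.
  + by apply: (tilted_small_angle ct m0 mE t1 tn _ pd Hs g0 gv); rewrite p0.
  + apply: (tilted_small_angle ct m0 mE t1 tn _ (lt_trans qp pd) Hs' g0' gv').
    by rewrite q0 (lt_trans qp).
  rewrite (J p sg)// (J (p / 2) sg')// => /addrI/mulIf h.
  have sp0 : 0 < sin p by apply: sin_gt0_pihalf; rewrite p0.
  have sq0 : 0 < sin (p / 2) by apply: sin_gt0_pihalf; rewrite q0 (lt_trans qp).
  have : sin (p / 2) < sin p.
    have pin : - (pi / 2) <= (0 : R) by rewrite oppr_le0 divr_ge0 ?pi_ge0.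
    rewrite ltr_sin// in_itv/= ?(le_trans pin (ltW q0)) ?(le_trans pin (ltW p0))/=.
      exact: ltW (lt_trans qp ppi).
    exact: ltW.
  rewrite -(ltr_pXn2r (n := 2))// ?nnegrE ?ltW//; rewrite h ?ltxx// subr_eq0.
  exact/eqP.
move=> n sg tr _ i ni; have [Hs Hr] := tr.
by apply: seg_integral_reflected; [exact: Hs (ltnW ni)|exact: Hs|exact: Hr].
Qed.

End Wall.
End Sign.

Lemma sign_part_disjoint x : sign_part I Om D 1 x -> ~ sign_part I Om D (-1) x.
Proof.
move=> [Ox p] [_ n]; have [c cx] := dom_cover S x.
have [X X0 XP] := D_line D_bisector Ox cx.
have DX : D c (coord c x) X by apply/XP; exists 1; rewrite scale1r.
have := p c X cx DX X0; have := n c X cx DX X0.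
by rewrite mul1r mulN1r oppr_gt0 => h /(lt_trans h); rewrite ltxx.
Qed.

(** The sign of the form on the foliation is locally constant, hence constant along
the wall. *)
Lemma wall_sign w : closed_leaf D Om w ->
  exists2 s : R, s ^+ 2 = 1 & forall t, sign_part I Om D s (w t).
Proof.
move=> [[reg _] il].
have wc t : {for t, continuous w}.
  by have [sm _] := reg (t - 1) (t + 1); exact: smooth_curve_continuous sm (in_itv1 t).
have wO t : Om (w t) by have [_ /(_ t (in_itv1 t))[]] := il (t - 1) (t + 1).
have loc t : exists2 e : R, 0 < e & forall u : R, t - e < u < t + e ->
    (sign_part I Om D 1 (w u) <-> sign_part I Om D 1 (w t)).
  have [p|n] := sign_part_cover zero_real D_bisector (wO t).
    have [r r0 rP] := preimage_norm (wc t) (sign_part_open Om_open D_bisector 1) p.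
    by exists r => // u; rewrite -ltr_distl => /rP.
  have [r r0 rP] := preimage_norm (wc t) (sign_part_open Om_open D_bisector (-1)) n.
  exists r => // u; rewrite -ltr_distl => /rP nu.
  by split=> /sign_part_disjoint.
have all t : sign_part I Om D 1 (w t) <-> sign_part I Om D 1 (w 0).
  have t0 : - (`|t| + 1) < t < `|t| + 1 by rewrite -ltr_norml ltrDl.
  have o0 : - (`|t| + 1) < 0 < `|t| + 1 by rewrite -ltr_norml normr0 ltr_wpDl.
  have lc := @locally_const _ (fun u => sign_part I Om D 1 (w u)) (- (`|t| + 1)) (`|t| + 1).
  by split; apply: lc => // u _; exact: loc.
have [p|n] := pselect (sign_part I Om D 1 (w 0)).
  by exists 1; [rewrite expr1n|move=> t; apply/all].
exists (-1); first by rewrite sqrrN expr1n.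
move=> t; have [/all|//] := sign_part_cover zero_real D_bisector (wO t).
by move=> /n.
Qed.

End WallGeometry.

Theorem theorem6 (R : realType) (M : topologicalType) (S : surface R M)
    (G : metric S) (I : quadratic_integral G) (Om : set M) (e : R -> M)
    (D : directions S) (w : R -> M) (T : set M)
    (Om_open : open Om)
    (zero_directions_real : forall x, Om x -> two_real_zero_directions I x)
    (e_simple_closed : simple_closed_curve S e)
    (e_envelope : envelope I Om e)
    (D_bisector : bisector_foliation I Om D)
    (D_along_e : goes_along Om D e)
    (w_leaf : closed_leaf D Om w)
    (T_table : one_sided_table S T w)
    (w_convex : wall_convex G T w) :
  (exists J : segment -> R, exists2 delta0 : R, 0 < delta0 &
     forall delta : R, 0 < delta <= delta0 -> motion_integral G T w delta J) /\
  foliated_by_caustics G T w.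
Proof.
have [s s2 w_sp] := wall_sign Om_open zero_directions_real D_bisector w_leaf.
split; last exact: (wall_foliated Om_open zero_directions_real D_bisector s2).
exists (seg_integral I); exists 1 => // delta /andP[delta0 _].
exact: (seg_motion_integral Om_open zero_directions_real D_bisector s2).
Qed.
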